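(* Let $\lambda\in P\setminus\{0\}$, $p\ne q$ in $\{1,\dots,n\}$, and assume $t_p-t_q\pm\lambda\notin\Lambda$. Put $\lambda'=\lambda-t_p+t_q$ and $c'=(c'_0,\dots,c'_n)$ with $c'_p=c_p+1$, $c'_q=c_q-1$, $c'_l=c_l$ otherwise; let $I'_c$ denote the intersection form $I_c$ built with parameters $(c',\lambda')$ in place of $(c,\lambda)$. Define the following elements of $\Omega^1_{-\lambda'}( *D)(E)$ (writing $\psi'^\vee_j=\mathfrak{s}(u-t_j;-\lambda')du$): $$\eta'^\vee_q=\psi'^\vee_q,\quad \eta'^\vee_k=\psi'^\vee_k-\frac{\mathfrak{s}(t_p-t_k;-\lambda')}{\mathfrak{s}(t_p-t_q;-\lambda')}\psi'^\vee_q\ (k\ne p,q),$$ $$\eta'^\vee_p=\psi'^\vee_p+\frac{1}{\mathfrak{s}(t_p-t_q;-\lambda')}\Big(\frac{1}{c_p+1}\Big(2\pi\sqrt{-1}c_0+\sum_{l\ne p}c'_l\rho(t_p-t_l)\Big)-\rho(\lambda')\Big)\psi'^\vee_q.$$ For $\varphi\in\Omega^1_{\lambda'}( *D)(E)$ write $J_k=I'_c([\varphi],[\eta'^\vee_k])/(2\pi\sqrt{-1})$. Then, with $\psi_j=\mathfrak{s}(u-t_j;\lambda)du$ and $\mathcal{S}^p_q([\varphi])=[\frac{\vartheta_1(u-t_p)}{\vartheta_1(u-t_q)}\varphi]$, $$\mathcal{S}^p_q([\varphi])=\sum_{j\ne p,q}J_j\frac{c_j\vartheta_1(t_j-t_p)}{\vartheta_1(t_j-t_q)}[\psi_j]+J_q\frac{c_p\vartheta_1(\lambda-t_p+t_q)}{\vartheta_1(\lambda)}[\psi_p]+B\,[\psi_q]$$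 in $H^1(M;\mathcal{L}_\lambda)$, where $$B=J_p\frac{(c_p+1)\vartheta_1(\lambda)}{\vartheta_1(\lambda-t_p+t_q)}-J_q\frac{c_p\vartheta_1(t_p-t_q)}{\vartheta_1'(0)}\big(\rho(t_p-t_q)-\rho(\lambda)\big)+\sum_{j\ne p,q}J_j\frac{c_j\vartheta_1(t_p-t_q)\vartheta_1(\lambda-t_p+t_j)}{\vartheta_1(t_j-t_q)\vartheta_1(\lambda-t_p+t_q)}.$$
   Context: Fix $\tau$ in the upper half plane, $\Lambda=\mathbb{Z}+\mathbb{Z}\tau$, $E=\mathbb{C}/\Lambda$, $P=\{a+b\tau:0\le a,b<1\}$. Let $\vartheta_1(u)=-\sum_{m\in\mathbb{Z}}\exp\big(\pi\sqrt{-1}(m+\tfrac12)^2\tau+2\pi\sqrt{-1}(m+\tfrac12)(u+\tfrac12)\big)$, $\rho(u)=\vartheta_1'(u)/\vartheta_1(u)$, and for $\mu\notin\Lambda$, $\mathfrak{s}(u;\mu)=\dfrac{\vartheta_1(u-\mu)\vartheta_1'(0)}{\vartheta_1(u)\vartheta_1(-\mu)}$. Let $n\ge2$, $t_1,\dots,t_n\in\mathbb{C}$ pairwise incongruent modulo $\Lambda$, $D=\{t_j\}\subset E$, $M=E\setminus D$. Let $c_0\in\mathbb{C}$, $c_1,\dots,c_n\in\mathbb{C}\setminus\mathbb{Z}$ with $\sum_{j\ge1}c_j=0$. For parameters $(c,\mu)$ let $\omega_c=\big(2\pi\sqrt{-1}c_0+\sum_j c_j\rho(u-t_j)\big)du$;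 $\mathcal{O}_\mu( *D)(E)$ is the space of meromorphic $f$ on $\mathbb{C}$ with poles only in $\{t_j\}+\Lambda$, $f(u+1)=f(u)$, $f(u+\tau)=e^{2\pi\sqrt{-1}\mu}f(u)$, and $\Omega^1_\mu( *D)(E)=\{f\,du\}$. The twisted cohomology groups are $H^1(M;\mathcal{L}_\mu)=\Omega^1_\mu( *D)(E)/\{df+f\omega_c\}$ and $H^1(M;\mathcal{L}^\vee_\mu)=\Omega^1_{-\mu}( *D)(E)/\{df-f\omega_c\}$. The intersection form $I_c([\varphi],[\varphi'])$ for $\varphi\in\Omega^1_\mu( *D)(E)$, $\varphi'\in\Omega^1_{-\mu}( *D)(E)$ is $\int_\Pi\varphi_1\wedge\varphi'$, where $\Pi$ is a fundamental parallelogram and $\varphi_1=\varphi-(dF+F\omega_c)$ is a smooth form vanishing near $\{t_j\}+\Lambda$ with $F$ smooth on $\mathbb{C}\setminus(\{t_j\}+\Lambda)$, $F(u+1)=F(u)$, $F(u+\tau)=e^{2\pi\sqrt{-1}\mu}F(u)$; equivalently $I_c=2\pi\sqrt{-1}\sum_j\operatorname{Res}_{u=t_j}(f_j\varphi')$ with $f_j$ the unique meromorphic solution near $t_j$ of $df_j+f_j\omega_c=\varphi$. The map $\mathcal{S}^p_q$ goes from $H^1(M;\mathcal{L}_{\lambda'})$ (parameters $(c',\lambda')$) to $H^1(M;\mathcal{L}_\lambda)$ (parameters $(c,\lambda)$) and is well defined. *)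

(* Defs.v *)
From Stdlib Require Import Reals ZArith Arith ClassicalEpsilon.
From Coquelicot Require Import Coquelicot.
Set Implicit Arguments.
Open Scope C_scope.

Definition Cexp (z : C) : C :=
  (exp (Re z) * cos (Im z), exp (Re z) * sin (Im z))%R.

Definition CSeries (a : nat -> C) : C :=
  (Series (fun k => Re (a k)), Series (fun k => Im (a k))).

Definition sum1n (n : nat) (a : nat -> C) : C := sum_n_m a 1 n.

Definition twopii : C := 2 * RtoC PI * Ci.

Definition theta_term (tau u : C) (m : Z) : C :=
  let h := RtoC (IZR m + /2)%R in
  Cexp (RtoC PI * Ci * (h * h) * tau + twopii * h * (u + RtoC (/2))).

(** theta_1(u) = - sum_{m in Z} ..., the sum over Z split as m>=0 and m<=-1 *)
Definition theta1 (tau u : C) : C :=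
  - CSeries (fun k => theta_term tau u (Z.of_nat k)
                      + theta_term tau u (- Z.of_nat k - 1)%Z).

Definition CDeriv (f : C -> C) (z : C) : C :=
  epsilon (inhabits (RtoC 0)) (fun l : C => is_derive (K := C_AbsRing) f z l).

Fixpoint CDeriv_n (k : nat) (f : C -> C) : C -> C :=
  match k with O => f | S k' => CDeriv (CDeriv_n k' f) end.

Fixpoint Cpow (z : C) (k : nat) : C :=
  match k with O => 1 | S k' => z * Cpow z k' end.

Definition theta1' (tau u : C) : C := CDeriv (theta1 tau) u.

Definition rho (tau u : C) : C := theta1' tau u / theta1 tau u.

Definition sfun (tau u mu : C) : C :=
  theta1 tau (u - mu) * theta1' tau 0 / (theta1 tau u * theta1 tau (- mu)).

Definition in_lattice (tau z : C) : Prop :=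
  exists m k : Z, z = RtoC (IZR m) + RtoC (IZR k) * tau.

Definition pole_set (tau : C) (n : nat) (t : nat -> C) (z : C) : Prop :=
  exists j, (1 <= j <= n)%nat /\ in_lattice tau (z - t j).

Definition holo_near (h : C -> C) (a : C) : Prop :=
  exists d : R, (0 < d)%R /\
    forall z, (Cmod (z - a) < d)%R -> ex_derive (K := C_AbsRing) h z.

Definition merom_at (f : C -> C) (a : C) : Prop :=
  exists (N : nat) (h : C -> C) (d : R), (0 < d)%R /\ holo_near h a /\
    forall u, (0 < Cmod (u - a) < d)%R -> h u = Cpow (u - a) N * f u.

Definition is_residue (g : C -> C) (a r : C) : Prop :=
  exists (N : nat) (h : C -> C) (d : R), (1 <= N)%nat /\ (0 < d)%R /\
    holo_near h a /\
    (forall u, (0 < Cmod (u - a) < d)%R -> h u = Cpow (u - a) N * g u) /\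
    r = CDeriv_n (N - 1) h a / RtoC (INR (fact (N - 1))).

Definition Res (g : C -> C) (a : C) : C :=
  epsilon (inhabits (RtoC 0)) (fun r => is_residue g a r).

(** O_mu( *D)(E) (and, identifying f du with f, Omega^1_mu( *D)(E)) *)
Definition twisted_sec (tau : C) (n : nat) (t : nat -> C) (mu : C)
    (f : C -> C) : Prop :=
  (forall z, ~ pole_set tau n t z -> ex_derive (K := C_AbsRing) f z) /\
  (forall z, pole_set tau n t z -> merom_at f z) /\
  (forall u, ~ pole_set tau n t u ->
     f (u + 1) = f u /\ f (u + tau) = Cexp (twopii * mu) * f u).

Definition omega (tau : C) (n : nat) (t : nat -> C) (c0 : C) (c : nat -> C)
    (u : C) : C :=
  twopii * c0 + sum1n n (fun j => c j * rho tau (u - t j)).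

(** [g1 du] = [g2 du] in H^1(M; L_mu) (parameters (c, mu)) *)
Definition cohomologous (tau : C) (n : nat) (t : nat -> C) (c0 : C)
    (c : nat -> C) (mu : C) (g1 g2 : C -> C) : Prop :=
  exists F : C -> C, twisted_sec tau n t mu F /\
    forall u, ~ pole_set tau n t u ->
      is_derive (K := C_AbsRing) F u (g1 u - g2 u - F u * omega tau n t c0 c u).

Definition local_sol (om phi : C -> C) (a : C) (f : C -> C) : Prop :=
  merom_at f a /\ exists d : R, (0 < d)%R /\
    forall u, (0 < Cmod (u - a) < d)%R ->
      is_derive (K := C_AbsRing) f u (phi u - f u * om u).

Definition int_form (tau : C) (n : nat) (t : nat -> C) (c0 : C) (c : nat -> C)
    (phi eta : C -> C) : C :=
  twopii * sum1n n (fun j =>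
    let fj := epsilon (inhabits (fun _ : C => RtoC 0))
                (local_sol (omega tau n t c0 c) phi (t j)) in
    Res (fun u => fj u * eta u) (t j)).

Definition cprime (c : nat -> C) (p q : nat) (j : nat) : C :=
  if Nat.eqb j p then c j + 1 else if Nat.eqb j q then c j - 1 else c j.

Definition sum_ne (n p q : nat) (a : nat -> C) : C :=
  sum1n n (fun j => if orb (Nat.eqb j p) (Nat.eqb j q) then RtoC 0 else a j).

Section Data.
Variables (tau : C) (n : nat) (t : nat -> C) (c0 : C) (c : nat -> C)
          (lam : C) (p q : nat).

Definition lamp : C := lam - t p + t q.

Definition psiv (j : nat) (u : C) : C := sfun tau (u - t j) (- lamp).

Definition etav (k : nat) (u : C) : C :=
  if Nat.eqb k q then psiv q u
  else if Nat.eqb k p then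
    psiv p u +
    / sfun tau (t p - t q) (- lamp) *
      (/ (c p + 1) *
         (twopii * c0 +
          sum1n n (fun l => if Nat.eqb l p then RtoC 0
                            else cprime c p q l * rho tau (t p - t l)))
       - rho tau lamp) * psiv q u
  else psiv k u - sfun tau (t p - t k) (- lamp) / sfun tau (t p - t q) (- lamp)
                  * psiv q u.

Definition psi (j : nat) (u : C) : C := sfun tau (u - t j) lam.

Definition Jk (phi : C -> C) (k : nat) : C :=
  int_form tau n t c0 (cprime c p q) phi (etav k) / twopii.

Definition Bcoef (phi : C -> C) : C :=
  Jk phi p * (c p + 1) * theta1 tau lam / theta1 tau (lam - t p + t q)
  - Jk phi q * c p * theta1 tau (t p - t q) / theta1' tau 0
      * (rho tau (t p - t q) - rho tau lam)
  + sum_ne n p q (fun j => Jk phi j * c j * theta1 tau (t p - t q)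
        * theta1 tau (lam - t p + t j)
        / (theta1 tau (t j - t q) * theta1 tau (lam - t p + t q))).

Definition rhs (phi : C -> C) (u : C) : C :=
  sum_ne n p q (fun j => Jk phi j * c j * theta1 tau (t j - t p)
                           / theta1 tau (t j - t q) * psi j u)
  + Jk phi q * c p * theta1 tau (lam - t p + t q) / theta1 tau lam * psi p u
  + Bcoef phi * psi q u.

Definition Spq (phi : C -> C) (u : C) : C :=
  theta1 tau (u - t p) / theta1 tau (u - t q) * phi u.

End Data.

(* Main.v *)
Require Import Defs.
From Stdlib Require Import Reals ZArith Arith.
From Stdlib Require Import Lra Lia Psatz Classical ClassicalEpsilon FunctionalExtensionality PropExtensionality.
From Coquelicot Require Import Coquelicot.
Open Scope C_scope.

(* Every class in H^1(M; L_lambda') has a representative sum_j a_j psi'_j with simple poles: the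
   derivatives of s(u - t_j; lambda') successively lower the pole orders (no c'_j is an integer), and a
   section with multiplier exp(2 pi i lambda'), lambda' not in the lattice, without poles vanishes by Liouville.
   If phi = sum_j a_j psi'_j + dF + F omega', a local solution at t_j differs from F by a function
   holomorphic at t_j with value a_j/c'_j, while F eta is elliptic and its residues add up to 0; hence
   J_k = sum_j (a_j/c'_j) Res_{t_j} eta_k, which is solved for the a_j.
   Multiplication by r = theta_1(u - t_p)/theta_1(u - t_q) intertwines d + omega' with d + omega. The section
   r sum_j a_j psi'_j - rhs - kappa (d psi_q + psi_q omega), with kappa chosen to cancel the double pole at t_q,
   has multiplier exp(2 pi i lambda) and no poles, so it vanishes. The residue at t_q involves the identity
   rho(x) + rho(y) + rho(z) - rho(x+y+z) = theta' theta(x+y) theta(y+z) theta(z+x) / (theta(x) theta(y) theta(z) theta(x+y+z)),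
   a residue theorem for a product of theta quotients.
   The zeros of theta_1 come from the finite Jacobi triple product; holomorphic functions are only assumed
   to be complex differentiable, so the function theory rests on Goursat's theorem. *)

(** * Complex derivatives *)
Implicit Types f g : C -> C.

(** The factor [theta_1(u - t_p)/theta_1(u - t_q)] has its only pole at [t_q] modulo the lattice, so
    a double pole arises only there and one multiple of [d psi_q + psi_q omega] removes it; the
    double-pole coefficient of this correction is [c_q - 1 = c'_q], the very factor relating [a_q]
    to [J_q]. The combinations [etav] make the system for the [a_j] triangular: [J_q] sees [a_q]
    alone, every other [J_k] sees [a_k] and [a_q]. In [int_form] the local solutions are picked by
    [epsilon], so its value is computable only once all meromorphic local solutions are known to
    have the same leading behaviour; nonintegral [c'_j] give existence and this uniqueness. No
    integral over a parallelogram occurs: the residue theorem becomes a statement on entire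
    functions after subtraction of polar parts built from derivatives of [rho], whose additive
    [tau]-period records the residue. Nor are the zeros of [theta_1] counted by contours: the finite
    products are bounded below uniformly in their length, and the bound survives the passage to the
    series. *)

Definition cder (f : C -> C) (z l : C) : Prop := is_derive (K := C_AbsRing) (V := C_NormedModule) f z l.
Notation "f '~>' l 'at' z" := (cder f z l) (at level 70, l at next level, z at next level).

(** The reference form of differentiability for all estimates below. The norm of [C_AbsRing] is
    [Cmod], and the limit point quantified in the library definition can only be [z] itself. *)
Lemma is_derive_Cmod (f : C -> C) (z l : C) :
  f ~> l at z <->
  (forall eps : R, (0 < eps)%R -> exists d : R, (0 < d)%R /\
     forall w, (Cmod (w - z) < d)%R ->
       (Cmod (f w - f z - (w - z) * l) <= eps * Cmod (w - z))%R).
Proof.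
unfold cder. split.
- intros [_ H] eps He.
  assert (Hz : is_filter_lim (locally (T := AbsRing_UniformSpace C_AbsRing) z) z).
  { intros P HP. exact HP. }
  destruct (H z Hz (mkposreal eps He)) as [d Hd].
  exists d. split. apply cond_pos.
  intros w Hw. apply (Hd w). exact Hw.
- intros H. split. apply is_linear_scal_l.
  intros x Hx.
  assert (E : z = x) by exact (is_filter_lim_locally_unique (K := C_AbsRing) (V := AbsRing_NormedModule C_AbsRing) z x Hx).
  subst x. intros eps. destruct (H eps (cond_pos eps)) as [d [Hd Hd']].
  exists (mkposreal d Hd). intros w Hw. apply (Hd' w). exact Hw.
Qed.

(* Coquelicot's product rule is stated for the [AbsRing] structure on the target, which carries other balls than [C_NormedModule]. *)
Lemma is_derive_AbsRing (f : C -> C) (z l : C) :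
  is_derive (K := C_AbsRing) (V := AbsRing_NormedModule C_AbsRing) f z l <-> f ~> l at z.
Proof.
unfold cder. split.
- intros [_ H]. split. apply is_linear_scal_l. exact H.
- intros [_ H]. split. apply is_linear_scal_l. exact H.
Qed.

Notation holo f z := (ex_derive (K := C_AbsRing) (V := C_NormedModule) f z).

Lemma Cmod_sub_sym (x y : C) : Cmod (x - y) = Cmod (y - x).
Proof. rewrite <- Cmod_opp. f_equal. ring. Qed.

Lemma Cmod_sub_le (x y : C) : (Cmod (x - y) <= Cmod x + Cmod y)%R.
Proof. rewrite <- (Cmod_opp y). apply Cmod_triangle. Qed.

Lemma Cmod_le_sub (x y : C) : (Cmod x - Cmod y <= Cmod (x - y))%R.
Proof.
assert (H := Cmod_triangle (x - y) y). replace (x - y + y) with x in H by ring. lra.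
Qed.

Lemma Cmod_triangle_sub (x y z : C) : (Cmod (x - z) <= Cmod (x - y) + Cmod (y - z))%R.
Proof. replace (x - z) with ((x - y) + (y - z)) by ring. apply Cmod_triangle. Qed.

Lemma Cmod_sub_self (x : C) : Cmod (x - x) = 0%R.
Proof. replace (x - x) with (RtoC 0) by ring. apply Cmod_0. Qed.

Lemma Cmod_sub_pos (x y : C) : x <> y -> (0 < Cmod (x - y))%R.
Proof.
intro H. apply Cmod_gt_0. intro E. apply H.
replace x with (x - y + y) by ring. rewrite E. ring.
Qed.

Lemma Cmod_sub_pos_neq (x y : C) : (0 < Cmod (x - y))%R -> x - y <> 0.
Proof. intros H E. rewrite E, Cmod_0 in H. lra. Qed.

Lemma Csub_neq_0 (x y : C) : x <> y -> x - y <> 0.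
Proof. intros H E. apply H. replace x with (x - y + y) by ring. rewrite E. ring. Qed.

Lemma Cmod_small_eq_0 (x : C) : (forall eps, (0 < eps)%R -> (Cmod x <= eps)%R) -> x = 0.
Proof.
intro H. apply Cmod_eq_0. destruct (Cmod_ge_0 x) as [h|h]; [|now symmetry].
assert (H' := H (Cmod x / 2)%R ltac:(lra)). lra.
Qed.

Lemma is_derive_holo f z l : f ~> l at z -> holo f z.
Proof. intro H. now exists l. Qed.

(** [CDeriv] is a choice, so nothing can be computed with it before derivatives are known to be
    unique. Two candidates are compared at a single small real increment. *)
Lemma CDeriv_unique f z l : f ~> l at z -> CDeriv f z = l.
Proof.
intro H. unfold CDeriv.
assert (H' := epsilon_spec (inhabits (RtoC 0)) (fun l : C => f ~> l at z) (ex_intro _ l H)).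
simpl in H'. set (e := epsilon _ _) in *.
rewrite is_derive_Cmod in H, H'.
assert (e - l = 0); [|replace e with (e - l + l) by ring; rewrite H0; ring].
apply Cmod_small_eq_0. intros eps He.
destruct (H (eps/2)%R ltac:(lra)) as [d1 [Hd1 K1]].
destruct (H' (eps/2)%R ltac:(lra)) as [d2 [Hd2 K2]].
set (r := (Rmin d1 d2 / 2)%R).
assert (Hr : (0 < r)%R) by (unfold r; apply Rdiv_lt_0_compat; [apply Rmin_pos; lra|lra]).
assert (Hr1 : (r < d1)%R) by (unfold r; assert (h := Rmin_l d1 d2); lra).
assert (Hr2 : (r < d2)%R) by (unfold r; assert (h := Rmin_r d1 d2); lra).
assert (E : Cmod (z + r - z) = r).
{ replace (z + r - z) with (RtoC r) by ring. rewrite Cmod_R. apply Rabs_pos_eq. lra. }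
specialize (K1 (z + r)). specialize (K2 (z + r)). rewrite E in K1, K2.
specialize (K1 Hr1). specialize (K2 Hr2).
apply Rmult_le_reg_l with r; [lra|].
replace (r * Cmod (e - l))%R with (Cmod ((z + r - z) * (e - l))) by (rewrite Cmod_mult, E; ring).
replace ((z + r - z) * (e - l)) with
 ((f (z + r) - f z - (z + r - z) * l) - (f (z + r) - f z - (z + r - z) * e)) by ring.
eapply Rle_trans. apply Cmod_sub_le. lra.
Qed.

Lemma is_derive_C_unique f z l1 l2 : f ~> l1 at z -> f ~> l2 at z -> l1 = l2.
Proof. intros H1 H2. rewrite <- (CDeriv_unique _ _ _ H1). now apply CDeriv_unique. Qed.

Lemma CDeriv_correct f z : holo f z -> f ~> (CDeriv f z) at z.
Proof. intros [l H]. now rewrite (CDeriv_unique _ _ _ H). Qed.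

Lemma is_derive_ext_near f g z l : (exists d, (0 < d)%R /\ forall w, (Cmod (w - z) < d)%R -> f w = g w) ->
  f ~> l at z -> g ~> l at z.
Proof.
intros [d [Hd E]] H. rewrite is_derive_Cmod in *. intros eps He.
destruct (H eps He) as [d' [Hd' K]].
exists (Rmin d d'). split. now apply Rmin_pos.
intros w Hw. rewrite <- !E. apply K. apply Rlt_le_trans with (1 := Hw). apply Rmin_r.
rewrite Cmod_sub_self. lra. apply Rlt_le_trans with (1 := Hw). apply Rmin_l.
Qed.

Lemma is_derive_ext_all f g z l : (forall w, f w = g w) -> f ~> l at z -> g ~> l at z.
Proof. intros E. apply is_derive_ext_near. exists 1%R. split. lra. auto. Qed.

Lemma is_derive_eq f z l l' : f ~> l at z -> l = l' -> f ~> l' at z.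
Proof. now intros H <-. Qed.

Lemma is_derive_C_const (a z : C) : (fun _ : C => a) ~> 0 at z.
Proof. apply (is_derive_const (K := C_AbsRing) (V := C_NormedModule) a z). Qed.

Lemma is_derive_C_id (z : C) : (fun u : C => u) ~> 1 at z.
Proof. apply is_derive_AbsRing. apply (is_derive_id (K := C_AbsRing) z). Qed.

Lemma is_derive_C_plus f g z a b : f ~> a at z -> g ~> b at z -> (fun u => f u + g u) ~> (a + b) at z.
Proof. intros H1 H2. exact (is_derive_plus (K := C_AbsRing) (V := C_NormedModule) f g z a b H1 H2). Qed.

Lemma is_derive_C_minus f g z a b : f ~> a at z -> g ~> b at z -> (fun u => f u - g u) ~> (a - b) at z.
Proof. intros H1 H2. exact (is_derive_minus (K := C_AbsRing) (V := C_NormedModule) f g z a b H1 H2). Qed.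

Lemma is_derive_C_opp f z a : f ~> a at z -> (fun u => - f u) ~> (- a) at z.
Proof. intros H1. exact (is_derive_opp (K := C_AbsRing) (V := C_NormedModule) f z a H1). Qed.

Lemma is_derive_C_mult f g z a b : f ~> a at z -> g ~> b at z ->
  (fun u => f u * g u) ~> (a * g z + f z * b) at z.
Proof.
rewrite <- !is_derive_AbsRing. intros H1 H2.
exact (is_derive_mult (K := C_AbsRing) f g z a b H1 H2 Cmult_comm).
Qed.

Lemma is_derive_C_comp f g z a b : f ~> a at (g z) -> g ~> b at z ->
  (fun u => f (g u)) ~> (b * a) at z.
Proof.
intros H1 H2. apply is_derive_AbsRing in H2.
exact (is_derive_comp (K := C_AbsRing) (V := C_NormedModule) f g z a b H1 H2).
Qed.

Lemma is_derive_C_scal (k : C) f z a : f ~> a at z -> (fun u => k * f u) ~> (k * a) at z.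
Proof.
intro H. eapply is_derive_eq. apply is_derive_C_mult. apply is_derive_C_const. exact H. cbv beta. ring.
Qed.

Definition ccont (f : C -> C) (z : C) : Prop :=
  forall eps, (0 < eps)%R -> exists d, (0 < d)%R /\
    forall w, (Cmod (w - z) < d)%R -> (Cmod (f w - f z) < eps)%R.

Lemma holo_ccont f z : holo f z -> ccont f z.
Proof.
intros [l H]. rewrite is_derive_Cmod in H. intros eps He.
destruct (H 1%R ltac:(lra)) as [d [Hd K]].
assert (Hl := Cmod_ge_0 l).
assert (Hq : (0 < eps / (2 + Cmod l))%R) by (apply Rdiv_lt_0_compat; lra).
exists (Rmin d (eps / (2 + Cmod l))). split. now apply Rmin_pos.
intros w Hw.
assert (H1 : (Cmod (w - z) < d)%R) by (apply Rlt_le_trans with (1 := Hw); apply Rmin_l).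
assert (H2 : (Cmod (w - z) < eps / (2 + Cmod l))%R) by (apply Rlt_le_trans with (1 := Hw); apply Rmin_r).
specialize (K w H1).
replace (f w - f z) with ((f w - f z - (w - z) * l) + (w - z) * l) by ring.
apply Rle_lt_trans with (1 := Cmod_triangle _ _). rewrite Cmod_mult.
apply Rle_lt_trans with (Cmod (w - z) * (1 + Cmod l))%R. lra.
apply Rle_lt_trans with (Cmod (w - z) * (2 + Cmod l))%R.
apply Rmult_le_compat_l. apply Cmod_ge_0. lra.
apply Rlt_le_trans with (eps / (2 + Cmod l) * (2 + Cmod l))%R.
apply Rmult_lt_compat_r; lra. right. field. lra.
Qed.

Lemma ccont_neq_0 f z : ccont f z -> f z <> 0 ->
  exists d, (0 < d)%R /\ forall w, (Cmod (w - z) < d)%R -> (Cmod (f z) / 2 < Cmod (f w))%R.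
Proof.
intros H Hz. apply Cmod_gt_0 in Hz. destruct (H (Cmod (f z) / 2)%R ltac:(lra)) as [d [Hd K]].
exists d. split; auto. intros w Hw. specialize (K w Hw).
rewrite Cmod_sub_sym in K. assert (h := Cmod_le_sub (f z) (f w)). lra.
Qed.

(** Carries an identity known only off a point to the point itself; values at poles are read off in
    this way. *)
Lemma ccont_eq_at f g z : ccont f z -> ccont g z ->
  (exists d, (0 < d)%R /\ forall w, (0 < Cmod (w - z) < d)%R -> f w = g w) -> f z = g z.
Proof.
intros Hf Hg [d [Hd E]].
assert (f z - g z = 0); [|replace (f z) with (f z - g z + g z) by ring; rewrite H; ring].
apply Cmod_small_eq_0. intros eps He.
destruct (Hf (eps/2)%R ltac:(lra)) as [d1 [Hd1 K1]].
destruct (Hg (eps/2)%R ltac:(lra)) as [d2 [Hd2 K2]].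
set (r := (Rmin d (Rmin d1 d2) / 2)%R).
assert (Hm : (0 < Rmin d (Rmin d1 d2))%R) by (repeat apply Rmin_pos; lra).
assert (h1 := Rmin_l d (Rmin d1 d2)). assert (h2 := Rmin_r d (Rmin d1 d2)).
assert (h3 := Rmin_l d1 d2). assert (h4 := Rmin_r d1 d2).
assert (Er : Cmod (z + r - z) = r).
{ replace (z + r - z) with (RtoC r) by ring. rewrite Cmod_R. apply Rabs_pos_eq. unfold r. lra. }
assert (Hr : (0 < r)%R) by (unfold r; lra).
specialize (K1 (z + r)). specialize (K2 (z + r)). specialize (E (z + r)). rewrite Er in *.
assert (r < d)%R by (unfold r; lra).
assert (r < d1)%R by (unfold r; lra).
assert (r < d2)%R by (unfold r; lra).
specialize (K1 ltac:(lra)). specialize (K2 ltac:(lra)). specialize (E ltac:(lra)).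
replace (f z - g z) with ((g (z + r) - g z) - (f (z + r) - f z)) by (rewrite E; ring).
eapply Rle_trans. apply Cmod_sub_le. lra.
Qed.

Lemma is_derive_C_inv (z : C) : z <> 0 -> Cinv ~> (- / (z * z)) at z.
Proof.
intro Hz. rewrite is_derive_Cmod. intros eps He.
assert (Hm := proj1 (Cmod_gt_0 z) Hz).
set (m := Cmod z) in *.
assert (Hq : (0 < eps * (m * m * m) / 2)%R).
{ apply Rdiv_lt_0_compat; [|lra]. repeat apply Rmult_lt_0_compat; lra. }
exists (Rmin (m / 2) (eps * (m * m * m) / 2)). split. apply Rmin_pos; lra.
intros w Hw.
assert (H1 : (Cmod (w - z) < m / 2)%R) by (apply Rlt_le_trans with (1 := Hw); apply Rmin_l).
assert (H2 : (Cmod (w - z) < eps * (m * m * m) / 2)%R) by (apply Rlt_le_trans with (1 := Hw); apply Rmin_r).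
assert (Hwm : (m / 2 < Cmod w)%R).
{ assert (h := Cmod_le_sub z w). rewrite Cmod_sub_sym in h. fold m in h. lra. }
assert (Hw0 : w <> 0) by (apply Cmod_gt_0; lra).
(* The error is exactly [(w - z)^2 / (w z^2)]. The first bound on [|w - z|] keeps [|w|] above
   [|z|/2], the second yields [eps]. *)
replace (/ w - / z - (w - z) * - / (z * z)) with ((w - z) * ((w - z) * / (w * (z * z)))) by (field; auto).
rewrite !Cmod_mult. rewrite Rmult_comm. apply Rmult_le_compat_r. apply Cmod_ge_0.
rewrite Cmod_inv, !Cmod_mult; [|repeat apply Cmult_neq_0; auto]. fold m.
apply Rle_trans with (eps * (m * m * m) / 2 * / (m / 2 * (m * m)))%R.
apply Rmult_le_compat. apply Cmod_ge_0. left. apply Rinv_0_lt_compat. apply Rmult_lt_0_compat; nra. lra.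
apply Rinv_le_contravar. apply Rmult_lt_0_compat; nra. apply Rmult_le_compat_r; nra.
right. field. lra.
Qed.

Lemma is_derive_C_div f g z a b : f ~> a at z -> g ~> b at z -> g z <> 0 ->
  (fun u => f u / g u) ~> ((a * g z - f z * b) / (g z * g z)) at z.
Proof.
intros H1 H2 H. unfold Cdiv at 1. eapply is_derive_eq. apply is_derive_C_mult. exact H1.
eapply (is_derive_C_comp Cinv g). apply is_derive_C_inv. exact H. exact H2. cbv beta. field. auto.
Qed.

Lemma is_derive_C_sum1n n (f : nat -> C -> C) (df : nat -> C) z :
  (forall j, (1 <= j <= n)%nat -> f j ~> df j at z) ->
  (fun u => sum1n n (fun j => f j u)) ~> sum1n n df at z.
Proof.
induction n; intro H.
- unfold sum1n. eapply is_derive_ext_all; [|eapply is_derive_eq; [apply (is_derive_C_const 0)|]].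
  intro w. symmetry. apply (sum_n_m_zero (G := C_AbelianMonoid)). lia.
  symmetry. apply (sum_n_m_zero (G := C_AbelianMonoid)). lia.
- unfold sum1n in *. eapply is_derive_ext_all; [|eapply is_derive_eq].
  intro w. symmetry. apply (sum_n_Sm (G := C_AbelianMonoid)). lia.
  apply is_derive_C_plus. apply IHn. intros; apply H; lia. apply H. lia.
  symmetry. apply (sum_n_Sm (G := C_AbelianMonoid)). lia.
Qed.

Lemma holo_const a z : holo (fun _ => a) z.
Proof. eexists. apply is_derive_C_const. Qed.
Lemma holo_id z : holo (fun u => u) z.
Proof. eexists. apply is_derive_C_id. Qed.
Lemma holo_plus f g z : holo f z -> holo g z -> holo (fun u => f u + g u) z.
Proof. intros [a Ha] [b Hb]. eexists. apply is_derive_C_plus; eassumption. Qed.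
Lemma holo_minus f g z : holo f z -> holo g z -> holo (fun u => f u - g u) z.
Proof. intros [a Ha] [b Hb]. eexists. apply is_derive_C_minus; eassumption. Qed.
Lemma holo_opp f z : holo f z -> holo (fun u => - f u) z.
Proof. intros [a Ha]. eexists. apply is_derive_C_opp; eassumption. Qed.
Lemma holo_mult f g z : holo f z -> holo g z -> holo (fun u => f u * g u) z.
Proof. intros [a Ha] [b Hb]. eexists. apply is_derive_C_mult; eassumption. Qed.
Lemma holo_div f g z : holo f z -> holo g z -> g z <> 0 -> holo (fun u => f u / g u) z.
Proof. intros [a Ha] [b Hb] H. eexists. apply is_derive_C_div; eassumption. Qed.
Lemma holo_comp f g z : holo f (g z) -> holo g z -> holo (fun u => f (g u)) z.
Proof. intros [a Ha] [b Hb]. eexists. apply is_derive_C_comp; eassumption. Qed.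
Lemma holo_sum1n n (f : nat -> C -> C) z : (forall j, (1 <= j <= n)%nat -> holo (f j) z) ->
  holo (fun u => sum1n n (fun j => f j u)) z.
Proof.
intro H. eexists. apply is_derive_C_sum1n with (df := fun j => CDeriv (f j) z).
intros j Hj. apply CDeriv_correct. now apply H.
Qed.
Lemma holo_ext_near f g z : (exists d, (0 < d)%R /\ forall w, (Cmod (w - z) < d)%R -> f w = g w) ->
  holo f z -> holo g z.
Proof. intros H [l Hl]. exists l. now apply is_derive_ext_near with f. Qed.
Lemma holo_Cpow f k z : holo f z -> holo (fun u => Cpow (f u) k) z.
Proof. intro H. induction k; simpl. apply holo_const. now apply holo_mult. Qed.
Lemma holo_sub_const a z : holo (fun u => u - a) z.
Proof. apply holo_minus. apply holo_id. apply holo_const. Qed.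
Lemma holo_shift f a z : holo f (z - a) -> holo (fun u => f (u - a)) z.
Proof. intro H. apply (holo_comp f (fun u => u - a)). exact H. apply holo_sub_const. Qed.

Lemma is_derive_shift f a z l : f ~> l at (z - a) -> (fun u => f (u - a)) ~> l at z.
Proof.
intro H. eapply is_derive_eq. apply (is_derive_C_comp f (fun u => u - a)). exact H.
apply is_derive_C_minus. apply is_derive_C_id. apply is_derive_C_const. ring.
Qed.

Lemma is_derive_shift_plus f a z l : f ~> l at (z + a) -> (fun u => f (u + a)) ~> l at z.
Proof.
intro H. eapply is_derive_eq. apply (is_derive_C_comp f (fun u => u + a)). exact H.
apply is_derive_C_plus. apply is_derive_C_id. apply is_derive_C_const. ring.
Qed.

(** * The complex exponential *)

Lemma Cexp_plus (x y : C) : Cexp (x + y) = Cexp x * Cexp y.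
Proof.
unfold Cexp. destruct x as [a b], y as [c d]. simpl.
rewrite exp_plus, cos_plus, sin_plus. unfold Cmult; simpl. f_equal; ring.
Qed.

Lemma Cexp_0 : Cexp 0 = 1.
Proof. unfold Cexp. simpl. rewrite exp_0, cos_0, sin_0. unfold RtoC. f_equal; ring. Qed.

Lemma Cexp_opp_mult (x : C) : Cexp (- x) * Cexp x = 1.
Proof. rewrite <- Cexp_plus. replace (- x + x) with (RtoC 0) by ring. apply Cexp_0. Qed.

Lemma Cexp_neq_0 (x : C) : Cexp x <> 0.
Proof.
intro H. assert (E := Cexp_opp_mult x). rewrite H, Cmult_0_r in E.
apply RtoC_inj in E. lra.
Qed.

Lemma Cexp_opp (x : C) : Cexp (- x) = / Cexp x.
Proof.
assert (H := Cexp_neq_0 x). replace (Cexp (- x)) with (Cexp (- x) * Cexp x * / Cexp x) by (field; auto).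
rewrite Cexp_opp_mult. ring.
Qed.

Lemma Cmod_Cexp (x : C) : Cmod (Cexp x) = exp (Re x).
Proof.
destruct x as [a b]. unfold Cmod, Cexp. simpl.
replace (_ + _)%R with (exp a * exp a * (Rsqr (cos b) + Rsqr (sin b)))%R by (unfold Rsqr; ring).
rewrite Rplus_comm, sin2_cos2, Rmult_1_r. apply sqrt_square. left. apply exp_pos.
Qed.

Lemma Cexp_nat (n : nat) (x : C) : Cexp (RtoC (INR n) * x) = Cexp x ^ n.
Proof.
induction n. simpl. rewrite Cmult_0_l. apply Cexp_0.
rewrite S_INR, RtoC_plus, Cmult_plus_distr_r, Cexp_plus, IHn, Cmult_1_l.
rewrite Cpow_S. ring.
Qed.

Lemma twopii_eq : twopii = (0, 2 * PI)%R.
Proof. unfold twopii, Ci, RtoC, Cmult. simpl. f_equal; ring. Qed.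

Lemma Cexp_Z (k : Z) : Cexp (twopii * RtoC (IZR k)) = 1.
Proof.
rewrite twopii_eq. unfold Cexp, Cmult, RtoC. simpl.
replace (0 * IZR k - 2 * PI * 0)%R with 0%R by ring.
replace (0 * 0 + 2 * PI * IZR k)%R with (2 * IZR k * PI)%R by ring.
rewrite exp_0.
assert (E : sin (IZR k * PI) = 0%R) by (apply sin_eq_0_1; now exists k).
replace (2 * IZR k * PI)%R with (2 * (IZR k * PI))%R by ring.
rewrite cos_2a_sin, sin_2a, E. f_equal; ring.
Qed.

(** The modulus forces the real part to vanish; then [cos b = 1 - 2 sin(b/2)^2] turns [cos b = 1]
    into a zero of the sine at [b/2]. *)
Lemma Cexp_eq_1 (z : C) : Cexp z = 1 -> exists k : Z, z = twopii * RtoC (IZR k).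
Proof.
destruct z as [a b]. unfold Cexp, RtoC. simpl. intro H. injection H as H1 H2.
assert (Ha : exp a = 1%R).
{ assert (E := Cmod_Cexp (a, b)). unfold Cexp in E. simpl in E.
  rewrite <- E, H1, H2. apply Cmod_1. }
rewrite Ha in H1, H2.
assert (a = 0%R) by (rewrite <- exp_0 in Ha; now apply exp_inv in Ha).
assert (Hs : sin (b / 2) = 0%R).
{ assert (E := cos_2a_sin (b / 2)). replace (2 * (b/2))%R with b in E by field. nra. }
apply sin_eq_0_0 in Hs. destruct Hs as [k Hk]. exists k.
rewrite twopii_eq. unfold Cmult, RtoC. simpl. f_equal. lra. rewrite Rmult_0_l, Rplus_0_l.
replace b with (2 * (b/2))%R by field. rewrite Hk. ring.
Qed.

Lemma derivable_pt_lim_eps (f : R -> R) x l : derivable_pt_lim f x l ->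
  forall eps, (0 < eps)%R -> exists d, (0 < d)%R /\
   forall h, (Rabs h < d)%R -> (Rabs (f (x + h) - f x - l * h) <= eps * Rabs h)%R.
Proof.
intros H eps He. destruct (H eps He) as [d Hd]. exists d. split. apply cond_pos.
intros h Hh. destruct (Req_dec h 0) as [->|H0].
rewrite Rplus_0_r. replace (f x - f x - l * 0)%R with 0%R by ring. rewrite Rabs_R0. lra.
specialize (Hd h H0 Hh).
replace (f (x + h) - f x - l * h)%R with (((f (x + h) - f x) / h - l) * h)%R by (field; auto).
rewrite Rabs_mult. apply Rmult_le_compat_r. apply Rabs_pos. lra.
Qed.

Lemma Cmod_le_Re_Im (z : C) : (Cmod z <= Rabs (Re z) + Rabs (Im z))%R.
Proof.
destruct z as [a b].
replace (a, b) with (RtoC a + Ci * RtoC b) by (unfold RtoC, Ci, Cmult, Cplus; simpl; f_equal; ring).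
eapply Rle_trans. apply Cmod_triangle. rewrite Cmod_mult, Cmod_Ci, !Cmod_R.
unfold RtoC, Ci, Cmult, Cplus; simpl.
replace (a + (0 * b - 1 * 0))%R with a by ring. replace (0 + (0 * 0 + 1 * b))%R with b by ring. lra.
Qed.

Lemma Im_le_Cmod (z : C) : (Rabs (Im z) <= Cmod z)%R.
Proof. destruct z as [a b]. eapply Rle_trans; [|apply Rmax_Cmod]. simpl. apply Rmax_r. Qed.

Lemma is_derive_Cexp_0 : Cexp ~> 1 at 0.
Proof.
apply is_derive_Cmod. intros eps He.
(* The bound 1 keeps [exp x] below 3. The errors of the real and imaginary parts then come to 4 and
   5 times [eps/12], hence the denominator. *)
destruct (derivable_pt_lim_eps exp 0 1 derivable_pt_lim_exp_0 (Rmin 1 (eps/12))) as [d1 [Hd1 K1]].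
apply Rmin_pos; lra.
destruct (derivable_pt_lim_eps cos 0 (- sin 0) (derivable_pt_lim_cos 0) (eps/12)%R ltac:(lra)) as [d2 [Hd2 K2]].
destruct (derivable_pt_lim_eps sin 0 (cos 0) (derivable_pt_lim_sin 0) (eps/12)%R ltac:(lra)) as [d3 [Hd3 K3]].
set (m := Rmin (Rmin d1 (eps/12)) (Rmin 1 (Rmin d2 d3))).
assert (Hm : (0 < m)%R) by (unfold m; repeat apply Rmin_pos; lra).
assert (h1 := Rmin_l (Rmin d1 (eps/12)) (Rmin 1 (Rmin d2 d3))).
assert (h2 := Rmin_r (Rmin d1 (eps/12)) (Rmin 1 (Rmin d2 d3))).
assert (h3 := Rmin_l d1 (eps/12)). assert (h4 := Rmin_r d1 (eps/12)).
assert (h5 := Rmin_l 1 (Rmin d2 d3)). assert (h6 := Rmin_r 1 (Rmin d2 d3)).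
assert (h7 := Rmin_l d2 d3). assert (h8 := Rmin_r d2 d3). fold m in h1, h2.
exists m. split; auto.
intros w Hw. rewrite Cexp_0. replace (w - 0) with w in * by ring. rewrite Cmult_1_r.
destruct w as [x y].
assert (Hx := re_le_Cmod (x, y)). assert (Hy := Im_le_Cmod (x, y)). simpl in Hx, Hy.
set (t := Cmod (x, y)) in *.
specialize (K1 x ltac:(lra)). specialize (K2 y ltac:(lra)). specialize (K3 y ltac:(lra)).
rewrite sin_0, cos_0, exp_0, !Rplus_0_l in *.
assert (k1 := Rmin_l 1 (eps/12)). assert (k2 := Rmin_r 1 (eps/12)).
assert (Ht : (0 <= t)%R) by apply Cmod_ge_0.
assert (K1a : (Rabs (exp x - 1 - 1 * x) <= Rabs x)%R).
{ eapply Rle_trans. exact K1. rewrite <- (Rmult_1_l (Rabs x)) at 2. apply Rmult_le_compat_r. apply Rabs_pos. lra. }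
assert (K1b : (Rabs (exp x - 1 - 1 * x) <= eps/12 * t)%R).
{ eapply Rle_trans. exact K1. apply Rmult_le_compat; try lra. apply Rmin_glb; lra. apply Rabs_pos. }
assert (Ex : (0 < exp x <= 3)%R).
{ split. apply exp_pos. assert (u := Rle_abs (exp x - 1 - 1 * x)). assert (v := Rle_abs x). lra. }
assert (Ex1 : (Rabs (exp x - 1) <= 2 * t)%R).
{ replace (exp x - 1)%R with ((exp x - 1 - 1 * x) + x)%R by ring. eapply Rle_trans. apply Rabs_triang. lra. }
eapply Rle_trans. apply Cmod_le_Re_Im.
unfold Cexp. simpl.
assert (A1 : (Rabs (exp x * cos y + - (1) + - x) <= 4 * (eps/12) * t)%R).
{ replace (exp x * cos y + - (1) + - x)%R with ((exp x - 1 - 1 * x) + exp x * (cos y - 1 - - 0 * y))%R by ring.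
  eapply Rle_trans. apply Rabs_triang. rewrite Rabs_mult. rewrite (Rabs_pos_eq (exp x)) by lra.
  assert (exp x * Rabs (cos y - 1 - - 0 * y) <= 3 * (eps/12 * t))%R.
  { apply Rmult_le_compat; try lra. apply Rabs_pos. eapply Rle_trans. exact K2. apply Rmult_le_compat_l; lra. }
  lra. }
assert (A2 : (Rabs (exp x * sin y + - 0 + - y) <= 5 * (eps/12) * t)%R).
{ replace (exp x * sin y + - 0 + - y)%R with (exp x * (sin y - 0 - 1 * y) + (exp x - 1) * y)%R by ring.
  eapply Rle_trans. apply Rabs_triang. rewrite !Rabs_mult. rewrite (Rabs_pos_eq (exp x)) by lra.
  assert (exp x * Rabs (sin y - 0 - 1 * y) <= 3 * (eps/12 * t))%R.
  { apply Rmult_le_compat; try lra. apply Rabs_pos. eapply Rle_trans. exact K3. apply Rmult_le_compat_l; lra. }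
  assert (Rabs (exp x - 1) * Rabs y <= (2 * t) * (eps/12))%R.
  { apply Rmult_le_compat; try lra; apply Rabs_pos. }
  lra. }
nra.
Qed.

Lemma is_derive_Cexp (z : C) : Cexp ~> Cexp z at z.
Proof.
eapply is_derive_ext_all; [|eapply is_derive_eq].
2: { apply (is_derive_C_scal (Cexp z) (fun u => Cexp (u - z))). apply is_derive_shift.
     replace (z - z) with (RtoC 0) by ring. apply is_derive_Cexp_0. }
- intro w. cbv beta. rewrite <- Cexp_plus. f_equal. ring.
- ring.
Qed.

Lemma is_derive_Cexp_lin (a z : C) : (fun u => Cexp (a * u)) ~> (a * Cexp (a * z)) at z.
Proof.
eapply is_derive_eq. apply (is_derive_C_comp Cexp (fun u => a * u)). apply is_derive_Cexp.
apply is_derive_C_scal. apply is_derive_C_id. ring.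
Qed.

Lemma holo_Cexp_lin (a z : C) : holo (fun u => Cexp (a * u)) z.
Proof. eexists. apply is_derive_Cexp_lin. Qed.

Lemma Cpow_Defs (z : C) k : Defs.Cpow z k = z ^ k.
Proof. induction k; simpl; [reflexivity|]. now rewrite IHk. Qed.

(** * Power series *)
Fixpoint csum (a : nat -> C) (n : nat) : C :=
  match n with O => 0 | S k => csum a k + a k end.
Fixpoint rsum (a : nat -> R) (n : nat) : R :=
  match n with O => 0%R | S k => (rsum a k + a k)%R end.

Definition csums (a : nat -> C) (l : C) : Prop :=
  forall eps, (0 < eps)%R -> exists N, forall n, (N <= n)%nat -> (Cmod (csum a n - l) < eps)%R.

Lemma csum_ext a b n : (forall k, (k < n)%nat -> a k = b k) -> csum a n = csum b n.
Proof. induction n; intro H; simpl. reflexivity. rewrite IHn, H; auto. Qed.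
Lemma csum_plus a b n : csum (fun k => a k + b k) n = csum a n + csum b n.
Proof. induction n; simpl. ring. rewrite IHn. ring. Qed.
Lemma csum_minus a b n : csum (fun k => a k - b k) n = csum a n - csum b n.
Proof. induction n; simpl. ring. rewrite IHn. ring. Qed.
Lemma csum_scal c a n : csum (fun k => c * a k) n = c * csum a n.
Proof. induction n; simpl. ring. rewrite IHn. ring. Qed.
Lemma csum_shift a n : csum a (S n) = a O + csum (fun k => a (S k)) n.
Proof. induction n. simpl. ring. change (csum a (S (S n))) with (csum a (S n) + a (S n)). rewrite IHn. simpl. ring. Qed.
Lemma csum_split a n m : csum a (n + m) = csum a n + csum (fun k => a (n + k)%nat) m.
Proof. induction m; simpl. rewrite Nat.add_0_r. ring. rewrite Nat.add_succ_r. simpl. rewrite IHm. ring. Qed.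

Lemma rsum_le a b n : (forall k, (k < n)%nat -> (a k <= b k)%R) -> (rsum a n <= rsum b n)%R.
Proof. induction n; intro H; simpl. lra. apply Rplus_le_compat; auto. Qed.
Lemma rsum_scal c a n : rsum (fun k => c * a k)%R n = (c * rsum a n)%R.
Proof. induction n; simpl. ring. rewrite IHn. ring. Qed.
Lemma rsum_ge_0 a n : (forall k, (k < n)%nat -> (0 <= a k)%R) -> (0 <= rsum a n)%R.
Proof. induction n; intro H; simpl. lra. assert (h := H n ltac:(lia)). assert (0 <= rsum a n)%R by auto. lra. Qed.

Lemma Cmod_csum_le a n : (Cmod (csum a n) <= rsum (fun k => Cmod (a k)) n)%R.
Proof. induction n; simpl. rewrite Cmod_0. lra. eapply Rle_trans. apply Cmod_triangle. lra. Qed.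

Lemma rsum_geom q n : (0 <= q < 1)%R -> (rsum (fun k => q ^ k)%R n <= / (1 - q))%R.
Proof.
intro Hq. assert (E : (rsum (fun k => q ^ k)%R n = (1 - q ^ n) / (1 - q))%R).
{ induction n; simpl. field. lra. rewrite IHn. field. lra. }
rewrite E. unfold Rdiv. rewrite <- (Rmult_1_l (/ (1 - q))) at 2. apply Rmult_le_compat_r.
left. apply Rinv_0_lt_compat. lra. assert (h := pow_le q n ltac:(lra)). lra.
Qed.

Lemma csums_unique a l1 l2 : csums a l1 -> csums a l2 -> l1 = l2.
Proof.
intros H1 H2. assert (l1 - l2 = 0); [|replace l1 with (l1 - l2 + l2) by ring; rewrite H; ring].
apply Cmod_small_eq_0. intros eps He.
destruct (H1 (eps/2)%R ltac:(lra)) as [N1 K1]. destruct (H2 (eps/2)%R ltac:(lra)) as [N2 K2].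
specialize (K1 (N1 + N2)%nat ltac:(lia)). specialize (K2 (N1 + N2)%nat ltac:(lia)).
eapply Rle_trans. apply (Cmod_triangle_sub _ (csum a (N1 + N2))).
rewrite (Cmod_sub_sym l1). lra.
Qed.

Lemma csums_ext a b l : (forall k, a k = b k) -> csums a l -> csums b l.
Proof.
intros E H eps He. destruct (H eps He) as [N K]. exists N. intros n Hn.
rewrite <- (csum_ext a b); auto.
Qed.

Lemma csums_plus a b l1 l2 : csums a l1 -> csums b l2 -> csums (fun k => a k + b k) (l1 + l2).
Proof.
intros H1 H2 eps He.
destruct (H1 (eps/2)%R ltac:(lra)) as [N1 K1]. destruct (H2 (eps/2)%R ltac:(lra)) as [N2 K2].
exists (N1 + N2)%nat. intros n Hn. specialize (K1 n ltac:(lia)). specialize (K2 n ltac:(lia)).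
rewrite csum_plus. replace (_ - _) with ((csum a n - l1) + (csum b n - l2)) by ring.
eapply Rle_lt_trans. apply Cmod_triangle. lra.
Qed.

Lemma csums_scal c a l : csums a l -> csums (fun k => c * a k) (c * l).
Proof.
intros H eps He. assert (Hc := Cmod_ge_0 c).
destruct (H (eps / (Cmod c + 1))%R) as [N K]. apply Rdiv_lt_0_compat; lra.
exists N. intros n Hn. specialize (K n Hn). rewrite csum_scal.
replace (_ - _) with (c * (csum a n - l)) by ring. rewrite Cmod_mult.
apply Rle_lt_trans with ((Cmod c + 1) * Cmod (csum a n - l))%R. apply Rmult_le_compat_r. apply Cmod_ge_0. lra.
apply Rlt_le_trans with ((Cmod c + 1) * (eps / (Cmod c + 1)))%R. apply Rmult_lt_compat_l; lra.
right. field. lra.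
Qed.

Lemma csums_minus a b l1 l2 : csums a l1 -> csums b l2 -> csums (fun k => a k - b k) (l1 - l2).
Proof.
intros H1 H2. replace (l1 - l2) with (l1 + (- (1)) * l2) by ring.
apply csums_ext with (fun k => a k + (- (1)) * b k). intro; ring.
apply csums_plus; auto. now apply csums_scal.
Qed.

Lemma csums_shift a l : csums a l -> csums (fun k => a (S k)) (l - a O).
Proof.
intros H eps He. destruct (H eps He) as [N K]. exists N. intros n Hn. specialize (K (S n) ltac:(lia)).
rewrite csum_shift in K. replace (_ - (l - a O)) with (a O + csum (fun k => a (S k)) n - l) by ring. exact K.
Qed.

Lemma csums_unshift a l : csums (fun k => a (S k)) l -> csums a (a O + l).
Proof.
intros H eps He. destruct (H eps He) as [N K]. exists (S N). intros n Hn.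
destruct n as [|n]; [lia|]. specialize (K n ltac:(lia)).
rewrite csum_shift. replace (_ - (_ + l)) with (csum (fun k => a (S k)) n - l) by ring. exact K.
Qed.

Lemma csums_bound a l B : csums a l -> (exists N, forall n, (N <= n)%nat -> (Cmod (csum a n) <= B)%R) -> (Cmod l <= B)%R.
Proof.
intros H [N0 HB]. apply le_epsilon. intros eps He. destruct (H eps He) as [N K].
specialize (K (N0 + N)%nat ltac:(lia)). specialize (HB (N0 + N)%nat ltac:(lia)).
assert (h := Cmod_le_sub l (csum a (N0 + N))). rewrite Cmod_sub_sym in h. lra.
Qed.


Lemma sum_n_csum (a : nat -> C) n : sum_n a n = csum a (S n).
Proof.
induction n. simpl. rewrite sum_O. now rewrite Cplus_0_l. rewrite sum_Sn, IHn. reflexivity.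
Qed.

Lemma csums_is_series (a : nat -> C) l : is_series (K := C_AbsRing) (V := C_NormedModule) a l -> csums a l.
Proof.
intros H eps He.
(* Balls of the normed module [C] are squares, contained in discs only after scaling by [sqrt 2]. *)
assert (Hs : (0 < sqrt 2)%R) by (apply sqrt_lt_R0; lra).
assert (Hq : (0 < eps / sqrt 2)%R) by (apply Rdiv_lt_0_compat; lra).
destruct (H (fun y => ball l (mkposreal _ Hq) y)) as [N HN]. now exists (mkposreal _ Hq).
exists (S N). intros n Hn. destruct n as [|n]; [lia|]. specialize (HN n ltac:(lia)).
apply C_NormedModule_mixin_compat2 in HN. rewrite sum_n_csum in HN.
eapply Rlt_le_trans. exact HN. simpl. right. field. lra.
Qed.

Lemma csums_abs_conv a B : (forall n, (rsum (fun k => Cmod (a k)) n <= B)%R) ->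
  exists l, csums a l /\ (Cmod l <= B)%R.
Proof.
intro H.
assert (Hr : ex_series (fun k => Cmod (a k))).
{ destruct (ex_finite_lim_seq_incr (sum_n (fun k => Cmod (a k))) B) as [l Hl].
  - intro n. rewrite sum_Sn. unfold plus. simpl. assert (h := Cmod_ge_0 (a (S n))). lra.
  - intro n. replace (sum_n (fun k => Cmod (a k)) n) with (rsum (fun k => Cmod (a k)) (S n)). apply H.
    induction n. rewrite sum_O. simpl. ring. rewrite sum_Sn, <- IHn. reflexivity.
  - exists l. exact Hl. }
destruct (ex_series_le (K := C_AbsRing) (V := C_CompleteNormedModule) a (fun k => Cmod (a k)) (fun n => Rle_refl _) Hr) as [l Hl].
exists l. apply csums_is_series in Hl. split; auto. apply csums_bound with a; auto.
exists O. intros n _. eapply Rle_trans. apply Cmod_csum_le. apply H.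
Qed.

Lemma Rpow_binomial_quadratic (rho d : R) k : (0 <= rho)%R -> (0 <= d)%R ->
  (0 <= (rho + d) ^ k - rho ^ k - INR k * rho ^ (k - 1) * d)%R.
Proof.
intros Hr Hd. induction k. simpl. lra.
replace (S k - 1)%nat with k by lia. rewrite S_INR.
assert (E : (INR k * rho ^ (k - 1) * rho = INR k * rho ^ k)%R).
{ destruct k. simpl. ring. simpl. replace (k - 0)%nat with k by lia. ring. }
assert (Hp : (0 <= INR k * rho ^ (k - 1))%R) by (apply Rmult_le_pos; [apply pos_INR | now apply pow_le]).
simpl. nra.
Qed.

(** The remainder of [(z + h)^k] beyond first order is [h^2] times a polynomial in [z] and [h] with
    nonnegative coefficients, hence dominated by its value at [(rho, d)]. The division by [d^2] is
    cleared to the left. *)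
Lemma Cpow_quadratic (z h : C) (rho d : R) k : (Cmod z <= rho)%R -> (Cmod h <= d)%R -> (0 < d)%R ->
  (Cmod ((z + h) ^ k - z ^ k - RtoC (INR k) * z ^ (k - 1) * h) * (d * d) <= Cmod h * Cmod h *
    ((rho + d) ^ k - rho ^ k - INR k * rho ^ (k - 1) * d))%R.
Proof.
intros Hz Hh Hd. assert (H0 := Cmod_ge_0 z). assert (H1 := Cmod_ge_0 h).
induction k.
- simpl. replace (1 - 1 - RtoC 0 * 1 * h) with (RtoC 0) by ring. rewrite Cmod_0. lra.
- replace (S k - 1)%nat with k by lia. rewrite S_INR.
assert (E : RtoC (INR k) * z ^ (k - 1) * z = RtoC (INR k) * z ^ k).
{ destruct k. simpl. ring. simpl. replace (k - 0)%nat with k by lia. ring. }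
assert (E' : (INR k * rho ^ (k - 1) * rho = INR k * rho ^ k)%R).
{ destruct k. simpl. ring. simpl. replace (k - 0)%nat with k by lia. ring. }
assert (Hq := Rpow_binomial_quadratic rho d k ltac:(lra) ltac:(lra)).
set (Q := ((rho + d) ^ k - rho ^ k - INR k * rho ^ (k - 1) * d)%R) in *.
replace ((z + h) ^ S k - z ^ S k - RtoC (INR k + 1) * z ^ k * h) with
 ((z + h) * ((z + h) ^ k - z ^ k - RtoC (INR k) * z ^ (k - 1) * h) + RtoC (INR k) * z ^ (k - 1) * (h * h)).
2: { rewrite !Cpow_S, RtoC_plus. transitivity ((z + h) * (z + h) ^ k - (z + h) * z ^ k - RtoC (INR k) * z ^ (k - 1) * z * h). ring. rewrite E. ring. }
set (D := (z + h) ^ k - z ^ k - RtoC (INR k) * z ^ (k - 1) * h) in *.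
assert (HD := Cmod_ge_0 D).
assert (HT : (Cmod (z + h) <= rho + d)%R) by (eapply Rle_trans; [apply Cmod_triangle|lra]).
assert (HT' : (0 <= Cmod (z + h))%R) by apply Cmod_ge_0.
assert (Hk := pos_INR k).
assert (Hp : (Cmod (RtoC (INR k) * z ^ (k - 1)) <= INR k * rho ^ (k - 1))%R).
{ rewrite Cmod_mult, Cmod_R, Rabs_pos_eq, Cmod_pow by auto. apply Rmult_le_compat_l; auto. apply pow_incr. lra. }
eapply Rle_trans. apply Rmult_le_compat_r. nra. apply Cmod_triangle.
rewrite (Cmod_mult (z + h)), (Cmod_mult _ (h * h)), (Cmod_mult h h).
apply Rle_trans with ((rho + d) * (Cmod h * Cmod h * Q) + (INR k * rho ^ (k - 1)) * (Cmod h * Cmod h) * (d * d))%R.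
rewrite Rmult_plus_distr_r. apply Rplus_le_compat.
rewrite Rmult_assoc. apply Rmult_le_compat; auto; nra.
apply Rmult_le_compat_r. nra. apply Rmult_le_compat_r. nra. exact Hp.
right. unfold Q. simpl.
transitivity (Cmod h * Cmod h * ((rho + d) * (rho + d) ^ k - (rho + d) * rho ^ k - INR k * rho ^ (k - 1) * rho * d))%R. ring.
rewrite E'. ring.
Qed.

Definition dcoef (a : nat -> C) (k : nat) : C := RtoC (INR (S k)) * a (S k).

(** Shrinking the radius pays for the factor [k + 1]: the first-order term of the binomial expansion
    gives [(k + 1) r'^k (r - r') <= r^(k + 1)]. *)
Lemma dcoef_bound a r r' M : (0 < r' < r)%R -> (forall k, (Cmod (a k) * r ^ k <= M)%R) ->
  forall k, (Cmod (dcoef a k) * r' ^ k <= M / (r - r'))%R.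
Proof.
intros Hr H k. unfold dcoef. rewrite Cmod_mult, Cmod_R, Rabs_pos_eq by apply pos_INR.
assert (Q := Rpow_binomial_quadratic r' (r - r') (S k) ltac:(lra) ltac:(lra)).
replace (r' + (r - r'))%R with r in Q by ring. replace (S k - 1)%nat with k in Q by lia.
assert (Hp := pow_le r' (S k) ltac:(lra)).
specialize (H (S k)). assert (Ha := Cmod_ge_0 (a (S k))).
apply Rmult_le_reg_r with (r - r')%R. lra.
apply Rle_trans with (Cmod (a (S k)) * r ^ S k)%R.
apply Rle_trans with (Cmod (a (S k)) * (INR (S k) * r' ^ k * (r - r')))%R. right; ring.
apply Rmult_le_compat_l; lra.
apply Rle_trans with (1 := H). right. field. lra.
Qed.

Lemma pser_abs a r M z : (forall k, (Cmod (a k) * r ^ k <= M)%R) -> (Cmod z < r)%R ->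
  forall n, (rsum (fun k => Cmod (a k * z ^ k)) n <= M * / (1 - Cmod z / r))%R.
Proof.
intros H Hz n. assert (H0 := Cmod_ge_0 z).
assert (Hq : (0 <= Cmod z / r < 1)%R).
{ split. apply Rmult_le_pos; auto. left. apply Rinv_0_lt_compat. lra.
  apply Rmult_lt_reg_r with r. lra. unfold Rdiv. rewrite Rmult_assoc, Rinv_l by lra. lra. }
assert (HM : (0 <= M)%R). { eapply Rle_trans; [|apply (H O)]. simpl. assert (h := Cmod_ge_0 (a O)). lra. }
eapply Rle_trans. 2: { apply Rmult_le_compat_l. exact HM. apply (rsum_geom _ n Hq). }
rewrite <- rsum_scal. apply rsum_le. intros k _. rewrite Cmod_mult, Cmod_pow.
unfold Rdiv. rewrite Rpow_mult_distr.
apply Rle_trans with ((Cmod (a k) * r ^ k) * (Cmod z ^ k * (/ r) ^ k))%R.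
right. rewrite pow_inv. field. apply pow_nonzero. lra.
apply Rmult_le_compat_r. apply Rmult_le_pos. now apply pow_le. apply pow_le. left. apply Rinv_0_lt_compat. lra.
apply H.
Qed.

Lemma pser_conv a r M z : (forall k, (Cmod (a k) * r ^ k <= M)%R) -> (Cmod z < r)%R ->
  exists l, csums (fun k => a k * z ^ k) l /\ (Cmod l <= M * / (1 - Cmod z / r))%R.
Proof. intros H Hz. apply csums_abs_conv. now apply pser_abs. Qed.

(** Termwise differentiation. At a radius [r'] strictly between [|z|] and [r], the second-order
    remainders of all terms are dominated by a geometric series of ratio [r'/r], so the total error
    is at most [K |h|^2]. *)
Lemma pser_is_derive a (f : C -> C) r M :
  (forall k, (Cmod (a k) * r ^ k <= M)%R) ->
  (forall z, (Cmod z < r)%R -> csums (fun k => a k * z ^ k) (f z)) ->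
  forall z, (Cmod z < r)%R -> exists l, csums (fun k => dcoef a k * z ^ k) l /\ f ~> l at z.
Proof.
intros H Hf z Hz. assert (H0 := Cmod_ge_0 z).
set (d := ((r - Cmod z) / 2)%R). assert (Hd : (0 < d)%R) by (unfold d; lra).
set (r' := (Cmod z + d)%R). assert (Hr' : (0 < r' < r)%R) by (unfold r', d; lra).
assert (HM : (0 <= M)%R). { eapply Rle_trans; [|apply (H O)]. simpl. assert (h := Cmod_ge_0 (a O)). lra. }
destruct (pser_conv (dcoef a) r' (M / (r - r')) z (dcoef_bound a r r' M Hr' H)) as [l [Hl _]].
unfold r'; lra.
exists l. split; auto.
set (q := (r' / r)%R).
assert (Hq : (0 <= q < 1)%R).
{ unfold q. split. apply Rmult_le_pos; try lra. left. apply Rinv_0_lt_compat. lra.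
  apply Rmult_lt_reg_r with r. lra. unfold Rdiv. rewrite Rmult_assoc, Rinv_l by lra. lra. }
set (K := (M * / (1 - q) / (d * d))%R).
assert (HK : (0 <= K)%R).
{ unfold K. apply Rmult_le_pos. apply Rmult_le_pos; auto. left. apply Rinv_0_lt_compat; lra.
  left. apply Rinv_0_lt_compat. nra. }
assert (HQ : forall h, (Cmod h <= d)%R -> (Cmod (f (z + h)%C - f z - h * l) <= K * (Cmod h * Cmod h))%R).
{ intros h Hh.
  assert (S1 : csums (fun k => a k * (z + h) ^ k - a k * z ^ k) (f (z + h) - f z)).
  { apply csums_minus; apply Hf; auto. eapply Rle_lt_trans. apply Cmod_triangle. unfold r' in Hr'. lra. }
  assert (S2 : csums (fun k => a k * (RtoC (INR k) * z ^ (k - 1) * h)) (h * l)).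
  { apply csums_scal with (c := h) in Hl.
    replace (h * l) with (a O * (RtoC (INR 0) * z ^ (0 - 1) * h) + h * l) by (simpl; ring).
    apply (csums_unshift (fun k => a k * (RtoC (INR k) * z ^ (k - 1) * h))).
    apply csums_ext with (2 := Hl). intro k. unfold dcoef. replace (S k - 1)%nat with k by lia. ring. }
  assert (S3 := csums_minus _ _ _ _ S1 S2).
  apply csums_bound with (1 := S3). exists O. intros n _.
  eapply Rle_trans. apply Cmod_csum_le.
  apply Rle_trans with (rsum (fun k => (M * (Cmod h * Cmod h) / (d * d)) * q ^ k)%R n).
  - apply rsum_le. intros k _.
    replace (a k * (z + h) ^ k - a k * z ^ k - a k * (RtoC (INR k) * z ^ (k - 1) * h))
      with (a k * ((z + h) ^ k - z ^ k - RtoC (INR k) * z ^ (k - 1) * h)) by ring.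
    assert (Q := Cpow_quadratic z h (Cmod z) d k (Rle_refl _) Hh Hd).
    set (D := Cmod ((z + h) ^ k - z ^ k - RtoC (INR k) * z ^ (k - 1) * h)) in *. fold r' in Q.
    rewrite Cmod_mult. fold D.
    assert (Hz1 := pow_le (Cmod z) k H0).
    assert (Hz2 : (0 <= INR k * Cmod z ^ (k - 1) * d)%R).
    { apply Rmult_le_pos; [|lra]. apply Rmult_le_pos. apply pos_INR. now apply pow_le. }
    assert (Hh0 : (0 <= Cmod h * Cmod h)%R) by (assert (g := Cmod_ge_0 h); nra).
    assert (Q' : (D * (d * d) <= Cmod h * Cmod h * r' ^ k)%R).
    { eapply Rle_trans. exact Q. apply Rmult_le_compat_l; lra. }
    apply Rmult_le_reg_r with (d * d)%R. nra.
    apply Rle_trans with (Cmod (a k) * (Cmod h * Cmod h * r' ^ k))%R.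
    rewrite Rmult_assoc. apply Rmult_le_compat_l; auto. apply Cmod_ge_0.
    assert (Er : (r' ^ k = r ^ k * q ^ k)%R). { rewrite <- Rpow_mult_distr. f_equal. unfold q. field. lra. }
    rewrite Er.
    apply Rle_trans with ((Cmod (a k) * r ^ k) * (Cmod h * Cmod h * q ^ k))%R. right; ring.
    apply Rle_trans with (M * (Cmod h * Cmod h * q ^ k))%R. apply Rmult_le_compat_r; auto.
    apply Rmult_le_pos; auto. apply pow_le; lra.
    right. field. lra.
  - rewrite rsum_scal. unfold K.
    apply Rle_trans with ((M * (Cmod h * Cmod h) / (d * d)) * / (1 - q))%R.
    apply Rmult_le_compat_l. apply Rmult_le_pos. apply Rmult_le_pos; auto. assert (g := Cmod_ge_0 h); nra.
    left. apply Rinv_0_lt_compat. nra. now apply rsum_geom.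
    right. field. split; lra. }
apply is_derive_Cmod. intros eps He.
exists (Rmin d (eps / (K + 1))). split. apply Rmin_pos; auto. apply Rdiv_lt_0_compat; lra.
intros w Hw.
assert (h1 := Rmin_l d (eps / (K + 1))). assert (h2 := Rmin_r d (eps / (K + 1))).
specialize (HQ (w - z) ltac:(lra)). replace (z + (w - z)) with w in HQ by ring.
eapply Rle_trans. exact HQ. rewrite <- Rmult_assoc. apply Rmult_le_compat_r. apply Cmod_ge_0.
apply Rle_trans with ((K + 1) * (eps / (K + 1)))%R. 2: right; field; lra.
apply Rmult_le_compat; try lra. apply Cmod_ge_0.
Qed.

(** * Goursat's theorem on rectangles *)
Definition CInt (f : R -> C) (a b : R) : C :=
  (RInt (fun x => Re (f x)) a b, RInt (fun x => Im (f x)) a b).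

Definition CInt_ok (f : R -> C) (a b : R) : Prop :=
  ex_RInt (fun x => Re (f x)) a b /\ ex_RInt (fun x => Im (f x)) a b.

Definition rcont (f : R -> C) (x : R) : Prop :=
  forall eps, (0 < eps)%R -> exists d, (0 < d)%R /\
    forall y, (Rabs (y - x) < d)%R -> (Cmod (f y - f x) < eps)%R.

Lemma rcont_continuous (f : R -> C) x : rcont f x ->
  continuous (fun x => Re (f x)) x /\ continuous (fun x => Im (f x)) x.
Proof.
intro H. split; apply filterlim_locally; intros eps; destruct (H eps (cond_pos eps)) as [d [Hd K]];
  exists (mkposreal d Hd); intros y Hy; specialize (K y Hy).
- eapply Rle_lt_trans; [|exact K]. exact (re_le_Cmod (f y - f x)).
- eapply Rle_lt_trans; [|exact K]. exact (Im_le_Cmod (f y - f x)).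
Qed.

Lemma rcont_CInt_ok (f : R -> C) a b : (a <= b)%R -> (forall x, (a <= x <= b)%R -> rcont f x) -> CInt_ok f a b.
Proof.
intros Hab H. split; apply (ex_RInt_continuous (V := R_CompleteNormedModule)); intros z Hz; rewrite Rmin_left, Rmax_right in Hz by auto;
 now apply rcont_continuous, H.
Qed.

Lemma rcont_ccont F (g : R -> C) x : ccont F (g x) -> rcont g x -> rcont (fun y => F (g y)) x.
Proof.
intros HF Hg eps He. destruct (HF eps He) as [d [Hd K]]. destruct (Hg d Hd) as [d' [Hd' K']].
exists d'. split; auto.
Qed.

Lemma CInt_ext (f g : R -> C) a b : (forall x, (Rmin a b < x < Rmax a b)%R -> f x = g x) -> CInt f a b = CInt g a b.
Proof.
intro H. unfold CInt. f_equal; apply RInt_ext; intros x Hx; cbv beta; now rewrite H.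
Qed.

Lemma CInt_ok_ext (f g : R -> C) a b : (forall x, f x = g x) -> CInt_ok f a b -> CInt_ok g a b.
Proof.
intros H [H1 H2]. split; [eapply ex_RInt_ext; [|exact H1] | eapply ex_RInt_ext; [|exact H2]];
 intros x _; cbv beta; now rewrite H.
Qed.

Lemma CInt_plus (f g : R -> C) a b : CInt_ok f a b -> CInt_ok g a b ->
  CInt (fun x => f x + g x) a b = CInt f a b + CInt g a b.
Proof.
intros [H1 H2] [H3 H4]. unfold CInt, Cplus at 3. simpl. f_equal.
apply (RInt_plus (V := R_CompleteNormedModule)); auto. apply (RInt_plus (V := R_CompleteNormedModule)); auto.
Qed.

Lemma CInt_ok_plus (f g : R -> C) a b : CInt_ok f a b -> CInt_ok g a b -> CInt_ok (fun x => f x + g x) a b.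
Proof.
intros [H1 H2] [H3 H4]. split. apply (ex_RInt_plus (V := R_CompleteNormedModule)); auto. apply (ex_RInt_plus (V := R_CompleteNormedModule)); auto.
Qed.

Lemma CInt_scal_ok (k : C) (f : R -> C) a b : CInt_ok f a b ->
  CInt_ok (fun x => k * f x) a b /\ CInt (fun x => k * f x) a b = k * CInt f a b.
Proof.
intros [H1 H2]. destruct k as [u v].
assert (E1 : is_RInt (fun x => (u * Re (f x) - v * Im (f x))%R) a b (u * RInt (fun x => Re (f x)) a b - v * RInt (fun x => Im (f x)) a b)%R).
{ apply (is_RInt_minus (V := R_NormedModule)); apply (is_RInt_scal (V := R_NormedModule));
  apply (RInt_correct (V := R_CompleteNormedModule)); auto. }
assert (E2 : is_RInt (fun x => (u * Im (f x) + v * Re (f x))%R) a b (u * RInt (fun x => Im (f x)) a b + v * RInt (fun x => Re (f x)) a b)%R).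
{ apply (is_RInt_plus (V := R_NormedModule)); apply (is_RInt_scal (V := R_NormedModule));
  apply (RInt_correct (V := R_CompleteNormedModule)); auto. }
split. split; eexists; [exact E1|exact E2].
unfold CInt, Cmult at 3. simpl. f_equal.
apply (is_RInt_unique (V := R_CompleteNormedModule)); exact E1. apply (is_RInt_unique (V := R_CompleteNormedModule)); exact E2.
Qed.

Lemma CInt_scal (k : C) (f : R -> C) a b : CInt_ok f a b -> CInt (fun x => k * f x) a b = k * CInt f a b.
Proof. intro H. now apply CInt_scal_ok. Qed.
Lemma CInt_ok_scal (k : C) (f : R -> C) a b : CInt_ok f a b -> CInt_ok (fun x => k * f x) a b.
Proof. intro H. now apply CInt_scal_ok. Qed.

Lemma CInt_ok_minus (f g : R -> C) a b : CInt_ok f a b -> CInt_ok g a b -> CInt_ok (fun x => f x - g x) a b.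
Proof.
intros H1 H2. apply CInt_ok_ext with (fun x => f x + (- (1)) * g x). intro; ring.
apply CInt_ok_plus; auto. now apply CInt_ok_scal.
Qed.

Lemma CInt_minus (f g : R -> C) a b : CInt_ok f a b -> CInt_ok g a b ->
  CInt (fun x => f x - g x) a b = CInt f a b - CInt g a b.
Proof.
intros H1 H2. rewrite (CInt_ext _ (fun x => f x + (- (1)) * g x)) by (intros; ring).
rewrite CInt_plus, CInt_scal; auto. ring. now apply CInt_ok_scal.
Qed.

Lemma CInt_Chasles (f : R -> C) a b c : CInt_ok f a b -> CInt_ok f b c -> CInt f a c = CInt f a b + CInt f b c.
Proof.
intros [H1 H2] [H3 H4]. unfold CInt, Cplus. simpl.
f_equal; symmetry; apply (RInt_Chasles (V := R_CompleteNormedModule)); auto.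
Qed.

(** Real and imaginary parts are bounded separately, which costs the factor 2; it reappears in the
    circle estimates and in the bound [2 * M] of [taylor_bound]. *)
Lemma CInt_bound (f : R -> C) a b M : (a <= b)%R -> CInt_ok f a b -> (forall x, (a <= x <= b)%R -> (Cmod (f x) <= M)%R) ->
  (Cmod (CInt f a b) <= 2 * M * (b - a))%R.
Proof.
intros Hab [H1 H2] H. eapply Rle_trans. apply Cmod_le_Re_Im. unfold CInt. simpl.
replace (2 * M * (b - a))%R with ((b - a) * M + (b - a) * M)%R by ring.
apply Rplus_le_compat; apply abs_RInt_le_const; auto; intros t Ht; specialize (H t Ht).
eapply Rle_trans. apply re_le_Cmod. exact H.
eapply Rle_trans. apply Im_le_Cmod. exact H.
Qed.

Lemma CInt_const (k : C) a b : CInt_ok (fun _ => k) a b /\ CInt (fun _ => k) a b = k * RtoC (b - a).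
Proof.
split. split; apply ex_RInt_const.
unfold CInt. rewrite !RInt_const. destruct k as [u v]. unfold Cmult, RtoC, scal. simpl. unfold mult. simpl. f_equal; ring.
Qed.

Lemma CInt_id a b : CInt_ok (fun x => RtoC x) a b /\ CInt (fun x => RtoC x) a b = RtoC ((b * b - a * a) / 2).
Proof.
assert (E : is_RInt (fun x => x) a b ((b * b - a * a) / 2)%R).
{ replace ((b * b - a * a) / 2)%R with (minus (b * b / 2)%R (a * a / 2)%R) by (unfold minus, plus, opp; simpl; field).
  apply (is_RInt_derive (fun x => x * x / 2)%R (fun x => x)).
  intros x _. auto_derive; auto. field. intros x _. apply continuous_id. }
split. split; simpl. eexists; exact E. apply ex_RInt_const.
unfold CInt, RtoC. simpl. f_equal. apply (is_RInt_unique (V := R_CompleteNormedModule)); exact E.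
rewrite RInt_const. unfold scal; simpl; unfold mult; simpl. ring.
Qed.

Lemma CInt_affine (A B : C) a b : CInt (fun x => A + B * RtoC x) a b = A * RtoC (b - a) + B * RtoC ((b * b - a * a) / 2).
Proof.
rewrite CInt_plus, CInt_scal.
assert (E1 := proj2 (CInt_const A a b)). assert (E2 := proj2 (CInt_id a b)). unfold CInt in *. rewrite E1, E2. reflexivity.
apply CInt_id. apply CInt_const. apply CInt_ok_scal, CInt_id.
Qed.

Lemma rcont_horizontal y x : rcont (fun x => (x, y)) x.
Proof.
intros eps He. exists eps. split; auto. intros x' H.
replace ((x', y) - (x, y)) with (RtoC (x' - x)) by (unfold RtoC, Cminus, Cplus, Copp; simpl; f_equal; ring).
now rewrite Cmod_R.
Qed.

Lemma rcont_vertical x y : rcont (fun y => (x, y)) y.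
Proof.
intros eps He. exists eps. split; auto. intros y' H.
replace ((x, y') - (x, y)) with (Ci * RtoC (y' - y)) by (unfold RtoC, Ci, Cmult, Cminus, Cplus, Copp; simpl; f_equal; ring).
now rewrite Cmod_mult, Cmod_Ci, Cmod_R, Rmult_1_l.
Qed.

Definition holo_rect (F : C -> C) x1 x2 y1 y2 : Prop :=
  forall x y, (x1 <= x <= x2)%R -> (y1 <= y <= y2)%R -> holo F (x, y).

(** The integral of [F dz] over the positively oriented boundary: [dz] is [dx] on the horizontal
    sides and [i dy] on the vertical ones. *)
Definition rect_int (F : C -> C) (x1 x2 y1 y2 : R) : C :=
  CInt (fun x => F (x, y1)) x1 x2 - CInt (fun x => F (x, y2)) x1 x2
  + Ci * (CInt (fun y => F (x2, y)) y1 y2 - CInt (fun y => F (x1, y)) y1 y2).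

Lemma holo_rect_ok_h F x1 x2 y1 y2 x3 x4 y : holo_rect F x1 x2 y1 y2 -> (x1 <= x3)%R -> (x3 <= x4)%R -> (x4 <= x2)%R ->
  (y1 <= y <= y2)%R -> CInt_ok (fun x => F (x, y)) x3 x4.
Proof.
intros H H1 H2 H3 Hy. apply rcont_CInt_ok; auto. intros x Hx.
apply (rcont_ccont F (fun x => (x, y))). apply holo_ccont, H; lra. apply rcont_horizontal.
Qed.

Lemma holo_rect_ok_v F x1 x2 y1 y2 y3 y4 x : holo_rect F x1 x2 y1 y2 -> (y1 <= y3)%R -> (y3 <= y4)%R -> (y4 <= y2)%R ->
  (x1 <= x <= x2)%R -> CInt_ok (fun y => F (x, y)) y3 y4.
Proof.
intros H H1 H2 H3 Hy. apply rcont_CInt_ok; auto. intros y Hx.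
apply (rcont_ccont F (fun y => (x, y))). apply holo_ccont, H; lra. apply rcont_vertical.
Qed.

Lemma rect_int_quarters F x1 x2 y1 y2 xm ym : holo_rect F x1 x2 y1 y2 -> (x1 <= xm <= x2)%R -> (y1 <= ym <= y2)%R ->
  rect_int F x1 x2 y1 y2 = rect_int F x1 xm y1 ym + rect_int F xm x2 y1 ym
    + rect_int F x1 xm ym y2 + rect_int F xm x2 ym y2.
Proof.
intros H Hx Hy. unfold rect_int.
assert (Eh : forall y, (y1 <= y <= y2)%R -> CInt (fun x => F (x, y)) x1 x2 = CInt (fun x => F (x, y)) x1 xm + CInt (fun x => F (x, y)) xm x2).
{ intros y Hy'. apply CInt_Chasles; eapply holo_rect_ok_h; eauto; lra. }
assert (Ev : forall x, (x1 <= x <= x2)%R -> CInt (fun y => F (x, y)) y1 y2 = CInt (fun y => F (x, y)) y1 ym + CInt (fun y => F (x, y)) ym y2).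
{ intros x Hx'. apply CInt_Chasles; eapply holo_rect_ok_v; eauto; lra. }
rewrite !Eh, !Ev by lra. ring.
Qed.

Lemma rect_int_minus F G x1 x2 y1 y2 : (x1 <= x2)%R -> (y1 <= y2)%R -> holo_rect F x1 x2 y1 y2 -> holo_rect G x1 x2 y1 y2 ->
  rect_int (fun w => F w - G w) x1 x2 y1 y2 = rect_int F x1 x2 y1 y2 - rect_int G x1 x2 y1 y2.
Proof.
intros Hx Hy HF HG. unfold rect_int. cbv beta.
assert (Eh : forall y, (y1 <= y <= y2)%R ->
  CInt (fun x => F (x, y) - G (x, y)) x1 x2 = CInt (fun x => F (x, y)) x1 x2 - CInt (fun x => G (x, y)) x1 x2).
{ intros y Hy'. apply CInt_minus; eapply holo_rect_ok_h; eauto; lra. }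
assert (Ev : forall x, (x1 <= x <= x2)%R ->
  CInt (fun y => F (x, y) - G (x, y)) y1 y2 = CInt (fun y => F (x, y)) y1 y2 - CInt (fun y => G (x, y)) y1 y2).
{ intros x Hx'. apply CInt_minus; eapply holo_rect_ok_v; eauto; lra. }
rewrite !Eh, !Ev by lra. ring.
Qed.

Lemma rect_int_affine (A B : C) x1 x2 y1 y2 : rect_int (fun w => A + B * w) x1 x2 y1 y2 = 0.
Proof.
unfold rect_int.
assert (Ep : forall x y : R, ((x, y) : C) = RtoC x + Ci * RtoC y).
{ intros x y. unfold RtoC, Ci, Cmult, Cplus; simpl; f_equal; ring. }
assert (Eh : forall y, CInt (fun x => A + B * (x, y)) x1 x2 = (A + B * Ci * RtoC y) * RtoC (x2 - x1) + B * RtoC ((x2 * x2 - x1 * x1) / 2)).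
{ intro y. rewrite <- CInt_affine. apply CInt_ext. intros x _. rewrite Ep. ring. }
assert (Ev : forall x, CInt (fun y => A + B * (x, y)) y1 y2 = (A + B * RtoC x) * RtoC (y2 - y1) + B * Ci * RtoC ((y2 * y2 - y1 * y1) / 2)).
{ intro x. rewrite <- CInt_affine. apply CInt_ext. intros y _. rewrite Ep. ring. }
rewrite !Eh, !Ev. rewrite !RtoC_minus. ring.
Qed.

Lemma rect_int_bound F x1 x2 y1 y2 M : (x1 <= x2)%R -> (y1 <= y2)%R -> holo_rect F x1 x2 y1 y2 ->
  (forall x y, (x1 <= x <= x2)%R -> (y1 <= y <= y2)%R -> (Cmod (F (x, y)) <= M)%R) ->
  (Cmod (rect_int F x1 x2 y1 y2) <= 4 * M * ((x2 - x1) + (y2 - y1)))%R.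
Proof.
intros Hx Hy HF HM. unfold rect_int.
assert (Bh : forall y, (y1 <= y <= y2)%R -> (Cmod (CInt (fun x => F (x, y)) x1 x2) <= 2 * M * (x2 - x1))%R).
{ intros y Hy'. apply CInt_bound; auto. eapply holo_rect_ok_h; eauto; lra. }
assert (Bv : forall x, (x1 <= x <= x2)%R -> (Cmod (CInt (fun y => F (x, y)) y1 y2) <= 2 * M * (y2 - y1))%R).
{ intros y Hy'. apply CInt_bound; auto. eapply holo_rect_ok_v; eauto; lra. }
eapply Rle_trans. apply Cmod_triangle. rewrite Cmod_mult, Cmod_Ci, Rmult_1_l.
eapply Rle_trans. apply Rplus_le_compat; apply Cmod_sub_le.
assert (b1 := Bh y1 ltac:(lra)). assert (b2 := Bh y2 ltac:(lra)).
assert (b3 := Bv x1 ltac:(lra)). assert (b4 := Bv x2 ltac:(lra)). lra.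
Qed.

Lemma nested_intervals (a b : nat -> R) : (forall n, (a n <= a (S n))%R) -> (forall n, (b (S n) <= b n)%R) ->
  (forall n, (a n <= b n)%R) -> exists X, forall n, (a n <= X <= b n)%R.
Proof.
intros Ha Hb Hab.
assert (Ma : forall n m, (n <= m)%nat -> (a n <= a m)%R).
{ induction 1. lra. specialize (Ha m). lra. }
assert (Mb : forall n m, (n <= m)%nat -> (b m <= b n)%R).
{ induction 1. lra. specialize (Hb m). lra. }
assert (Hmn : forall n m, (a n <= b m)%R).
{ intros n m. assert (h1 := Ma n (n + m)%nat ltac:(lia)). assert (h2 := Mb m (n + m)%nat ltac:(lia)).
  specialize (Hab (n + m)%nat). lra. }
destruct (completeness (fun x => exists n, x = a n)) as [X [HX1 HX2]].
- exists (b O). intros x [n ->]. apply Hmn.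
- exists (a O). now exists O.
- exists X. intro n. split. apply HX1. now exists n. apply HX2. intros x [m ->]. apply Hmn.
Qed.

Definition rect := ((R * R) * (R * R))%type.
Definition rint F (r : rect) := rect_int F (fst (fst r)) (snd (fst r)) (fst (snd r)) (snd (snd r)).
(** The fourth quarter is taken without a test: if the other three all stay below a quarter of the
    total modulus, the triangle inequality forces the last one to reach it. *)
Definition halve (F : C -> C) (r : rect) : rect :=
  let '((x1, x2), (y1, y2)) := r in
  let xm := ((x1 + x2) / 2)%R in let ym := ((y1 + y2) / 2)%R in
  let big q := Rle_dec (Cmod (rint F r) / 4) (Cmod (rint F q)) in
  if big ((x1, xm), (y1, ym)) then ((x1, xm), (y1, ym)) else
  if big ((xm, x2), (y1, ym)) then ((xm, x2), (y1, ym)) else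
  if big ((x1, xm), (ym, y2)) then ((x1, xm), (ym, y2)) else ((xm, x2), (ym, y2)).

Lemma halve_spec F x1 x2 y1 y2 : (x1 <= x2)%R -> (y1 <= y2)%R -> holo_rect F x1 x2 y1 y2 ->
  exists x1' x2' y1' y2', halve F ((x1, x2), (y1, y2)) = ((x1', x2'), (y1', y2')) /\
   (x1 <= x1' <= x2')%R /\ (x2' <= x2)%R /\ (y1 <= y1' <= y2')%R /\ (y2' <= y2)%R /\
   (x2' - x1' = (x2 - x1) / 2)%R /\ (y2' - y1' = (y2 - y1) / 2)%R /\
   (Cmod (rect_int F x1 x2 y1 y2) / 4 <= Cmod (rect_int F x1' x2' y1' y2'))%R.
Proof.
intros Hx Hy H. unfold halve.
assert (E := rect_int_quarters F x1 x2 y1 y2 ((x1 + x2) / 2) ((y1 + y2) / 2) H ltac:(lra) ltac:(lra)).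
unfold rint; simpl.
destruct (Rle_dec _ _) as [h1|h1].
{ do 4 eexists. split. reflexivity. repeat split; try lra. }
destruct (Rle_dec _ _) as [h2|h2].
{ do 4 eexists. split. reflexivity. repeat split; try lra. }
destruct (Rle_dec _ _) as [h3|h3].
{ do 4 eexists. split. reflexivity. repeat split; try lra. }
{ do 4 eexists. split. reflexivity. repeat split; try lra.
  apply Rnot_le_lt in h1, h2, h3.
  set (xm := ((x1 + x2) / 2)%R) in *. set (ym := ((y1 + y2) / 2)%R) in *.
  set (q1 := rect_int F x1 xm y1 ym) in *. set (q2 := rect_int F xm x2 y1 ym) in *.
  set (q3 := rect_int F x1 xm ym y2) in *. set (q4 := rect_int F xm x2 ym y2) in *.
  rewrite E in *.
  assert (T1 := Cmod_triangle (q1 + q2 + q3) q4). assert (T2 := Cmod_triangle (q1 + q2) q3). assert (T3 := Cmod_triangle q1 q2).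
  lra. }
Qed.

Lemma holo_rect_sub F x1 x2 y1 y2 x1' x2' y1' y2' : holo_rect F x1 x2 y1 y2 ->
  (x1 <= x1')%R -> (x2' <= x2)%R -> (y1 <= y1')%R -> (y2' <= y2)%R -> holo_rect F x1' x2' y1' y2'.
Proof. intros H ? ? ? ? x y Hx Hy. apply H; lra. Qed.

(** Bisection towards a point where [F] is differentiable. The affine approximation integrates to 0,
    so the integral over the [n]-th rectangle is at most [4 e s_n^2] with [s_n = s / 2^n], while the
    choice of quarters loses only the factor [4^n]; the powers cancel. *)
Lemma goursat F x1 x2 y1 y2 : (x1 <= x2)%R -> (y1 <= y2)%R -> holo_rect F x1 x2 y1 y2 ->
  rect_int F x1 x2 y1 y2 = 0.
Proof.
intros Hx Hy H.
set (r n := Nat.iter n (halve F) ((x1, x2), (y1, y2))).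
assert (Inv : forall n, exists a b c d, r n = ((a, b), (c, d)) /\ (x1 <= a <= b)%R /\ (b <= x2)%R /\ (y1 <= c <= d)%R /\ (d <= y2)%R /\
  (b - a = (x2 - x1) / 2 ^ n)%R /\ (d - c = (y2 - y1) / 2 ^ n)%R /\
  (Cmod (rect_int F x1 x2 y1 y2) / 4 ^ n <= Cmod (rect_int F a b c d))%R /\
  (let '((a', b'), (c', d')) := r (S n) in (a <= a' /\ b' <= b /\ c <= c' /\ d' <= d)%R)).
{ intro n.
  assert (HS : forall a b c d, r n = ((a, b), (c, d)) -> (x1 <= a <= b)%R -> (b <= x2)%R -> (y1 <= c <= d)%R -> (d <= y2)%R ->
    (let '((a', b'), (c', d')) := r (S n) in (a <= a' /\ b' <= b /\ c <= c' /\ d' <= d)%R)).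
  { intros a b c d E ? ? ? ?. change (r (S n)) with (halve F (r n)). rewrite E.
    destruct (halve_spec F a b c d) as (a' & b' & c' & d' & -> & ?); try lra.
    apply holo_rect_sub with (1 := H); lra. }
  induction n.
  - exists x1, x2, y1, y2. split. reflexivity.
    split; [lra|]. split; [lra|]. split; [lra|]. split; [lra|].
    split; [simpl; field|]. split; [simpl; field|]. split; [simpl; lra|].
    apply HS; try lra. reflexivity.
  - destruct IHn as (a & b & c & d & E & ? & ? & ? & ? & ? & ? & HJ & _).
    { intros a b c d E ? ? ? ?. change (r (S n)) with (halve F (r n)). rewrite E.
    destruct (halve_spec F a b c d) as (a' & b' & c' & d' & -> & ?); try lra.
    apply holo_rect_sub with (1 := H); lra. }
    destruct (halve_spec F a b c d) as (a' & b' & c' & d' & E' & ? & ? & ? & ? & ? & ? & HJ'); try lra.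
    apply holo_rect_sub with (1 := H); lra.
    assert (ES : r (S n) = ((a', b'), (c', d'))).
    { change (r (S n)) with (halve F (r n)). now rewrite E. }
    assert (0 < 2 ^ n)%R by (apply pow_lt; lra). assert (0 < 4 ^ n)%R by (apply pow_lt; lra).
    exists a', b', c', d'. split. exact ES.
    split; [lra|]. split; [lra|]. split; [lra|]. split; [lra|]. split; [|split; [|split]].
    + simpl. replace (b' - a')%R with ((x2 - x1) / 2 ^ n / 2)%R by lra. field. lra.
    + simpl. replace (d' - c')%R with ((y2 - y1) / 2 ^ n / 2)%R by lra. field. lra.
    + simpl. apply Rle_trans with (Cmod (rect_int F x1 x2 y1 y2) / 4 ^ n / 4)%R. right; field; lra. lra.
    + apply HS; try lra. exact ES. }
set (pa n := fst (fst (r n))). set (pb n := snd (fst (r n))). set (pc n := fst (snd (r n))). set (pd n := snd (snd (r n))).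
destruct (nested_intervals pa pb) as [X HX].
{ intro n. unfold pa. destruct (Inv n) as (a & b & c & d & E & ? & ? & ? & ? & ? & ? & _ & K). rewrite E. destruct (r (S n)) as [[? ?] [? ?]]. simpl. lra. }
{ intro n. unfold pb. destruct (Inv n) as (a & b & c & d & E & ? & ? & ? & ? & ? & ? & _ & K). rewrite E. destruct (r (S n)) as [[? ?] [? ?]]. simpl. lra. }
{ intro n. unfold pa, pb. destruct (Inv n) as (a & b & c & d & E & ? & ? & ? & ? & ? & ? & _ & K). rewrite E. simpl. lra. }
destruct (nested_intervals pc pd) as [Y HY].
{ intro n. unfold pc. destruct (Inv n) as (a & b & c & d & E & ? & ? & ? & ? & ? & ? & _ & K). rewrite E. destruct (r (S n)) as [[? ?] [? ?]]. simpl. lra. }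
{ intro n. unfold pd. destruct (Inv n) as (a & b & c & d & E & ? & ? & ? & ? & ? & ? & _ & K). rewrite E. destruct (r (S n)) as [[? ?] [? ?]]. simpl. lra. }
{ intro n. unfold pc, pd. destruct (Inv n) as (a & b & c & d & E & ? & ? & ? & ? & ? & ? & _ & K). rewrite E. simpl. lra. }
destruct (H X Y) as [l Hl].
{ apply (HX O). } { apply (HY O). }
fold (cder F (X, Y) l) in Hl.
set (s := ((x2 - x1) + (y2 - y1))%R).
assert (Hs : (0 <= s)%R) by (unfold s; lra).
apply Cmod_small_eq_0. intros eps He.
rewrite is_derive_Cmod in Hl.
(* Chosen so that the final bound [4 e s^2] is at most [eps]; the summand 1 covers a degenerate
   rectangle with [s = 0]. *)
destruct (Hl (eps / (4 * s * s + 1))%R) as [d [Hd Kd]]. { apply Rdiv_lt_0_compat; nra. }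
set (e := (eps / (4 * s * s + 1))%R) in *.
assert (He' : (0 < e)%R) by (apply Rdiv_lt_0_compat; nra).
assert (Hn : exists n, (s / 2 ^ n < d)%R).
{ destruct (pow_lt_1_zero (/2) ltac:(rewrite Rabs_pos_eq; lra) (d / (s + 1))) as [N HN]. apply Rdiv_lt_0_compat; lra.
  exists N. specialize (HN N (le_n N)). rewrite Rabs_pos_eq in HN by (apply pow_le; lra).
  rewrite pow_inv in HN.
  assert (0 < / 2 ^ N)%R by (apply Rinv_0_lt_compat, pow_lt; lra).
  apply Rle_lt_trans with ((s + 1) * / 2 ^ N)%R. unfold Rdiv. apply Rmult_le_compat_r; lra.
  apply Rlt_le_trans with ((s + 1) * (d / (s + 1)))%R. apply Rmult_lt_compat_l; lra. right. field. lra. }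
destruct Hn as [n Hn].
assert (HXn := HX n). assert (HYn := HY n). unfold pa, pb, pc, pd in HXn, HYn.
destruct (Inv n) as (a & b & c & d' & E & Hab & Hb & Hcd & Hd' & W1 & W2 & HJ & _). rewrite E in HXn, HYn. simpl in HXn, HYn.
assert (H2n : (0 < 2 ^ n)%R) by (apply pow_lt; lra).
set (sn := (s / 2 ^ n)%R) in *.
assert (Hsn : ((b - a) + (d' - c) = sn)%R). { rewrite W1, W2. unfold sn, s. field. lra. }
assert (HF : holo_rect F a b c d') by (apply holo_rect_sub with (1 := H); lra).
assert (HG : holo_rect (fun w => (F (X, Y) - l * (X, Y)) + l * w) a b c d').
{ intros x y _ _. apply holo_plus. apply holo_const. apply holo_mult. apply holo_const. apply holo_id. }
assert (EJ : rect_int F a b c d' = rect_int (fun w => F w - ((F (X, Y) - l * (X, Y)) + l * w)) a b c d').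
{ rewrite rect_int_minus; try lra; auto. rewrite rect_int_affine. ring. }
assert (B : (Cmod (rect_int F a b c d') <= 4 * (e * sn) * sn)%R).
{ rewrite EJ, <- Hsn at 1. rewrite Hsn.
  assert (B := rect_int_bound (fun w => F w - (F (X, Y) - l * (X, Y) + l * w)) a b c d' (e * sn)).
  rewrite Hsn in B. apply B; try lra.
  intros x y hx hy; apply holo_minus; [apply HF | apply HG]; auto.
  intros x y hx hy.
  assert (Hw : (Cmod ((x, y) - (X, Y)) <= sn)%R).
  { eapply Rle_trans. apply Cmod_le_Re_Im. simpl. rewrite <- Hsn.
    apply Rplus_le_compat; apply Rabs_le; lra. }
  replace (F (x, y) - (F (X, Y) - l * (X, Y) + l * (x, y))) with (F (x, y) - F (X, Y) - ((x, y) - (X, Y)) * l) by ring.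
  eapply Rle_trans. apply Kd. lra. apply Rmult_le_compat_l; lra. }
assert (E4 : (4 ^ n = 2 ^ n * 2 ^ n)%R). { rewrite <- Rpow_mult_distr. f_equal; lra. }
assert (Q : (Cmod (rect_int F x1 x2 y1 y2) <= 4 * e * s * s)%R).
{ assert (Cmod (rect_int F x1 x2 y1 y2) / 4 ^ n <= 4 * (e * sn) * sn)%R by lra.
  apply Rmult_le_reg_r with (/ 4 ^ n)%R. apply Rinv_0_lt_compat. rewrite E4. nra.
  eapply Rle_trans. eassumption. right. unfold sn. rewrite E4. field. lra. }
eapply Rle_trans. exact Q. unfold e.
apply Rle_trans with (eps * ((4 * s * s) / (4 * s * s + 1)))%R. right; field; nra.
rewrite <- (Rmult_1_r eps) at 2. apply Rmult_le_compat_l. lra.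
apply Rmult_le_reg_r with (4 * s * s + 1)%R. nra. unfold Rdiv. rewrite Rmult_assoc, Rinv_l by nra. nra.
Qed.

(** * Cauchy's formula and Taylor expansions *)
Definition cir (r th : R) : C := RtoC r * Cexp (0%R, th).

Lemma Cmod_cir r th : (0 <= r)%R -> Cmod (cir r th) = r.
Proof.
intro H. unfold cir. rewrite Cmod_mult, Cmod_R, Cmod_Cexp, Rabs_pos_eq by auto. simpl. rewrite exp_0. ring.
Qed.

Lemma rcont_cir r th : rcont (cir r) th.
Proof.
apply (rcont_ccont (fun w => RtoC r * Cexp w) (fun th => (0%R, th))).
apply holo_ccont. apply holo_mult. apply holo_const. eexists. apply is_derive_Cexp. apply rcont_vertical.
Qed.

Lemma rcont_cir_shift a r th : rcont (fun th => a + cir r th) th.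
Proof.
apply (rcont_ccont (fun w => a + w) (cir r)).
apply holo_ccont. apply holo_plus. apply holo_const. apply holo_id. apply rcont_cir.
Qed.

Lemma cir_exp x th : cir (exp x) th = Cexp (x, th).
Proof. unfold cir, Cexp, RtoC, Cmult. simpl. rewrite exp_0. f_equal; ring. Qed.

(** Integration is with respect to the angle, that is, of [h(u) du / (i (u - a))]. This is why the
    Cauchy kernel appears below as [(u - a) / (u - z)]. *)
Definition circ (h : C -> C) (a : C) (r : R) : C := CInt (fun th => h (a + cir r th)) 0 (2 * PI).

Lemma circ_ok h a r : (0 <= r)%R -> (forall u, Cmod (u - a) = r -> ccont h u) ->
  CInt_ok (fun th => h (a + cir r th)) 0 (2 * PI).
Proof.
intros Hr H. apply rcont_CInt_ok. assert (h0 := PI_RGT_0). lra.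
intros x _. apply (rcont_ccont h (fun th => a + cir r th)). apply H.
replace (a + cir r x - a) with (cir r x) by ring. now apply Cmod_cir. apply rcont_cir_shift.
Qed.

Lemma circ_ext h g a r : (0 <= r)%R -> (forall u, Cmod (u - a) = r -> h u = g u) -> circ h a r = circ g a r.
Proof.
intros Hr H. apply CInt_ext. intros th _. apply H. replace (a + cir r th - a) with (cir r th) by ring. now apply Cmod_cir.
Qed.

Lemma circ_bound h a r M : (0 <= r)%R -> (forall u, Cmod (u - a) = r -> ccont h u) ->
  (forall u, Cmod (u - a) = r -> (Cmod (h u) <= M)%R) -> (Cmod (circ h a r) <= 4 * PI * M)%R.
Proof.
intros Hr H HM. replace (4 * PI * M)%R with (2 * M * (2 * PI - 0))%R by ring.
apply CInt_bound. assert (h0 := PI_RGT_0). lra. now apply circ_ok.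
intros x _. apply HM. replace (a + cir r x - a) with (cir r x) by ring. now apply Cmod_cir.
Qed.

(** The map [w -> a + exp w] sends the rectangle between [ln r1] and [ln r2] of height [2 pi] onto
    the annulus. Its horizontal sides have the same image, so in Goursat's theorem only the two
    vertical sides remain, and these are the two circle integrals. *)
Lemma circ_const_annulus h a r1 r2 : (0 < r1 <= r2)%R -> (forall u, (r1 <= Cmod (u - a) <= r2)%R -> holo h u) ->
  circ h a r1 = circ h a r2.
Proof.
intros Hr H. assert (hpi := PI_RGT_0).
assert (Hln : (ln r1 <= ln r2)%R). { destruct (proj2 Hr) as [h1|h1]. left. apply ln_increasing; lra. right. now rewrite h1. }
assert (HF : holo_rect (fun w => h (a + Cexp w)) (ln r1) (ln r2) 0 (2 * PI)).
{ intros x y Hx Hy. apply (holo_comp h (fun w => a + Cexp w)).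
  - apply H. replace (a + Cexp (x, y) - a) with (Cexp (x, y)) by ring. rewrite Cmod_Cexp. simpl.
    assert (Hle : forall s t, (s <= t)%R -> (exp s <= exp t)%R).
    { intros s t [h1|h1]. left. now apply exp_increasing. right. now rewrite h1. }
    assert (e1 := Hle _ _ (proj1 Hx)). assert (e2 := Hle _ _ (proj2 Hx)). rewrite exp_ln in e1, e2 by lra. lra.
  - apply holo_plus. apply holo_const. eexists. apply is_derive_Cexp. }
assert (H2pi : (0 <= 2 * PI)%R) by lra.
assert (G := goursat _ _ _ _ _ Hln H2pi HF). unfold rect_int in G.
rewrite (CInt_ext (fun x => h (a + Cexp (x, 0%R))) (fun x => h (a + Cexp (x, (2 * PI)%R)))) in G.
2: { intros x _. f_equal. f_equal. unfold Cexp. simpl. rewrite cos_2PI, sin_2PI, cos_0, sin_0. reflexivity. }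
assert (E : forall r, (0 < r)%R -> CInt (fun y => h (a + Cexp (ln r, y))) 0 (2 * PI) = circ h a r).
{ intros r Hr'. apply CInt_ext. intros y _. rewrite <- cir_exp, exp_ln; auto. }
rewrite !E in G by lra.
assert (G' : circ h a r2 - circ h a r1 = 0).
{ transitivity (- Ci * (Ci * (circ h a r2 - circ h a r1))).
  transitivity (- (Ci * Ci) * (circ h a r2 - circ h a r1)).
  replace (Ci * Ci) with (- (1)). ring. unfold Ci, RtoC, Cmult, Copp; simpl; f_equal; ring. ring.
  replace (Ci * (circ h a r2 - circ h a r1)) with (RtoC 0). ring. rewrite <- G. ring. }
replace (circ h a r2) with (circ h a r2 - circ h a r1 + circ h a r1) by ring. rewrite G'. ring.
Qed.

Lemma circ_unif_cont h a r0 : (0 <= r0)%R -> (forall u, Cmod (u - a) = r0 -> ccont h u) ->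
  forall eps, (0 < eps)%R -> exists d, (0 < d)%R /\ forall r th, (Rabs (r - r0) < d)%R -> (0 <= th <= 2 * PI)%R ->
   (Cmod (h (a + cir r th)%C - h (a + cir r0 th)%C) < eps)%R.
Proof.
intros Hr H eps He.
assert (HD : forall t : R, exists d : posreal, forall x r, (Rabs (x - t) < d)%R -> (Rabs (r - r0) < d)%R ->
   (Cmod (h (a + cir r x)%C - h (a + cir r0 t)%C) < eps / 2)%R).
{ intro t. destruct (H (a + cir r0 t)) with (eps := (eps/2)%R) as [d1 [Hd1 K1]].
  replace (a + cir r0 t - a) with (cir r0 t) by ring. now apply Cmod_cir. lra.
  destruct (rcont_cir r0 t (d1/2)%R ltac:(lra)) as [d2 [Hd2 K2]].
  assert (Hm : (0 < Rmin d2 (d1/2))%R) by (apply Rmin_pos; lra).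
  exists (mkposreal _ Hm). simpl. intros x r Hx Hrr.
  assert (m1 := Rmin_l d2 (d1/2)). assert (m2 := Rmin_r d2 (d1/2)).
  apply K1. replace (a + cir r x - (a + cir r0 t)) with ((cir r x - cir r0 x) + (cir r0 x - cir r0 t)) by ring.
  eapply Rle_lt_trans. apply Cmod_triangle.
  assert (Cmod (cir r x - cir r0 x) = Rabs (r - r0)).
  { unfold cir. replace (_ - _) with (RtoC (r - r0) * Cexp (0%R, x)) by (rewrite RtoC_minus; ring).
    rewrite Cmod_mult, Cmod_R, Cmod_Cexp. simpl. rewrite exp_0. ring. }
  rewrite H0. specialize (K2 x ltac:(lra)). lra. }
set (delta t := proj1_sig (constructive_indefinite_description _ (HD t))).
assert (Hdelta := fun t => proj2_sig (constructive_indefinite_description _ (HD t))).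
fold delta in Hdelta.
(* The finite subcover comes under a double negation, so the bound is first decided classically and
   the cover is used only to refute its failure. *)
destruct (compactness_value_1d 0 (2 * PI) delta) as [d Hd].
exists d. split. apply cond_pos.
intros r th Hrd Hth.
destruct (excluded_middle_informative (Cmod (h (a + cir r th)%C - h (a + cir r0 th)%C) < eps)%R) as [h1|h1]; auto.
exfalso. apply (Hd th Hth). intros [t [Ht [Ht1 Ht2]]]. apply h1.
assert (k1 := Hdelta t th r). assert (k2 := Hdelta t th r0). unfold delta in *.
set (dd := proj1_sig _) in *. simpl in k1, k2.
specialize (k1 Ht1 ltac:(lra)). specialize (k2 Ht1). rewrite Rminus_diag, Rabs_R0 in k2. specialize (k2 (cond_pos _)).
eapply Rle_lt_trans. apply (Cmod_triangle_sub _ (h (a + cir r0 t))). rewrite (Cmod_sub_sym (h (a + cir r0 t))). lra.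
Qed.

Lemma circ_continuous h a r0 : (0 <= r0)%R ->
  (exists d, (0 < d)%R /\ forall u, (Rabs (Cmod (u - a) - r0) < d)%R -> ccont h u) ->
  forall eps, (0 < eps)%R -> exists d, (0 < d)%R /\ forall r, (0 <= r)%R -> (Rabs (r - r0) < d)%R ->
   (Cmod (circ h a r - circ h a r0) < eps)%R.
Proof.
intros Hr [d0 [Hd0 H]] eps He. assert (hpi := PI_RGT_0).
assert (H0 : forall u, Cmod (u - a) = r0 -> ccont h u).
{ intros u Hu. apply H. rewrite Hu, Rminus_diag, Rabs_R0. auto. }
destruct (circ_unif_cont h a r0 Hr H0 (eps / (8 * PI))) as [d [Hd K]].
apply Rdiv_lt_0_compat; lra.
exists (Rmin d0 d). split. now apply Rmin_pos.
intros r Hr' Hrd. assert (m1 := Rmin_l d0 d). assert (m2 := Rmin_r d0 d).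
unfold circ. rewrite <- CInt_minus.
2: { apply circ_ok; auto. intros u Hu. apply H. rewrite Hu. lra. } 2: { now apply circ_ok. }
eapply Rle_lt_trans. apply CInt_bound with (M := (eps / (8 * PI))%R). lra.
apply CInt_ok_minus; apply circ_ok; auto. intros u Hu. apply H. rewrite Hu. lra.
intros x Hx. left. apply K; lra.
replace (2 * (eps / (8 * PI)) * (2 * PI - 0))%R with (eps / 2)%R by (field; lra). lra.
Qed.

Lemma circ_bounded h a r : (0 <= r)%R -> (forall u, Cmod (u - a) = r -> ccont h u) ->
  exists M, forall th, (0 <= th <= 2 * PI)%R -> (Cmod (h (a + cir r th)%C) <= M)%R.
Proof.
intros Hr H.
assert (HD : forall t : R, exists d : posreal, (Cmod (h (a + cir r t)%C) < / d)%R /\ forall x, (Rabs (x - t) < d)%R ->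
   (Cmod (h (a + cir r x)%C - h (a + cir r t)%C) < 1)%R).
{ intro t. destruct (rcont_ccont h (fun th => a + cir r th) t) with (eps := 1%R) as [d [Hd K]].
  apply H. replace (a + cir r t - a) with (cir r t) by ring. now apply Cmod_cir. apply rcont_cir_shift. lra.
  assert (h0 := Cmod_ge_0 (h (a + cir r t))).
  set (m := (/ (1 + Cmod (h (a + cir r t)%C)))%R). assert (Hm : (0 < m)%R) by (apply Rinv_0_lt_compat; lra).
  assert (Hmm : (0 < Rmin d m)%R) by now apply Rmin_pos.
  exists (mkposreal _ Hmm). simpl. split.
  apply Rlt_le_trans with (/ m)%R. unfold m. rewrite Rinv_inv. lra. apply Rinv_le_contravar. auto. apply Rmin_r.
  intros x Hx. apply K. eapply Rlt_le_trans. exact Hx. apply Rmin_l. }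
set (delta t := proj1_sig (constructive_indefinite_description _ (HD t))).
assert (Hdelta := fun t => proj2_sig (constructive_indefinite_description _ (HD t))).
destruct (compactness_value_1d 0 (2 * PI) delta) as [d Hd].
exists (/ d + 1)%R.
intros th Hth.
destruct (Rle_dec (Cmod (h (a + cir r th)%C)) (/ d + 1)) as [h1|h1]; auto.
exfalso. apply (Hd th Hth). intros [t [Ht [Ht1 Ht2]]]. apply h1.
destruct (Hdelta t) as [k1 k2]. specialize (k2 th Ht1). fold (delta t) in k1.
assert (/ delta t <= / d)%R by (apply Rinv_le_contravar; auto; apply cond_pos).
assert (k3 := Cmod_le_sub (h (a + cir r th)) (h (a + cir r t))). lra.
Qed.

(** The integral does not depend on the radius and is at most [4 pi / s^k] on the circle of radius
    [s], which tends to 0. *)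
Lemma CInt_inv_pow_circle a k r : (0 < r)%R -> (1 <= k)%nat -> circ (fun u => / (u - a) ^ k) a r = 0.
Proof.
intros Hr Hk. assert (hpi := PI_RGT_0).
assert (Hh : forall u, (0 < Cmod (u - a))%R -> holo (fun u => / (u - a) ^ k) u).
{ intros u Hu. apply Cmod_sub_pos_neq in Hu.
  eapply holo_ext_near. 2: apply (holo_div (fun _ => 1) (fun u => Defs.Cpow (u - a) k)).
  exists 1%R. split. lra. intros w _. rewrite Cpow_Defs. unfold Cdiv. ring. apply holo_const. apply holo_Cpow, holo_sub_const.
  rewrite Cpow_Defs. now apply Cpow_nz. }
apply Cmod_small_eq_0. intros eps He.
set (s := Rmax r (Rmax 1 (4 * PI / eps))).
assert (s1 : (r <= s)%R) by apply Rmax_l.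
assert (s2 : (1 <= s)%R) by (eapply Rle_trans; [|apply Rmax_r]; apply Rmax_l).
assert (s3 : (4 * PI / eps <= s)%R) by (eapply Rle_trans; [|apply Rmax_r]; apply Rmax_r).
rewrite (circ_const_annulus _ a r s); [|lra|intros u Hu; apply Hh; lra].
eapply Rle_trans. apply (circ_bound _ a s (/ s)); [lra| |].
intros u Hu. apply holo_ccont. apply Hh. lra.
intros u Hu. rewrite Cmod_inv, Cmod_pow, Hu. apply Rinv_le_contravar. lra.
destruct k; [lia|]. simpl. assert (1 <= s ^ k)%R by now apply pow_R1_Rle. nra.
apply Cpow_nz. apply Cmod_gt_0. lra.
apply Rmult_le_reg_r with s. lra. rewrite Rmult_assoc, Rinv_l, Rmult_1_r by lra.
apply Rmult_le_reg_l with (/ eps)%R. apply Rinv_0_lt_compat; lra.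
replace (/ eps * (eps * s))%R with s by (field; lra). replace (/ eps * (4 * PI))%R with (4 * PI / eps)%R by (field; lra). auto.
Qed.

(* Difference quotients of a holomorphic [f] are continuous at the exceptional point, so concentric circle integrals do not jump there. *)
Lemma cauchy_kernel_zero f a R0 z r : (forall u, (Cmod (u - a) < R0)%R -> holo f u) ->
  (Cmod (z - a) < r < R0)%R -> circ (fun u => (f u - f z) * ((u - a) / (u - z))) a r = 0.
Proof.
intros Hf Hr. set (rho := Cmod (z - a)) in *. assert (Hrho : (0 <= rho)%R) by apply Cmod_ge_0.
destruct (Hf z) as [l Hl]. unfold rho in Hr; lra. fold (cder f z l) in Hl.
(* The value at [z] is the limit of the difference quotient times [u - a], so [g] is continuous
   everywhere and holomorphic off [z]. *)
set (g u := if excluded_middle_informative (u = z) then l * (z - a) else (f u - f z) * ((u - a) / (u - z))).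
assert (Hgh : forall u, (Cmod (u - a) < R0)%R -> u <> z -> holo g u).
{ intros u Hu Huz. assert (Huz' := Cmod_sub_pos u z Huz).
  apply holo_ext_near with (fun u => (f u - f z) * ((u - a) / (u - z))).
  exists (Cmod (u - z)). split; auto. intros w Hw. unfold g. destruct (excluded_middle_informative _) as [->|]; auto.
  rewrite Cmod_sub_sym in Hw. lra.
  apply holo_mult. apply holo_minus; auto. apply holo_const. apply holo_div; try apply holo_sub_const.
  now apply Csub_neq_0. }
assert (Hgc : forall u, (Cmod (u - a) < R0)%R -> ccont g u).
{ intros u Hu. destruct (excluded_middle_informative (u = z)) as [->|Huz]. 2: now apply holo_ccont, Hgh.
  intros eps He. rewrite is_derive_Cmod in Hl.
  set (m := (1 + rho + Cmod l)%R). assert (Hm : (1 <= m)%R). { unfold m. assert (h := Cmod_ge_0 l). lra. }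
  destruct (Hl (eps / (4 * m))%R) as [d [Hd K]]. apply Rdiv_lt_0_compat; lra.
  assert (Hd2 : (0 < eps / (4 * m))%R) by (apply Rdiv_lt_0_compat; lra).
  set (e := (eps / (4 * m))%R) in *.
  exists (Rmin d (Rmin 1 e)). split. repeat apply Rmin_pos; lra.
  intros w Hw. assert (m1 := Rmin_l d (Rmin 1 e)). assert (m2 := Rmin_r d (Rmin 1 e)).
  assert (m3 := Rmin_l 1 e). assert (m4 := Rmin_r 1 e).
  unfold g. destruct (excluded_middle_informative (z = z)) as [_|]; [|congruence].
  destruct (excluded_middle_informative (w = z)) as [_|Hwz]. rewrite Cmod_sub_self. lra.
  specialize (K w ltac:(lra)). assert (Hp := Cmod_sub_pos w z Hwz). assert (Hn := Csub_neq_0 w z Hwz).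
  set (q := (f w - f z - (w - z) * l) / (w - z)).
  assert (Hq : (Cmod q <= e)%R).
  { unfold q. rewrite Cmod_div by auto. apply Rmult_le_reg_r with (Cmod (w - z)). auto. unfold Rdiv. rewrite Rmult_assoc, Rinv_l by lra. lra. }
  replace ((f w - f z) * ((w - a) / (w - z)) - l * (z - a)) with (q * ((w - z) + (z - a)) + l * (w - z)).
  2: { unfold q. field. auto. }
  eapply Rle_lt_trans. apply Cmod_triangle. rewrite !Cmod_mult.
  assert (Hs : (Cmod (w - z + (z - a)) <= 1 + rho)%R) by (eapply Rle_trans; [apply Cmod_triangle|unfold rho; lra]).
  assert (h := Cmod_ge_0 l).
  apply Rle_lt_trans with (e * (1 + rho) + Cmod l * e)%R.
  apply Rplus_le_compat. apply Rmult_le_compat; auto; apply Cmod_ge_0. apply Rmult_le_compat_l; lra.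
  apply Rle_lt_trans with (e * m)%R. unfold m. lra. unfold e. replace (eps / (4 * m) * m)%R with (eps / 4)%R by (field; lra). lra. }
assert (Hga : g a = 0).
{ unfold g. destruct (excluded_middle_informative (a = z)) as [->|]. ring. unfold Cdiv. ring. }
assert (Hc : forall r1 r2, (0 < r1 <= r2)%R -> (r2 < R0)%R -> (r2 < rho \/ rho < r1)%R -> circ g a r1 = circ g a r2).
{ intros r1 r2 h1 h2 h3. apply circ_const_annulus; auto. intros u Hu. apply Hgh. lra. intros ->. fold rho in Hu. lra. }
assert (Hcont : forall r0, (0 <= r0 < R0)%R -> forall eps, (0 < eps)%R -> exists d, (0 < d)%R /\ forall r, (0 <= r)%R -> (Rabs (r - r0) < d)%R ->
   (Cmod (circ g a r - circ g a r0) < eps)%R).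
{ intros r0 Hr0. apply circ_continuous. lra. exists (R0 - r0)%R. split. lra. intros u Hu. apply Hgc.
  apply Rabs_lt_between in Hu. lra. }
(* The factor [u - a] vanishes at the centre, which settles radius 0. Radii below [rho] are joined
   to 0 and radii above [rho] to each other by the annulus lemma; continuity in the radius crosses
   [rho], where [g] may fail to be holomorphic. *)
assert (H0 : circ g a 0 = 0).
{ unfold circ. rewrite (CInt_ext _ (fun _ => 0)). rewrite (proj2 (CInt_const 0 _ _)). ring.
  intros x _. unfold cir. replace (a + RtoC 0 * Cexp (0%R, x)) with a by ring. exact Hga. }
assert (Hsmall : circ g a rho = 0).
{ destruct (Req_dec rho 0) as [->|hr]. exact H0.
  assert (Hlt : forall s, (0 < s < rho)%R -> circ g a s = 0).
  { intros s Hs. apply Cmod_small_eq_0. intros eps He. destruct (Hcont 0%R ltac:(lra) eps He) as [d [Hd K]].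
    set (s' := Rmin s (d/2)). assert (0 < s')%R by (apply Rmin_pos; lra).
    assert (m1 := Rmin_l s (d/2)). assert (m2 := Rmin_r s (d/2)). fold s' in m1, m2.
    rewrite <- (Hc s' s) by (try left; lra). specialize (K s' ltac:(lra)). rewrite H0 in K.
    replace (circ g a s' - 0) with (circ g a s') in K by ring. left. apply K. rewrite Rabs_pos_eq; lra. }
  apply Cmod_small_eq_0. intros eps He. destruct (Hcont rho ltac:(lra) eps He) as [d [Hd K]].
  set (s := Rmax (rho / 2) (rho - d / 2)). assert (m1 := Rmax_l (rho / 2) (rho - d / 2)). assert (m2 := Rmax_r (rho / 2) (rho - d / 2)).
  fold s in m1, m2. assert (s < rho)%R by (unfold s; apply Rmax_lub_lt; lra).
  specialize (K s ltac:(lra)). rewrite Hlt in K by lra. replace (0 - circ g a rho) with (- circ g a rho) in K by ring. rewrite Cmod_opp in K.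
  left. apply K. rewrite Rabs_left; lra. }
transitivity (circ g a r).
{ apply circ_ext. lra. intros u Hu. unfold g. destruct (excluded_middle_informative _) as [->|]; auto. fold rho in Hu. lra. }
apply Cmod_small_eq_0. intros eps He. destruct (Hcont rho ltac:(lra) eps He) as [d [Hd K]].
set (s := Rmin r (rho + d / 2)). assert (m1 := Rmin_l r (rho + d / 2)). assert (m2 := Rmin_r r (rho + d / 2)).
fold s in m1, m2. assert (rho < s)%R by (unfold s; apply Rmin_glb_lt; lra).
rewrite <- (Hc s r) by (try right; lra). specialize (K s ltac:(lra)). rewrite Hsmall in K.
replace (circ g a s - 0) with (circ g a s) in K by ring. left. apply K. rewrite Rabs_pos_eq; lra.
Qed.

Implicit Types h : C -> C.

Lemma holo_pow_C f k z : holo f z -> holo (fun u => f u ^ k) z.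
Proof.
intro H. eapply holo_ext_near. 2: apply (holo_Cpow f k z H). exists 1%R. split. lra.
intros w _. apply Cpow_Defs.
Qed.

(** The coefficients are the angular means of [f(u) / (u - a)^k]. [E k] is the integral of the
    Cauchy kernel weighted by [(v / (u - a))^k]: it vanishes for [k = 0], its decrements are the
    Taylor terms, and it decays like [(|v| / r)^k]. Only a bound on one circle enters, as
    Liouville's theorem requires. *)
Lemma taylor_bound f a R0 r M : (forall u, (Cmod (u - a) < R0)%R -> holo f u) -> (0 < r < R0)%R ->
  (forall th, (0 <= th <= 2 * PI)%R -> (Cmod (f (a + cir r th)%C) <= M)%R) ->
  exists c, (forall k, (Cmod (c k) * r ^ k <= 2 * M)%R) /\
    forall z, (Cmod (z - a) < r)%R -> csums (fun k => c k * (z - a) ^ k) (f z).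
Proof.
intros Hf Hr HM. assert (hpi := PI_RGT_0).
assert (Hpi2 : RtoC (2 * PI) <> 0). { intro E. apply RtoC_inj in E. lra. }
assert (Hnz : forall u, Cmod (u - a) = r -> u - a <> 0). { intros u Hu. apply Cmod_gt_0. lra. }
assert (Hin : forall u, Cmod (u - a) = r -> holo f u). { intros u Hu. apply Hf. lra. }
assert (HM0 : (0 <= M)%R). { eapply Rle_trans; [apply Cmod_ge_0|apply (HM 0%R)]. lra. }
assert (Hpw : forall k u, Cmod (u - a) = r -> holo (fun u => / (u - a) ^ k) u).
{ intros k u Hu. apply holo_ext_near with (fun u => 1 / (u - a) ^ k). exists 1%R. split. lra. intros; unfold Cdiv; ring.
  apply holo_div. apply holo_const. apply holo_pow_C, holo_sub_const. apply Cpow_nz. auto. }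
set (c k := / RtoC (2 * PI) * circ (fun u => f u * / (u - a) ^ k) a r).
exists c. split.
- intro k. unfold c. rewrite Cmod_mult, Cmod_inv, Cmod_R, Rabs_pos_eq by (auto; lra).
  assert (B : (Cmod (circ (fun u => f u * / (u - a) ^ k)%C a r) <= 4 * PI * (M * / r ^ k))%R).
  { unfold circ. replace (4 * PI * (M * / r ^ k))%R with (2 * (M * / r ^ k) * (2 * PI - 0))%R by ring.
    apply CInt_bound. lra. apply (circ_ok (fun u => f u * / (u - a) ^ k)). lra.
    intros u Hu. apply holo_ccont, holo_mult; auto.
    intros th Hth. rewrite Cmod_mult, Cmod_inv, Cmod_pow.
    replace (a + cir r th - a) with (cir r th) by ring. rewrite Cmod_cir by lra.
    apply Rmult_le_compat_r. left. apply Rinv_0_lt_compat, pow_lt; lra. now apply HM.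
    apply Cpow_nz. replace (a + cir r th - a) with (cir r th) by ring. apply Cmod_gt_0. rewrite Cmod_cir; lra. }
  assert (Hrk : (0 < r ^ k)%R) by (apply pow_lt; lra).
  apply Rle_trans with (/ (2 * PI) * (4 * PI * (M * / r ^ k)) * r ^ k)%R.
  apply Rmult_le_compat_r. lra. apply Rmult_le_compat_l. left. apply Rinv_0_lt_compat; lra. exact B.
  right. field. lra.
- intros z Hz. set (v := z - a) in *.
  set (q := (Cmod v / r)%R).
  assert (Hq : (0 <= q < 1)%R).
  { unfold q. split. apply Rmult_le_pos; try apply Cmod_ge_0. left. apply Rinv_0_lt_compat. lra.
  apply Rmult_lt_reg_r with r. lra. unfold Rdiv. rewrite Rmult_assoc, Rinv_l by lra. lra. }
  set (h k u := (f u - f z) * (v ^ k * / (u - a) ^ k) * ((u - a) / (u - z))).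
  assert (Huz : forall u, Cmod (u - a) = r -> u - z <> 0).
  { intros u Hu E. assert (E' : u - a = v) by (unfold v; transitivity (u - z + (z - a)); [ring|rewrite E; ring]).
    rewrite E' in Hu. lra. }
  assert (Hh : forall k u, Cmod (u - a) = r -> holo (h k) u).
  { intros k u Hu. unfold h. apply holo_mult. apply holo_mult. apply holo_minus; auto. apply holo_const.
    apply holo_mult; auto. apply holo_const. apply holo_div; auto; apply holo_sub_const. }
  set (E k := circ (h k) a r).
  assert (E0 : E O = 0).
  { unfold E. rewrite <- (cauchy_kernel_zero f a R0 z r) by (auto; fold v; lra). apply circ_ext. lra.
    intros u Hu. unfold h. simpl. field. auto. }
  (* Multiplication by [1 - v / (u - a)] cancels the denominator [u - z]. What remains splits into
     the mean defining [c k] and a multiple of the mean of [1 / (u - a)^k], nonzero only for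
     [k = 0]. *)
  assert (ES : forall k, E k - E (S k) = RtoC (2 * PI) * (c k * v ^ k) - (if Nat.eqb k 0 then RtoC (2 * PI) * f z else 0)).
  { intro k. unfold E, circ. rewrite <- CInt_minus by (apply circ_ok; [lra|intros; now apply holo_ccont, Hh]).
    transitivity (circ (fun u => v ^ k * (f u * / (u - a) ^ k) - (v ^ k * f z) * (/ (u - a) ^ k)) a r).
    { apply (circ_ext (fun u => h k u - h (S k) u)). lra. intros u Hu. unfold h. rewrite !Cpow_S.
      assert (E1 := Huz u Hu). assert (E2 := Hnz u Hu).
      replace (u - z) with ((u - a) - v) in * by (unfold v; ring). field. repeat split; auto. apply Cpow_nz; auto. }
    unfold circ. rewrite CInt_minus, CInt_scal, CInt_scal.
    2: apply (circ_ok (fun u => / (u - a) ^ k)); [lra|intros; now apply holo_ccont, Hpw].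
    2: apply (circ_ok (fun u => f u * / (u - a) ^ k)); [lra|intros; apply holo_ccont, holo_mult; auto].
    2: apply CInt_ok_scal, (circ_ok (fun u => f u * / (u - a) ^ k)); [lra|intros; apply holo_ccont, holo_mult; auto].
    2: apply CInt_ok_scal, (circ_ok (fun u => / (u - a) ^ k)); [lra|intros; now apply holo_ccont, Hpw].
    change (CInt (fun x => / (a + cir r x - a) ^ k) 0 (2 * PI)) with (circ (fun u => / (u - a) ^ k) a r).
    change (CInt (fun x => f (a + cir r x) * / (a + cir r x - a) ^ k) 0 (2 * PI)) with (circ (fun u => f u * / (u - a) ^ k) a r).
    destruct k as [|k].
    - replace (circ (fun u => / (u - a) ^ 0) a r) with (RtoC (2 * PI)). unfold c. simpl. field. exact Hpi2.
      unfold circ. rewrite (CInt_ext _ (fun _ => 1)). rewrite (proj2 (CInt_const 1 _ _)). rewrite Rminus_0_r. ring.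
      intros; simpl. field.
    - rewrite CInt_inv_pow_circle by (try lia; lra). unfold c. simpl. field. exact Hpi2. }
  assert (ET : forall N, csum (fun k => c k * v ^ k) (S N) = f z - / RtoC (2 * PI) * E (S N)).
  { induction N.
    - specialize (ES O). simpl in ES. rewrite E0 in ES. simpl.
      transitivity (/ RtoC (2 * PI) * (RtoC (2 * PI) * (c O * 1))). field. exact Hpi2.
      replace (RtoC (2 * PI) * (c O * 1)) with (0 - E 1%nat + RtoC (2 * PI) * f z) by (rewrite ES; ring). field. exact Hpi2.
    - specialize (ES (S N)). change (csum (fun k => c k * v ^ k) (S (S N))) with (csum (fun k => c k * v ^ k) (S N) + c (S N) * v ^ S N).
      rewrite IHN. cbn [Nat.eqb] in ES.
      transitivity (f z - / RtoC (2 * PI) * E (S N) + / RtoC (2 * PI) * (RtoC (2 * PI) * (c (S N) * v ^ S N) - 0)). field; exact Hpi2.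
      rewrite <- ES. ring. }
  set (K := (4 * PI * ((M + Cmod (f z)) * (r / (r - Cmod v))))%R).
  assert (HE : forall k, (Cmod (E k) <= K * q ^ k)%R).
  { intro k. unfold E, circ, K. replace (4 * PI * ((M + Cmod (f z)) * (r / (r - Cmod v))) * q ^ k)%R with
      (2 * ((M + Cmod (f z)) * q ^ k * (r / (r - Cmod v))) * (2 * PI - 0))%R by ring.
    apply CInt_bound. lra. apply circ_ok. lra. intros; now apply holo_ccont, Hh.
    intros th Hth. set (u := a + cir r th). assert (Hu : Cmod (u - a) = r).
    { unfold u. replace (a + cir r th - a) with (cir r th) by ring. rewrite Cmod_cir; lra. }
    unfold h. rewrite !Cmod_mult. rewrite Cmod_inv by (apply Cpow_nz; auto). rewrite Cmod_div by auto. rewrite !Cmod_pow, Hu.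
    apply Rmult_le_compat. apply Rmult_le_pos. apply Cmod_ge_0. apply Rmult_le_pos. apply pow_le, Cmod_ge_0.
    left; apply Rinv_0_lt_compat, pow_lt; lra.
    apply Rmult_le_pos. lra. left. apply Rinv_0_lt_compat. apply Cmod_gt_0. auto.
    apply Rmult_le_compat. apply Cmod_ge_0. apply Rmult_le_pos. apply pow_le, Cmod_ge_0.
    left; apply Rinv_0_lt_compat, pow_lt; lra.
    eapply Rle_trans. apply Cmod_sub_le. apply Rplus_le_compat_r. now apply HM.
    right. unfold q, Rdiv. rewrite Rpow_mult_distr, pow_inv. ring.
    apply Rmult_le_compat_l. lra. apply Rinv_le_contravar. lra.
    assert (T := Cmod_le_sub (u - a) v). replace (u - a - v) with (u - z) in T by (unfold v; ring). lra. }
  assert (HK : (0 <= K)%R).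
  { unfold K. apply Rmult_le_pos. lra. apply Rmult_le_pos. assert (h0 := Cmod_ge_0 (f z)). lra.
    apply Rmult_le_pos. lra. left. apply Rinv_0_lt_compat. lra. }
  intros eps He.
  destruct (pow_lt_1_zero q) with (y := (eps / (K + 1))%R) as [N HN]. rewrite Rabs_pos_eq; lra. apply Rdiv_lt_0_compat; lra.
  exists (S N). intros n Hn. destruct n as [|n]; [lia|]. rewrite ET.
  replace (f z - / RtoC (2 * PI) * E (S n) - f z) with (- (/ RtoC (2 * PI) * E (S n))) by ring.
  rewrite Cmod_opp, Cmod_mult, Cmod_inv, Cmod_R, Rabs_pos_eq by (auto; lra).
  specialize (HN (S n) ltac:(lia)). rewrite Rabs_pos_eq in HN by (apply pow_le; lra).
  specialize (HE (S n)).
  assert (P4 := PI2_3_2).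
  apply Rle_lt_trans with (1 * (K * q ^ S n))%R.
  apply Rmult_le_compat; auto. left. apply Rinv_0_lt_compat; lra. apply Cmod_ge_0. rewrite <- Rinv_1. apply Rinv_le_contravar; lra.
  rewrite Rmult_1_l. assert (Hqp : (0 <= q ^ S n)%R) by (apply pow_le; lra).
  apply Rle_lt_trans with ((K + 1) * q ^ S n)%R. apply Rmult_le_compat_r; lra.
  apply Rlt_le_trans with ((K + 1) * (eps / (K + 1)))%R. apply Rmult_lt_compat_l; lra.
  right. field. lra.
Qed.

Lemma taylor f a R0 r : (forall u, (Cmod (u - a) < R0)%R -> holo f u) -> (0 < r < R0)%R ->
  exists c M, (forall k, (Cmod (c k) * r ^ k <= M)%R) /\
    forall z, (Cmod (z - a) < r)%R -> csums (fun k => c k * (z - a) ^ k) (f z).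
Proof.
intros Hf Hr. destruct (circ_bounded f a r) as [M HM]. lra. intros u Hu. apply holo_ccont, Hf. lra.
destruct (taylor_bound f a R0 r M Hf Hr HM) as [c [H1 H2]]. now exists c, (2 * M)%R.
Qed.

Lemma csums_pow_0 (c : nat -> C) (z : C) : z = 0 -> csums (fun k => c k * z ^ k) (c O).
Proof.
intros -> eps He. exists 1%nat. intros n Hn.
assert (E : csum (fun k => c k * 0 ^ k) n = c O).
{ destruct n; [lia|]. clear Hn. induction n. simpl. ring.
  change (csum (fun k => c k * 0 ^ k) (S (S n))) with (csum (fun k => c k * 0 ^ k) (S n) + c (S n) * 0 ^ S n). rewrite IHn, Cpow_S. ring. }
rewrite E, Cmod_sub_self. auto.
Qed.

(** On a circle of radius [r] all terms after the constant one add up to at most [2 M q / (1 - q)]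
    with [q = |z| / r]. *)
Lemma liouville f M : (forall u, holo f u) -> (forall u, (Cmod (f u) <= M)%R) -> forall z, f z = f 0.
Proof.
intros Hf HM z.
assert (HM0 : (0 <= M)%R) by (eapply Rle_trans; [apply Cmod_ge_0|apply (HM 0)]).
assert (f z - f 0 = 0); [|replace (f z) with (f z - f 0 + f 0) by ring; rewrite H; ring].
apply Cmod_small_eq_0. intros eps He. assert (Hz := Cmod_ge_0 z).
(* The first summands make the ratio [q] at most 1/2; the last one makes [4 M |z| / r] at most
   [eps]. *)
set (r := (2 * Cmod z + 1 + 4 * M * Cmod z / eps)%R).
assert (Hr0 : (0 <= 4 * M * Cmod z / eps)%R).
{ apply Rmult_le_pos. apply Rmult_le_pos; lra. left. now apply Rinv_0_lt_compat. }
destruct (taylor_bound f 0 (r + 1) r M) as [c [H1 H2]]; auto. unfold r; lra.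
assert (Hzr : (Cmod (z - 0) < r)%R). { replace (z - 0) with z by ring. unfold r. lra. }
assert (S1 := H2 z Hzr).
assert (S0 : f 0 = c O).
{ apply (csums_unique (fun k => c k * (0 - 0) ^ k)). apply H2. rewrite Cmod_sub_self. unfold r; lra. apply (csums_pow_0 c (RtoC 0 - RtoC 0)%C). ring. }
apply csums_shift in S1. simpl in S1. rewrite S0.
replace (z - 0) with z in * by ring. replace (f z - c O * 1) with (f z - c O) in S1 by ring.
set (q := (Cmod z / r)%R).
assert (Hr : (0 < r)%R) by (unfold r; lra).
assert (Hq : (0 <= q <= 1/2)%R).
{ unfold q. split. apply Rmult_le_pos; auto. left. apply Rinv_0_lt_compat. lra.
  apply Rmult_le_reg_r with r. lra. unfold Rdiv. rewrite Rmult_assoc, Rinv_l by lra. unfold r; lra. }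
eapply Rle_trans. apply csums_bound with (1 := S1) (B := (2 * M * q * / (1 - q))%R). exists O. intros n _.
- eapply Rle_trans. apply Cmod_csum_le.
  apply Rle_trans with (rsum (fun k => (2 * M * q) * q ^ k)%R n).
  apply rsum_le. intros k _. change (z * z ^ k) with (z ^ S k). rewrite Cmod_mult, Cmod_pow.
  replace (Cmod z ^ S k)%R with (r ^ S k * q ^ S k)%R.
  2: { rewrite <- Rpow_mult_distr. f_equal. unfold q. field. lra. }
  rewrite <- Rmult_assoc. replace (2 * M * q * q ^ k)%R with (2 * M * q ^ S k)%R by (simpl; ring).
  apply Rmult_le_compat_r. apply pow_le; lra. apply H1.
  rewrite rsum_scal. apply Rmult_le_compat_l. apply Rmult_le_pos; lra. apply rsum_geom. lra.
- apply Rle_trans with (2 * M * q * 2)%R.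
  apply Rmult_le_compat_l. apply Rmult_le_pos; lra. replace 2%R with (/ (1/2))%R by lra. apply Rinv_le_contravar; lra.
  assert (4 * M * Cmod z <= eps * r)%R.
  { unfold r. assert (eps * (4 * M * Cmod z / eps) = 4 * M * Cmod z)%R by (field; lra). nra. }
  unfold q. apply Rmult_le_reg_r with r. auto.
  replace (2 * M * (Cmod z / r) * 2 * r)%R with (4 * M * Cmod z)%R by (field; lra). auto.
Qed.

(** * Taylor coefficients and local factorization *)
Definition near (a : C) (P : C -> Prop) : Prop :=
  exists d, (0 < d)%R /\ forall u, (Cmod (u - a) < d)%R -> P u.
Definition pnear (a : C) (P : C -> Prop) : Prop :=
  exists d, (0 < d)%R /\ forall u, (0 < Cmod (u - a) < d)%R -> P u.

Lemma near_and a P Q : near a P -> near a Q -> near a (fun u => P u /\ Q u).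
Proof.
intros [d1 [h1 k1]] [d2 [h2 k2]]. exists (Rmin d1 d2). split. now apply Rmin_pos.
intros u Hu. assert (m1 := Rmin_l d1 d2). assert (m2 := Rmin_r d1 d2). split; [apply k1|apply k2]; lra.
Qed.
Lemma pnear_and a P Q : pnear a P -> pnear a Q -> pnear a (fun u => P u /\ Q u).
Proof.
intros [d1 [h1 k1]] [d2 [h2 k2]]. exists (Rmin d1 d2). split. now apply Rmin_pos.
intros u Hu. assert (m1 := Rmin_l d1 d2). assert (m2 := Rmin_r d1 d2). split; [apply k1|apply k2]; lra.
Qed.
Lemma near_impl a P (Q : C -> Prop) : near a P -> (forall u, P u -> Q u) -> near a Q.
Proof. intros [d [h k]] H. exists d. split; auto. Qed.
Lemma pnear_impl a P (Q : C -> Prop) : pnear a P -> (forall u, u <> a -> P u -> Q u) -> pnear a Q.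
Proof.
intros [d [h k]] H. exists d. split; auto. intros u Hu. apply H; auto.
intros ->. rewrite Cmod_sub_self in Hu. lra.
Qed.
Lemma near_true a (P : C -> Prop) : (forall u, P u) -> near a P.
Proof. exists 1%R. split; auto. lra. Qed.
Lemma near_pnear a P : near a P -> pnear a P.
Proof. intros [d [h k]]. exists d. split; auto. intros u [_ Hu]. auto. Qed.
Lemma near_self a P : near a P -> P a.
Proof. intros [d [h k]]. apply k. rewrite Cmod_sub_self. auto. Qed.
Lemma near_open a P : near a P -> near a (fun u => near u P).
Proof.
intros [d [h k]]. exists d. split; auto. intros u Hu. exists (d - Cmod (u - a))%R. split. lra.
intros w Hw. apply k. eapply Rle_lt_trans. apply (Cmod_triangle_sub w u a). lra.
Qed.
Lemma pnear_open a P : pnear a P -> pnear a (fun u => near u P).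
Proof.
intros [d [h k]]. exists d. split; auto. intros u Hu.
exists (Rmin (Cmod (u - a)) (d - Cmod (u - a))). split. apply Rmin_pos; lra.
intros w Hw. assert (m1 := Rmin_l (Cmod (u - a)) (d - Cmod (u - a))). assert (m2 := Rmin_r (Cmod (u - a)) (d - Cmod (u - a))).
apply k. split.
assert (T := Cmod_triangle_sub u w a). rewrite (Cmod_sub_sym u w) in T. lra.
eapply Rle_lt_trans. apply (Cmod_triangle_sub w u a). lra.
Qed.
Lemma pnear_near_at a (P : C -> Prop) : pnear a P -> P a -> near a P.
Proof.
intros [d [h k]] H. exists d. split; auto. intros u Hu.
destruct (Cmod_ge_0 (u - a)) as [h1|h1]. auto.
replace u with a; auto. symmetry in h1. apply Cmod_eq_0 in h1. replace u with (u - a + a) by ring. rewrite h1. ring.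
Qed.
Lemma near_shift a b P : near (a - b) P -> near a (fun u => P (u - b)).
Proof.
intros [d [h k]]. exists d. split; auto. intros u Hu. apply k. now replace (u - b - (a - b)) with (u - a) by ring.
Qed.
Lemma pnear_shift a b P : pnear (a - b) P -> pnear a (fun u => P (u - b)).
Proof.
intros [d [h k]]. exists d. split; auto. intros u Hu. apply k. now replace (u - b - (a - b)) with (u - a) by ring.
Qed.
Lemma near_ccont_neq f z : ccont f z -> f z <> 0 -> near z (fun u => f u <> 0).
Proof.
intros H Hz. destruct (ccont_neq_0 f z H Hz) as [d [Hd K]]. exists d. split; auto.
intros u Hu. apply Cmod_gt_0. specialize (K u Hu). assert (h := Cmod_ge_0 (f z)). lra.
Qed.
Lemma near_forall n (P : nat -> C -> Prop) a : (forall j, (1 <= j <= n)%nat -> near a (P j)) ->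
  near a (fun u => forall j, (1 <= j <= n)%nat -> P j u).
Proof.
induction n; intro H. apply near_true. intros; lia.
apply near_impl with (fun u => (forall j, (1 <= j <= n)%nat -> P j u) /\ P (S n) u).
apply near_and. apply IHn. intros; apply H; lia. apply H; lia.
intros u [h1 h2] j Hj. destruct (Nat.eq_dec j (S n)) as [->|]; auto. apply h1. lia.
Qed.

Lemma holo_near_at f a : holo_near f a -> holo f a.
Proof. apply (near_self a (fun z => holo f z)). Qed.
Lemma holo_near_ccont f a : holo_near f a -> ccont f a.
Proof. intro. now apply holo_ccont, holo_near_at. Qed.
Lemma holo_near_all f a : (forall z, holo f z) -> holo_near f a.
Proof. intro H. now apply near_true. Qed.
Lemma holo_near_plus f g a : holo_near f a -> holo_near g a -> holo_near (fun u => f u + g u) a.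
Proof. intros H1 H2. eapply near_impl. apply (near_and _ _ _ H1 H2). intros u [? ?]. now apply holo_plus. Qed.
Lemma holo_near_minus f g a : holo_near f a -> holo_near g a -> holo_near (fun u => f u - g u) a.
Proof. intros H1 H2. eapply near_impl. apply (near_and _ _ _ H1 H2). intros u [? ?]. now apply holo_minus. Qed.
Lemma holo_near_mult f g a : holo_near f a -> holo_near g a -> holo_near (fun u => f u * g u) a.
Proof. intros H1 H2. eapply near_impl. apply (near_and _ _ _ H1 H2). intros u [? ?]. now apply holo_mult. Qed.
Lemma holo_near_const k a : holo_near (fun _ => k) a.
Proof. apply holo_near_all. intro; apply holo_const. Qed.
Lemma holo_near_sub_const b a : holo_near (fun u => u - b) a.
Proof. apply holo_near_all. intro; apply holo_sub_const. Qed.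
Lemma holo_near_scal k f a : holo_near f a -> holo_near (fun u => k * f u) a.
Proof. apply holo_near_mult. apply holo_near_const. Qed.
Lemma holo_near_div f g a : holo_near f a -> holo_near g a -> g a <> 0 -> holo_near (fun u => f u / g u) a.
Proof.
intros H1 H2 H. eapply near_impl. apply (near_and _ _ _ H1 (near_and _ _ _ H2 (near_ccont_neq g a (holo_near_ccont _ _ H2) H))).
intros u [? [? ?]]. now apply holo_div.
Qed.
Lemma holo_near_pow f k a : holo_near f a -> holo_near (fun u => f u ^ k) a.
Proof. intro H. eapply near_impl. exact H. intros u Hu. now apply holo_pow_C. Qed.
Lemma holo_near_shift f a b : holo_near f (a - b) -> holo_near (fun u => f (u - b)) a.
Proof.
intro H. eapply near_impl. apply (near_shift _ _ _ H). cbv beta. intros u Hu. now apply holo_shift.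
Qed.
Lemma holo_near_open f a : holo_near f a -> near a (fun u => holo_near f u).
Proof. intro H. apply (near_open a (fun u => holo f u) H). Qed.

Lemma is_derive_near f g z l : near z (fun w => f w = g w) -> f ~> l at z -> g ~> l at z.
Proof. intros H. apply is_derive_ext_near. exact H. Qed.
Lemma CDeriv_ext_near f g z : near z (fun w => f w = g w) -> CDeriv f z = CDeriv g z.
Proof.
intros H. unfold CDeriv. f_equal. apply FunctionalExtensionality.functional_extensionality. intro l.
apply PropExtensionality.propositional_extensionality. split; apply is_derive_near; auto.
apply (near_impl _ _ _ H). auto.
Qed.
Lemma CDeriv_n_ext_near k f g z : near z (fun w => f w = g w) -> near z (fun w => CDeriv_n k f w = CDeriv_n k g w).
Proof.
intro H. induction k; simpl; auto. apply (near_impl _ _ _ (near_open _ _ IHk)). intros u Hu. now apply CDeriv_ext_near.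
Qed.

Definition pser_at (c : nat -> C) (h : C -> C) (a : C) : Prop :=
  exists r M, (0 < r)%R /\ (forall k, (Cmod (c k) * r ^ k <= M)%R) /\
   forall u, (Cmod (u - a) < r)%R -> csums (fun k => c k * (u - a) ^ k) (h u).

Lemma holo_near_pser h a : holo_near h a -> exists c, pser_at c h a.
Proof.
intros [d [Hd H]]. destruct (taylor h a d (d/2)) as [c [M [h1 h2]]]. exact H. lra.
exists c, (d/2)%R, M. split. lra. auto.
Qed.

Lemma pser_at_derive c h a : pser_at c h a -> near a (fun u => holo h u) /\ pser_at (dcoef c) (CDeriv h) a.
Proof.
intros [r [M [Hr [H1 H2]]]].
assert (K : forall u, (Cmod (u - a) < r)%R -> exists l, csums (fun k => dcoef c k * (u - a) ^ k) l /\ h ~> l at u).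
{ intros u Hu.
  destruct (pser_is_derive c (fun w => h (w + a)) r M H1) with (z := u - a) as [l [Hl1 Hl2]]; auto.
  - intros z Hz.
    apply (csums_ext (fun k => c k * (z + a - a) ^ k)). intro k. now replace (z + a - a) with z by ring.
    apply H2. now replace (z + a - a) with z by ring.
  - exists l. split; auto. apply (is_derive_shift (fun w => h (w + a)) a) in Hl2.
    apply is_derive_ext_all with (2 := Hl2). intro w. f_equal. ring. }
split.
- exists r. split; auto. intros u Hu. destruct (K u Hu) as [l [_ Hl]]. now exists l.
- exists (r/2)%R, (M / (r - r / 2))%R. split. lra. split. apply dcoef_bound; auto; lra.
  intros u Hu. destruct (K u ltac:(lra)) as [l [Hl1 Hl2]]. now rewrite (CDeriv_unique _ _ _ Hl2).
Qed.

Lemma pser_at_holo c h a : pser_at c h a -> holo_near h a.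
Proof. intro H. now apply pser_at_derive in H. Qed.

Lemma pser_at_0 c h a : pser_at c h a -> h a = c O.
Proof.
intros [r [M [Hr [H1 H2]]]]. apply csums_unique with (fun k => c k * (a - a) ^ k). apply H2. rewrite Cmod_sub_self. auto.
apply (csums_pow_0 c (a - a)). ring.
Qed.

Lemma pser_at_exists c a r M : (0 < r)%R -> (forall k, (Cmod (c k) * r ^ k <= M)%R) -> exists h, pser_at c h a.
Proof.
intros Hr H.
set (h u := epsilon (inhabits (RtoC 0)) (fun l => csums (fun k => c k * (u - a) ^ k) l)).
exists h, r, M. split; auto. split; auto. intros u Hu. unfold h. apply epsilon_spec.
destruct (pser_conv c r M (u - a) H Hu) as [l [Hl _]]. now exists l.
Qed.

Lemma CDeriv_holo_near h a : holo_near h a -> holo_near (CDeriv h) a.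
Proof.
intro H. destruct (holo_near_pser h a H) as [c Hc]. apply pser_at_derive in Hc. destruct Hc as [_ Hc].
now apply pser_at_holo in Hc.
Qed.

Lemma CDeriv_n_holo_near k h a : holo_near h a -> holo_near (CDeriv_n k h) a.
Proof. intro H. induction k; simpl; auto. now apply CDeriv_holo_near. Qed.

Definition tcoef (h : C -> C) (a : C) (m : nat) : C := CDeriv_n m h a / RtoC (INR (fact m)).

Lemma INR_fact_C_neq k : RtoC (INR (fact k)) <> 0.
Proof. intro E. apply RtoC_inj in E. now apply INR_fact_neq_0 in E. Qed.

(** Links iterated chosen derivatives to series coefficients: [m] applications of [dcoef] multiply
    the coefficient of index [k + m] by [(k + m)! / k!], which at [k = 0] is the factorial divided
    out in [tcoef]. *)
Lemma pser_at_tcoef c h a m : pser_at c h a -> tcoef h a m = c m.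
Proof.
intro H.
assert (K : pser_at (Nat.iter m dcoef c) (CDeriv_n m h) a).
{ induction m; simpl; auto. now apply pser_at_derive in IHm. }
assert (E : forall m k, Nat.iter m dcoef c k * RtoC (INR (fact k)) = RtoC (INR (fact (k + m))) * c (k + m)%nat).
{ clear. intro m. induction m; intro k. simpl. rewrite Nat.add_0_r. ring.
  change (Nat.iter (S m) dcoef c k) with (RtoC (INR (S k)) * Nat.iter m dcoef c (S k)).
  replace (k + S m)%nat with (S k + m)%nat by lia. rewrite <- IHm.
  change (fact (S k)) with (S k * fact k)%nat. rewrite mult_INR, RtoC_mult. ring. }
unfold tcoef. rewrite (pser_at_0 _ _ _ K). specialize (E m O). simpl in E. rewrite Cmult_1_r in E.
unfold Cdiv. rewrite E. field. apply INR_fact_C_neq.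
Qed.

Lemma holo_near_tcoef h a : holo_near h a -> pser_at (tcoef h a) h a.
Proof.
intro H. destruct (holo_near_pser h a H) as [c Hc]. assert (E := fun m => pser_at_tcoef c h a m Hc).
destruct Hc as [r [M [Hr [H1 H2]]]]. exists r, M. split; auto. split. intro k. now rewrite E.
intros u Hu. apply csums_ext with (2 := H2 u Hu). intro k. now rewrite E.
Qed.


Lemma tcoef_ext h g a m : near a (fun u => h u = g u) -> tcoef h a m = tcoef g a m.
Proof. intro H. unfold tcoef. f_equal. apply (near_self a (fun w => CDeriv_n m h w = CDeriv_n m g w)). now apply CDeriv_n_ext_near. Qed.

Lemma pser_at_lin c d h g a k : pser_at c h a -> pser_at d g a -> pser_at (fun m => c m + k * d m) (fun u => h u + k * g u) a.
Proof.
intros [r [M [Hr [H1 H2]]]] [r' [M' [Hr' [H1' H2']]]].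
assert (m1 := Rmin_l r r'). assert (m2 := Rmin_r r r'). assert (Hm : (0 < Rmin r r')%R) by now apply Rmin_pos.
exists (Rmin r r'), (M + Cmod k * M')%R. split; auto. split.
- intro m. assert (0 <= Rmin r r' ^ m)%R by (apply pow_le; lra).
  apply Rle_trans with ((Cmod (c m) + Cmod k * Cmod (d m)) * Rmin r r' ^ m)%R.
  apply Rmult_le_compat_r; auto. rewrite <- Cmod_mult. apply Cmod_triangle.
  rewrite Rmult_plus_distr_r. apply Rplus_le_compat.
  apply Rle_trans with (2 := H1 m). apply Rmult_le_compat_l. apply Cmod_ge_0. apply pow_incr. lra.
  rewrite Rmult_assoc. apply Rmult_le_compat_l. apply Cmod_ge_0.
  apply Rle_trans with (2 := H1' m). apply Rmult_le_compat_l. apply Cmod_ge_0. apply pow_incr. lra.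
- intros u Hu. apply csums_ext with (fun m => c m * (u - a) ^ m + k * (d m * (u - a) ^ m)). intro; ring.
  apply csums_plus. apply H2; lra. apply csums_scal. apply H2'; lra.
Qed.

Lemma tcoef_lin h g a k m : holo_near h a -> holo_near g a ->
  tcoef (fun u => h u + k * g u) a m = tcoef h a m + k * tcoef g a m.
Proof.
intros H1 H2. apply (pser_at_tcoef (fun m => tcoef h a m + k * tcoef g a m)).
apply pser_at_lin; now apply holo_near_tcoef.
Qed.

Lemma pser_at_mul_X c h a : pser_at c h a -> pser_at (fun k => match k with O => 0 | S k' => c k' end) (fun u => (u - a) * h u) a.
Proof.
intros [r [M [Hr [H1 H2]]]]. exists r, (r * M)%R. split; auto.
assert (HM : (0 <= M)%R). { eapply Rle_trans; [|apply (H1 O)]. simpl. assert (h0 := Cmod_ge_0 (c O)). lra. }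
split.
- intros [|k]. rewrite Cmod_0. apply Rle_trans with 0%R. lra. now apply Rmult_le_pos; [lra|].
  simpl. rewrite <- Rmult_assoc, (Rmult_comm _ r), Rmult_assoc. apply Rmult_le_compat_l. lra. apply H1.
- intros u Hu. replace ((u - a) * h u) with (0 * (u - a) ^ 0 + (u - a) * h u) by (simpl; ring).
  apply (csums_unshift (fun k => match k with O => 0 | S k' => c k' end * (u - a) ^ k)).
  apply csums_ext with (fun k => (u - a) * (c k * (u - a) ^ k)). intro k. simpl. ring.
  apply csums_scal. auto.
Qed.

Lemma tcoef_mul_X h a m : holo_near h a -> tcoef (fun u => (u - a) * h u) a (S m) = tcoef h a m.
Proof.
intro H. apply (pser_at_tcoef (fun k => match k with O => 0 | S k' => tcoef h a k' end) _ _ (S m)).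
apply pser_at_mul_X. now apply holo_near_tcoef.
Qed.

Lemma tcoef_mul_pow h a N m : holo_near h a -> tcoef (fun u => (u - a) ^ N * h u) a (N + m) = tcoef h a m.
Proof.
intro H. induction N. simpl. apply tcoef_ext. apply near_true. intro; ring.
rewrite <- IHN. change (S N + m)%nat with (S (N + m)). rewrite <- (tcoef_mul_X (fun u => (u - a) ^ N * h u)).
apply tcoef_ext, near_true. intro; rewrite Cpow_S; ring.
apply holo_near_mult; auto. apply holo_near_pow, holo_near_sub_const.
Qed.

(** The quotient is the sum of the shifted series: its coefficients satisfy the same kind of bound,
    with [M / r^k] in place of [M], so it is holomorphic without any argument on removable
    singularities. *)
Lemma taylor_factor h a k : holo_near h a -> exists g, holo_near g a /\ g a = tcoef h a k /\
  near a (fun u => h u = csum (fun j => tcoef h a j * (u - a) ^ j) k + (u - a) ^ k * g u).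
Proof.
intro H. destruct (holo_near_tcoef h a H) as [r [M [Hr [H1 H2]]]].
assert (Hrk : (0 < r ^ k)%R) by (apply pow_lt; lra).
destruct (pser_at_exists (fun j => tcoef h a (k + j)) a r (M / r ^ k)) as [g Hg]; auto.
{ intro j. apply Rmult_le_reg_r with (r ^ k)%R; auto. unfold Rdiv. rewrite (Rmult_assoc M), Rinv_l, Rmult_1_r by lra.
  specialize (H1 (k + j)%nat). rewrite pow_add in H1. lra. }
exists g. split. now apply pser_at_holo in Hg. split. rewrite (pser_at_0 _ _ _ Hg). now rewrite Nat.add_0_r.
destruct Hg as [r' [M' [Hr' [H1' H2']]]]. exists (Rmin r r'). split. now apply Rmin_pos.
intros u Hu. assert (m1 := Rmin_l r r'). assert (m2 := Rmin_r r r').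
specialize (H2 u ltac:(lra)). specialize (H2' u ltac:(lra)).
apply csums_unique with (1 := H2).
apply csums_scal with (c := (u - a) ^ k) in H2'.
intros eps He. destruct (H2' eps He) as [N HN]. exists (k + N)%nat. intros n Hn.
replace n with (k + (n - k))%nat by lia. rewrite csum_split.
specialize (HN (n - k)%nat ltac:(lia)).
rewrite (csum_ext (fun j => tcoef h a (k + j) * (u - a) ^ (k + j)) (fun j => (u - a) ^ k * (tcoef h a (k + j) * (u - a) ^ j)))
  by (intros; rewrite Cpow_add_r; ring).
replace (_ - _) with (csum (fun j => (u - a) ^ k * (tcoef h a (k + j) * (u - a) ^ j)) (n - k) - (u - a) ^ k * g u) by ring.
exact HN.
Qed.

Lemma tcoef_0 h a : tcoef h a 0 = h a.
Proof. unfold tcoef. simpl. field. Qed.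
Lemma tcoef_1 h a : tcoef h a 1 = CDeriv h a.
Proof. unfold tcoef. simpl. field. Qed.

Lemma taylor_factor1 h a : holo_near h a -> exists g, holo_near g a /\ g a = CDeriv h a /\
  near a (fun u => h u = h a + (u - a) * g u).
Proof.
intro H. destruct (taylor_factor h a 1 H) as [g [H1 [H2 H3]]]. exists g. split; auto. split. now rewrite H2, tcoef_1.
apply (near_impl _ _ _ H3). intros u ->. simpl. rewrite tcoef_0. ring.
Qed.

Lemma holo_near_order h a : holo_near h a ->
  near a (fun u => h u = 0) \/ exists k g, holo_near g a /\ g a <> 0 /\ near a (fun u => h u = (u - a) ^ k * g u).
Proof.
intro H.
destruct (excluded_middle_informative (exists k, tcoef h a k <> 0)) as [E|E].
- right.
  assert (Hmin : exists k, tcoef h a k <> 0 /\ forall j, (j < k)%nat -> tcoef h a j = 0).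
  { destruct E as [k0 Hk0]. revert Hk0.
    induction k0 as [k0 IH] using lt_wf_ind. intro Hk0.
    destruct (excluded_middle_informative (exists j, (j < k0)%nat /\ tcoef h a j <> 0)) as [[j [Hj Hj']]|E].
    now apply (IH j). exists k0. split; auto. intros j Hj.
    destruct (excluded_middle_informative (tcoef h a j = 0)); auto. exfalso. apply E. now exists j. }
  destruct Hmin as [k [Hk Hk0]]. destruct (taylor_factor h a k H) as [g [H1 [H2 H3]]].
  exists k, g. split; auto. split. now rewrite H2. apply (near_impl _ _ _ H3). intros u ->.
  rewrite (csum_ext _ (fun j => 0 * (u - a) ^ j)) by (intros j Hj; now rewrite Hk0).
  assert (Z : forall n, csum (fun j => 0 * (u - a) ^ j) n = 0). { induction n; simpl. reflexivity. rewrite IHn. ring. }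
  rewrite Z. ring.
- left. destruct (holo_near_tcoef h a H) as [r [M [Hr [H1 H2]]]]. exists r. split; auto. intros u Hu.
  apply csums_unique with (1 := H2 u Hu). intros eps He. exists O. intros n _.
  assert (Z : csum (fun k => tcoef h a k * (u - a) ^ k) n = 0).
  { induction n; simpl. reflexivity. rewrite IHn. destruct (excluded_middle_informative (tcoef h a n = 0)) as [Q|Q].
    rewrite Q. ring. exfalso. apply E. now exists n. }
  rewrite Z, Cmod_sub_self. auto.
Qed.

(** * Meromorphic functions and residues *)
(** [N] only bounds the pole order from above, since [h a] may vanish; the value of [f] at [a]
    itself is irrelevant. *)
Definition pole_rep (f : C -> C) (a : C) (N : nat) (h : C -> C) : Prop :=
  holo_near h a /\ pnear a (fun u => h u = (u - a) ^ N * f u).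

Lemma merom_at_iff f a : merom_at f a <-> exists N h, pole_rep f a N h.
Proof.
split.
- intros [N [h [d [Hd [H1 H2]]]]]. exists N, h. split; auto. exists d. split; [assumption|]. intros u Hu. rewrite H2, Cpow_Defs; auto.
- intros [N [h [H1 [d [Hd H2]]]]]. exists N, h, d. split; [assumption|]. split; [assumption|]. intros u Hu. rewrite Cpow_Defs; auto.
Qed.

Lemma is_residue_iff g a r : is_residue g a r <-> exists N h, pole_rep g a (S N) h /\ r = tcoef h a N.
Proof.
split.
- intros [N [h [d [HN [Hd [H1 [H2 ->]]]]]]]. destruct N as [|N]; [lia|]. exists N, h. split. split; [assumption|].
  exists d. split; [assumption|]. intros u Hu. rewrite H2, Cpow_Defs; auto. unfold tcoef. now replace (S N - 1)%nat with N by lia.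
- intros [N [h [[H1 [d [Hd H2]]] ->]]]. exists (S N), h, d. split. lia. split; auto. split; auto. split.
  intros u Hu. rewrite Cpow_Defs; auto. unfold tcoef. now replace (S N - 1)%nat with N by lia.
Qed.

Lemma pole_rep_raise f a N h k : pole_rep f a N h -> pole_rep f a (k + N) (fun u => (u - a) ^ k * h u).
Proof.
intros [H1 H2]. split. apply holo_near_mult; auto. apply holo_near_pow, holo_near_sub_const.
apply (pnear_impl _ _ _ H2). intros u _ ->. rewrite Cpow_add_r. ring.
Qed.

Lemma holo_near_eq f g a : holo_near f a -> holo_near g a -> pnear a (fun u => f u = g u) -> near a (fun u => f u = g u).
Proof.
intros H1 H2 H3. apply pnear_near_at; auto. apply ccont_eq_at; auto; now apply holo_near_ccont.
Qed.

Lemma pole_rep_unique f a N h k : pole_rep f a N h -> pole_rep f a N k -> near a (fun u => h u = k u).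
Proof.
intros [H1 H2] [H3 H4]. apply holo_near_eq; auto. apply (pnear_impl _ _ _ (pnear_and _ _ _ H2 H4)).
intros u _ [-> ->]. reflexivity.
Qed.

(** Two representations may use different exponents. Raised to a common one they agree near [a], and
    multiplication by a power of [u - a] merely shifts the Taylor index. *)
Lemma is_residue_unique g a r s : is_residue g a r -> is_residue g a s -> r = s.
Proof.
rewrite !is_residue_iff. intros [N [h [H1 ->]]] [M [k [H2 ->]]].
rewrite <- (tcoef_mul_pow h a M N) by apply H1. rewrite <- (tcoef_mul_pow k a N M) by apply H2.
rewrite (Nat.add_comm N M). apply tcoef_ext. apply (pole_rep_unique g a (S M + N)).
replace (S M + N)%nat with (M + S N)%nat by lia. now apply pole_rep_raise.
replace (S M + N)%nat with (N + S M)%nat by lia. now apply pole_rep_raise.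
Qed.

Lemma Res_eq g a r : is_residue g a r -> Res g a = r.
Proof.
intro H. apply is_residue_unique with g a; auto. unfold Res. apply epsilon_spec. now exists r.
Qed.

Lemma is_residue_lin f g a r s k : is_residue f a r -> is_residue g a s -> is_residue (fun u => f u + k * g u) a (r + k * s).
Proof.
rewrite !is_residue_iff. intros [N [h [H1 ->]]] [M [l [H2 ->]]].
exists (M + N)%nat, (fun u => (u - a) ^ M * h u + k * ((u - a) ^ N * l u)).
assert (P1 := pole_rep_raise _ _ _ _ M H1). assert (P2 := pole_rep_raise _ _ _ _ N H2).
split.
- destruct P1 as [Q1 Q2], P2 as [Q3 Q4]. split. apply holo_near_plus; auto. now apply holo_near_scal.
  apply (pnear_impl _ _ _ (pnear_and _ _ _ Q2 Q4)). intros u _ [-> ->].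
  replace (S (M + N)) with (M + S N)%nat by lia. replace (N + S M)%nat with (M + S N)%nat by lia. ring.
- rewrite tcoef_lin by (apply P1 || apply P2). rewrite tcoef_mul_pow by apply H1.
  replace (M + N)%nat with (N + M)%nat by lia. now rewrite tcoef_mul_pow by apply H2.
Qed.

Lemma is_residue_ext f g a r : pnear a (fun u => f u = g u) -> is_residue f a r -> is_residue g a r.
Proof.
intro E. rewrite !is_residue_iff. intros [N [h [[H1 H2] ->]]]. exists N, h. split; auto. split; auto.
apply (pnear_impl _ _ _ (pnear_and _ _ _ E H2)). intros u _ [<- ->]. reflexivity.
Qed.

Lemma is_residue_simple g a h : holo_near h a -> pnear a (fun u => h u = (u - a) * g u) -> is_residue g a (h a).
Proof.
intros H1 H2. apply is_residue_iff. exists O, h. split. split; auto. apply (pnear_impl _ _ _ H2). intros u _ ->. simpl. ring.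
now rewrite tcoef_0.
Qed.

Lemma is_residue_double g a h : holo_near h a -> pnear a (fun u => h u = (u - a) ^ 2 * g u) -> is_residue g a (CDeriv h a).
Proof.
intros H1 H2. apply is_residue_iff. exists 1%nat, h. split. split; auto. now rewrite tcoef_1.
Qed.

Lemma is_residue_holo g a h : holo_near h a -> pnear a (fun u => g u = h u) -> is_residue g a 0.
Proof.
intros H1 H2. replace (RtoC 0) with ((a - a) * h a) by ring.
apply (is_residue_simple g a (fun u => (u - a) * h u)). apply holo_near_mult; auto. apply holo_near_sub_const.
apply (pnear_impl _ _ _ H2). intros u _ ->. reflexivity.
Qed.

Lemma merom_is_residue g a : merom_at g a -> exists r, is_residue g a r.
Proof.
rewrite merom_at_iff. intros [N [h H]]. exists (tcoef (fun u => (u - a) ^ 1 * h u) a N). apply is_residue_iff.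
exists N, (fun u => (u - a) ^ 1 * h u). split; auto. apply (pole_rep_raise g a N h 1 H).
Qed.

(** The leading coefficient is multiplied by [-(N + 1)], hence never lost. Derivatives of one
    function with a simple pole therefore reach every pole order. *)
Lemma pole_rep_derive f g a N h : pole_rep f a (S N) h -> pnear a (fun u => f ~> g u at u) ->
  pole_rep g a (S (S N)) (fun u => (u - a) * CDeriv h u - RtoC (INR (S N)) * h u).
Proof.
intros [H1 H2] H3. assert (H1' := CDeriv_holo_near h a H1). split.
- apply holo_near_minus. apply holo_near_mult; auto. apply holo_near_sub_const. now apply holo_near_scal.
- apply (pnear_impl _ _ _ (pnear_and _ _ _ (near_pnear _ _ H1) (pnear_and _ _ _ (pnear_open _ _ H2) H3))).
  intros u Hu [[l Hl] [K1 K2]]. fold (cder h u l) in Hl.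
  assert (Q : h ~> (RtoC (INR (S N)) * (u - a) ^ N * f u + (u - a) ^ S N * g u) at u).
  { apply is_derive_near with (fun u => (u - a) ^ S N * f u). apply (near_impl _ _ _ K1). intros w ->. reflexivity.
    apply is_derive_C_mult; auto. clear. induction N.
    - eapply is_derive_ext_all; [|eapply is_derive_eq; [apply is_derive_C_minus; [apply is_derive_C_id | apply (is_derive_C_const a)]|]].
      intro w; simpl; ring. simpl; ring.
    - eapply is_derive_eq. eapply is_derive_ext_all; [|apply is_derive_C_mult; [apply is_derive_C_minus; [apply is_derive_C_id | apply (is_derive_C_const a)]|exact IHN]].
      intro w. cbv beta. rewrite (Cpow_S _ (S N)). reflexivity. cbv beta.
      rewrite (S_INR (S N)), RtoC_plus, !Cpow_S. ring. }
  rewrite (CDeriv_unique _ _ _ Q). rewrite (near_self _ _ K1), !Cpow_S. ring.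
Qed.

(** In the numerator [(u - a) h' - (N + 1) h] the Taylor coefficient of index [N + 1] cancels, both
    terms giving [N + 1] times that of [h]. Raising the exponent by one beforehand includes a
    regular [f]. *)
Lemma is_residue_derive f g a : merom_at f a -> pnear a (fun u => f ~> g u at u) -> is_residue g a 0.
Proof.
rewrite merom_at_iff. intros [N [h H]] H3. apply (pole_rep_raise _ _ _ _ 1) in H. simpl in H.
set (h1 := fun u => (u - a) * 1 * h u) in *.
assert (P := pole_rep_derive _ _ _ _ _ H H3). apply is_residue_iff. exists (S N). eexists. split. exact P.
assert (HC := CDeriv_holo_near h1 a (proj1 H)).
rewrite (tcoef_ext _ (fun u => (u - a) * CDeriv h1 u + (- RtoC (INR (S N))) * h1 u)) by (apply near_true; intro; ring).
rewrite tcoef_lin, tcoef_mul_X; auto.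
- assert (E : tcoef (CDeriv h1) a N = RtoC (INR (S N)) * tcoef h1 a (S N)).
  { apply (pser_at_tcoef (dcoef (tcoef h1 a))). apply pser_at_derive. apply holo_near_tcoef, H. }
  rewrite E. ring.
- apply holo_near_mult; auto. apply holo_near_sub_const.
- apply H.
Qed.

Lemma merom_at_holo_near f a : holo_near f a -> merom_at f a.
Proof. intro H. apply merom_at_iff. exists O, f. split; auto. exists 1%R. split. lra. intros; simpl; ring. Qed.
Lemma merom_at_ext f g a : pnear a (fun u => f u = g u) -> merom_at f a -> merom_at g a.
Proof.
rewrite !merom_at_iff. intros E [N [h [H1 H2]]]. exists N, h. split; auto.
apply (pnear_impl _ _ _ (pnear_and _ _ _ E H2)). intros u _ [<- ->]. reflexivity.
Qed.
Lemma merom_at_plus f g a : merom_at f a -> merom_at g a -> merom_at (fun u => f u + g u) a.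
Proof.
rewrite !merom_at_iff. intros [N [h H1]] [M [l H2]].
destruct (pole_rep_raise _ _ _ _ M H1) as [P1 P2]. destruct (pole_rep_raise _ _ _ _ N H2) as [P3 P4].
exists (M + N)%nat. eexists. split. apply holo_near_plus. exact P1. exact P3.
apply (pnear_impl _ _ _ (pnear_and _ _ _ P2 P4)). intros u _ [-> ->]. rewrite (Nat.add_comm N M). ring.
Qed.
Lemma merom_at_mult f g a : merom_at f a -> merom_at g a -> merom_at (fun u => f u * g u) a.
Proof.
rewrite !merom_at_iff. intros [N [h [P1 P2]]] [M [l [P3 P4]]].
exists (M + N)%nat. eexists. split. apply holo_near_mult. exact P1. exact P3.
apply (pnear_impl _ _ _ (pnear_and _ _ _ P2 P4)). intros u _ [-> ->]. rewrite Cpow_add_r. ring.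
Qed.
Lemma merom_at_const k a : merom_at (fun _ => k) a.
Proof. apply merom_at_holo_near, holo_near_const. Qed.
Lemma merom_at_scal k f a : merom_at f a -> merom_at (fun u => k * f u) a.
Proof. apply merom_at_mult, merom_at_const. Qed.
Lemma merom_at_minus f g a : merom_at f a -> merom_at g a -> merom_at (fun u => f u - g u) a.
Proof.
intros H1 H2. apply merom_at_ext with (fun u => f u + (- (1)) * g u). exists 1%R. split. lra. intros; ring.
apply merom_at_plus; auto. now apply merom_at_scal.
Qed.
(** This convention lets the periodicity under 1 of quotients of theta functions hold at their poles
    too, and it covers the zero function in [merom_at_inv]. *)
Lemma Cinv_0 : / 0 = 0.
Proof. unfold Cinv, RtoC. simpl. unfold Rdiv. f_equal; rewrite ?Ropp_0; ring. Qed.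
Lemma merom_at_inv f a : merom_at f a -> merom_at (fun u => / f u) a.
Proof.
rewrite !merom_at_iff. intros [N [h [P1 P2]]].
destruct (holo_near_order h a P1) as [Z|[k [g [G1 [G2 G3]]]]].
- exists O, (fun _ => 0). split. apply holo_near_const.
  apply (pnear_impl _ _ _ (pnear_and _ _ _ P2 (near_pnear _ _ Z))). intros u Hu [E1 E2]. rewrite E2 in E1.
  assert (f u = 0). { transitivity (/ (u - a) ^ N * ((u - a) ^ N * f u)). field. apply Cpow_nz, Csub_neq_0; auto. rewrite <- E1. ring. }
  rewrite H, Cinv_0. ring.
- exists k, (fun u => (u - a) ^ N / g u). split. apply holo_near_div; auto. apply holo_near_pow, holo_near_sub_const.
  apply (pnear_impl _ _ _ (pnear_and _ _ _ P2 (pnear_and _ _ _ (near_pnear _ _ G3) (near_pnear _ _ (near_ccont_neq g a (holo_near_ccont _ _ G1) G2))))).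
  intros u Hu [E1 [E2 E3]]. rewrite E2 in E1. apply Csub_neq_0 in Hu.
  assert (E : f u = (u - a) ^ k * g u / (u - a) ^ N). { rewrite E1. field. now apply Cpow_nz. }
  rewrite E. field. repeat split; auto; now apply Cpow_nz.
Qed.
Lemma merom_at_div f g a : merom_at f a -> merom_at g a -> merom_at (fun u => f u / g u) a.
Proof. intros H1 H2. apply merom_at_mult; auto. now apply merom_at_inv. Qed.
Lemma merom_at_sum1n n (F : nat -> C -> C) a : (forall j, (1 <= j <= n)%nat -> merom_at (F j) a) ->
  merom_at (fun u => sum1n n (fun j => F j u)) a.
Proof.
induction n; intro H.
- apply merom_at_ext with (fun _ => 0). exists 1%R. split. lra. intros. symmetry. apply (sum_n_m_zero (G := C_AbelianMonoid)). lia. apply merom_at_const.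
- apply merom_at_ext with (fun u => sum1n n (fun j => F j u) + F (S n) u). exists 1%R. split. lra. intros. symmetry.
  apply (sum_n_Sm (G := C_AbelianMonoid)). lia. apply merom_at_plus. apply IHn. intros; apply H; lia. apply H. lia.
Qed.
Lemma merom_at_csum n (F : nat -> C -> C) a : (forall j, merom_at (F j) a) ->
  merom_at (fun u => csum (fun j => F j u) n) a.
Proof. intro H. induction n; simpl. apply merom_at_const. now apply merom_at_plus. Qed.
Lemma merom_at_shift f a b : merom_at f (a - b) -> merom_at (fun u => f (u - b)) a.
Proof.
rewrite !merom_at_iff. intros [N [h [P1 P2]]]. exists N, (fun u => h (u - b)). split. now apply holo_near_shift.
apply (pnear_impl _ _ _ (pnear_shift _ _ _ P2)). intros u _ ->. now replace (u - b - (a - b)) with (u - a) by ring.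
Qed.
Lemma pole_rep_holo f a N h : pole_rep f a N h -> pnear a (fun u => holo f u).
Proof.
intros [H1 H2]. apply (pnear_impl _ _ _ (pnear_and _ _ _ (near_pnear _ _ H1) (pnear_open _ _ H2))).
intros u Hu [K1 K2]. apply Csub_neq_0 in Hu.
apply holo_ext_near with (fun u => h u / (u - a) ^ N).
- destruct (near_and _ _ _ K2 (near_ccont_neq (fun u => u - a) u (holo_ccont _ _ (holo_sub_const a u)) Hu)) as [d [Hd K]].
  exists d. split; auto. intros w Hw. destruct (K w Hw) as [-> K']. field. now apply Cpow_nz.
- apply holo_div; auto. apply holo_pow_C, holo_sub_const. now apply Cpow_nz.
Qed.
Lemma merom_at_derive f g a : merom_at f a -> pnear a (fun u => f ~> g u at u) -> merom_at g a.
Proof.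
intros H1 H3. apply merom_at_iff in H1. destruct H1 as [N [h H]]. apply (pole_rep_raise _ _ _ _ 1) in H. simpl in H.
apply merom_at_iff. eexists. eexists. eapply pole_rep_derive; eauto.
Qed.
Lemma merom_at_pnear_holo f a : merom_at f a -> pnear a (fun u => holo f u).
Proof. intro H. apply merom_at_iff in H. destruct H as [N [h H]]. exact (pole_rep_holo _ _ _ _ H). Qed.
Lemma merom_at_CDeriv f a : merom_at f a -> merom_at (CDeriv f) a.
Proof.
intro H. apply merom_at_derive with f; auto. apply (pnear_impl _ _ _ (merom_at_pnear_holo f a H)).
intros u _. apply CDeriv_correct.
Qed.
Lemma merom_at_CDeriv_n k f a : merom_at f a -> merom_at (CDeriv_n k f) a.
Proof. intro H. induction k; simpl; auto. now apply merom_at_CDeriv. Qed.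

Lemma csum_merge (b : nat -> C) (x : C) N (F : nat -> C) :
  csum (fun m => (if Nat.eqb m N then x else b m) * F m) (S N) = csum (fun m => b m * F m) N + x * F N.
Proof.
simpl. rewrite Nat.eqb_refl. f_equal. apply csum_ext. intros k Hk.
destruct (Nat.eqb_spec k N). lia. reflexivity.
Qed.

(** [K m] has a pole of exact order [m + 1], so a multiple of it removes the top order and induction
    does the rest. It serves for polar parts by derivatives of [rho] and for the reduction of pole
    orders modulo [d + omega]. *)
Lemma pole_span (K : nat -> C -> C) a :
  (forall m, exists H, pole_rep (K m) a (S m) H /\ H a <> 0) ->
  forall N g h, pole_rep g a N h ->
  exists (b : nat -> C) k, holo_near k a /\ pnear a (fun u => g u - csum (fun m => b m * K m u) N = k u).
Proof.
intros HK N. induction N; intros g h [H1 H2].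
- exists (fun _ => 0), h. split; auto. apply (pnear_impl _ _ _ H2). intros u _ ->. simpl. ring.
- destruct (HK N) as [H [[K1 K2] K3]].
  set (x := h a / H a).
  assert (Hd : holo_near (fun u => h u - x * H u) a) by (apply holo_near_minus; auto; now apply holo_near_scal).
  destruct (taylor_factor1 _ a Hd) as [h2 [L1 [_ L2]]].
  assert (P : pole_rep (fun u => g u - x * K N u) a N h2).
  { split; auto. apply (pnear_impl _ _ _ (pnear_and _ _ _ H2 (pnear_and _ _ _ K2 (near_pnear _ _ L2)))).
    intros u Hu [E1 [E2 E3]]. apply Csub_neq_0 in Hu. rewrite E1, E2 in E3.
    replace (h a - x * H a) with (RtoC 0) in E3 by (unfold x; field; auto).
    transitivity ((0 + (u - a) * h2 u) / (u - a)). field; auto. rewrite <- E3. rewrite !Cpow_S. field. auto. }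
  destruct (IHN _ _ P) as [b [k [Q1 Q2]]].
  exists (fun m => if Nat.eqb m N then x else b m), k. split; auto.
  apply (pnear_impl _ _ _ Q2). intros u _ <-. rewrite csum_merge. ring.
Qed.

Lemma pole_rep_CDeriv_n f a H m : pole_rep f a 1 H -> H a <> 0 ->
  exists H', pole_rep (CDeriv_n m f) a (S m) H' /\ H' a <> 0.
Proof.
intros P Ha. induction m. now exists H.
destruct IHm as [H' [P' Ha']]. simpl. eexists. split. apply (pole_rep_derive (CDeriv_n m f)). exact P'.
apply (pnear_impl _ _ _ (pole_rep_holo _ _ _ _ P')). intros u _. apply CDeriv_correct.
cbv beta. replace (a - a) with (RtoC 0) by ring.
replace (0 * CDeriv H' a - RtoC (INR (S m)) * H' a) with ((- RtoC (INR (S m))) * H' a) by ring.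
apply Cmult_neq_0; auto. intro E. apply (f_equal Copp) in E. replace (- - RtoC (INR (S m))) with (RtoC (INR (S m))) in E by ring. replace (- 0) with (RtoC 0) in E by ring.
apply RtoC_inj in E. apply not_0_INR in E; auto.
Qed.

(** * The finite Jacobi triple product *)
Fixpoint cprod (x : nat -> C) (n : nat) : C :=
  match n with O => 1 | S k => cprod x k * (1 - x k) end.

Lemma cprod_split (x : nat -> C) n m : cprod x (n + m) = cprod x n * cprod (fun k => x (n + k)%nat) m.
Proof. induction m; simpl. rewrite Nat.add_0_r. ring. rewrite Nat.add_succ_r. simpl. rewrite IHm. ring. Qed.

Lemma cprod_neq_0 (x : nat -> C) n : (forall k, (k < n)%nat -> x k <> 1) -> cprod x n <> 0.
Proof.
induction n; intro H; simpl. intro E; apply RtoC_inj in E; lra.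
apply Cmult_neq_0. apply IHn; auto. apply Csub_neq_0. intro E. symmetry in E. revert E. apply H. lia.
Qed.

Lemma cprod_weierstrass (x : nat -> C) n : (rsum (fun k => Cmod (x k)) n <= 1)%R ->
  (1 - rsum (fun k => Cmod (x k)) n <= Cmod (cprod x n))%R.
Proof.
induction n; simpl; intro H. rewrite Cmod_1. lra.
assert (h := Cmod_ge_0 (x n)). specialize (IHn ltac:(lra)).
assert (hs : (0 <= rsum (fun k => Cmod (x k)) n)%R) by (apply rsum_ge_0; intros; apply Cmod_ge_0).
rewrite Cmod_mult. assert (T := Cmod_le_sub 1 (x n)). rewrite Cmod_1 in T.
assert (hp := Cmod_ge_0 (cprod x n)). nra.
Qed.

Lemma min_positive (f : nat -> R) : (forall n, (0 < f n)%R) -> forall K, exists d, (0 < d)%R /\ forall n, (n < K)%nat -> (d <= f n)%R.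
Proof.
intros H K. induction K. exists 1%R. split. lra. intros; lia.
destruct IHK as [d [Hd K']]. exists (Rmin d (f K)). split. now apply Rmin_pos.
intros n Hn. destruct (Nat.eq_dec n K) as [->|]. apply Rmin_r. eapply Rle_trans. apply Rmin_l. apply K'. lia.
Qed.

(** From some index [K] on, the moduli add up to at most 1/2, so the tail products stay above 1/2 by
    the Weierstrass inequality; the products up to length [K] are finitely many nonzero numbers. *)
Lemma cprod_lower_bound (x : nat -> C) M q : (0 <= q < 1)%R -> (forall k, (Cmod (x k) <= M * q ^ k)%R) -> (forall k, x k <> 1) ->
  exists d, (0 < d)%R /\ forall n, (d <= Cmod (cprod x n))%R.
Proof.
intros Hq Hx H1.
assert (HM : (0 <= M)%R). { assert (h := Hx O). simpl in h. assert (h' := Cmod_ge_0 (x O)). lra. }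
(* With this threshold the geometric tail [M q^K / (1 - q)] is at most 1/2. *)
destruct (pow_lt_1_zero q) with (y := ((1 - q) / (2 * (M + 1)))%R) as [K HK]. rewrite Rabs_pos_eq; lra. apply Rdiv_lt_0_compat; lra.
assert (Hqk := HK K (le_n K)). rewrite Rabs_pos_eq in Hqk by (apply pow_le; lra).
assert (HT : forall m, (1 / 2 <= Cmod (cprod (fun k => x (K + k)%nat) m))%R).
{ intro m. assert (S : (rsum (fun k => Cmod (x (K + k)%nat)) m <= 1 / 2)%R).
  { apply Rle_trans with (rsum (fun k => (M * q ^ K) * q ^ k)%R m).
    apply rsum_le. intros k _. eapply Rle_trans. apply Hx. rewrite pow_add. right; ring.
    rewrite rsum_scal. apply Rle_trans with ((M * q ^ K) * / (1 - q))%R.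
    apply Rmult_le_compat_l. apply Rmult_le_pos; auto. apply pow_le; lra. now apply rsum_geom.
    apply Rmult_le_reg_r with (1 - q)%R. lra. rewrite Rmult_assoc, Rinv_l, Rmult_1_r by lra.
    apply Rle_trans with ((M + 1) * q ^ K)%R. apply Rmult_le_compat_r. apply pow_le; lra. lra.
    apply Rle_trans with ((M + 1) * ((1 - q) / (2 * (M + 1))))%R. apply Rmult_le_compat_l; lra. right. field. lra. }
  assert (W := cprod_weierstrass (fun k => x (K + k)%nat) m ltac:(lra)). lra. }
destruct (min_positive (fun n => Cmod (cprod x n)) ltac:(intro n; now apply Cmod_gt_0, cprod_neq_0) (S K)) as [d [Hd HdK]].
exists (d / 2)%R. split. lra. intro n. destruct (le_lt_dec n K) as [h|h].
- specialize (HdK n ltac:(lia)). lra.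
- replace n with (K + (n - K))%nat by lia. rewrite cprod_split, Cmod_mult.
  specialize (HT (n - K)%nat). specialize (HdK K ltac:(lia)). nra.
Qed.

Fixpoint tri (k : nat) : nat := match k with O => O | S k' => (tri k' + S k')%nat end.

Section TripleProduct.
Variable Q : C.
Hypothesis HQ0 : Q <> 0.
Hypothesis HQ1 : (Cmod Q < 1)%R.

(** [(-1)^k Q^(k(k+1)/2)], the theta coefficients for [Q = exp(2 pi i tau)] once the factor [tpre]
    is taken out. *)
Definition ecoef (k : nat) : C := (- (1)) ^ k * Q ^ tri k.

Lemma ecoef_S k : ecoef (S k) = - Q ^ S k * ecoef k.
Proof. unfold ecoef. simpl tri. rewrite Cpow_add_r. rewrite !Cpow_S. ring. Qed.

Lemma Cmod_ecoef_S k : Cmod (ecoef (S k)) = (Cmod Q ^ S k * Cmod (ecoef k))%R.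
Proof. rewrite ecoef_S, Cmod_mult, Cmod_opp, Cmod_pow. reflexivity. Qed.

(** The quadratic exponent beats every geometric growth, so the series with these coefficients
    converge everywhere. *)
Lemma ecoef_bound r : exists M, forall k, (Cmod (ecoef k) * r ^ k <= M)%R.
Proof.
assert (h0 := Cmod_ge_0 Q).
assert (Main : forall s, (1 <= s)%R -> exists M, forall k, (Cmod (ecoef k) * s ^ k <= M)%R).
{ intros s Hs.
  destruct (pow_lt_1_zero (Cmod Q)) with (y := (/ s)%R) as [N HN]. rewrite Rabs_pos_eq; lra. apply Rinv_0_lt_compat; lra.
  assert (He : forall k, (Cmod (ecoef k) <= 1)%R).
  { induction k. unfold ecoef. simpl. rewrite Cmult_1_l, Cmod_1. lra. rewrite Cmod_ecoef_S.
    assert (h1 := Cmod_ge_0 (ecoef k)).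
    assert (h2 : (0 <= Cmod Q ^ S k <= 1)%R). { split. now apply pow_le. rewrite <- (pow1 (S k)). apply pow_incr. lra. }
    nra. }
  (* Up to index [N] the coefficients are at most 1 in modulus; beyond it, passing from [k] to
     [k + 1] multiplies the term by [|Q|^(k+1) s], which is at most 1. *)
  exists (s ^ N)%R. intro k. destruct (le_lt_dec k N) as [hk|hk].
  - apply Rle_trans with (1 * s ^ k)%R. apply Rmult_le_compat_r. apply pow_le; lra. apply He. rewrite Rmult_1_l. now apply Rle_pow.
  - replace k with (N + (k - N))%nat by lia. induction (k - N)%nat as [|j IH].
    + rewrite Nat.add_0_r. apply Rle_trans with (1 * s ^ N)%R. apply Rmult_le_compat_r. apply pow_le; lra. apply He. lra.
    + rewrite Nat.add_succ_r, Cmod_ecoef_S.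
      replace (Cmod Q ^ S (N + j) * Cmod (ecoef (N + j)) * s ^ S (N + j))%R with ((Cmod Q ^ S (N + j) * s) * (Cmod (ecoef (N + j)) * s ^ (N + j)))%R by (simpl; ring).
      specialize (HN (S (N + j)) ltac:(lia)). rewrite Rabs_pos_eq in HN by now apply pow_le.
      assert (A : (Cmod Q ^ S (N + j) * s <= 1)%R).
      { apply Rmult_le_reg_r with (/ s)%R. apply Rinv_0_lt_compat; lra. rewrite Rmult_assoc, Rinv_r by lra. lra. }
      assert (A' : (0 <= Cmod Q ^ S (N + j) * s)%R) by (apply Rmult_le_pos; [now apply pow_le|lra]).
      assert (A'' : (0 <= Cmod (ecoef (N + j)) * s ^ (N + j))%R) by (apply Rmult_le_pos; [apply Cmod_ge_0|apply pow_le; lra]).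
      nra. }
destruct (Main (Rmax 1 (Rabs r)) (Rmax_l _ _)) as [M HM]. exists M. intro k.
eapply Rle_trans. 2: apply (HM k). apply Rmult_le_compat_l. apply Cmod_ge_0.
apply Rle_trans with (Rabs r ^ k)%R. rewrite RPow_abs. apply Rle_abs. apply pow_incr. split. apply Rabs_pos. apply Rmax_r.
Qed.

Definition qp (n : nat) : C := cprod (fun k => Q ^ S k) n.

Lemma Q_pow_neq_1 k : Q ^ S k <> 1.
Proof.
intro E. apply (f_equal Cmod) in E. rewrite Cmod_pow, Cmod_1 in E.
assert (h0 := Cmod_ge_0 Q). assert ((Cmod Q ^ k <= 1)%R). { rewrite <- (pow1 k). apply pow_incr. lra. }
assert (0 <= Cmod Q ^ k)%R by now apply pow_le. simpl in E. nra.
Qed.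

Lemma qp_neq_0 n : qp n <> 0.
Proof. apply cprod_neq_0. intros; apply Q_pow_neq_1. Qed.

Lemma qp_S n : qp (S n) = qp n * (1 - Q ^ S n).
Proof. reflexivity. Qed.

(** The reciprocal of the Pochhammer symbol [(Q;Q)] of length [a - b]. Setting it to 0 for negative
    length makes [iq_S] hold for all [a] and [b], including [a = b], where the factor [1 - Q^0]
    vanishes. *)
Definition iq (a b : nat) : C := if Nat.leb b a then / qp (a - b) else 0.

Lemma iq_S a b : iq a (S b) = iq a b * (1 - Q ^ (a - b)).
Proof.
unfold iq. destruct (Nat.leb_spec b a) as [h|h]; destruct (Nat.leb_spec (S b) a) as [h'|h']; try lia.
- replace (a - b)%nat with (S (a - S b)) by lia. rewrite qp_S. field. split; [|apply qp_neq_0].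
  apply Csub_neq_0. intro E. symmetry in E. now apply Q_pow_neq_1 in E.
- replace (a - b)%nat with O by lia. simpl. ring.
- ring.
Qed.

Lemma iq_0_S a : iq a 0 = iq (S a) 0 * (1 - Q ^ S a).
Proof. rewrite <- (Nat.sub_0_r (S a)) at 2. rewrite <- iq_S. unfold iq. simpl. now rewrite Nat.sub_0_r. Qed.

(* [binc N k] is the Gaussian binomial coefficient [2N+1 choose N-k] at [Q], extended by [0] for [k > N]. *)
Definition binc (N k : nat) : C := qp (2 * N + 1) * iq N k * iq (N + 1 + k) 0.

(** The recursion of the Gaussian binomials with the reciprocals of the Pochhammer symbols of
    lengths [N + 1 - k] and [N + 2 + k] abstracted to [I] and [J]. The alternatives account for
    truncated subtraction: the generic range, a vanishing [I], and [k = N + 1], where two summands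
    die through [1 - Q^0]. *)
Lemma binc_rec_poly N k (I J : C) : (k <= N)%nat \/ I = 0 \/ k = S N ->
  (1 - Q ^ (2 * N + 2)) * (1 - Q ^ (2 * N + 3)) * (I * J) =
  (1 + Q ^ (2 * N + 2)) * (I * (1 - Q ^ (S N - k)) * (J * (1 - Q ^ (N + 2 + k))))
  + Q ^ (S N - k) * (I * (J * (1 - Q ^ (N + 2 + k)) * (1 - Q ^ (N + 1 + k))))
  + Q ^ (N + 2 + k) * (I * (1 - Q ^ (S N - k)) * (1 - Q ^ (N - k)) * J).
Proof.
intros H. destruct H as [h|[E|E]]; [|subst I|subst k].
- replace (S N - k)%nat with (S (N - k)) by lia.
  replace (2 * N + 2)%nat with (S (N - k) + (N + 1 + k))%nat by lia.
  replace (2 * N + 3)%nat with (S (N - k) + S (N + 1 + k))%nat by lia.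
  replace (N + 2 + k)%nat with (S (N + 1 + k)) by lia.
  set (m := (N + 1 + k)%nat). rewrite !Cpow_add_r, !Cpow_S. ring.
- ring.
- replace (S N - S N)%nat with O by lia.
  replace (2 * N + 2)%nat with (N + 1 + S N)%nat by lia. replace (2 * N + 3)%nat with (N + 2 + S N)%nat by lia.
  simpl (Q ^ 0). ring.
Qed.

Lemma qp_binc N : qp (2 * S N + 1) = qp (2 * N + 1) * ((1 - Q ^ (2 * N + 2)) * (1 - Q ^ (2 * N + 3))).
Proof.
replace (2 * S N + 1)%nat with (S (S (2 * N + 1))) by lia. rewrite !qp_S.
replace (S (2 * N + 1)) with (2 * N + 2)%nat by lia. replace (S (2 * N + 2)) with (2 * N + 3)%nat by lia. ring.
Qed.

Lemma iq_shift N k : iq N k = iq (S N) (S k).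
Proof. reflexivity. Qed.

(** This is what comparing coefficients demands when the product grows by [(1 - Q^(N+1) w)(1 -
    Q^(N+1) / w) = 1 + Q^(2N+2) - Q^(N+1) (w + 1/w)]. *)
Lemma binc_rec N k : (binc (S N) (S k) = (1 + Q ^ (2 * N + 2)) * binc N (S k) + Q ^ (N - k) * binc N k + Q ^ (N + 3 + k) * binc N (S (S k))).
Proof.
unfold binc. rewrite qp_binc.
assert (E1 : iq (S N) (S (S k)) = iq (S N) (S k) * (1 - Q ^ (S N - S k))) by apply iq_S.
assert (E2 : iq (S N) (S (S (S k))) = iq (S N) (S (S k)) * (1 - Q ^ (N - S k))).
{ rewrite iq_S. now replace (S N - S (S k))%nat with (N - S k)%nat by lia. }
rewrite !(iq_shift N). rewrite E2, E1.
assert (E3 : iq (N + 1 + S k) 0 = iq (S (N + 1 + S k)) 0 * (1 - Q ^ (N + 2 + S k))).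
{ rewrite iq_0_S. do 3 f_equal. f_equal. lia. }
assert (E4 : iq (N + 1 + k) 0 = iq (N + 1 + S k) 0 * (1 - Q ^ (N + 1 + S k))).
{ rewrite iq_0_S. replace (S (N + 1 + k)) with (N + 1 + S k)%nat by lia. reflexivity. }
replace (S N + 1 + S k)%nat with (S (N + 1 + S k)) by lia.
replace (N + 1 + S (S k))%nat with (S (N + 1 + S k)) by lia.
rewrite E4, E3.
assert (P := binc_rec_poly N (S k) (iq (S N) (S k)) (iq (S (N + 1 + S k)) 0)).
replace (N + 3 + k)%nat with (N + 2 + S k)%nat by lia.
change (N - k)%nat with (S N - S k)%nat.
transitivity (qp (2 * N + 1) * ((1 - Q ^ (2 * N + 2)) * (1 - Q ^ (2 * N + 3)) * (iq (S N) (S k) * iq (S (N + 1 + S k)) 0))). ring.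
rewrite P. ring.
destruct (le_lt_dec (S k) N). now left. right. destruct (Nat.eq_dec (S k) (S N)). now right. left.
unfold iq. destruct (Nat.leb_spec (S k) (S N)). lia. reflexivity.
Qed.

(** At the boundary the neighbour of index [-1] is [binc N 0] again, as [2N+1 choose N+1] equals
    [2N+1 choose N]. This matches [x * cheb x 0 = cheb x 1 - cheb x 0]. *)
Lemma binc_rec_0 N : binc (S N) 0 = (1 + Q ^ (2 * N + 2)) * binc N 0 + Q ^ (S N) * binc N 0 + Q ^ (N + 2) * binc N 1.
Proof.
unfold binc. rewrite qp_binc.
assert (E1 : iq (S N) 1 = iq (S N) 0 * (1 - Q ^ (S N - 0))) by apply iq_S.
assert (E2 : iq (S N) 2 = iq (S N) 1 * (1 - Q ^ (N - 0))).
{ rewrite iq_S. now replace (S N - 1)%nat with (N - 0)%nat by lia. }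
assert (E3 : iq (S N) 0 = iq (N + 2) 0 * (1 - Q ^ (N + 2))).
{ rewrite iq_0_S. replace (S (S N)) with (N + 2)%nat by lia. reflexivity. }
replace (S N + 1 + 0)%nat with (N + 2)%nat by lia.
replace (N + 1 + 0)%nat with (S N) by lia. replace (N + 1 + 1)%nat with (N + 2)%nat by lia.
rewrite !(iq_shift N). rewrite E2, E1.
assert (P := binc_rec_poly N 0 (iq (S N) 0) (iq (N + 2) 0) ltac:(lia)). rewrite !Nat.add_0_r, !Nat.sub_0_r in *.
replace (N + 1)%nat with (S N) in P by lia.
transitivity (qp (2 * N + 1) * ((1 - Q ^ (2 * N + 2)) * (1 - Q ^ (2 * N + 3)) * (iq (S N) 0 * iq (N + 2) 0))). ring.
rewrite P. rewrite E3. ring.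
Qed.

(** At [x = w + 1/w] this is the Dirichlet kernel, the sum of [w^j] for [j] from [-k] to [k]. It is
    the theta pair [w^k - w^(-k-1)] divided by [1 - 1/w]: the zero at [w = 1] is taken out, so that
    the nonvanishing result applies at [w = 1] as well. *)
Fixpoint cheb (x : C) (k : nat) : C :=
  match k with O => 1 | S k' => match k' with O => x + 1 | S k'' => x * cheb x k' - cheb x k'' end end.

Lemma cheb_SS x k : cheb x (S (S k)) = x * cheb x (S k) - cheb x k.
Proof. reflexivity. Qed.

(** Multiplication by [al - be x] acts on the coefficients as a three-term recursion, by the
    recurrence of [cheb]; the bracket at the end collects the two boundary terms of the truncated
    sum. *)
Lemma cheb_mult_sum (d d' : nat -> C) al be x :
  d' O = al * d O - be * (d 1%nat - d O) -> (forall k, d' (S k) = al * d (S k) - be * (d k + d (S (S k)))) ->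
  forall n, (al - be * x) * csum (fun k => d k * cheb x k) (S n) =
    csum (fun k => d' k * cheb x k) (S n) - be * (d n * cheb x (S n) - d (S n) * cheb x n).
Proof.
intros H0 HS n. induction n. simpl. rewrite H0. ring.
change (csum (fun k => d k * cheb x k) (S (S n))) with (csum (fun k => d k * cheb x k) (S n) + d (S n) * cheb x (S n)).
change (csum (fun k => d' k * cheb x k) (S (S n))) with (csum (fun k => d' k * cheb x k) (S n) + d' (S n) * cheb x (S n)).
rewrite Cmult_plus_distr_l, IHn, HS, cheb_SS. ring.
Qed.

Lemma finite_triple_product (w : C) : w <> 0 -> forall N,
  cprod (fun k => Q ^ S k * w) N * cprod (fun k => Q ^ S k * / w) N =
  csum (fun k => ecoef k * binc N k * cheb (w + / w) k) (S N).
Proof.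
intros Hw N. set (x := w + / w).
assert (Hb : forall N k, (N < k)%nat -> binc N k = 0).
{ intros M k h. unfold binc, iq at 1. destruct (Nat.leb_spec k M). lia. ring. }
induction N.
- simpl. unfold binc, iq. simpl. unfold ecoef. simpl. change (qp 0) with (RtoC 1). field. apply qp_neq_0.
- assert (E : forall w', cprod (fun k => Q ^ S k * w') (S N) = cprod (fun k => Q ^ S k * w') N * (1 - Q ^ S N * w')) by reflexivity.
  rewrite !E. clear E.
  (* The sum is lengthened by a term with [binc N (N + 1) = 0], so that both boundary terms of
     [cheb_mult_sum] vanish. *)
  transitivity ((1 + Q ^ (2 * N + 2) - Q ^ S N * x) * csum (fun k => ecoef k * binc N k * cheb x k) (S (S N))).
  + change (csum (fun k => ecoef k * binc N k * cheb x k) (S (S N))) with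
     (csum (fun k => ecoef k * binc N k * cheb x k) (S N) + ecoef (S N) * binc N (S N) * cheb x (S N)).
    rewrite Hb, <- IHN by lia. unfold x. replace (2 * N + 2)%nat with (S N + S N)%nat by lia. rewrite Cpow_add_r. field. auto.
  + assert (CM := cheb_mult_sum (fun k => ecoef k * binc N k) (fun k => ecoef k * binc (S N) k) (1 + Q ^ (2 * N + 2)) (Q ^ S N) x).
    cbv beta in CM. rewrite CM; clear CM.
    rewrite (Hb N (S (S N))), (Hb N (S N)) by lia. ring.
    * rewrite binc_rec_0, ecoef_S. assert (E2 : Q ^ (N + 2) = Q ^ S N * Q ^ 1) by (rewrite <- Cpow_add_r; f_equal; lia).
      rewrite E2, Cpow_1_r. change (ecoef 0) with (1 * RtoC 1). ring.
    * intro k. rewrite binc_rec, !ecoef_S. assert (E2 : Q ^ (N + 3 + k) = Q ^ S N * Q ^ S (S k)) by (rewrite <- Cpow_add_r; f_equal; lia).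
      rewrite E2. destruct (le_lt_dec k N) as [h|h].
      assert (EN : Q ^ S N = Q ^ (N - k) * Q ^ S k) by (rewrite <- Cpow_add_r; f_equal; lia). rewrite EN. ring.
      rewrite !Hb by lia. ring.
Qed.
End TripleProduct.

(** From [|1 - x| <= 1 + |x|] and [(1 + |x|)(1 - |x|) <= 1]. A lower bound for the product of the
    [1 - |x_k|] thus becomes an upper bound for the given product. *)
Lemma cprod_upper (x : nat -> C) n : (forall k, (Cmod (x k) <= 1)%R) ->
  (Cmod (cprod x n) * Cmod (cprod (fun k => RtoC (Cmod (x k))) n) <= 1)%R.
Proof.
intro H. induction n; simpl. rewrite Cmod_1. lra.
rewrite !Cmod_mult. assert (T := Cmod_sub_le 1 (x n)). rewrite Cmod_1 in T.
assert (h := Cmod_ge_0 (x n)). specialize (H n).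
assert (E : Cmod (1 - RtoC (Cmod (x n))) = (1 - Cmod (x n))%R).
{ rewrite <- RtoC_minus, Cmod_R. apply Rabs_pos_eq. lra. }
rewrite E.
assert (h1 := Cmod_ge_0 (cprod x n)). assert (h2 := Cmod_ge_0 (cprod (fun k => RtoC (Cmod (x k))) n)).
assert (h3 := Cmod_ge_0 (1 - x n)).
apply Rle_trans with ((Cmod (cprod x n) * Cmod (cprod (fun k => RtoC (Cmod (x k))) n)) * (Cmod (1 - x n) * (1 - Cmod (x n))))%R.
right; ring. apply Rle_trans with (1 * 1)%R; [|lra]. apply Rmult_le_compat; auto. now apply Rmult_le_pos. apply Rmult_le_pos; lra.
apply Rle_trans with ((1 + Cmod (x n)) * (1 - Cmod (x n)))%R. apply Rmult_le_compat_r; lra. nra.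
Qed.

Lemma cheb_bound x k : (Cmod (cheb x k) <= (1 + Cmod x) ^ k)%R.
Proof.
assert (h := Cmod_ge_0 x).
assert (H : forall k, (Cmod (cheb x k) <= (1 + Cmod x) ^ k)%R /\ (Cmod (cheb x (S k)) <= (1 + Cmod x) ^ (S k))%R).
{ clear k. induction k. split. simpl. rewrite Cmod_1. lra. simpl. eapply Rle_trans. apply Cmod_triangle. rewrite Cmod_1. lra.
  destruct IHk as [H1 H2]. split; auto. rewrite cheb_SS. eapply Rle_trans. apply Cmod_sub_le. rewrite Cmod_mult.
  assert (p : (0 <= (1 + Cmod x) ^ k)%R) by (apply pow_le; lra). simpl in *.
  apply Rle_trans with (Cmod x * ((1 + Cmod x) * (1 + Cmod x) ^ k) + (1 + Cmod x) ^ k)%R.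
  apply Rplus_le_compat; auto. apply Rmult_le_compat_l; auto. nra. }
apply H.
Qed.

Lemma cheb_2 k : cheb 2 k = RtoC (2 * INR k + 1).
Proof.
assert (H : forall k, cheb 2 k = RtoC (2 * INR k + 1) /\ cheb 2 (S k) = RtoC (2 * INR (S k) + 1)).
{ clear k. induction k. split; simpl; rewrite ?RtoC_plus, ?RtoC_mult. ring. ring.
  destruct IHk as [H1 H2]. split; auto. rewrite cheb_SS, H1, H2, !S_INR, <- RtoC_mult, <- RtoC_minus. f_equal. ring. }
apply H.
Qed.

Lemma cheb_pow (w : C) k : w <> 0 -> (1 - / w) * cheb (w + / w) k = w ^ k - (/ w) ^ S k.
Proof.
intro Hw.
assert (H : forall k, (1 - / w) * cheb (w + / w) k = w ^ k - (/ w) ^ S k /\ (1 - / w) * cheb (w + / w) (S k) = w ^ S k - (/ w) ^ S (S k)).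
{ clear k. induction k. split. simpl. ring. simpl. field. auto.
  destruct IHk as [H1 H2]. split; auto. rewrite cheb_SS.
  transitivity ((w + / w) * ((1 - / w) * cheb (w + / w) (S k)) - (1 - / w) * cheb (w + / w) k). ring.
  rewrite H1, H2. rewrite !Cpow_S. field. auto. }
apply H.
Qed.

Lemma INR_le_pow2 k : (INR k <= 2 ^ k)%R.
Proof. induction k. simpl; lra. rewrite S_INR. simpl. assert (1 <= 2 ^ k)%R by (apply pow_R1_Rle; lra). lra. Qed.

(** * Uniform bounds and passage to the infinite series *)

Section Nonvanishing.
Variable Q : C.
Hypothesis HQ0 : Q <> 0.
Hypothesis HQ1 : (Cmod Q < 1)%R.

Let q := Cmod Q.

Lemma qp_bounds : exists b, (0 < b)%R /\ forall n, (b <= Cmod (qp Q n))%R /\ (Cmod (qp Q n) <= / b)%R.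
Proof.
assert (h0 := Cmod_ge_0 Q).
assert (Hq : forall k, (Cmod (Q ^ S k) <= 1 * q ^ k)%R).
{ intro k. rewrite Cmod_pow. fold q. simpl. assert (0 <= q ^ k)%R by now apply pow_le. unfold q in *. nra. }
destruct (cprod_lower_bound (fun k => Q ^ S k) 1 q) as [d1 [Hd1 K1]]. unfold q; lra. exact Hq. intros k; now apply Q_pow_neq_1.
destruct (cprod_lower_bound (fun k => RtoC (Cmod (Q ^ S k))) 1 q) as [d2 [Hd2 K2]]. unfold q; lra.
intro k. rewrite Cmod_R, Rabs_pos_eq by apply Cmod_ge_0. apply Hq.
{ intros k E. apply RtoC_inj in E. rewrite Cmod_pow in E. fold q in E. simpl in E.
  assert ((q ^ k <= 1)%R). { rewrite <- (pow1 k). apply pow_incr. unfold q; lra. }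
  assert (0 <= q ^ k)%R by now apply pow_le. unfold q in *. nra. }
exists (Rmin d1 d2). split. now apply Rmin_pos. intro n. assert (m1 := Rmin_l d1 d2). assert (m2 := Rmin_r d1 d2).
assert (Hm : (0 < Rmin d1 d2)%R) by now apply Rmin_pos.
split. eapply Rle_trans. exact m1. apply K1.
assert (U := cprod_upper (fun k => Q ^ S k) n). cbv beta in U. specialize (K2 n).
assert (hh := Cmod_ge_0 (qp Q n)). unfold qp in *.
set (A := Cmod (cprod (fun k => Q ^ S k) n)) in *. set (B := Cmod (cprod (fun k => RtoC (Cmod (Q ^ S k))) n)) in *.
assert (U' : (A * B <= 1)%R).
{ apply U. intro k. eapply Rle_trans. apply Hq. rewrite Rmult_1_l. rewrite <- (pow1 k). apply pow_incr. unfold q; lra. }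
apply Rmult_le_reg_r with (Rmin d1 d2). auto. rewrite Rinv_l by lra. nra.
Qed.

(** For large [N] the dependence on [k] fades: consecutive values differ by a bounded multiple of
    [Q^(N+2+k) - Q^(N-k)]. The bound is poor for [k] near [N], where the decay of [ecoef] has to
    help. *)
Lemma binc_bounds : exists B, (0 < B)%R /\ (forall N, (Cmod (binc Q N 0) <= B)%R) /\
  forall N k, (k <= N)%nat -> (Cmod (binc Q N k - binc Q N 0) <= 2 * B * INR k * q ^ (N - k))%R.
Proof.
assert (h0 := Cmod_ge_0 Q).
destruct qp_bounds as [b [Hb Kb]].
assert (Hib : (0 < / b)%R) by now apply Rinv_0_lt_compat.
assert (Hiq : forall a c, (Cmod (iq Q a c) <= / b)%R).
{ intros a c. unfold iq. destruct (Nat.leb c a). rewrite Cmod_inv by now apply qp_neq_0. apply Rinv_le_contravar; auto. apply Kb.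
  rewrite Cmod_0. lra. }
set (B := (/ b * / b * / b)%R). assert (HB : (0 < B)%R) by (unfold B; repeat apply Rmult_lt_0_compat; auto).
assert (H3 : forall n a c a' c', (Cmod (qp Q n * iq Q a c * iq Q a' c') <= B)%R).
{ intros. rewrite !Cmod_mult. unfold B. apply Rmult_le_compat; auto; try apply Rmult_le_pos; try apply Cmod_ge_0.
  apply Rmult_le_compat; auto; try apply Cmod_ge_0. apply Kb. }
exists B. split; auto. split. intro N. apply H3.
intros N. induction k; intro hk.
- rewrite Cmod_sub_self. simpl. assert (0 <= q ^ (N - 0))%R by now apply pow_le. lra.
- assert (E : binc Q N (S k) - binc Q N k = qp Q (2 * N + 1) * iq Q N k * iq Q (N + 2 + k) 0 * (Q ^ (N + 2 + k) - Q ^ (N - k))).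
  { unfold binc. rewrite iq_S by auto. replace (N + 1 + S k)%nat with (N + 2 + k)%nat by lia.
    rewrite (iq_0_S Q HQ1 (N + 1 + k)). replace (S (N + 1 + k)) with (N + 2 + k)%nat by lia. ring. }
  specialize (IHk ltac:(lia)).
  replace (binc Q N (S k) - binc Q N 0) with ((binc Q N (S k) - binc Q N k) + (binc Q N k - binc Q N 0)) by ring.
  eapply Rle_trans. apply Cmod_triangle. rewrite E, Cmod_mult.
  assert (D : (Cmod (Q ^ (N + 2 + k) - Q ^ (N - k)) <= 2 * q ^ (N - S k))%R).
  { eapply Rle_trans. apply Cmod_sub_le. rewrite !Cmod_pow. fold q.
    assert (forall m, (N - S k <= m)%nat -> (q ^ m <= q ^ (N - S k))%R).
    { intros m hm. replace m with (N - S k + (m - (N - S k)))%nat by lia. rewrite pow_add.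
      assert (0 <= q ^ (N - S k))%R by now apply pow_le.
      assert (q ^ (m - (N - S k)) <= 1)%R. { rewrite <- (pow1 (m - (N - S k))). apply pow_incr. unfold q; lra. }
      assert (0 <= q ^ (m - (N - S k)))%R by now apply pow_le. nra. }
    assert (k1 := H (N + 2 + k)%nat ltac:(lia)). assert (k2 := H (N - k)%nat ltac:(lia)). lra. }
  assert (D2 : (q ^ (N - k) <= q ^ (N - S k))%R).
  { replace (N - k)%nat with (S (N - S k)) by lia. simpl. assert (0 <= q ^ (N - S k))%R by now apply pow_le. unfold q in *; nra. }
  assert (D1 := H3 (2 * N + 1)%nat N k (N + 2 + k)%nat O).
  rewrite S_INR.
  apply Rle_trans with (B * (2 * q ^ (N - S k)) + 2 * B * INR k * q ^ (N - S k))%R. 2: right; ring.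
  apply Rplus_le_compat. apply Rmult_le_compat; auto; apply Cmod_ge_0.
  eapply Rle_trans. exact IHk. apply Rmult_le_compat_l; auto. apply Rmult_le_pos. lra. apply pos_INR.
Qed.

(** The finite products are bounded below uniformly in [N]. By the triple product they are close to
    [binc N 0] times the partial sums, which would become small if the series had sum 0. *)
Lemma triple_product_neq_0 (w l : C) : w <> 0 -> (forall k, Q ^ S k * w <> 1) -> (forall k, Q ^ S k * / w <> 1) ->
  csums (fun k => ecoef Q k * cheb (w + / w) k) l -> l <> 0.
Proof.
intros Hw H1 H2 Hl ->.
assert (h0 : (0 < q)%R) by now apply Cmod_gt_0.
set (x := w + / w) in *. assert (hx := Cmod_ge_0 x).
assert (Hlow : exists d, (0 < d)%R /\ forall n, (d <= Cmod (csum (fun k => ecoef Q k * binc Q n k * cheb x k)%C (S n)))%R).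
{ assert (Hf : forall v, (forall k, Q ^ S k * v <> 1) -> exists d, (0 < d)%R /\ forall n, (d <= Cmod (cprod (fun k => Q ^ S k * v)%C n))%R).
  { intros v Hv. apply cprod_lower_bound with (M := Cmod v) (q := q); auto. unfold q in *; lra.
    intro k. rewrite Cmod_mult, Cmod_pow. fold q. assert (0 <= q ^ k)%R by (apply pow_le; lra). assert (hv := Cmod_ge_0 v).
    simpl. assert (q * q ^ k <= 1 * q ^ k)%R by (apply Rmult_le_compat_r; auto; unfold q; lra). nra. }
  destruct (Hf w H1) as [d1 [Hd1 K1]]. destruct (Hf (/ w) H2) as [d2 [Hd2 K2]].
  exists (d1 * d2)%R. split. now apply Rmult_lt_0_compat. intro n. unfold x. rewrite <- finite_triple_product by auto.
  rewrite Cmod_mult. apply Rmult_le_compat; auto; lra. }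
destruct Hlow as [d [Hd Kd]].
destruct binc_bounds as [B [HB [KB1 KB2]]].
(* This radius gives terms of size at most [M (q/4)^k]. The power of [q] restores [q^(N-k)] to
   [q^N], and [4^(-k)] absorbs the factor [k] while leaving a summable [2^(-k)]. *)
destruct (ecoef_bound Q HQ1 ((1 + Cmod x) * (4 / q))%R) as [M HM].
assert (HM0 : (0 <= M)%R). { eapply Rle_trans; [|apply (HM O)]. simpl. rewrite Rmult_1_r. apply Cmod_ge_0. }
assert (Hterm : forall k, (Cmod (ecoef Q k * cheb x k) <= M * (q / 4) ^ k)%R).
{ intro k. rewrite Cmod_mult. specialize (HM k). assert (hc := cheb_bound x k).
  apply Rle_trans with (Cmod (ecoef Q k) * (1 + Cmod x) ^ k)%R. apply Rmult_le_compat_l; auto. apply Cmod_ge_0.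
  apply Rle_trans with ((Cmod (ecoef Q k) * ((1 + Cmod x) * (4 / q)) ^ k) * (q / 4) ^ k)%R.
  rewrite Rmult_assoc, <- Rpow_mult_distr. right. f_equal. f_equal. field. lra.
  apply Rmult_le_compat_r; auto. apply pow_le. unfold Rdiv. nra. }
assert (Herr : forall N, (Cmod (csum (fun k => ecoef Q k * binc Q N k * cheb x k)%C (S N) - binc Q N 0 * csum (fun k => ecoef Q k * cheb x k)%C (S N)) <= 4 * B * M * q ^ N)%R).
{ intro N. rewrite <- csum_scal, <- csum_minus. eapply Rle_trans. apply Cmod_csum_le.
  apply Rle_trans with (rsum (fun k => (2 * B * M * q ^ N) * (1 / 2) ^ k)%R (S N)).
  - apply rsum_le. intros k hk.
    replace (ecoef Q k * binc Q N k * cheb x k - binc Q N 0 * (ecoef Q k * cheb x k)) with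
      ((binc Q N k - binc Q N 0) * (ecoef Q k * cheb x k)) by ring.
    rewrite Cmod_mult. specialize (KB2 N k ltac:(lia)). specialize (Hterm k).
    eapply Rle_trans. apply Rmult_le_compat. apply Cmod_ge_0. apply Cmod_ge_0. exact KB2. exact Hterm.
    assert (Eq : (q ^ (N - k) * (q / 4) ^ k = q ^ N * (/ 4) ^ k)%R).
    { unfold Rdiv. rewrite Rpow_mult_distr, <- Rmult_assoc, <- pow_add. f_equal. f_equal. lia. }
    apply Rle_trans with (2 * B * M * INR k * (q ^ (N - k) * (q / 4) ^ k))%R. right; ring. rewrite Eq.
    assert (E4 : ((/ 4) ^ k = (1 / 2) ^ k * (1 / 2) ^ k)%R). { rewrite <- Rpow_mult_distr. f_equal. field. }
    assert (E2 : (INR k * (1 / 2) ^ k <= 1)%R).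
    { apply Rle_trans with (2 ^ k * (1 / 2) ^ k)%R. apply Rmult_le_compat_r. apply pow_le; lra. apply INR_le_pow2.
      rewrite <- Rpow_mult_distr. replace (2 * (1 / 2))%R with 1%R by field. rewrite pow1. lra. }
    rewrite E4. apply Rle_trans with ((2 * B * M * q ^ N * (1 / 2) ^ k) * (INR k * (1 / 2) ^ k))%R. right; ring.
    rewrite <- (Rmult_1_r (2 * B * M * q ^ N * (1 / 2) ^ k)) at 2. apply Rmult_le_compat_l; auto.
    repeat apply Rmult_le_pos; try lra; apply pow_le; lra.
  - rewrite rsum_scal. assert (G := rsum_geom (1 / 2) (S N) ltac:(lra)).
    replace (/ (1 - 1 / 2))%R with 2%R in G by field.
    apply Rle_trans with ((2 * B * M * q ^ N) * 2)%R. apply Rmult_le_compat_l; auto. repeat apply Rmult_le_pos; try lra; apply pow_le; lra. right; ring. }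
(* Each of the two thresholds costs [d/4], so the finite product would be at most [d/2], below its
   lower bound [d]. *)
destruct (Hl (d / (4 * B))%R) as [N1 HN1]. apply Rdiv_lt_0_compat; lra.
destruct (pow_lt_1_zero q) with (y := (d / (16 * B * (M + 1)))%R) as [N2 HN2]. rewrite Rabs_pos_eq; unfold q in *; lra.
apply Rdiv_lt_0_compat; auto. repeat apply Rmult_lt_0_compat; lra.
set (N := (N1 + N2)%nat). specialize (HN1 (S N) ltac:(lia)). specialize (HN2 N ltac:(lia)). specialize (Herr N). specialize (Kd N). specialize (KB1 N).
rewrite Rabs_pos_eq in HN2 by (apply pow_le; lra).
set (P := csum (fun k => ecoef Q k * binc Q N k * cheb x k) (S N)) in *. set (S0 := csum (fun k => ecoef Q k * cheb x k) (S N)) in *.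
replace (S0 - 0) with S0 in HN1 by ring.
assert (T := Cmod_le_sub P (binc Q N 0 * S0)). rewrite Cmod_mult in T.
assert (T1 : (Cmod (binc Q N 0) * Cmod S0 <= B * (d / (4 * B)))%R) by (apply Rmult_le_compat; try apply Cmod_ge_0; auto; lra).
replace (B * (d / (4 * B)))%R with (d / 4)%R in T1 by (field; lra).
assert (T2 : (4 * B * M * q ^ N <= d / 4)%R).
{ apply Rle_trans with (4 * B * (M + 1) * (d / (16 * B * (M + 1))))%R.
  apply Rmult_le_compat. repeat apply Rmult_le_pos; lra. apply pow_le; lra.
  apply Rmult_le_compat_l; lra. lra. right. field. split; lra. }
lra.
Qed.
End Nonvanishing.

(** * The theta function *)
(** The one-sided half of the theta series, a partial theta function, entire in [w]. *)
Definition esum (Q w : C) : C := epsilon (inhabits (RtoC 0)) (fun l => csums (fun k => ecoef Q k * w ^ k) l).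

Lemma esum_spec Q w : (Cmod Q < 1)%R -> csums (fun k => ecoef Q k * w ^ k) (esum Q w).
Proof.
intro HQ. unfold esum. apply epsilon_spec. destruct (ecoef_bound Q HQ (Cmod w + 1)) as [M HM].
destruct (pser_conv (ecoef Q) (Cmod w + 1) M w HM ltac:(lra)) as [l [Hl _]]. now exists l.
Qed.

Lemma esum_derive Q w : (Cmod Q < 1)%R -> exists l, csums (fun k => dcoef (ecoef Q) k * w ^ k) l /\ esum Q ~> l at w.
Proof.
intro HQ. destruct (ecoef_bound Q HQ (Cmod w + 1)) as [M HM].
apply (pser_is_derive (ecoef Q) (esum Q) (Cmod w + 1) M HM). intros z _. now apply esum_spec. lra.
Qed.

(** An index shift, by [ecoef (k + 1) = -Q^(k+1) ecoef k]. The behaviour of [theta1] under the shift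
    by [tau] comes from here. *)
Lemma esum_mult_Q Q w : (Cmod Q < 1)%R -> Q * w * esum Q (Q * w) = 1 - esum Q w.
Proof.
intro HQ. assert (H := csums_shift _ _ (esum_spec Q w HQ)).
assert (H' := csums_scal (- (Q * w)) _ _ (esum_spec Q (Q * w) HQ)).
apply (csums_ext _ (fun k => ecoef Q (S k) * w ^ S k)) in H'.
2: { intro k. rewrite ecoef_S, Cpow_mult_l, !Cpow_S. ring. }
assert (E := csums_unique _ _ _ H H'). cbv beta in E.
assert (E0 : ecoef Q 0 * w ^ 0 = 1) by (unfold ecoef; simpl; ring). rewrite E0 in E.
transitivity (- (- (Q * w) * esum Q (Q * w))). ring. rewrite <- E. ring.
Qed.

Lemma CSeries_csums a l : csums a l -> CSeries a = l.
Proof.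
intro H.
assert (K : forall (p : C -> R), (forall x y, p (x + y) = (p x + p y)%R) -> (forall x, (Rabs (p x) <= Cmod x)%R) -> (forall x y, p (x - y) = (p x - p y)%R) ->
   Series (fun k => p (a k)) = p l).
{ intros p Hp Hb Hm. apply is_series_unique. intros P [eps HP]. destruct (H eps (cond_pos eps)) as [N HN].
  exists N. intros n Hn. apply HP.
  assert (Es : sum_n (fun k => p (a k)) n = p (csum a (S n))).
  { assert (p0 : p 0 = 0%R). { assert (h := Hb 0). rewrite Cmod_0 in h. assert (g := Rabs_pos (p 0)). apply Rabs_eq_0. lra. }
    clear - Hp p0. induction n. rewrite sum_O. simpl. rewrite Hp, p0. ring. rewrite sum_Sn, IHn. unfold plus. simpl. now rewrite !Hp. }
  change (Rabs (sum_n (fun k => p (a k)) n - p l) < eps)%R. rewrite Es. specialize (HN (S n) ltac:(lia)).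
  rewrite <- Hm.
  eapply Rle_lt_trans. apply Hb. exact HN. }
unfold CSeries. rewrite (K Re), (K Im); auto. destruct l; reflexivity.
apply Im_le_Cmod. apply re_le_Cmod.
Qed.


Lemma Cexp_PI : Cexp (RtoC PI * Ci) = - (1).
Proof.
replace (RtoC PI * Ci) with ((0%R, PI) : C) by (unfold Ci, RtoC, Cmult; simpl; f_equal; ring).
unfold Cexp. simpl. rewrite exp_0, cos_PI, sin_PI. unfold RtoC, Copp. simpl. f_equal; ring.
Qed.

Lemma INR_tri k : RtoC (INR (tri k)) = RtoC (INR k) * (RtoC (INR k) + 1) * / 2.
Proof.
induction k. simpl. field. simpl tri. rewrite plus_INR, RtoC_plus, IHk, !S_INR, !RtoC_plus. field.
Qed.

Definition nome (tau : C) : C := Cexp (twopii * tau).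
(** The factor common to all theta terms: [(m + 1/2)^2 = m(m + 1) + 1/4], so what remains of the
    Gaussian is [Q^(m(m+1)/2)]. *)
Definition tpre (tau u : C) : C := Cexp (RtoC PI * Ci * tau * / 4 + RtoC PI * Ci * u + RtoC PI * Ci * / 2).

Lemma RtoC_half : RtoC (/ 2) = / 2.
Proof. apply RtoC_inv. lra. Qed.

Lemma theta_term_pos tau u k : theta_term tau u (Z.of_nat k) = tpre tau u * (ecoef (nome tau) k * Cexp (twopii * u) ^ k).
Proof.
unfold theta_term, tpre, ecoef, nome. rewrite <- Cexp_PI, <- !Cexp_nat, <- !Cexp_plus. f_equal.
rewrite INR_tri, <- INR_IZR_INZ, RtoC_plus, RtoC_half. unfold twopii. field.
Qed.

Lemma theta_term_neg tau u k : theta_term tau u (- Z.of_nat k - 1) = - tpre tau u * (ecoef (nome tau) k * (/ Cexp (twopii * u)) ^ S k).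
Proof.
rewrite <- Cexp_opp. replace (- tpre tau u) with (Cexp (- (RtoC PI * Ci)) * tpre tau u).
2: { rewrite Cexp_opp, Cexp_PI. field. }
unfold theta_term, tpre, ecoef, nome. rewrite <- (Cexp_nat (S k)), <- (Cexp_nat (tri k)).
replace ((- (1)) ^ k) with (Cexp (- (RtoC (INR k) * (RtoC PI * Ci)))).
2: { rewrite Cexp_opp, Cexp_nat, Cexp_PI, <- Cpow_inv. f_equal. field. intro E. apply (f_equal Copp) in E.
     replace (- - (1)) with (RtoC 1) in E by ring. replace (- 0) with (RtoC 0) in E by ring. apply RtoC_inj in E. lra. }
rewrite <- !Cexp_plus. f_equal.
rewrite INR_tri, minus_IZR, opp_IZR, <- INR_IZR_INZ, S_INR, !RtoC_plus, RtoC_minus, RtoC_opp, RtoC_half. unfold twopii. field.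
Qed.

Lemma Re_twopii_mult z : Re (twopii * z) = (- (2 * PI * Im z))%R.
Proof. rewrite twopii_eq. destruct z. unfold Cmult. simpl. ring. Qed.

Lemma Cmod_nome tau : (0 < Im tau)%R -> (Cmod (nome tau) < 1)%R.
Proof.
intro H. unfold nome. rewrite Cmod_Cexp, Re_twopii_mult, <- exp_0. apply exp_increasing.
assert (h := PI_RGT_0). nra.
Qed.

Lemma nome_neq_0 tau : nome tau <> 0.
Proof. apply Cexp_neq_0. Qed.

Section Theta.
Variable tau : C.
Hypothesis Htau : (0 < Im tau)%R.
Let Q := nome tau.
Let HQ1 : (Cmod Q < 1)%R := Cmod_nome tau Htau.

(** The bilateral series folded about [m = -1/2], which pairs [w^k] with [-w^(-k-1)] and leaves two
    entire power series, in [w] and in [1/w]. *)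
Definition jac (w : C) : C := esum Q w - / w * esum Q (/ w).

Lemma theta1_eq u : theta1 tau u = - tpre tau u * jac (Cexp (twopii * u)).
Proof.
set (w := Cexp (twopii * u)). unfold theta1, jac.
rewrite (CSeries_csums _ (tpre tau u * (esum Q w - / w * esum Q (/ w)))). ring.
apply csums_ext with (fun k => tpre tau u * (ecoef Q k * w ^ k - / w * (ecoef Q k * (/ w) ^ k))).
{ intro k. rewrite theta_term_pos, theta_term_neg. fold Q. fold w. rewrite Cpow_S. ring. }
apply csums_scal, csums_minus. now apply esum_spec. apply csums_scal. now apply esum_spec.
Qed.

Lemma theta1_odd u : theta1 tau (- u) = - theta1 tau u.
Proof.
rewrite !theta1_eq. replace (twopii * - u) with (- (twopii * u)) by ring. rewrite Cexp_opp. unfold jac.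
assert (E : tpre tau (- u) = tpre tau u * / Cexp (twopii * u)).
{ unfold tpre. rewrite <- Cexp_opp, <- Cexp_plus. f_equal. unfold twopii. ring. }
rewrite E. assert (h := Cexp_neq_0 (twopii * u)).
set (w := Cexp (twopii * u)) in *. replace (/ / w) with w by (field; auto). field. auto.
Qed.

Lemma theta1_0 : theta1 tau 0 = 0.
Proof.
assert (H := theta1_odd 0). replace (- 0) with (RtoC 0) in H by ring.
transitivity (/ 2 * (theta1 tau 0 - - theta1 tau 0)). field. rewrite <- H. ring.
Qed.

Lemma theta1_add_1 u : theta1 tau (u + 1) = - theta1 tau u.
Proof.
rewrite !theta1_eq.
assert (E : Cexp (twopii * (u + 1)) = Cexp (twopii * u)).
{ rewrite Cmult_plus_distr_l, Cexp_plus. rewrite (Cexp_Z 1). ring. }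
rewrite E.
assert (E' : tpre tau (u + 1) = - tpre tau u).
{ transitivity (tpre tau u * Cexp (RtoC PI * Ci)). unfold tpre. rewrite <- Cexp_plus. f_equal. ring. rewrite Cexp_PI. ring. }
rewrite E'. ring.
Qed.

Lemma theta1_add_tau u : theta1 tau (u + tau) = - Cexp (- (RtoC PI * Ci * tau) - twopii * u) * theta1 tau u.
Proof.
rewrite !theta1_eq.
assert (E : Cexp (twopii * (u + tau)) = Q * Cexp (twopii * u)).
{ rewrite Cmult_plus_distr_l, Cexp_plus. unfold Q, nome. ring. }
rewrite E.
assert (E' : tpre tau (u + tau) = Cexp (- (RtoC PI * Ci * tau) - twopii * u) * tpre tau u * (Q * Cexp (twopii * u))).
{ unfold tpre, Q, nome. rewrite <- !Cexp_plus. f_equal. unfold twopii. ring. }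
rewrite E'. unfold jac. set (w := Cexp (twopii * u)) in *.
assert (hw : w <> 0) by apply Cexp_neq_0. assert (hq : Q <> 0) by apply nome_neq_0.
assert (F1 := esum_mult_Q Q w HQ1). assert (F2 := esum_mult_Q Q (/ (Q * w)) HQ1).
replace (Q * / (Q * w)) with (/ w) in F2 by (field; auto).
replace (esum Q (Q * w)) with ((1 - esum Q w) / (Q * w)) by (rewrite <- F1; field; auto).
replace (esum Q (/ (Q * w))) with (1 - / w * esum Q (/ w)) by (rewrite F2; ring).
field. auto.
Qed.

Lemma holo_jac (w : C) : w <> 0 -> holo jac w.
Proof.
intro Hw. unfold jac.
assert (H : forall z, holo (esum Q) z) by (intro z; destruct (esum_derive Q z HQ1) as [l [_ Hl]]; now exists l).
assert (Hi : holo Cinv w) by (eexists; now apply is_derive_C_inv).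
apply holo_minus; auto. apply holo_mult; auto. now apply (holo_comp (esum Q) Cinv).
Qed.

Lemma holo_tpre u : holo (tpre tau) u.
Proof.
unfold tpre. eapply (holo_comp Cexp). eexists. apply is_derive_Cexp.
apply holo_plus. apply holo_plus. apply holo_const. apply holo_mult. apply holo_const. apply holo_id. apply holo_const.
Qed.

Lemma holo_theta1 u : holo (theta1 tau) u.
Proof.
apply holo_ext_near with (fun u => - tpre tau u * jac (Cexp (twopii * u))).
exists 1%R. split. lra. intros; symmetry; apply theta1_eq.
apply holo_mult. apply holo_opp, holo_tpre. apply (holo_comp jac (fun u => Cexp (twopii * u))). apply holo_jac, Cexp_neq_0. apply holo_Cexp_lin.
Qed.

(** [jac w] is [1 - 1/w] times the series in [cheb]. The case [k = 0] of the hypotheses deals with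
    the first factor, the cases [k >= 1] with the second. *)
Lemma jac_neq_0 (w : C) : w <> 0 -> (forall k, Q ^ k * w <> 1) -> (forall k, Q ^ k * / w <> 1) -> jac w <> 0.
Proof.
intros Hw H1 H2.
assert (h1 : 1 - / w <> 0). { apply Csub_neq_0. intro E. specialize (H2 O). simpl in H2. apply H2. rewrite <- E. ring. }
assert (L : csums (fun k => ecoef Q k * cheb (w + / w) k) (/ (1 - / w) * jac w)).
{ apply csums_ext with (fun k => / (1 - / w) * (ecoef Q k * w ^ k - / w * (ecoef Q k * (/ w) ^ k))).
  - intro k. assert (E := cheb_pow w k Hw).
    transitivity (/ (1 - / w) * (ecoef Q k * ((1 - / w) * cheb (w + / w) k))). rewrite E, Cpow_S. ring.
    field. split; auto. replace (w - 1) with (w * (1 - / w)) by (field; auto). now apply Cmult_neq_0.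
  - apply csums_scal, csums_minus. now apply esum_spec. apply csums_scal. now apply esum_spec. }
intro E. rewrite E in L. apply (triple_product_neq_0 Q (nome_neq_0 tau) HQ1 w _ Hw) in L. apply L. ring.
intro k; apply (H1 (S k)). intro k; apply (H2 (S k)).
Qed.

Lemma theta1_eq_0 u : theta1 tau u = 0 -> in_lattice tau u.
Proof.
intro H. apply NNPP. intro Hn. revert H. rewrite theta1_eq.
assert (hp : - tpre tau u <> 0). { intro E. apply (Cexp_neq_0 (RtoC PI * Ci * tau * / 4 + RtoC PI * Ci * u + RtoC PI * Ci * / 2)). fold (tpre tau u).
  replace (tpre tau u) with (- - tpre tau u) by ring. rewrite E. ring. }
apply Cmult_neq_0; auto.
assert (h2 : twopii <> 0). { rewrite twopii_eq. unfold RtoC. intro E. injection E as E. assert (h := PI_RGT_0). lra. }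
apply jac_neq_0. apply Cexp_neq_0.
- intros k E. unfold Q, nome in E. rewrite <- Cexp_nat, <- Cexp_plus in E. apply Cexp_eq_1 in E. destruct E as [m E]. apply Hn.
  exists m, (- Z.of_nat k)%Z. rewrite opp_IZR, <- INR_IZR_INZ, RtoC_opp.
  transitivity (/ twopii * (RtoC (INR k) * (twopii * tau) + twopii * u) - RtoC (INR k) * tau). field; auto. rewrite E. field; auto.
- intros k E. unfold Q, nome in E. rewrite <- Cexp_opp, <- Cexp_nat, <- Cexp_plus in E. apply Cexp_eq_1 in E. destruct E as [m E]. apply Hn.
  exists (- m)%Z, (Z.of_nat k). rewrite opp_IZR, <- INR_IZR_INZ, RtoC_opp.
  transitivity (- (/ twopii * (RtoC (INR k) * (twopii * tau) + - (twopii * u))) + RtoC (INR k) * tau). field; auto. rewrite E. field; auto.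
Qed.

Lemma theta1_add_Z u (m : Z) : theta1 tau u = 0 -> theta1 tau (u + RtoC (IZR m)) = 0.
Proof.
intro H.
assert (P : forall n : nat, theta1 tau (u + RtoC (INR n)) = 0 /\ theta1 tau (u - RtoC (INR n)) = 0).
{ induction n. simpl. split. now replace (u + 0) with u by ring. now replace (u - 0) with u by ring.
  destruct IHn as [I1 I2]. rewrite S_INR, RtoC_plus. split.
  replace (u + (RtoC (INR n) + 1)) with (u + RtoC (INR n) + 1) by ring. rewrite theta1_add_1, I1. ring.
  assert (E := theta1_add_1 (u - (RtoC (INR n) + 1))). replace (u - (RtoC (INR n) + 1) + 1) with (u - RtoC (INR n)) in E by ring.
  transitivity (- - theta1 tau (u - (RtoC (INR n) + 1))). ring. rewrite <- E, I2. ring. }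
destruct m as [|p|p]. exact (proj1 (P O)).
rewrite <- positive_nat_Z, <- INR_IZR_INZ. exact (proj1 (P (Pos.to_nat p))).
rewrite <- Pos2Z.opp_pos, opp_IZR, RtoC_opp, <- positive_nat_Z, <- INR_IZR_INZ. exact (proj2 (P (Pos.to_nat p))).
Qed.

Lemma theta1_add_Z_tau u (m : Z) : theta1 tau u = 0 -> theta1 tau (u + RtoC (IZR m) * tau) = 0.
Proof.
intro H.
assert (P : forall n : nat, theta1 tau (u + RtoC (INR n) * tau) = 0 /\ theta1 tau (u - RtoC (INR n) * tau) = 0).
{ induction n. simpl. split. now replace (u + 0 * tau) with u by ring. now replace (u - 0 * tau) with u by ring.
  destruct IHn as [I1 I2]. rewrite S_INR, RtoC_plus. split.
  replace (u + (RtoC (INR n) + 1) * tau) with (u + RtoC (INR n) * tau + tau) by ring. rewrite theta1_add_tau, I1. ring.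
  assert (E := theta1_add_tau (u - (RtoC (INR n) + 1) * tau)). replace (u - (RtoC (INR n) + 1) * tau + tau) with (u - RtoC (INR n) * tau) in E by ring.
  rewrite I2 in E. set (x := - (RtoC PI * Ci * tau) - twopii * (u - (RtoC (INR n) + 1) * tau)) in E. assert (h := Cexp_neq_0 x).
  transitivity (- / Cexp x * (- Cexp x * theta1 tau (u - (RtoC (INR n) + 1) * tau))). field; auto. rewrite <- E. ring. }
destruct m as [|p|p]. exact (proj1 (P O)).
rewrite <- positive_nat_Z, <- INR_IZR_INZ. exact (proj1 (P (Pos.to_nat p))).
rewrite <- Pos2Z.opp_pos, opp_IZR, RtoC_opp, <- positive_nat_Z, <- INR_IZR_INZ.
replace (u + - RtoC (INR (Pos.to_nat p)) * tau) with (u - RtoC (INR (Pos.to_nat p)) * tau) by ring. exact (proj2 (P (Pos.to_nat p))).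
Qed.

Lemma theta1_zero_iff u : theta1 tau u = 0 <-> in_lattice tau u.
Proof.
split. apply theta1_eq_0. intros [m [k ->]]. apply theta1_add_Z_tau. replace (RtoC (IZR m)) with (0 + RtoC (IZR m)) by ring.
apply theta1_add_Z. apply theta1_0.
Qed.

(** Up to nonzero factors the derivative is the sum of [(2k + 1) ecoef k]. Since
    [cheb 2 k = 2k + 1], this is the series of [triple_product_neq_0] at [w = 1]. *)
Lemma theta1'_0_neq_0 : theta1' tau 0 <> 0.
Proof.
destruct (esum_derive Q 1 HQ1) as [l [Hl1 Hl2]].
assert (D : theta1 tau ~> (- tpre tau 0 * twopii * (2 * l + esum Q 1)) at 0).
{ eapply is_derive_ext_all; [intro w; symmetry; apply theta1_eq|].
  assert (E0 : Cexp (twopii * 0) = 1) by (rewrite Cmult_0_r; apply Cexp_0).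
  assert (J : jac ~> (l - (- (1) * esum Q 1 + 1 * (- (1) * l))) at (Cexp (twopii * 0))).
  { rewrite E0. unfold jac. apply is_derive_C_minus; auto.
    assert (I1 : Cinv ~> - (1) at 1). { eapply is_derive_eq. apply is_derive_C_inv. intro E; apply RtoC_inj in E; lra. field. }
    assert (E1 : / 1 = 1) by field.
    eapply is_derive_eq. apply is_derive_C_mult. exact I1. apply (is_derive_C_comp (esum Q) Cinv). rewrite E1. exact Hl2. exact I1.
    cbv beta. rewrite !E1. ring. }
  eapply is_derive_eq. apply is_derive_C_mult. apply is_derive_C_opp. apply CDeriv_correct, holo_tpre.
  apply (is_derive_C_comp jac (fun u => Cexp (twopii * u))). exact J. apply is_derive_Cexp_lin.
  cbv beta. rewrite E0. unfold jac. replace (/ 1) with (RtoC 1) by field. ring. }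
unfold theta1'. rewrite (CDeriv_unique _ _ _ D).
assert (L : csums (fun k => ecoef Q k * cheb (1 + / 1) k) (2 * l + esum Q 1)).
{ assert (S1 := esum_spec Q 1 HQ1).
  assert (S2 : csums (fun k => 2 * (RtoC (INR k) * ecoef Q k)) (2 * l)).
  { apply csums_scal. replace l with (RtoC (INR 0) * ecoef Q 0 + l) by (simpl; ring). apply (csums_unshift (fun k => RtoC (INR k) * ecoef Q k)).
    apply csums_ext with (2 := Hl1). intro k. unfold dcoef. rewrite Cpow_1_l. ring. }
  apply csums_ext with (2 := csums_plus _ _ _ _ S2 S1). intro k. rewrite Cpow_1_l.
  replace (1 + / 1) with (RtoC 2). rewrite cheb_2, RtoC_plus, RtoC_mult. ring.
  replace (/ 1) with (RtoC 1) by field. rewrite <- RtoC_plus. f_equal. }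
assert (h1 : RtoC 1 <> 0) by (intro E; apply RtoC_inj in E; lra).
apply Cmult_neq_0; [apply Cmult_neq_0|].
- intro E. apply (Cexp_neq_0 (RtoC PI * Ci * tau * / 4 + RtoC PI * Ci * 0 + RtoC PI * Ci * / 2)). fold (tpre tau 0).
  replace (tpre tau 0) with (- - tpre tau 0) by ring. rewrite E. ring.
- rewrite twopii_eq. unfold RtoC. intro E. injection E as E. assert (h := PI_RGT_0). lra.
- apply (triple_product_neq_0 Q (nome_neq_0 tau) HQ1 1 _ h1) with (3 := L).
  intros k. rewrite Cmult_1_r. now apply Q_pow_neq_1. intros k. replace (/ 1) with (RtoC 1) by field. rewrite Cmult_1_r. now apply Q_pow_neq_1.
Qed.

Lemma theta1_derive u : theta1 tau ~> theta1' tau u at u.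
Proof. apply CDeriv_correct, holo_theta1. Qed.
End Theta.

(** * Liouville's theorem on the torus *)
Definition removable (f : C -> C) (a : C) : Prop := exists k, holo_near k a /\ pnear a (fun u => f u = k u).

(** Replaces [f] at every point by the value of the holomorphic function it agrees with around that
    point; arbitrary values at the poles are repaired everywhere at once. *)
Definition cont_ext (f : C -> C) (u : C) : C :=
  epsilon (inhabits (RtoC 0)) (fun l => exists k, holo_near k u /\ k u = l /\ pnear u (fun w => f w = k w)).

Lemma cont_ext_eq f u k : holo_near k u -> pnear u (fun w => f w = k w) -> cont_ext f u = k u.
Proof.
intros H1 H2.
assert (E : exists l k, holo_near k u /\ k u = l /\ pnear u (fun w => f w = k w)) by (exists (k u), k; auto).
destruct (epsilon_spec (inhabits (RtoC 0)) _ E) as [k' [K1 [K2 K3]]]. fold (cont_ext f u) in K2. rewrite <- K2.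
apply ccont_eq_at; try now apply holo_near_ccont.
apply (pnear_impl _ _ _ (pnear_and _ _ _ K3 H2)). intros w _ [<- ->]. reflexivity.
Qed.

Lemma cont_ext_near f u k : holo_near k u -> pnear u (fun w => f w = k w) -> near u (fun w => cont_ext f w = k w).
Proof.
intros H1 H2. apply pnear_near_at. 2: now apply cont_ext_eq.
apply (pnear_impl _ _ _ (pnear_and _ _ _ (near_pnear _ _ (holo_near_open _ _ H1)) (pnear_open _ _ H2))).
intros w _ [K1 K2]. apply cont_ext_eq; auto. now apply near_pnear.
Qed.

Lemma cont_ext_holo f u : removable f u -> holo (cont_ext f) u.
Proof.
intros [k [H1 H2]]. apply holo_ext_near with k. 2: now apply holo_near_at.
apply (near_impl _ _ _ (cont_ext_near f u k H1 H2)). auto.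
Qed.

Lemma removable_holo_near f u : holo_near f u -> removable f u.
Proof. intro H. exists f. split; auto. exists 1%R. split; auto. lra. Qed.

Lemma cont_ext_at f u : holo_near f u -> cont_ext f u = f u.
Proof. intro H. apply cont_ext_eq; auto. exists 1%R. split; auto. lra. Qed.

Lemma removable_lin f g a k : removable f a -> removable g a -> removable (fun u => f u + k * g u) a.
Proof.
intros [p [H1 H2]] [q [H3 H4]]. exists (fun u => p u + k * q u). split. apply holo_near_plus; auto. now apply holo_near_scal.
apply (pnear_impl _ _ _ (pnear_and _ _ _ H2 H4)). intros w _ [-> ->]. reflexivity.
Qed.
Lemma removable_ext f g a : pnear a (fun u => f u = g u) -> removable f a -> removable g a.
Proof.
intros E [p [H1 H2]]. exists p. split; auto. apply (pnear_impl _ _ _ (pnear_and _ _ _ E H2)). intros w _ [<- ->]. reflexivity.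
Qed.

Lemma Z_period {T : Type} (G : C -> T) (p : C) : (forall u, G (u + p) = G u) -> forall (m : Z) u, G (u + RtoC (IZR m) * p) = G u.
Proof.
intro H.
assert (P : forall (n : nat) u, G (u + RtoC (INR n) * p) = G u).
{ induction n; intro u. simpl. f_equal. ring. rewrite S_INR, RtoC_plus. rewrite <- (IHn u), <- (H (u + RtoC (INR n) * p)). f_equal. ring. }
intros m u. destruct m as [|q|q]. exact (P O u).
rewrite <- positive_nat_Z, <- INR_IZR_INZ. exact (P _ u).
rewrite <- Pos2Z.opp_pos, opp_IZR, RtoC_opp, <- positive_nat_Z, <- INR_IZR_INZ.
rewrite <- (P (Pos.to_nat q) (u + - RtoC (INR (Pos.to_nat q)) * p)). f_equal. ring.
Qed.

Section Lattice.
Variable tau : C.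
Hypothesis Htau : (0 < Im tau)%R.

Lemma in_lattice_0 : in_lattice tau 0.
Proof. exists 0%Z, 0%Z. ring. Qed.
Lemma in_lattice_1 : in_lattice tau 1.
Proof. exists 1%Z, 0%Z. ring. Qed.
Lemma in_lattice_tau : in_lattice tau tau.
Proof. exists 0%Z, 1%Z. ring. Qed.
Lemma in_lattice_plus x y : in_lattice tau x -> in_lattice tau y -> in_lattice tau (x + y).
Proof. intros [m [k ->]] [m' [k' ->]]. exists (m + m')%Z, (k + k')%Z. rewrite !plus_IZR, !RtoC_plus. ring. Qed.
Lemma in_lattice_opp x : in_lattice tau x -> in_lattice tau (- x).
Proof. intros [m [k ->]]. exists (- m)%Z, (- k)%Z. rewrite !opp_IZR, !RtoC_opp. ring. Qed.
Lemma in_lattice_minus x y : in_lattice tau x -> in_lattice tau y -> in_lattice tau (x - y).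
Proof. intros H1 H2. apply in_lattice_plus; auto. now apply in_lattice_opp. Qed.
Lemma in_lattice_opp_iff x : in_lattice tau (- x) <-> in_lattice tau x.
Proof. split. intro H. replace x with (- - x) by ring. now apply in_lattice_opp. apply in_lattice_opp. Qed.

Lemma lattice_sep z : in_lattice tau z -> z <> 0 -> (Rmin 1 (Im tau) <= Cmod z)%R.
Proof.
intros [m [k E]] Hz. assert (m1 := Rmin_l 1 (Im tau)). assert (m2 := Rmin_r 1 (Im tau)).
assert (Habs : forall j : Z, j <> 0%Z -> (1 <= Rabs (IZR j))%R).
{ intros j Hj. rewrite <- abs_IZR. apply IZR_le. lia. }
assert (EI : Im z = (IZR k * Im tau)%R). { rewrite E. destruct tau. simpl. ring. }
destruct (Z.eq_dec k 0) as [->|Hk].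
- assert (ER : z = RtoC (IZR m)) by (rewrite E; ring). rewrite ER, Cmod_R.
  assert (m <> 0%Z). { intros ->. apply Hz. rewrite ER. reflexivity. }
  specialize (Habs m H). lra.
- specialize (Habs k Hk). assert (h := Im_le_Cmod z). rewrite EI, Rabs_mult, (Rabs_pos_eq (Im tau)) in h by lra. nra.
Qed.

Lemma lattice_discrete a u : pnear u (fun w => ~ in_lattice tau (w - a)).
Proof.
set (d := Rmin 1 (Im tau)). assert (Hd : (0 < d)%R) by (apply Rmin_pos; lra).
(* Two points of the translated lattice within [d/2] of [u] would be closer to each other than the
   minimal distance [d], so at most one has to be avoided. *)
destruct (classic (exists w0, w0 <> u /\ (Cmod (w0 - u) < d / 2)%R /\ in_lattice tau (w0 - a))) as [[w0 [H1 [H2 H3]]]|H].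
- exists (Cmod (w0 - u)). split. now apply Cmod_sub_pos. intros w Hw Hl.
  assert (E : w - w0 = 0).
  { apply NNPP. intro N. assert (L := lattice_sep (w - w0)). fold d in L.
    assert (T := Cmod_triangle_sub w u w0). rewrite (Cmod_sub_sym u w0) in T.
    assert (d <= Cmod (w - w0))%R. apply L; auto. replace (w - w0) with ((w - a) - (w0 - a)) by ring. now apply in_lattice_minus. lra. }
  replace w with (w - w0 + w0) in Hw by ring. rewrite E in Hw. replace (0 + w0 - u) with (w0 - u) in Hw by ring. lra.
- exists (d / 2)%R. split. lra. intros w Hw Hl. apply H. exists w. split; [|split]; auto; try lra.
  intros ->. rewrite Cmod_sub_self in Hw. lra.
Qed.

Lemma lattice_coords z : exists a b : R, z = RtoC a + RtoC b * tau.
Proof.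
exists (Re z - Im z / Im tau * Re tau)%R, (Im z / Im tau)%R.
destruct z as [x y], tau as [s r]. simpl in *. unfold RtoC, Cmult, Cplus. simpl. f_equal; field; lra.
Qed.

Lemma frac_coord x : exists m : Z, (0 <= x - IZR m <= 1)%R.
Proof. exists (Int_part x). destruct (base_Int_part x). lra. Qed.

Lemma bounded_on_parallelogram h : (forall u, holo h u) ->
  exists M, forall x y, (0 <= x <= 1)%R -> (0 <= y <= 1)%R -> (Cmod (h (RtoC x + RtoC y * tau)%C) <= M)%R.
Proof.
intros H. assert (ht := Cmod_ge_0 tau).
assert (HD : forall x y : R, exists d : posreal, (Cmod (h (RtoC x + RtoC y * tau)%C) < / d)%R /\ forall x' y', (Rabs (x' - x) < d)%R -> (Rabs (y' - y) < d)%R ->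
   (Cmod (h (RtoC x' + RtoC y' * tau)%C - h (RtoC x + RtoC y * tau)%C) < 1)%R).
{ intros x y. destruct (holo_ccont h (RtoC x + RtoC y * tau) (H _) 1%R ltac:(lra)) as [d [Hd K]].
  set (z := RtoC x + RtoC y * tau) in *.
  assert (h0 := Cmod_ge_0 (h z)).
  set (m := (/ (1 + Cmod (h z)))%R). assert (Hm : (0 < m)%R) by (apply Rinv_0_lt_compat; lra).
  set (e := (d / (1 + Cmod tau))%R). assert (He : (0 < e)%R) by (apply Rdiv_lt_0_compat; lra).
  assert (Hmm : (0 < Rmin e m)%R) by now apply Rmin_pos.
  assert (m1 := Rmin_l e m). assert (m2 := Rmin_r e m).
  exists (mkposreal _ Hmm). simpl. split.
  apply Rlt_le_trans with (/ m)%R. unfold m. rewrite Rinv_inv. lra. apply Rinv_le_contravar; auto.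
  intros x' y' Hx Hy. apply K.
  replace (RtoC x' + RtoC y' * tau - z) with (RtoC (x' - x) + RtoC (y' - y) * tau) by (unfold z; rewrite !RtoC_minus; ring).
  eapply Rle_lt_trans. apply Cmod_triangle. rewrite Cmod_mult, !Cmod_R.
  apply Rlt_le_trans with (e + e * Cmod tau)%R.
  assert (Rabs (y' - y) * Cmod tau <= e * Cmod tau)%R by (apply Rmult_le_compat_r; lra). lra.
  right. unfold e. field. lra. }
set (delta x y := proj1_sig (constructive_indefinite_description _ (HD x y))).
assert (Hdelta := fun x y => proj2_sig (constructive_indefinite_description _ (HD x y))).
destruct (compactness_value_2d 0 1 0 1 delta) as [d Hd].
exists (/ d + 1)%R.
intros x y Hx Hy.
destruct (Rle_dec (Cmod (h (RtoC x + RtoC y * tau)%C)) (/ d + 1)) as [h1|h1]; auto.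
exfalso. apply (Hd x y Hx Hy). intros [s [t [_ [_ [Ht1 [Ht2 Ht3]]]]]]. apply h1.
destruct (Hdelta s t) as [k1 k2]. specialize (k2 x y Ht1 Ht2). fold (delta s t) in k1.
assert (/ delta s t <= / d)%R by (apply Rinv_le_contravar; auto; apply cond_pos).
assert (k3 := Cmod_le_sub (h (RtoC x + RtoC y * tau)) (h (RtoC s + RtoC t * tau))). lra.
Qed.

(** Periodicity of the modulus suffices for boundedness, which admits unimodular multipliers. *)
Lemma entire_elliptic_const h : (forall u, holo h u) -> (forall u, Cmod (h (u + 1)) = Cmod (h u)) ->
  (forall u, Cmod (h (u + tau)) = Cmod (h u)) -> forall u, h u = h 0.
Proof.
intros H H1 H2. destruct (bounded_on_parallelogram h H) as [M HM].
apply (liouville h M H). intro u. destruct (lattice_coords u) as [a [b ->]].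
destruct (frac_coord a) as [m Hm]. destruct (frac_coord b) as [k Hk].
specialize (HM _ _ Hm Hk).
rewrite <- (Z_period (fun u => Cmod (h u)) 1 H1 m) in HM. rewrite <- (Z_period (fun u => Cmod (h u)) tau H2 k) in HM.
replace (RtoC a + RtoC b * tau) with (RtoC (a - IZR m) + RtoC (b - IZR k) * tau + RtoC (IZR m) * 1 + RtoC (IZR k) * tau); auto.
rewrite !RtoC_minus. ring.
Qed.

(** With [mu = a + b tau] for real [a] and [b], the factor [exp(-2 pi i b u)] makes both multipliers
    unimodular, so the product is constant. If the constant is nonzero, both multipliers are 1, and
    then [a] and [b] are integers. *)
Lemma entire_multiplier_zero h mu : (forall u, holo h u) -> (forall u, h (u + 1) = h u) ->
  (forall u, h (u + tau) = Cexp (twopii * mu) * h u) -> ~ in_lattice tau mu -> forall u, h u = 0.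
Proof.
intros H H1 H2 Hmu. destruct (lattice_coords mu) as [a [b Eab]].
assert (ht : twopii <> 0). { rewrite twopii_eq. unfold RtoC. intro E. injection E as E. assert (h0 := PI_RGT_0). lra. }
set (g u := h u * Cexp (- twopii * RtoC b * u)).
assert (G1 : forall u, g (u + 1) = Cexp (- twopii * RtoC b) * g u).
{ intro u. unfold g. rewrite H1, Cmult_plus_distr_l, Cexp_plus, Cmult_1_r. ring. }
assert (G2 : forall u, g (u + tau) = Cexp (twopii * RtoC a) * g u).
{ intro u. unfold g. rewrite H2. replace (twopii * RtoC a) with (twopii * mu - twopii * RtoC b * tau) by (rewrite Eab; ring).
  transitivity ((Cexp (twopii * mu) * Cexp (- twopii * RtoC b * (u + tau))) * h u). ring.
  transitivity ((Cexp (twopii * mu - twopii * RtoC b * tau) * Cexp (- twopii * RtoC b * u)) * h u). 2: ring.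
  rewrite <- !Cexp_plus. do 2 f_equal. ring. }
assert (Hu : forall r : R, Cmod (Cexp (twopii * RtoC r)) = 1%R).
{ intro r. rewrite Cmod_Cexp, Re_twopii_mult. simpl. rewrite Rmult_0_r, Ropp_0. apply exp_0. }
assert (Hc : forall u, g u = g 0).
{ apply entire_elliptic_const.
  - intro u. apply holo_mult; auto. apply holo_Cexp_lin.
  - intro u. rewrite G1, Cmod_mult. replace (- twopii * RtoC b) with (twopii * RtoC (- b)) by (rewrite RtoC_opp; ring). rewrite Hu. ring.
  - intro u. rewrite G2, Cmod_mult, Hu. ring. }
destruct (classic (g 0 = 0)) as [Z|Z].
- intro u. specialize (Hc u). rewrite Z in Hc. unfold g in Hc. assert (e := Cexp_neq_0 (- twopii * RtoC b * u)).
  transitivity (h u * Cexp (- twopii * RtoC b * u) / Cexp (- twopii * RtoC b * u)). field; auto. rewrite Hc. field; auto.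
- exfalso. apply Hmu.
  assert (E1 : Cexp (- twopii * RtoC b) = 1).
  { transitivity (Cexp (- twopii * RtoC b) * g 0 / g 0). field; auto. rewrite <- G1, Hc. field; auto. }
  assert (E2 : Cexp (twopii * RtoC a) = 1).
  { transitivity (Cexp (twopii * RtoC a) * g 0 / g 0). field; auto. rewrite <- G2, Hc. field; auto. }
  apply Cexp_eq_1 in E1, E2. destruct E1 as [k E1], E2 as [m E2]. exists m, (- k)%Z.
  rewrite Eab. rewrite opp_IZR, RtoC_opp.
  replace (RtoC a) with (/ twopii * (twopii * RtoC a)) by (field; auto). rewrite E2.
  replace (RtoC b) with (- / twopii * (- twopii * RtoC b)) by (field; auto). rewrite E1. field; auto.
Qed.

Lemma CDeriv_n_const_0 k c u : CDeriv_n (S k) (fun _ => c) u = 0.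
Proof.
revert u. induction k; intro u. simpl. apply CDeriv_unique, is_derive_C_const.
change (CDeriv (CDeriv_n (S k) (fun _ => c)) u = 0). rewrite (CDeriv_ext_near _ (fun _ => 0)). apply CDeriv_unique, is_derive_C_const.
apply near_true. intro w. apply IHk.
Qed.

Lemma CDeriv_n_CDeriv k h : CDeriv_n k (CDeriv h) = CDeriv (CDeriv_n k h).
Proof. induction k; simpl; congruence. Qed.

Lemma entire_affine h A : (forall u, holo h u) -> (forall u, CDeriv h u = A) -> forall z, h z = h 0 + z * A.
Proof.
intros H HA z. assert (hz := Cmod_ge_0 z).
destruct (taylor h 0 (Cmod z + 2) (Cmod z + 1)) as [c [M [H1 H2]]]. auto. lra.
assert (Hc : forall k, tcoef h 0 k = c k). { intro k. apply pser_at_tcoef. exists (Cmod z + 1)%R, M. split. lra. auto. }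
specialize (H2 z). replace (z - 0) with z in H2 by ring. specialize (H2 ltac:(lra)).
apply csums_unique with (1 := H2). intros eps He. exists 2%nat. intros n Hn.
assert (E : csum (fun k => c k * z ^ k) n = h 0 + z * A).
{ destruct n as [|[|n]]; try lia. clear Hn. induction n.
  - simpl. rewrite <- !Hc, tcoef_0, tcoef_1, HA. ring.
  - change (csum (fun k => c k * z ^ k) (S (S (S n)))) with (csum (fun k => c k * z ^ k) (S (S n)) + c (S (S n)) * z ^ S (S n)).
    rewrite IHn, <- Hc. unfold tcoef. change (CDeriv_n (S (S n)) h) with (CDeriv (CDeriv_n (S n) h)). rewrite <- CDeriv_n_CDeriv.
    assert (EA : CDeriv h = fun _ => A) by (apply functional_extensionality; auto).
    rewrite EA, CDeriv_n_const_0. unfold Cdiv. ring. }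
rewrite E, Cmod_sub_self. auto.
Qed.

Lemma CDeriv_shift_rel f (p e K u : C) : holo f u -> near u (fun w => f (w + p) = e * f w + K) -> CDeriv f (u + p) = e * CDeriv f u.
Proof.
intros Hf H. apply CDeriv_unique.
apply is_derive_ext_near with (fun w => e * f (w - p) + K).
- destruct H as [d [Hd E]]. exists d. split; auto. intros w Hw. rewrite <- E. f_equal; ring.
  now replace (w - p - u) with (w - (u + p)) by ring.
- eapply is_derive_eq. apply is_derive_C_plus. apply is_derive_C_scal. apply is_derive_shift.
  replace (u + p - p) with u by ring. apply CDeriv_correct; auto. apply is_derive_C_const. ring.
Qed.

(** The derivative is elliptic and entire, hence constant, so [h] is affine. Period 1 kills the
    slope, and with it [K]. *)
Lemma entire_additive_zero h K : (forall u, holo h u) -> (forall u, h (u + 1) = h u) -> (forall u, h (u + tau) = h u + K) -> K = 0.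
Proof.
intros H H1 H2.
assert (HD : forall u, holo (CDeriv h) u) by (intro u; apply holo_near_at, CDeriv_holo_near, holo_near_all; auto).
assert (C1 : forall u, CDeriv h (u + 1) = CDeriv h u).
{ intro u. rewrite (CDeriv_shift_rel h 1 1 0); auto. ring. apply near_true. intro w. rewrite H1. ring. }
assert (C2 : forall u, CDeriv h (u + tau) = CDeriv h u).
{ intro u. rewrite (CDeriv_shift_rel h tau 1 K); auto. ring. apply near_true. intro w. rewrite H2. ring. }
assert (HA := entire_affine h (CDeriv h 0) H (entire_elliptic_const (CDeriv h) HD (fun u => f_equal Cmod (C1 u)) (fun u => f_equal Cmod (C2 u)))).
set (A := CDeriv h 0) in *.
assert (A0 : A = 0).
{ assert (E := H1 0). rewrite (HA (0 + 1)) in E. transitivity (h 0 + (0 + 1) * A - h 0). ring. rewrite E. ring. }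
assert (E := H2 0). rewrite (HA (0 + tau)), A0 in E.
transitivity (h 0 + K - h 0). ring. rewrite <- E. ring.
Qed.
End Lattice.

(** * Quasi-periodic functions with poles *)
Lemma sum1n_S n a : sum1n (S n) a = sum1n n a + a (S n).
Proof. apply (sum_n_Sm (G := C_AbelianMonoid)). lia. Qed.
Lemma sum1n_0 a : sum1n 0 a = 0.
Proof. apply (sum_n_m_zero (G := C_AbelianMonoid)). lia. Qed.
Lemma sum1n_ext n a b : (forall j, (1 <= j <= n)%nat -> a j = b j) -> sum1n n a = sum1n n b.
Proof. induction n; intro H. now rewrite !sum1n_0. rewrite !sum1n_S, IHn, H; auto. lia. intros; apply H; lia. Qed.
Lemma sum1n_plus n a b : sum1n n (fun j => a j + b j) = sum1n n a + sum1n n b.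
Proof. induction n. rewrite !sum1n_0. ring. rewrite !sum1n_S, IHn. ring. Qed.
Lemma sum1n_scal n c a : sum1n n (fun j => c * a j) = c * sum1n n a.
Proof. induction n. rewrite !sum1n_0. ring. rewrite !sum1n_S, IHn. ring. Qed.
Lemma sum1n_zero n : sum1n n (fun _ => 0) = 0.
Proof. induction n. apply sum1n_0. rewrite sum1n_S, IHn. ring. Qed.
Lemma sum1n_split n i a : (1 <= i <= n)%nat -> sum1n n a = a i + sum1n n (fun j => if Nat.eqb j i then 0 else a j).
Proof.
induction n; intro Hi. lia. rewrite !sum1n_S. destruct (Nat.eq_dec i (S n)) as [->|Hn].
- rewrite Nat.eqb_refl. rewrite (sum1n_ext n (fun j => if Nat.eqb j (S n) then 0 else a j) a). ring.
  intros j Hj. destruct (Nat.eqb_spec j (S n)). lia. reflexivity.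
- rewrite IHn by lia. destruct (Nat.eqb_spec (S n) i). lia. ring.
Qed.

Lemma holo_near_sum1n n (F : nat -> C -> C) a : (forall j, (1 <= j <= n)%nat -> holo_near (F j) a) -> holo_near (fun u => sum1n n (fun j => F j u)) a.
Proof.
intro H. eapply near_impl. apply (near_forall n (fun j u => holo (F j) u) a H). intros u Hu. apply holo_sum1n, Hu.
Qed.
Lemma holo_csum n (F : nat -> C -> C) z : (forall j, holo (F j) z) -> holo (fun u => csum (fun j => F j u) n) z.
Proof. intro H. induction n; simpl. apply holo_const. now apply holo_plus. Qed.

Lemma pnear_forall n (P : nat -> C -> Prop) a : (forall j, (1 <= j <= n)%nat -> pnear a (P j)) ->
  pnear a (fun u => forall j, (1 <= j <= n)%nat -> P j u).
Proof.
induction n; intro H. exists 1%R. split. lra. intros; lia.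
apply pnear_impl with (fun u => (forall j, (1 <= j <= n)%nat -> P j u) /\ P (S n) u).
apply pnear_and. apply IHn. intros; apply H; lia. apply H; lia.
intros u _ [h1 h2] j Hj. destruct (Nat.eq_dec j (S n)) as [->|]; auto. apply h1. lia.
Qed.

Section Poles.
Variables (tau : C) (n : nat) (t : nat -> C).
Hypothesis Htau : (0 < Im tau)%R.
Local Notation S_ := (pole_set tau n t).

Lemma pole_set_pnear u : pnear u (fun w => ~ S_ w).
Proof.
apply pnear_impl with (fun w => forall j, (1 <= j <= n)%nat -> ~ in_lattice tau (w - t j)).
apply pnear_forall. intros j _. now apply lattice_discrete.
intros w _ H [j [Hj Hl]]. exact (H j Hj Hl).
Qed.
Lemma pole_set_near u : ~ S_ u -> near u (fun w => ~ S_ w).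
Proof. intro H. apply pnear_near_at; auto. apply pole_set_pnear. Qed.
Lemma pole_set_shift u l : in_lattice tau l -> (S_ (u + l) <-> S_ u).
Proof.
intro Hl. split; intros [j [Hj H]]; exists j; split; auto.
replace (u - t j) with (u + l - t j - l) by ring. now apply in_lattice_minus.
replace (u + l - t j) with (u - t j + l) by ring. now apply in_lattice_plus.
Qed.
Lemma not_pole_shift u l : in_lattice tau l -> ~ S_ u -> ~ S_ (u + l).
Proof. intros Hl H H'. apply H. revert H'. now apply pole_set_shift. Qed.
Lemma not_pole_lattice u j : (1 <= j <= n)%nat -> ~ S_ u -> ~ in_lattice tau (u - t j).
Proof. intros Hj H H'. apply H. now exists j. Qed.

(** The affine form covers at once sections with a multiplier ([K = 0]) and functions such as [rho]
    with an additive period ([e = 1]). *)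
Definition quasi_period (e K : C) (f : C -> C) (p : C) : Prop := forall u, ~ S_ u -> f (u + p) = e * f u + K.

Lemma removable_shift f (e K p a : C) : in_lattice tau p -> quasi_period e K f p -> removable f a -> removable f (a + p).
Proof.
intros Hp Hq [k [H1 H2]]. exists (fun w => e * k (w - p) + K). split.
- apply holo_near_plus. apply holo_near_scal, holo_near_shift. now replace (a + p - p) with a by ring. apply holo_near_const.
- assert (G : pnear (a + p) (fun w => f (w - p) = k (w - p) /\ ~ S_ (w - p))).
  { apply (pnear_shift (a + p) p (fun w => f w = k w /\ ~ S_ w)). replace (a + p - p) with a by ring. apply pnear_and; auto. apply pole_set_pnear. }
  apply (pnear_impl _ _ _ G). intros w _ [<- Hw]. specialize (Hq _ Hw). replace (w - p + p) with w in Hq by ring. exact Hq.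
Qed.

Lemma quasi_period_inv f (e K p : C) : in_lattice tau p -> e <> 0 -> quasi_period e K f p -> quasi_period (/ e) (- / e * K) f (- p).
Proof.
intros Hp He H u Hu. assert (H' := H (u + - p) (not_pole_shift _ _ (in_lattice_opp _ _ Hp) Hu)).
replace (u + - p + p) with u in H' by ring. rewrite H'. field. auto.
Qed.

Lemma removable_Z f (e K p a : C) (m : Z) : in_lattice tau p -> e <> 0 -> quasi_period e K f p -> removable f a -> removable f (a + RtoC (IZR m) * p).
Proof.
intros Hp He Hq Ha.
assert (P : forall p e K, in_lattice tau p -> quasi_period e K f p -> forall k : nat, removable f (a + RtoC (INR k) * p)).
{ intros p' e' K' Hp' Hq'. induction k. simpl. now replace (a + 0 * p') with a by ring.
  rewrite S_INR, RtoC_plus. replace (a + (RtoC (INR k) + 1) * p') with (a + RtoC (INR k) * p' + p') by ring. now apply removable_shift with e' K'. }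
destruct m as [|q|q].
- apply (P p e K Hp Hq O).
- rewrite <- positive_nat_Z, <- INR_IZR_INZ. exact (P p e K Hp Hq _).
- rewrite <- Pos2Z.opp_pos, opp_IZR, RtoC_opp, <- positive_nat_Z, <- INR_IZR_INZ.
  replace (a + - RtoC (INR (Pos.to_nat q)) * p) with (a + RtoC (INR (Pos.to_nat q)) * - p) by ring.
  exact (P _ _ _ (in_lattice_opp _ _ Hp) (quasi_period_inv f e K p Hp He Hq) _).
Qed.

Lemma removable_all f (e K : C) : (forall u, ~ S_ u -> holo f u) -> quasi_period 1 0 f 1 -> e <> 0 -> quasi_period e K f tau ->
  (forall j, (1 <= j <= n)%nat -> removable f (t j)) -> forall u, removable f u.
Proof.
intros Hh H1 He H2 Hr u. destruct (classic (S_ u)) as [[j [Hj [m [k E]]]]|Hu].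
- replace u with (t j + RtoC (IZR m) * 1 + RtoC (IZR k) * tau) by (transitivity (t j + (u - t j)); [rewrite E|]; ring).
  apply removable_Z with e K; auto. apply in_lattice_tau. apply removable_Z with (RtoC 1) (RtoC 0); auto. apply in_lattice_1.
  intro X. apply RtoC_inj in X. lra.
- apply removable_holo_near. apply (near_impl _ _ _ (pole_set_near u Hu)). auto.
Qed.

Lemma cont_ext_quasi_period f (e K p : C) : in_lattice tau p -> (forall u, removable f u) -> quasi_period e K f p ->
  forall u, cont_ext f (u + p) = e * cont_ext f u + K.
Proof.
intros Hp Hr Hq u. destruct (Hr u) as [k [H1 H2]]. rewrite (cont_ext_eq f u k H1 H2).
replace (k u) with (k (u + p - p)) by (f_equal; ring).
apply (cont_ext_eq f (u + p) (fun w => e * k (w - p) + K)).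
- apply holo_near_plus. apply holo_near_scal, holo_near_shift. now replace (u + p - p) with u by ring. apply holo_near_const.
- assert (G : pnear (u + p) (fun w => f (w - p) = k (w - p) /\ ~ S_ (w - p))).
  { apply (pnear_shift (u + p) p (fun w => f w = k w /\ ~ S_ w)). replace (u + p - p) with u by ring. apply pnear_and; auto. apply pole_set_pnear. }
  apply (pnear_impl _ _ _ G). intros w _ [<- Hw]. specialize (Hq _ Hw). replace (w - p + p) with w in Hq by ring. exact Hq.
Qed.

Lemma removable_multiplier_zero f mu : (forall u, ~ S_ u -> holo f u) -> quasi_period 1 0 f 1 ->
  quasi_period (Cexp (twopii * mu)) 0 f tau -> ~ in_lattice tau mu ->
  (forall j, (1 <= j <= n)%nat -> removable f (t j)) -> forall u, ~ S_ u -> f u = 0.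
Proof.
intros Hh H1 H2 Hmu Hr u Hu.
assert (R := removable_all f _ _ Hh H1 (Cexp_neq_0 _) H2 Hr).
rewrite <- (cont_ext_at f u). 2: { apply (near_impl _ _ _ (pole_set_near u Hu)). auto. }
apply (entire_multiplier_zero tau Htau (cont_ext f) mu); auto.
- intro w. apply cont_ext_holo, R.
- intro w. rewrite (cont_ext_quasi_period f 1 0 1); auto. ring. apply in_lattice_1.
- intro w. rewrite (cont_ext_quasi_period f _ 0 tau (in_lattice_tau tau) R H2). ring.
Qed.

Lemma removable_additive_zero f K : (forall u, ~ S_ u -> holo f u) -> quasi_period 1 0 f 1 ->
  quasi_period 1 K f tau -> (forall j, (1 <= j <= n)%nat -> removable f (t j)) -> K = 0.
Proof.
intros Hh H1 H2 Hr. assert (h1 : RtoC 1 <> 0) by (intro X; apply RtoC_inj in X; lra).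
assert (R := removable_all f _ _ Hh H1 h1 H2 Hr).
apply (entire_additive_zero tau Htau (cont_ext f)).
- intro w. apply cont_ext_holo, R.
- intro w. rewrite (cont_ext_quasi_period f 1 0 1); auto. ring. apply in_lattice_1.
- intro w. rewrite (cont_ext_quasi_period f _ K tau (in_lattice_tau tau) R H2). ring.
Qed.

(** * Quasi-periods and poles of theta_1, rho and s *)

Lemma theta1_neq_0 u : ~ in_lattice tau u -> theta1 tau u <> 0.
Proof. intros H E. apply H. now apply theta1_zero_iff in E. Qed.

Lemma theta1'_add_1 u : theta1' tau (u + 1) = - theta1' tau u.
Proof.
unfold theta1'. rewrite (CDeriv_shift_rel (theta1 tau) 1 (- (1)) 0). ring. now apply holo_theta1.
apply near_true. intro w. rewrite theta1_add_1 by auto. ring.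
Qed.

Definition theta_mult (u : C) : C := - Cexp (- (RtoC PI * Ci * tau) - twopii * u).

Lemma theta_mult_neq_0 u : theta_mult u <> 0.
Proof.
intro E. apply (Cexp_neq_0 (- (RtoC PI * Ci * tau) - twopii * u)). unfold theta_mult in E.
transitivity (- - Cexp (- (RtoC PI * Ci * tau) - twopii * u)). ring. rewrite E. ring.
Qed.

Lemma theta1_tau u : theta1 tau (u + tau) = theta_mult u * theta1 tau u.
Proof. now apply theta1_add_tau. Qed.

Lemma theta_mult_derive u : theta_mult ~> (- twopii * theta_mult u) at u.
Proof.
unfold theta_mult. eapply is_derive_eq. apply is_derive_C_opp.
apply (is_derive_C_comp Cexp (fun w => - (RtoC PI * Ci * tau) - twopii * w)). apply is_derive_Cexp.
apply is_derive_C_minus. apply is_derive_C_const. apply is_derive_C_scal, is_derive_C_id. cbv beta. ring.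
Qed.

Lemma theta1'_tau u : theta1' tau (u + tau) = theta_mult u * theta1' tau u - twopii * theta_mult u * theta1 tau u.
Proof.
unfold theta1' at 1. apply CDeriv_unique.
apply is_derive_ext_all with (fun w => theta_mult (w - tau) * theta1 tau (w - tau)).
- intro w. rewrite <- theta1_tau. f_equal. ring.
- eapply is_derive_eq. apply is_derive_C_mult.
  + apply is_derive_shift. replace (u + tau - tau) with u by ring. apply theta_mult_derive.
  + apply is_derive_shift. replace (u + tau - tau) with u by ring. now apply theta1_derive.
  + cbv beta. replace (u + tau - tau) with u by ring. ring.
Qed.

Lemma rho_add_1 u : rho tau (u + 1) = rho tau u.
Proof.
unfold rho. rewrite theta1'_add_1, theta1_add_1 by auto. unfold Cdiv.
destruct (classic (theta1 tau u = 0)) as [->|H]. replace (- 0) with (RtoC 0) by ring. rewrite Cinv_0. ring. field. auto.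
Qed.

(** Unlike [rho_add_1] this is confined to points off the lattice: at a lattice point both values of
    [rho] are 0 by [/ 0 = 0]. *)
Lemma rho_add_tau u : ~ in_lattice tau u -> rho tau (u + tau) = rho tau u - twopii.
Proof.
intro H. apply theta1_neq_0 in H. unfold rho. rewrite theta1'_tau, theta1_tau by auto. field. split; auto. apply theta_mult_neq_0.
Qed.

Lemma theta1'_even u : theta1' tau (- u) = theta1' tau u.
Proof.
unfold theta1' at 1. apply CDeriv_unique.
apply is_derive_ext_all with (fun w => - theta1 tau (- w)).
- intro w. rewrite theta1_odd by auto. ring.
- eapply is_derive_eq. apply is_derive_C_opp. apply (is_derive_C_comp (theta1 tau) Copp).
  replace (- - u) with u by ring. now apply theta1_derive.
  apply is_derive_C_opp, is_derive_C_id. ring.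
Qed.

Lemma rho_odd u : rho tau (- u) = - rho tau u.
Proof.
unfold rho. rewrite theta1'_even, theta1_odd by auto. unfold Cdiv.
destruct (classic (theta1 tau u = 0)) as [->|H]. replace (- 0) with (RtoC 0) by ring. rewrite Cinv_0. ring. field. auto.
Qed.

Lemma holo_theta1' u : holo (theta1' tau) u.
Proof. apply holo_near_at, (CDeriv_holo_near (theta1 tau)), holo_near_all. intro; now apply holo_theta1. Qed.

Lemma holo_rho u : ~ in_lattice tau u -> holo (rho tau) u.
Proof. intro H. apply holo_div. apply holo_theta1'. now apply holo_theta1. now apply theta1_neq_0. Qed.

Lemma merom_theta1 u : merom_at (theta1 tau) u.
Proof. apply merom_at_holo_near, holo_near_all. intro; now apply holo_theta1. Qed.
Lemma merom_rho u : merom_at (rho tau) u.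
Proof. apply merom_at_div. apply merom_at_holo_near, holo_near_all. intro; apply holo_theta1'. apply merom_theta1. Qed.

Lemma sfun_add_1 u mu : sfun tau (u + 1) mu = sfun tau u mu.
Proof.
unfold sfun. replace (u + 1 - mu) with (u - mu + 1) by ring. rewrite !theta1_add_1 by auto.
destruct (classic (theta1 tau u = 0)) as [->|H]. unfold Cdiv. replace (- 0 * theta1 tau (- mu)) with (RtoC 0) by ring.
replace (0 * theta1 tau (- mu)) with (RtoC 0) by ring. rewrite Cinv_0. ring.
destruct (classic (theta1 tau (- mu) = 0)) as [->|H']. unfold Cdiv. rewrite !Cmult_0_r, Cinv_0. ring.
field. auto.
Qed.

Lemma sfun_add_tau u mu : ~ in_lattice tau u -> sfun tau (u + tau) mu = Cexp (twopii * mu) * sfun tau u mu.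
Proof.
intro H. apply theta1_neq_0 in H. unfold sfun. replace (u + tau - mu) with (u - mu + tau) by ring. rewrite !theta1_tau by auto.
assert (E : theta_mult (u - mu) = Cexp (twopii * mu) * theta_mult u).
{ unfold theta_mult. transitivity (- (Cexp (twopii * mu) * Cexp (- (RtoC PI * Ci * tau) - twopii * u))). 2: ring.
  rewrite <- Cexp_plus. do 2 f_equal. ring. }
rewrite E. assert (h := theta_mult_neq_0 u).
destruct (classic (theta1 tau (- mu) = 0)) as [->|H']. unfold Cdiv. rewrite !Cmult_0_r, Cinv_0. ring.
field. auto.
Qed.

Lemma holo_sfun u mu : ~ in_lattice tau u -> ~ in_lattice tau mu -> holo (fun u => sfun tau u mu) u.
Proof.
intros H Hm. unfold sfun. apply holo_div. apply holo_mult. apply holo_shift. now apply holo_theta1. apply holo_const.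
apply holo_mult. now apply holo_theta1. apply holo_const. apply Cmult_neq_0; apply theta1_neq_0; auto. now rewrite in_lattice_opp_iff.
Qed.

Lemma merom_sfun u mu : merom_at (fun u => sfun tau u mu) u.
Proof.
unfold sfun. apply merom_at_div. apply merom_at_mult. apply (merom_at_shift (theta1 tau)). apply merom_theta1. apply merom_at_const.
apply merom_at_mult. apply merom_theta1. apply merom_at_const.
Qed.

(* [Th] is theta_1(v)/v, even, so that its derivative at [0] vanishes. *)
Lemma theta1_factor : exists Th, holo_near Th 0 /\ Th 0 = theta1' tau 0 /\ CDeriv Th 0 = 0 /\
  near 0 (fun v => theta1 tau v = v * Th v /\ Th v <> 0).
Proof.
assert (Hn : holo_near (theta1 tau) 0) by (apply holo_near_all; intro; now apply holo_theta1).
destruct (taylor_factor1 _ 0 Hn) as [Th [H1 [H2 H3]]]. exists Th. split; auto. split; auto.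
assert (H3' : near 0 (fun v => theta1 tau v = v * Th v)).
{ apply (near_impl _ _ _ H3). intros v ->. rewrite theta1_0 by auto. ring. }
assert (Hev : near 0 (fun v => Th (- v) = Th v)).
{ assert (H4 : near 0 (fun v => theta1 tau (- v) = - v * Th (- v))).
  { destruct H3' as [d [Hd K]]. exists d. split; auto. intros v Hv. apply K.
    replace (- v - 0) with (- (v - 0)) by ring. now rewrite Cmod_opp. }
  apply pnear_near_at. 2: (f_equal; ring).
  apply (pnear_impl _ _ _ (near_pnear _ _ (near_and _ _ _ H3' H4))). intros v Hv [E1 E2].
  rewrite theta1_odd, E1 in E2 by auto. transitivity (/ (- v) * (- v * Th (- v))). field; auto. rewrite <- E2. field. auto. }
split.
- assert (D := CDeriv_correct Th (RtoC 0) (holo_near_at _ _ H1)).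
  assert (D' : (fun v => Th (- v)) ~> (- CDeriv Th 0) at 0).
  { eapply is_derive_eq. apply (is_derive_C_comp Th Copp). replace (- 0) with (RtoC 0) by ring. exact D. apply is_derive_C_opp, is_derive_C_id. ring. }
  assert (E := is_derive_C_unique _ _ _ _ D (is_derive_near _ _ _ _ Hev D')).
  transitivity (/ 2 * (CDeriv Th 0 - - CDeriv Th 0)). field. rewrite <- E. ring.
- apply near_and; auto. apply near_ccont_neq. now apply holo_near_ccont. rewrite H2. now apply theta1'_0_neq_0.
Qed.

Lemma rho_pole_rep : exists H, pole_rep (rho tau) 0 1 H /\ H 0 = 1.
Proof.
destruct theta1_factor as [Th [H1 [H2 [_ H3]]]]. assert (h0 := theta1'_0_neq_0 tau Htau).
exists (fun v => theta1' tau v / Th v). split. split.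
- apply holo_near_div; auto. apply holo_near_all. intro; apply holo_theta1'. now rewrite H2.
- apply (pnear_impl _ _ _ (near_pnear _ _ H3)). intros v Hv [E1 E2]. unfold rho. rewrite E1. field. auto.
- rewrite H2. field. auto.
Qed.

Lemma sfun_pole_rep mu : ~ in_lattice tau mu -> exists H, pole_rep (fun u => sfun tau u mu) 0 1 H /\ H 0 = 1.
Proof.
intro Hmu. destruct theta1_factor as [Th [H1 [H2 [_ H3]]]]. assert (h0 := theta1'_0_neq_0 tau Htau).
assert (hm : theta1 tau (- mu) <> 0) by (apply theta1_neq_0; now rewrite in_lattice_opp_iff).
exists (fun v => theta1 tau (v - mu) * theta1' tau 0 / (Th v * theta1 tau (- mu))). split. split.
- apply holo_near_div. apply holo_near_mult. apply (holo_near_shift (theta1 tau)). apply holo_near_all. intro; now apply holo_theta1. apply holo_near_const.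
  apply holo_near_mult; auto. apply holo_near_const. rewrite H2. now apply Cmult_neq_0.
- apply (pnear_impl _ _ _ (near_pnear _ _ H3)). intros v Hv [E1 E2]. unfold sfun. rewrite E1. field. auto.
- rewrite H2. replace (0 - mu) with (- mu) by ring. field. auto.
Qed.

Lemma pole_rep_shift f a b N h : pole_rep f (a - b) N h -> pole_rep (fun u => f (u - b)) a N (fun u => h (u - b)).
Proof.
intros [P1 P2]. split. now apply holo_near_shift.
apply (pnear_impl _ _ _ (pnear_shift _ _ _ P2)). intros u _ ->. now replace (u - b - (a - b)) with (u - a) by ring.
Qed.

Lemma in_lattice_near u : ~ in_lattice tau u -> near u (fun w => ~ in_lattice tau w).
Proof.
intro H. apply pnear_near_at; auto. apply pnear_impl with (2 := fun w _ H => H).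
apply (pnear_impl _ _ _ (lattice_discrete tau Htau 0 u)). intros w _ Hw. now replace w with (w - 0) by ring.
Qed.

Lemma holo_CDeriv_n_off f m : (forall u, ~ in_lattice tau u -> holo f u) -> forall u, ~ in_lattice tau u -> holo (CDeriv_n m f) u.
Proof.
intros H u Hu. apply holo_near_at, CDeriv_n_holo_near. apply (near_impl _ _ _ (in_lattice_near u Hu)). auto.
Qed.

(** The additive constant survives only without differentiation. Among the derivatives of [rho],
    only [rho] itself therefore has a nonzero additive period. *)
Lemma CDeriv_n_shift f m (p e K : C) : in_lattice tau p -> (forall u, ~ in_lattice tau u -> holo f u) ->
  (forall u, ~ in_lattice tau u -> f (u + p) = e * f u + K) ->
  forall u, ~ in_lattice tau u -> CDeriv_n m f (u + p) = e * CDeriv_n m f u + (if Nat.eqb m 0 then K else 0).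
Proof.
intros Hp Hf H. induction m; intros u Hu. simpl. auto.
simpl. rewrite (CDeriv_shift_rel _ p e (if Nat.eqb m 0 then K else 0)). ring. now apply holo_CDeriv_n_off.
apply (near_impl _ _ _ (in_lattice_near u Hu)). auto.
Qed.
End Poles.

(** * Residue theorem on the torus *)
Lemma is_residue_csum N (b r : nat -> C) (K : nat -> C -> C) a : (forall m, is_residue (K m) a (r m)) ->
  is_residue (fun u => csum (fun m => b m * K m u) N) a (csum (fun m => b m * r m) N).
Proof.
intro H. induction N; simpl.
- apply is_residue_holo with (fun _ => 0). apply holo_near_const. exists 1%R. split. lra. reflexivity.
- now apply is_residue_lin.
Qed.

Lemma RtoC_1_neq_0 : RtoC 1 <> 0.
Proof. intro X. apply RtoC_inj in X. lra. Qed.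

Section Residues.
Variable tau : C.
Hypothesis Htau : (0 < Im tau)%R.


Lemma lattice_near a u : ~ in_lattice tau (u - a) -> near u (fun w => ~ in_lattice tau (w - a)).
Proof. intro H. apply (near_shift u a (fun w => ~ in_lattice tau w)). now apply in_lattice_near. Qed.

Lemma is_residue_rho_derive a m : is_residue (fun u => CDeriv_n m (rho tau) (u - a)) a (if Nat.eqb m 0 then 1 else 0).
Proof.
destruct m as [|m].
- simpl. destruct (rho_pole_rep tau Htau) as [H [P H0]].
  assert (P' : pole_rep (fun u => rho tau (u - a)) a 1 (fun u => H (u - a))) by (apply pole_rep_shift; now replace (a - a) with (RtoC 0) by ring).
  destruct P' as [P1 P2]. rewrite <- H0. replace (H 0) with (H (a - a)) by (f_equal; ring). apply (is_residue_simple _ a (fun u => H (u - a))); auto.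
  apply (pnear_impl _ _ _ P2). intros u _ ->. simpl. ring.
- simpl. apply is_residue_derive with (fun u => CDeriv_n m (rho tau) (u - a)).
  apply (merom_at_shift (CDeriv_n m (rho tau))). apply merom_at_CDeriv_n, merom_rho; auto.
  apply (pnear_impl _ _ _ (lattice_discrete tau Htau a a)). intros u _ Hu.
  apply is_derive_shift. apply CDeriv_correct. apply (holo_CDeriv_n_off tau Htau (rho tau)); auto. intros; now apply holo_rho.
Qed.

(** Derivatives of [rho(u - a)] realise every polar part. Only the term with [m = 0] has a residue,
    and only it has an additive period, so this period is [-2 pi i] times the residue. *)
Lemma polar_part_rho g a : merom_at g a -> exists P r,
  (forall u, ~ in_lattice tau (u - a) -> holo P u /\ P (u + 1) = P u /\ P (u + tau) = P u - twopii * r) /\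
  removable (fun u => g u - P u) a /\ is_residue g a r.
Proof.
intro Hg. apply merom_at_iff in Hg. destruct Hg as [N [h Hh]].
set (K := fun m u => CDeriv_n m (rho tau) (u - a)).
destruct (rho_pole_rep tau Htau) as [H [P0 H0]].
destruct (pole_span K a) with (2 := Hh) as [b [k [B1 B2]]].
{ intro m. destruct (pole_rep_CDeriv_n (rho tau) 0 H m P0) as [H' [Q1 Q2]]. rewrite H0. apply RtoC_1_neq_0.
  exists (fun u => H' (u - a)). split. apply (pole_rep_shift (CDeriv_n m (rho tau))). now replace (a - a) with (RtoC 0) by ring.
  now replace (a - a) with (RtoC 0) by ring. }
set (P := fun u => csum (fun m => b m * K m u) N).
set (r := csum (fun m => b m * (if Nat.eqb m 0 then 1 else 0)) N).
exists P, r.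
assert (HR : removable (fun u => g u - P u) a) by (exists k; auto).
split; [|split; auto].
- intros u Hu. split; [|split].
  + unfold P. apply (holo_csum N (fun m u => b m * K m u)). intro m. apply holo_mult. apply holo_const.
    apply (holo_shift (CDeriv_n m (rho tau))). apply (holo_CDeriv_n_off tau Htau (rho tau)); auto. intros; now apply holo_rho.
  + unfold P. apply csum_ext. intros m _. unfold K. replace (u + 1 - a) with (u - a + 1) by ring.
    rewrite (CDeriv_n_shift tau Htau (rho tau) m 1 1 0); auto. destruct (Nat.eqb m 0); ring. apply in_lattice_1. intros; now apply holo_rho.
    intros w Hw. rewrite rho_add_1 by auto. ring.
  + unfold P, r. rewrite <- csum_scal, <- csum_minus. apply csum_ext. intros m _. unfold K. replace (u + tau - a) with (u - a + tau) by ring.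
    rewrite (CDeriv_n_shift tau Htau (rho tau) m tau 1 (- twopii)); auto. destruct (Nat.eqb m 0); ring. apply in_lattice_tau. intros; now apply holo_rho.
    intros w Hw. rewrite rho_add_tau by auto. ring.
- destruct HR as [k' [R1 R2]].
  apply is_residue_ext with (fun u => (g u - P u) + 1 * P u). exists 1%R. split. lra. intros; ring.
  replace r with (0 + 1 * r) by ring. apply is_residue_lin. now apply is_residue_holo with k'.
  unfold P, r. apply is_residue_csum. intro m. apply is_residue_rho_derive.
Qed.

(** Subtracting all polar parts leaves removable singularities and a [tau]-period equal to [2 pi i]
    times the sum of the residues, which [entire_additive_zero] forces to be 0. *)
Lemma residue_theorem n t g : (forall i j, (1 <= i <= n)%nat -> (1 <= j <= n)%nat -> i <> j -> ~ in_lattice tau (t i - t j)) ->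
  (forall u, ~ pole_set tau n t u -> holo g u) -> (forall u, ~ pole_set tau n t u -> g (u + 1) = g u /\ g (u + tau) = g u) ->
  (forall j, (1 <= j <= n)%nat -> merom_at g (t j)) -> sum1n n (fun j => Res g (t j)) = 0.
Proof.
intros Hd Hh Hp Hm.
(* The choice runs over all natural numbers; indices outside the range receive a dummy pair. *)
assert (HP : forall j, exists Pr : (C -> C) * C, (1 <= j <= n)%nat ->
  (forall u, ~ in_lattice tau (u - t j) -> holo (fst Pr) u /\ fst Pr (u + 1) = fst Pr u /\ fst Pr (u + tau) = fst Pr u - twopii * snd Pr) /\
  removable (fun u => g u - fst Pr u) (t j) /\ is_residue g (t j) (snd Pr)).
{ intro j. destruct (classic (1 <= j <= n)%nat) as [h|h].
  destruct (polar_part_rho g (t j) (Hm j h)) as [P [r H]]. exists (P, r). auto.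
  exists (fun _ => RtoC 0, RtoC 0). tauto. }
set (Pr j := proj1_sig (constructive_indefinite_description _ (HP j))).
assert (HPr := fun j => proj2_sig (constructive_indefinite_description _ (HP j))).
change (forall j, (1 <= j <= n)%nat ->
  (forall u, ~ in_lattice tau (u - t j) -> holo (fst (Pr j)) u /\ fst (Pr j) (u + 1) = fst (Pr j) u /\ fst (Pr j) (u + tau) = fst (Pr j) u - twopii * snd (Pr j)) /\
  removable (fun u => g u - fst (Pr j) u) (t j) /\ is_residue g (t j) (snd (Pr j))) in HPr.
rewrite (sum1n_ext n _ (fun j => snd (Pr j))). 2: { intros j Hj. apply Res_eq. now apply HPr. }
set (G u := g u - sum1n n (fun j => fst (Pr j) u)).
assert (ht : twopii <> 0). { rewrite twopii_eq. unfold RtoC. intro E. injection E as E. assert (h0 := PI_RGT_0). lra. }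
assert (Z : twopii * sum1n n (fun j => snd (Pr j)) = 0).
{ apply (removable_additive_zero tau n t Htau G).
  - intros u Hu. apply holo_minus; auto. apply holo_sum1n. intros j Hj. apply HPr; auto. now apply (not_pole_lattice tau n t).
  - intros u Hu. unfold G. destruct (Hp u Hu) as [-> _]. rewrite (sum1n_ext n (fun j => fst (Pr j) (u + 1)) (fun j => fst (Pr j) u)). ring.
    intros j Hj. apply HPr; auto. now apply (not_pole_lattice tau n t).
  - intros u Hu. unfold G. destruct (Hp u Hu) as [_ ->]. rewrite (sum1n_ext n (fun j => fst (Pr j) (u + tau)) (fun j => fst (Pr j) u + (- twopii) * snd (Pr j))).
    rewrite sum1n_plus, sum1n_scal. ring.
    intros j Hj. destruct (HPr j Hj) as [H _]. destruct (H u (not_pole_lattice tau n t u j Hj Hu)) as [_ [_ E]]. rewrite E. ring.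
  - intros i Hi. unfold G.
    apply removable_ext with (fun u => (g u - fst (Pr i) u) + (- (1)) * sum1n n (fun j => if Nat.eqb j i then 0 else fst (Pr j) u)).
    exists 1%R. split. lra. intros u _. rewrite (sum1n_split n i (fun j => fst (Pr j) u)) by auto. ring.
    apply removable_lin. now apply HPr. apply removable_holo_near, holo_near_sum1n. intros j Hj.
    destruct (Nat.eqb_spec j i) as [->|Hji]. apply holo_near_const.
    apply near_impl with (fun u => ~ in_lattice tau (u - t j)). apply lattice_near. apply Hd; auto.
    intros u Hu. now apply HPr. }
transitivity (/ twopii * (twopii * sum1n n (fun j => snd (Pr j)))). field; auto. rewrite Z. ring.
Qed.

(** With [s = x + y + z], the quotient [theta(u+x) theta(u+y) theta(u+z) / (theta(u)^2 theta(u+s))]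
    is elliptic because the shifts balance. Its double pole at 0 has as residue a logarithmic
    derivative, the left-hand side; its simple pole at [-s] gives the product on the right. *)
Lemma rho_identity x y z : ~ in_lattice tau x -> ~ in_lattice tau y -> ~ in_lattice tau z -> ~ in_lattice tau (x + y + z) ->
  rho tau x + rho tau y + rho tau z - rho tau (x + y + z) =
  theta1' tau 0 * theta1 tau (x + y) * theta1 tau (y + z) * theta1 tau (z + x) /
   (theta1 tau x * theta1 tau y * theta1 tau z * theta1 tau (x + y + z)).
Proof.
intros Hx Hy Hz Hs. set (s := x + y + z) in *.
assert (hx := theta1_neq_0 tau Htau x Hx). assert (hy := theta1_neq_0 tau Htau y Hy). assert (hz := theta1_neq_0 tau Htau z Hz).
assert (hs := theta1_neq_0 tau Htau s Hs). assert (h0 := theta1'_0_neq_0 tau Htau).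
set (g u := theta1 tau (u + x) * theta1 tau (u + y) * theta1 tau (u + z) / (theta1 tau u * theta1 tau u * theta1 tau (u + s))).
set (t := fun j : nat => if Nat.eqb j 1 then RtoC 0 else - s).
assert (Ht : forall a u, theta1 tau ~> theta1' tau (u + a) at (u + a)) by (intros; now apply theta1_derive).
assert (Hta : forall a u, (fun w => theta1 tau (w + a)) ~> theta1' tau (u + a) at u) by (intros; now apply (is_derive_shift_plus (theta1 tau))).
assert (Hth : forall a u, holo (fun w => theta1 tau (w + a)) u) by (intros a u; eexists; apply Hta).
assert (Hp0 : forall u, ~ pole_set tau 2 t u -> theta1 tau u <> 0 /\ theta1 tau (u + s) <> 0).
{ intros u Hu. split; apply theta1_neq_0; auto.
  - assert (H := not_pole_lattice tau 2 t u 1 ltac:(lia) Hu). unfold t in H. simpl in H. now replace (u - 0) with u in H by ring.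
  - assert (H := not_pole_lattice tau 2 t u 2 ltac:(lia) Hu). unfold t in H. simpl in H. now replace (u - - s) with (u + s) in H by ring. }
destruct (theta1_factor tau Htau) as [Th [T1 [T2 [T3 T4]]]].
assert (R1 : is_residue g 0 (theta1 tau x * theta1 tau y * theta1 tau z / (theta1' tau 0 * theta1' tau 0 * theta1 tau s) * (rho tau x + rho tau y + rho tau z - rho tau s))).
{ set (h := fun v => theta1 tau (v + x) * theta1 tau (v + y) * theta1 tau (v + z) / (Th v * Th v * theta1 tau (v + s))).
  assert (D : h ~> (theta1 tau x * theta1 tau y * theta1 tau z / (theta1' tau 0 * theta1' tau 0 * theta1 tau s) * (rho tau x + rho tau y + rho tau z - rho tau s)) at 0).
  { assert (DT := CDeriv_correct Th (RtoC 0) (holo_near_at _ _ T1)). rewrite T3 in DT.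
    unfold h. eapply is_derive_eq. apply is_derive_C_div.
    apply is_derive_C_mult. apply is_derive_C_mult. apply Hta. apply Hta. apply Hta.
    apply is_derive_C_mult. apply is_derive_C_mult. exact DT. exact DT. apply Hta.
    cbv beta. rewrite T2. replace (0 + s) with s by ring. repeat apply Cmult_neq_0; auto.
    cbv beta. rewrite T2. rewrite !Cplus_0_l. unfold rho. field. repeat split; auto. }
  rewrite <- (CDeriv_unique _ _ _ D). apply is_residue_double.
  - unfold h. apply holo_near_div. (apply holo_near_mult; [apply holo_near_mult|]); apply holo_near_all; auto.
    apply holo_near_mult. apply holo_near_mult; auto. apply holo_near_all; auto.
    rewrite T2, Cplus_0_l. repeat apply Cmult_neq_0; auto.
  - assert (Hsn : near 0 (fun v => theta1 tau (v + s) <> 0)).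
    { apply near_ccont_neq. apply holo_ccont, Hth. now rewrite Cplus_0_l. }
    apply (pnear_impl _ _ _ (near_pnear _ _ (near_and _ _ _ T4 Hsn))). intros v Hv [[E1 E2] E3]. unfold h, g. rewrite E1. simpl. field. auto. }
assert (Hs2 : - s + s = 0) by ring.
assert (hms : theta1 tau (- s) <> 0). { apply theta1_neq_0; auto. now rewrite in_lattice_opp_iff. }
assert (R2 : is_residue g (- s) (- (theta1 tau (x + y) * theta1 tau (y + z) * theta1 tau (z + x)) / (theta1 tau s * theta1 tau s * theta1' tau 0))).
{ set (h := fun v => theta1 tau (v + x) * theta1 tau (v + y) * theta1 tau (v + z) / (theta1 tau v * theta1 tau v * Th (v - - s))).
  replace (- (theta1 tau (x + y) * theta1 tau (y + z) * theta1 tau (z + x)) / (theta1 tau s * theta1 tau s * theta1' tau 0)) with (h (- s)).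
  2: { unfold h. replace (- s - - s) with (RtoC 0) by ring. rewrite T2.
       replace (- s + x) with (- (y + z)) by (unfold s; ring). replace (- s + y) with (- (z + x)) by (unfold s; ring). replace (- s + z) with (- (x + y)) by (unfold s; ring).
       rewrite !theta1_odd by auto. field. auto. }
  assert (TS : near (- s) (fun v => theta1 tau (v - - s) = (v - - s) * Th (v - - s) /\ Th (v - - s) <> 0)).
  { apply (near_shift (- s) (- s) (fun v => theta1 tau v = v * Th v /\ Th v <> 0)). now replace (- s - - s) with (RtoC 0) by ring. }
  apply is_residue_simple.
  - unfold h. apply holo_near_div. (apply holo_near_mult; [apply holo_near_mult|]); apply holo_near_all; auto.
    apply holo_near_mult. (apply holo_near_mult; apply holo_near_all; intro; now apply holo_theta1).
    apply holo_near_shift. now replace (- s - - s) with (RtoC 0) by ring.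
    replace (- s - - s) with (RtoC 0) by ring. rewrite T2. repeat apply Cmult_neq_0; auto.
  - assert (Hsn : near (- s) (fun v => theta1 tau v <> 0)).
    { apply near_ccont_neq; auto. apply holo_ccont. now apply holo_theta1. }
    apply (pnear_impl _ _ _ (near_pnear _ _ (near_and _ _ _ TS Hsn))). intros v Hv [[E1 E2] E3]. unfold h, g.
    replace (v + s) with (v - - s) by ring. rewrite E1. field. repeat split; auto. now apply Csub_neq_0. }
assert (RT := residue_theorem 2 t g).
rewrite !sum1n_S, sum1n_0 in RT. change (t 1%nat) with (RtoC 0) in RT. change (t 2%nat) with (- s) in RT.
rewrite (Res_eq _ _ _ R1), (Res_eq _ _ _ R2) in RT.
set (A := rho tau x + rho tau y + rho tau z - rho tau s) in *.
assert (E : 0 + theta1 tau x * theta1 tau y * theta1 tau z / (theta1' tau 0 * theta1' tau 0 * theta1 tau s) * A +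
     - (theta1 tau (x + y) * theta1 tau (y + z) * theta1 tau (z + x)) / (theta1 tau s * theta1 tau s * theta1' tau 0) = 0).
{ apply RT; clear RT.
  - assert (L : ~ in_lattice tau (0 - - s)) by (now replace (0 - - s) with s by ring).
    assert (L' : ~ in_lattice tau (- s - 0)) by (replace (- s - 0) with (- s) by ring; now rewrite in_lattice_opp_iff).
    intros i j Hi Hj Hij. assert (hi : (i = 1 \/ i = 2)%nat) by lia. assert (hj : (j = 1 \/ j = 2)%nat) by lia.
    destruct hi as [-> | ->], hj as [-> | ->]; try congruence; auto.
  - intros u Hu. destruct (Hp0 u Hu). unfold g. apply holo_div. (apply holo_mult; [apply holo_mult|]); auto.
    (apply holo_mult; [apply holo_mult|]); auto; now apply holo_theta1. repeat apply Cmult_neq_0; auto.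
  - intros u Hu. destruct (Hp0 u Hu). unfold g. split.
    + replace (u + 1 + x) with (u + x + 1) by ring. replace (u + 1 + y) with (u + y + 1) by ring. replace (u + 1 + z) with (u + z + 1) by ring.
      replace (u + 1 + s) with (u + s + 1) by ring. rewrite !theta1_add_1 by auto. field. auto.
    + replace (u + tau + x) with (u + x + tau) by ring. replace (u + tau + y) with (u + y + tau) by ring. replace (u + tau + z) with (u + z + tau) by ring.
      replace (u + tau + s) with (u + s + tau) by ring. rewrite !theta1_tau by auto.
      assert (M : forall a, theta_mult tau (u + a) = Cexp (- twopii * a) * theta_mult tau u).
      { intro a. unfold theta_mult. transitivity (- (Cexp (- twopii * a) * Cexp (- (RtoC PI * Ci * tau) - twopii * u))). rewrite <- Cexp_plus. do 2 f_equal. ring. ring. }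
      rewrite !M. replace (- twopii * s) with (- twopii * x + - twopii * y + - twopii * z) by (unfold s; ring). rewrite !Cexp_plus.
      field. repeat split; auto; try apply Cexp_neq_0. apply theta_mult_neq_0.
  - intros j Hj. unfold g. apply merom_at_div. (apply merom_at_mult; [apply merom_at_mult|]); apply merom_at_holo_near, holo_near_all; auto.
    (apply merom_at_mult; [apply merom_at_mult|]); apply merom_at_holo_near, holo_near_all; auto; intro; now apply holo_theta1. }
transitivity (theta1' tau 0 * theta1' tau 0 * theta1 tau s / (theta1 tau x * theta1 tau y * theta1 tau z) *
 (0 + theta1 tau x * theta1 tau y * theta1 tau z / (theta1' tau 0 * theta1' tau 0 * theta1 tau s) * A +
     - (theta1 tau (x + y) * theta1 tau (y + z) * theta1 tau (z + x)) / (theta1 tau s * theta1 tau s * theta1' tau 0))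
  + theta1' tau 0 * theta1 tau (x + y) * theta1 tau (y + z) * theta1 tau (z + x) / (theta1 tau x * theta1 tau y * theta1 tau z * theta1 tau s)).
field. repeat split; auto. rewrite E. ring.
Qed.
End Residues.

(** * Local solutions at a regular singular point *)
Lemma pser_at_eq c h g a : pser_at c h a -> pser_at c g a -> near a (fun u => h u = g u).
Proof.
intros [r [M [Hr [_ H]]]] [r' [M' [Hr' [_ H']]]]. exists (Rmin r r'). split. now apply Rmin_pos.
intros u Hu. assert (m1 := Rmin_l r r'). assert (m2 := Rmin_r r r').
apply csums_unique with (fun k => c k * (u - a) ^ k). apply H; lra. apply H'; lra.
Qed.

Lemma holo_near_primitive f a : holo_near f a -> exists g, near a (fun u => g ~> f u at u).
Proof.
intro Hf. destruct (holo_near_pser f a Hf) as [c Hc].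
set (d := fun k => match k with O => RtoC 0 | S k' => c k' / RtoC (INR (S k')) end).
assert (Hk : forall k, RtoC (INR (S k)) <> 0) by (intros k E; apply RtoC_inj in E; now apply not_0_INR in E).
assert (Hb : exists r M, (0 < r)%R /\ forall k, (Cmod (d k) * r ^ k <= M)%R).
{ destruct Hc as [r [M [Hr [H1 _]]]]. exists r, (r * M)%R. split; auto.
  assert (HM : (0 <= M)%R). { eapply Rle_trans; [|apply (H1 O)]. simpl. assert (h0 := Cmod_ge_0 (c O)). lra. }
  intros [|k]. unfold d. rewrite Cmod_0. apply Rle_trans with 0%R. lra. apply Rmult_le_pos; lra.
  unfold d. rewrite Cmod_div, Cmod_R, Rabs_pos_eq by (auto; apply pos_INR).
  assert (h1 : (1 <= INR (S k))%R). { rewrite S_INR. assert (h2 := pos_INR k). lra. }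
  simpl pow. rewrite <- Rmult_assoc, (Rmult_comm _ r), Rmult_assoc. apply Rmult_le_compat_l. lra.
  eapply Rle_trans; [|apply (H1 k)]. apply Rmult_le_compat_r. apply pow_le; lra.
  unfold Rdiv. rewrite <- (Rmult_1_r (Cmod (c k))) at 2. apply Rmult_le_compat_l. apply Cmod_ge_0. rewrite <- Rinv_1. apply Rinv_le_contravar; lra. }
destruct Hb as [r [M [Hr HM]]]. destruct (pser_at_exists d a r M Hr HM) as [g Hg]. exists g.
destruct (pser_at_derive _ _ _ Hg) as [G1 G2].
assert (E : near a (fun u => f u = CDeriv g u)).
{ apply (pser_at_eq (dcoef d)); auto.
  assert (Ed : dcoef d = c). { apply functional_extensionality. intro k. unfold dcoef, d. field. auto. }
  now rewrite Ed. }
apply (near_impl _ _ _ (near_and _ _ _ G1 E)). intros u [K1 ->]. now apply CDeriv_correct.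
Qed.

(** There are no small denominators: [|k + c| >= k - |c|] handles large [k], and the remaining
    finitely many values are nonzero. *)
Lemma shift_nonint_bound (c : C) : (forall k : nat, RtoC (INR k) + c <> 0) -> exists B, (0 < B)%R /\ forall k : nat, (Cmod (/ (RtoC (INR k) + c)) <= B)%R.
Proof.
intro H. destruct (INR_unbounded (Cmod c + 1)) as [K HK].
destruct (min_positive (fun k => Cmod (RtoC (INR k) + c)) (fun k => proj1 (Cmod_gt_0 _) (H k)) K) as [d [Hd Kd]].
assert (Hm : (0 < Rmin d 1)%R) by (apply Rmin_pos; lra). assert (m1 := Rmin_l d 1). assert (m2 := Rmin_r d 1).
exists (/ Rmin d 1)%R. split. now apply Rinv_0_lt_compat. intro k. rewrite Cmod_inv by auto. apply Rinv_le_contravar; auto.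
destruct (le_lt_dec K k) as [h|h].
- assert (T := Cmod_le_sub (RtoC (INR k)) (- c)). rewrite Cmod_opp, Cmod_R, Rabs_pos_eq in T by apply pos_INR.
  replace (RtoC (INR k) - - c) with (RtoC (INR k) + c) in T by ring. apply le_INR in h. lra.
- specialize (Kd k h). lra.
Qed.

(* The regular singular equation v y' + c y = beta is solved coefficientwise by y_k = beta_k / (k + c). *)
Lemma euler_equation (c : C) b a : (forall k : nat, RtoC (INR k) + c <> 0) -> holo_near b a ->
  exists y, holo_near y a /\ near a (fun u => (u - a) * CDeriv y u + c * y u = b u).
Proof.
intros Hc Hb. destruct (holo_near_pser b a Hb) as [be Hbe]. destruct (shift_nonint_bound c Hc) as [B [HB KB]].
set (d := fun k => be k * / (RtoC (INR k) + c)).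
assert (Hd : exists r M, (0 < r)%R /\ forall k, (Cmod (d k) * r ^ k <= M)%R).
{ destruct Hbe as [r [M [Hr [H1 _]]]]. exists r, (B * M)%R. split; auto. intro k. unfold d. rewrite Cmod_mult.
  apply Rle_trans with (Cmod (/ (RtoC (INR k) + c)) * (Cmod (be k) * r ^ k))%R. right; ring.
  apply Rmult_le_compat; auto. apply Cmod_ge_0. apply Rmult_le_pos. apply Cmod_ge_0. apply pow_le; lra. }
destruct Hd as [r [M [Hr HM]]]. destruct (pser_at_exists d a r M Hr HM) as [y Hy]. exists y.
split. now apply pser_at_holo in Hy.
apply (pser_at_eq be); auto.
assert (P := pser_at_lin _ _ _ _ _ c (pser_at_mul_X _ _ _ (proj2 (pser_at_derive _ _ _ Hy))) Hy).
match type of P with pser_at ?e _ _ => assert (E : e = be) end.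
{ apply functional_extensionality. intros [|k]. unfold d. simpl INR. field. specialize (Hc O). simpl in Hc. rewrite Cplus_0_l in Hc. exact Hc.
  unfold dcoef, d. field. apply (Hc (S k)). }
rewrite <- E. exact P.
Qed.

(** The regular part [al] of [omega] is removed by the integrating factor [E = exp A] with
    [A' = al]. For [y = h E] there remains the Euler equation with right-hand side [X E]. *)
Lemma local_exist (om ch W X : C -> C) a : holo_near W a -> pnear a (fun u => W u = (u - a) * om u) ->
  holo_near X a -> pnear a (fun u => X u = (u - a) * ch u) -> (forall k : nat, RtoC (INR k) + W a <> 0) ->
  exists h, holo_near h a /\ pnear a (fun u => h ~> (ch u - h u * om u) at u).
Proof.
intros HW EW HX EX Hc. destruct (taylor_factor1 W a HW) as [al [A1 [_ A2]]].
destruct (holo_near_primitive al a A1) as [A HA].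
set (E := fun u => Cexp (A u)).
assert (HE : near a (fun u => E ~> (al u * E u) at u)).
{ apply (near_impl _ _ _ HA). intros u Hu. unfold E. apply (is_derive_C_comp Cexp A); auto. apply is_derive_Cexp. }
assert (HEh : holo_near E a) by (apply (near_impl _ _ _ HE); intros u Hu; now apply is_derive_holo in Hu).
assert (HE0 : forall u, E u <> 0) by (intro; apply Cexp_neq_0).
destruct (euler_equation (W a) (fun u => X u * E u) a Hc) as [y [Y1 Y2]]. now apply holo_near_mult.
exists (fun u => y u / E u). split. now apply holo_near_div.
apply (pnear_impl _ _ _ (pnear_and _ _ _ (near_pnear _ _ (near_and _ _ _ A2 (near_and _ _ _ HE (near_and _ _ _ Y1 Y2)))) (pnear_and _ _ _ EW EX))).
intros u Hu [[E1 [E2 [E3 E4]]] [E5 E6]]. apply Csub_neq_0 in Hu.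
eapply is_derive_eq. apply is_derive_C_div. apply CDeriv_correct, E3. exact E2. auto.
assert (Ey : CDeriv y u = (X u * E u - W a * y u) / (u - a)). { rewrite <- E4. field. auto. }
assert (Ea : al u = (W u - W a) / (u - a)). { rewrite E1. field. auto. }
rewrite Ey, Ea, E5, E6. field. auto.
Qed.

(** Makes the [epsilon] in [int_form] harmless: every meromorphic solution is regular at [a], and
    its value is forced by the equation multiplied by [u - a], evaluated at [a]. *)
Lemma local_leading (om ch W X : C -> C) a h : holo_near W a -> pnear a (fun u => W u = (u - a) * om u) ->
  holo_near X a -> pnear a (fun u => X u = (u - a) * ch u) -> (forall k : nat, W a <> RtoC (INR k)) ->
  merom_at h a -> pnear a (fun u => h ~> (ch u - h u * om u) at u) ->
  exists k, holo_near k a /\ pnear a (fun u => h u = k u) /\ k a = X a / W a.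
Proof.
intros HW EW HX EX Hc Hm Hh. apply merom_at_iff in Hm. destruct Hm as [N [H [P1 P2]]].
assert (Hreg : forall k, holo_near k a -> pnear a (fun u => h u = k u) -> k a = X a / W a).
{ intros k K1 K2. assert (K3 := CDeriv_holo_near k a K1).
  assert (E : (fun u => (u - a) * CDeriv k u + W u * k u) a = X a).
  { apply (ccont_eq_at (fun u => (u - a) * CDeriv k u + W u * k u) X a). apply holo_near_ccont, holo_near_plus. apply holo_near_mult; auto. apply holo_near_sub_const. now apply holo_near_mult.
    now apply holo_near_ccont.
    apply (pnear_impl _ _ _ (pnear_and _ _ _ (pnear_and _ _ _ EW EX) (pnear_and _ _ _ Hh (pnear_open _ _ K2)))).
    intros u Hu [[E1 E2] [E3 E4]]. rewrite (CDeriv_unique k u (ch u - h u * om u)). 2: now apply is_derive_near with h.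
    rewrite <- (near_self _ _ E4), E1, E2. ring. }
  cbv beta in E. assert (W a <> 0) by exact (Hc O). rewrite <- E. field. auto. }
destruct (holo_near_order H a P1) as [Z|[k [g [G1 [G2 G3]]]]].
- exists (fun _ => 0). assert (K : pnear a (fun u => h u = 0)).
  { apply (pnear_impl _ _ _ (pnear_and _ _ _ P2 (near_pnear _ _ Z))). intros u Hu [E1 E2]. apply Csub_neq_0 in Hu. rewrite E2 in E1.
    transitivity (/ (u - a) ^ N * ((u - a) ^ N * h u)). field. now apply Cpow_nz. rewrite <- E1. ring. }
  split. apply holo_near_const. split; auto. apply (Hreg (fun _ => 0)); auto. apply holo_near_const.
- destruct (le_lt_dec N k) as [h1|h1].
  + exists (fun u => (u - a) ^ (k - N) * g u).
    assert (Q1 : holo_near (fun u => (u - a) ^ (k - N) * g u) a) by (apply holo_near_mult; auto; apply holo_near_pow, holo_near_sub_const).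
    assert (Q2 : pnear a (fun u => h u = (u - a) ^ (k - N) * g u)).
    { apply (pnear_impl _ _ _ (pnear_and _ _ _ P2 (near_pnear _ _ G3))). intros u Hu [E1 E2]. apply Csub_neq_0 in Hu. rewrite E2 in E1.
      replace ((u - a) ^ k) with ((u - a) ^ N * (u - a) ^ (k - N)) in E1 by (rewrite <- Cpow_add_r; f_equal; lia).
      assert (n0 := Cpow_nz (u - a) N Hu).
      transitivity (((u - a) ^ N * h u) / (u - a) ^ N). field; auto. rewrite <- E1. field; auto. }
    split; [auto|split; [auto|]]. apply (Hreg _ Q1 Q2).
  (* For a pole of exact order [M + 1] with leading coefficient [g a], the top order of the equation
     reads [g a (W a - (M + 1)) = 0], so [W a] would be a natural number. *)
  + exfalso. destruct (N - k)%nat as [|M] eqn:EM. lia.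
    assert (PR : pole_rep h a (S M) g).
    { split; auto. apply (pnear_impl _ _ _ (pnear_and _ _ _ P2 (near_pnear _ _ G3))). intros u Hu [E1 E2]. apply Csub_neq_0 in Hu. rewrite E2 in E1.
      replace ((u - a) ^ N) with ((u - a) ^ k * (u - a) ^ S M) in E1 by (rewrite <- Cpow_add_r; f_equal; lia).
      assert (n0 := Cpow_nz (u - a) k Hu).
      transitivity (((u - a) ^ k * g u) / (u - a) ^ k). field; auto. rewrite E1. field; auto. }
    destruct (pole_rep_derive _ _ _ _ _ PR Hh) as [D1 D2].
    assert (E : (fun u => (u - a) * CDeriv g u - RtoC (INR (S M)) * g u) a = (fun u => (u - a) ^ S M * X u - g u * W u) a).
    { apply (ccont_eq_at (fun u => (u - a) * CDeriv g u - RtoC (INR (S M)) * g u) (fun u => (u - a) ^ S M * X u - g u * W u) a); try apply holo_near_ccont; auto.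
      apply holo_near_minus; apply holo_near_mult; auto. apply holo_near_pow, holo_near_sub_const.
      apply (pnear_impl _ _ _ (pnear_and _ _ _ D2 (pnear_and _ _ _ (proj2 PR) (pnear_and _ _ _ EW EX)))).
      intros u Hu [E1 [E2 [E3 E4]]]. rewrite E1, E3, E4, E2. rewrite !Cpow_S. ring. }
    cbv beta in E. rewrite Cpow_S in E. replace (a - a) with (RtoC 0) in E by ring.
    apply (Hc (S M)).
    assert (E' : g a * (W a - RtoC (INR (S M))) = 0).
    { transitivity ((0 * CDeriv g a - RtoC (INR (S M)) * g a) - (0 * 0 ^ M * X a - g a * W a)). ring. rewrite E. ring. }
    transitivity (g a * (W a - RtoC (INR (S M))) / g a + RtoC (INR (S M))). field; auto. rewrite E'. field. auto.
Qed.

(** [r] and [d] are the Laurent coefficients of orders [-N] and [1 - N]. For [N = 2] they are the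
    double pole and the residue, so the pair [0, 0] means a removable singularity. *)
Definition lau (N : nat) (f : C -> C) (a r d : C) : Prop := exists h, pole_rep f a N h /\ h a = r /\ CDeriv h a = d.

Lemma lau_lin N f g a r d r' d' k : lau N f a r d -> lau N g a r' d' -> lau N (fun u => f u + k * g u) a (r + k * r') (d + k * d').
Proof.
intros [h [[P1 P2] [<- <-]]] [l [[Q1 Q2] [<- <-]]]. exists (fun u => h u + k * l u). split; [split|split].
- apply holo_near_plus; auto. now apply holo_near_scal.
- apply (pnear_impl _ _ _ (pnear_and _ _ _ P2 Q2)). intros u _ [-> ->]. ring.
- reflexivity.
- apply CDeriv_unique. apply is_derive_C_plus. apply CDeriv_correct. now apply holo_near_at. apply is_derive_C_scal, CDeriv_correct. now apply holo_near_at.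
Qed.

Lemma lau_ext N f g a r d : pnear a (fun u => f u = g u) -> lau N f a r d -> lau N g a r d.
Proof.
intros E [h [[P1 P2] K]]. exists h. split; auto. split; auto. apply (pnear_impl _ _ _ (pnear_and _ _ _ E P2)). intros u _ [<- ->]. reflexivity.
Qed.

Lemma lau_eq N f a r d r' d' : lau N f a r d -> r = r' -> d = d' -> lau N f a r' d'.
Proof. now intros H <- <-. Qed.

Lemma lau_mult f g a r d r' d' : lau 1 f a r d -> lau 1 g a r' d' -> lau 2 (fun u => f u * g u) a (r * r') (d * r' + r * d').
Proof.
intros [h [[P1 P2] [<- <-]]] [l [[Q1 Q2] [<- <-]]]. exists (fun u => h u * l u). split; [split|split].
- now apply holo_near_mult.
- apply (pnear_impl _ _ _ (pnear_and _ _ _ P2 Q2)). intros u _ [-> ->]. simpl. ring.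
- reflexivity.
- apply CDeriv_unique. apply is_derive_C_mult; apply CDeriv_correct; now apply holo_near_at.
Qed.

Lemma lau_derive f g a r d : lau 1 f a r d -> pnear a (fun u => f ~> g u at u) -> lau 2 g a (- r) 0.
Proof.
intros [h [P [<- <-]]] H. eexists. split. exact (pole_rep_derive _ _ _ _ _ P H). split. simpl. ring.
destruct P as [P1 _]. assert (P3 := CDeriv_holo_near h a P1). apply CDeriv_unique.
eapply is_derive_eq. apply is_derive_C_minus. apply is_derive_C_mult. apply is_derive_C_minus. apply is_derive_C_id. apply (is_derive_C_const a).
apply CDeriv_correct. now apply holo_near_at. apply is_derive_C_scal, CDeriv_correct. now apply holo_near_at. cbv beta. simpl. ring.
Qed.

Lemma lau_regular f a : holo_near f a -> lau 1 f a 0 (f a).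
Proof.
intros H. exists (fun u => (u - a) * f u). split; [split|split].
- apply holo_near_mult; auto. apply holo_near_sub_const.
- exists 1%R. split. lra. intros u _. simpl. ring.
- ring.
- apply CDeriv_unique. eapply is_derive_eq. apply is_derive_C_mult. apply is_derive_C_minus. apply is_derive_C_id. apply (is_derive_C_const a).
  apply CDeriv_correct. now apply holo_near_at. cbv beta. ring.
Qed.

Lemma lau_raise f a r d : lau 1 f a r d -> lau 2 f a 0 r.
Proof.
intros [h [P [<- _]]]. eexists. split. exact (pole_rep_raise _ _ _ _ 1 P). split. simpl. ring.
apply CDeriv_unique. apply is_derive_ext_all with (fun u => (u - a) * h u). intro u. rewrite Cpow_1_r. reflexivity.
eapply is_derive_eq. apply is_derive_C_mult. apply is_derive_C_minus. apply is_derive_C_id. apply (is_derive_C_const a).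
apply CDeriv_correct. apply holo_near_at, P. cbv beta. ring.
Qed.

Lemma lau_removable f a : lau 2 f a 0 0 -> removable f a.
Proof.
intros [h [[P1 P2] [E1 E2]]]. destruct (taylor_factor h a 2 P1) as [g [G1 [_ G2]]]. exists g. split; auto.
apply (pnear_impl _ _ _ (pnear_and _ _ _ P2 (near_pnear _ _ G2))). intros u Hu [E3 E4]. apply Csub_neq_0 in Hu.
simpl csum in E4. rewrite tcoef_0, tcoef_1, E1, E2 in E4. rewrite E3 in E4.
assert (n0 := Cpow_nz (u - a) 2 Hu).
transitivity (((u - a) ^ 2 * f u) / (u - a) ^ 2). field; auto. rewrite E4. field; auto.
Qed.

(** * Twisted cohomology *)
Lemma lau_shift N f a b r d : lau N f (a - b) r d -> lau N (fun u => f (u - b)) a r d.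
Proof.
intros [h [P [<- <-]]]. exists (fun u => h (u - b)). split. now apply pole_rep_shift. split. reflexivity.
apply CDeriv_unique. apply is_derive_shift, CDeriv_correct. apply holo_near_at, P.
Qed.

Lemma removable_simple f h a : holo_near h a -> pnear a (fun u => h u = (u - a) * f u) -> h a = 0 -> removable f a.
Proof.
intros H1 H2 H3. destruct (taylor_factor1 h a H1) as [g [G1 [_ G2]]]. exists g. split; auto.
apply (pnear_impl _ _ _ (pnear_and _ _ _ H2 (near_pnear _ _ G2))). intros u Hu [E1 E2]. apply Csub_neq_0 in Hu.
rewrite H3, E1 in E2. transitivity (((u - a) * f u) / (u - a)). field; auto. rewrite E2. field; auto.
Qed.

Section Twisted.
Variables (tau : C) (n : nat) (t : nat -> C).
Hypothesis Htau : (0 < Im tau)%R.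
Hypothesis Hdist : forall i j, (1 <= i <= n)%nat -> (1 <= j <= n)%nat -> i <> j -> ~ in_lattice tau (t i - t j).
Local Notation S_ := (pole_set tau n t).

(** With [theta_1(v) = v Th(v)] one has [rho(v) = 1/v + Th'(v)/Th(v)], and the constant term
    vanishes because [Th] is even. *)
Lemma lau_rho : lau 1 (rho tau) 0 1 0.
Proof.
destruct (theta1_factor tau Htau) as [Th [T1 [T2 [T3 T4]]]]. assert (h0 := theta1'_0_neq_0 tau Htau).
assert (T5 := CDeriv_holo_near Th 0 T1).
assert (Hq : holo_near (fun v => CDeriv Th v / Th v) 0) by (apply holo_near_div; auto; now rewrite T2).
exists (fun v => 1 + v * (CDeriv Th v / Th v)). split; [split|split].
- apply holo_near_plus. apply holo_near_const. apply holo_near_mult; auto. apply holo_near_all. intro; apply holo_id.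
- apply (pnear_impl _ _ _ (near_pnear _ _ (near_and _ _ _ (near_open _ _ T4) T1))). intros v Hv [E1 E2].
  assert (E3 : theta1' tau v = Th v + v * CDeriv Th v).
  { unfold theta1'. apply CDeriv_unique. apply is_derive_near with (fun v => v * Th v). apply (near_impl _ _ _ E1). intros w [-> _]; reflexivity.
    eapply is_derive_eq. apply is_derive_C_mult. apply is_derive_C_id. apply CDeriv_correct, E2. cbv beta. ring. }
  destruct (near_self _ _ E1) as [E4 E5]. unfold rho. rewrite E3, E4. simpl. field. auto.
- ring.
- apply CDeriv_unique. eapply is_derive_eq. apply is_derive_C_plus. apply is_derive_C_const. apply is_derive_C_mult. apply is_derive_C_id.
  apply CDeriv_correct. now apply holo_near_at. cbv beta. rewrite T3. unfold Cdiv. ring.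
Qed.

(** Only [theta_1(u - mu)] contributes to the constant term, by its logarithmic derivative
    [rho(-mu)], since [Th] is stationary at 0. *)
Lemma lau_sfun mu : ~ in_lattice tau mu -> lau 1 (fun u => sfun tau u mu) 0 1 (- rho tau mu).
Proof.
intro Hmu. destruct (theta1_factor tau Htau) as [Th [T1 [T2 [T3 T4]]]]. assert (h0 := theta1'_0_neq_0 tau Htau).
assert (hm : theta1 tau (- mu) <> 0) by (apply theta1_neq_0; auto; now rewrite in_lattice_opp_iff).
exists (fun v => theta1 tau (v - mu) * theta1' tau 0 / (Th v * theta1 tau (- mu))). split; [split|split].
- apply holo_near_div. apply holo_near_mult. apply (holo_near_shift (theta1 tau)). apply holo_near_all. intro; now apply holo_theta1. apply holo_near_const.
  apply holo_near_mult; auto. apply holo_near_const. rewrite T2. now apply Cmult_neq_0.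
- apply (pnear_impl _ _ _ (near_pnear _ _ T4)). intros v Hv [E1 E2]. unfold sfun. rewrite E1. simpl. field. auto.
- rewrite T2. replace (0 - mu) with (- mu) by ring. field. auto.
- apply CDeriv_unique. rewrite <- rho_odd by auto.
  assert (DT := CDeriv_correct Th (RtoC 0) (holo_near_at _ _ T1)). rewrite T3 in DT.
  eapply is_derive_eq. apply is_derive_C_div. apply is_derive_C_mult. apply is_derive_shift. apply (theta1_derive tau Htau). apply is_derive_C_const.
  apply is_derive_C_mult. exact DT. apply is_derive_C_const. cbv beta. rewrite T2. now apply Cmult_neq_0.
  cbv beta. rewrite T2. replace (0 - mu) with (- mu) by ring. unfold rho. field. auto.
Qed.

Lemma sfun_at_pole j mu : ~ in_lattice tau mu -> lau 1 (fun u => sfun tau (u - t j) mu) (t j) 1 (- rho tau mu).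
Proof.
intro H. apply (lau_shift 1 (fun u => sfun tau u mu)). replace (t j - t j) with (RtoC 0) by ring. now apply lau_sfun.
Qed.

Lemma sfun_holo_off a mu u : ~ in_lattice tau mu -> ~ in_lattice tau (u - a) -> holo_near (fun u => sfun tau (u - a) mu) u.
Proof.
intros Hmu Hu. apply near_impl with (fun w => ~ in_lattice tau (w - a)). now apply lattice_near.
intros w Hw. apply (holo_shift (fun w => sfun tau w mu)). now apply holo_sfun.
Qed.

Lemma merom_sfun_shift a mu u : merom_at (fun u => sfun tau (u - a) mu) u.
Proof. apply (merom_at_shift (fun u => sfun tau u mu)). now apply merom_sfun. Qed.

Section Connection.
Variables (c0 : C) (c : nat -> C).
Hypothesis Hsum : sum1n n c = 0.
Local Notation om := (omega tau n t c0 c).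

(** The constant Laurent term of [omega] at [t_j]; [rho(u - t_j)] contributes none. *)
Definition omega_reg (j : nat) : C := twopii * c0 + sum1n n (fun i => if Nat.eqb i j then 0 else c i * rho tau (t j - t i)).

Lemma omega_lau j : (1 <= j <= n)%nat -> lau 1 om (t j) (c j) (omega_reg j).
Proof.
intro Hj.
set (reg u := twopii * c0 + sum1n n (fun i => if Nat.eqb i j then 0 else c i * rho tau (u - t i))).
assert (Hreg : holo_near reg (t j)).
{ apply holo_near_plus. apply holo_near_const. apply (holo_near_sum1n n (fun i u => if Nat.eqb i j then 0 else c i * rho tau (u - t i))).
  intros i Hi. destruct (Nat.eqb_spec i j) as [->|Hij]. apply holo_near_const.
  apply near_impl with (fun u => ~ in_lattice tau (u - t i)). apply lattice_near; auto.
  intros u Hu. apply holo_mult. apply holo_const. apply (holo_shift (rho tau)). now apply holo_rho. }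
apply lau_ext with (fun u => reg u + c j * rho tau (u - t j)).
{ exists 1%R. split. lra. intros u _. unfold reg, omega. rewrite (sum1n_split n j (fun i => c i * rho tau (u - t i))) by auto. ring. }
eapply lau_eq. apply lau_lin. apply lau_regular. exact Hreg. apply (lau_shift 1 (rho tau)). replace (t j - t j) with (RtoC 0) by ring. apply lau_rho.
ring. unfold reg, omega_reg. ring.
Qed.

Lemma omega_holo u : ~ S_ u -> holo om u.
Proof.
intro Hu. unfold omega. apply holo_plus. apply holo_const. apply (holo_sum1n n (fun j u => c j * rho tau (u - t j))). intros j Hj.
apply holo_mult. apply holo_const. apply (holo_shift (rho tau)). apply holo_rho; auto. now apply (not_pole_lattice tau n t).
Qed.

Lemma omega_add_1 u : om (u + 1) = om u.
Proof.
unfold omega. f_equal. apply sum1n_ext. intros j _. replace (u + 1 - t j) with (u - t j + 1) by ring. now rewrite rho_add_1.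
Qed.

Lemma omega_add_tau u : ~ S_ u -> om (u + tau) = om u.
Proof.
intro Hu. unfold omega. f_equal. rewrite (sum1n_ext n _ (fun j => c j * rho tau (u - t j) + (- twopii) * c j)).
rewrite sum1n_plus, sum1n_scal, Hsum. ring.
intros j Hj. replace (u + tau - t j) with (u - t j + tau) by ring. rewrite rho_add_tau; auto. ring. now apply (not_pole_lattice tau n t).
Qed.


Hypothesis Hnonint : forall j, (1 <= j <= n)%nat -> ~ exists k : Z, c j = RtoC (IZR k).
Variable mu : C.
Hypothesis Hmu : ~ in_lattice tau mu.

Lemma nonint_neq_nat j k : (1 <= j <= n)%nat -> c j <> RtoC (INR k).
Proof. intros Hj E. apply (Hnonint j Hj). exists (Z.of_nat k). now rewrite E, <- INR_IZR_INZ. Qed.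
Lemma nonint_plus_nat j k : (1 <= j <= n)%nat -> RtoC (INR k) + c j <> 0.
Proof.
intros Hj E. apply (Hnonint j Hj). exists (- Z.of_nat k)%Z. rewrite opp_IZR, <- INR_IZR_INZ, RtoC_opp.
transitivity (RtoC (INR k) + c j - RtoC (INR k)). ring. rewrite E. ring.
Qed.

(** Applied to the [m]-th derivative of [s(u - t_j)], the operator [d + omega] produces a pole of
    exact order [m + 2]: to leading order it multiplies by [c_j - (m + 1)], which is nonzero. *)
Lemma reduce_pole_order (phi : C -> C) j : (1 <= j <= n)%nat -> merom_at phi (t j) ->
  exists P : C -> C, (forall u, ~ in_lattice tau (u - t j) -> holo P u /\ P (u + 1) = P u /\ P (u + tau) = Cexp (twopii * mu) * P u) /\
    (forall u, merom_at P u) /\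
    exists h : C -> C, holo_near h (t j) /\ pnear (t j) (fun u => h u = (u - t j) * (phi u - (CDeriv P u + P u * om u))).
Proof.
intros Hj Hphi. set (a := t j) in *. set (s u := sfun tau u mu).
destruct (omega_lau j Hj) as [W [[W1 W2] [W3 _]]]. fold a in W1, W2, W3.
destruct (sfun_pole_rep tau Htau mu Hmu) as [H [P0 H0]]. fold s in P0.
assert (Hs : forall u, ~ in_lattice tau u -> holo s u) by exact (fun u Hu => holo_sfun tau Htau u mu Hu Hmu).
set (k m u := CDeriv_n m s (u - a)).
assert (Hk : forall m u, ~ in_lattice tau (u - a) -> holo (k m) u).
{ intros m u Hu. apply (holo_shift (CDeriv_n m s)). now apply (holo_CDeriv_n_off tau Htau). }
(* The factor [u - a] lowers all orders by one, so that [pole_span] starts at order one and what it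
   leaves untouched is the simple pole. *)
set (K m u := (u - a) * (CDeriv (k m) u + k m u * om u)).
apply merom_at_iff in Hphi. destruct Hphi as [N [h0 [F1 F2]]].
destruct (pole_span K a) with (N := N) (g := fun u => (u - a) * phi u) (h := fun u => (u - a) * h0 u) as [b [kk [B1 B2]]].
- intro m. destruct (pole_rep_CDeriv_n s 0 H m P0) as [Hm [Q1 Q2]]. rewrite H0. apply RtoC_1_neq_0.
  assert (Q3 : pole_rep (k m) a (S m) (fun u => Hm (u - a))).
  { apply (pole_rep_shift (CDeriv_n m s)). now replace (a - a) with (RtoC 0) by ring. }
  assert (Q4 : pnear a (fun u => k m ~> CDeriv (k m) u at u)).
  { apply (pnear_impl _ _ _ (lattice_discrete tau Htau a a)). intros u _ Hu. apply CDeriv_correct. now apply Hk. }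
  assert (Q5 := pole_rep_derive _ _ _ _ _ Q3 Q4).
  eexists. split. split.
  + apply holo_near_plus. exact (proj1 Q5). apply holo_near_mult. exact (proj1 Q3). exact W1.
  + apply (pnear_impl _ _ _ (pnear_and _ _ _ (pnear_and _ _ _ (proj2 Q5) (proj2 Q3)) W2)). intros u Hu [[E1 E2] E3].
    cbv beta in E1, E2. rewrite E1, E2, E3. unfold K. rewrite !Cpow_S. simpl. ring.
  + cbv beta. replace (a - a) with (RtoC 0) by ring. rewrite W3.
    replace (0 * CDeriv (fun u => Hm (u - a)) a - RtoC (INR (S m)) * Hm 0 + Hm 0 * c j) with (Hm 0 * (c j - RtoC (INR (S m)))) by ring.
    apply Cmult_neq_0; auto. apply Csub_neq_0. now apply nonint_neq_nat.
- split. apply holo_near_mult; auto. apply holo_near_sub_const. apply (pnear_impl _ _ _ F2). intros u _ ->. ring.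
- exists (fun u => csum (fun m => b m * k m u) N). split; [|split].
  + intros u Hu. split; [|split].
    * apply (holo_csum N (fun m u => b m * k m u)). intro m. apply holo_mult. apply holo_const. now apply Hk.
    * apply csum_ext. intros m _. unfold k. replace (u + 1 - a) with (u - a + 1) by ring.
      rewrite (CDeriv_n_shift tau Htau s m 1 1 0); auto. destruct (Nat.eqb m 0); ring. apply in_lattice_1.
      intros w Hw. unfold s. rewrite sfun_add_1 by auto. ring.
    * rewrite <- csum_scal. apply csum_ext. intros m _. unfold k. replace (u + tau - a) with (u - a + tau) by ring.
      rewrite (CDeriv_n_shift tau Htau s m tau (Cexp (twopii * mu)) 0); auto. destruct (Nat.eqb m 0); ring. apply in_lattice_tau.
      intros w Hw. unfold s. rewrite sfun_add_tau by auto. ring.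
  + intro u. apply (merom_at_csum N (fun m u => b m * k m u)). intro m. apply merom_at_scal.
    apply (merom_at_shift (CDeriv_n m s)). apply merom_at_CDeriv_n. exact (merom_sfun tau Htau (u - a) mu).
  + exists kk. split; auto. apply (pnear_impl _ _ _ (pnear_and _ _ _ B2 (lattice_discrete tau Htau a a))). intros u _ [<- Hu].
    assert (ED : CDeriv (fun u => csum (fun m => b m * k m u) N) u = csum (fun m => b m * CDeriv (k m) u) N).
    { apply CDeriv_unique. clear - Hk Hu. induction N; simpl. apply is_derive_C_const. apply is_derive_C_plus; auto.
      apply is_derive_C_scal. apply CDeriv_correct. now apply Hk. }
    rewrite ED. unfold K.
    rewrite (csum_ext (fun m => b m * ((u - a) * (CDeriv (k m) u + k m u * om u))) (fun m => (u - a) * (b m * CDeriv (k m) u) + ((u - a) * om u) * (b m * k m u))) by (intros; ring).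
    rewrite csum_plus, !csum_scal. ring.
Qed.

(** Reductions at different points do not interfere: [P j] is holomorphic at every other [t_i],
    where it brings in at most the simple pole of [omega]. *)
Lemma cohomologous_simple_poles (phi : C -> C) : twisted_sec tau n t mu phi ->
  exists a, cohomologous tau n t c0 c mu phi (fun u => sum1n n (fun j => a j * sfun tau (u - t j) mu)).
Proof.
intros [Hh [Hm Hp]].
assert (Htj : forall j, (1 <= j <= n)%nat -> S_ (t j)).
{ intros j Hj. exists j. split; auto. replace (t j - t j) with (RtoC 0) by ring. apply in_lattice_0. }
assert (HP : forall j, exists P : C -> C, (1 <= j <= n)%nat -> (forall u, ~ in_lattice tau (u - t j) -> holo P u /\ P (u + 1) = P u /\ P (u + tau) = Cexp (twopii * mu) * P u) /\
    (forall u, merom_at P u) /\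
    exists h : C -> C, holo_near h (t j) /\ pnear (t j) (fun u => h u = (u - t j) * (phi u - (CDeriv P u + P u * om u)))).
{ intro j. destruct (classic (1 <= j <= n)%nat) as [h|h]. destruct (reduce_pole_order phi j h (Hm _ (Htj j h))) as [P H]. now exists P.
  exists (fun _ => RtoC 0). tauto. }
set (P j := proj1_sig (constructive_indefinite_description _ (HP j))).
assert (HPj : forall j, (1 <= j <= n)%nat -> (forall u, ~ in_lattice tau (u - t j) -> holo (P j) u /\ P j (u + 1) = P j u /\ P j (u + tau) = Cexp (twopii * mu) * P j u) /\
    (forall u, merom_at (P j) u) /\
    exists h : C -> C, holo_near h (t j) /\ pnear (t j) (fun u => h u = (u - t j) * (phi u - (CDeriv (P j) u + P j u * om u)))) by exact (fun j => proj2_sig (constructive_indefinite_description _ (HP j))).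
set (F u := sum1n n (fun j => P j u)).
assert (HPd : forall u, ~ S_ u -> forall j, (1 <= j <= n)%nat -> holo (P j) u).
{ intros u Hu j Hj. apply HPj; auto. now apply (not_pole_lattice tau n t). }
assert (DF : forall u, ~ S_ u -> F ~> sum1n n (fun j => CDeriv (P j) u) at u).
{ intros u Hu. apply (is_derive_C_sum1n n P). intros j Hj. apply CDeriv_correct. now apply HPd. }
assert (HFtw : twisted_sec tau n t mu F).
{ split; [|split].
  - intros u Hu. exact (is_derive_holo _ _ _ (DF u Hu)).
  - intros u _. apply (merom_at_sum1n n P). intros j Hj. now apply HPj.
  - intros u Hu. unfold F. split.
    + apply sum1n_ext. intros j Hj. apply HPj; auto. now apply (not_pole_lattice tau n t).
    + rewrite <- sum1n_scal. apply sum1n_ext. intros j Hj. apply HPj; auto. now apply (not_pole_lattice tau n t). }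
set (R u := phi u - (sum1n n (fun j => CDeriv (P j) u) + F u * om u)).
assert (HR : forall i, exists h : C -> C, (1 <= i <= n)%nat -> holo_near h (t i) /\ pnear (t i) (fun u => h u = (u - t i) * R u)).
{ intro i. destruct (classic (1 <= i <= n)%nat) as [Hi|Hi]. 2: (exists (fun _ => RtoC 0); tauto).
  destruct (HPj i Hi) as [_ [_ [h [h1 h2]]]]. destruct (omega_lau i Hi) as [W [[W1 W2] _]].
  (* The contributions of the [P j] with [j <> i] are subtracted after multiplication by [u - t_i],
     where [W] stands for the regular function [(u - t_i) omega]. *)
  exists (fun u => h u - sum1n n (fun j => if Nat.eqb j i then 0 else (u - t i) * CDeriv (P j) u + P j u * W u)). intros _. split.
  - apply holo_near_minus; auto. apply (holo_near_sum1n n (fun j u => if Nat.eqb j i then 0 else (u - t i) * CDeriv (P j) u + P j u * W u)).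
    intros j Hj. destruct (Nat.eqb_spec j i) as [->|Hji]. apply holo_near_const.
    assert (HPn : holo_near (P j) (t i)). { apply near_impl with (fun u => ~ in_lattice tau (u - t j)). apply lattice_near; auto. intros u Hu. now apply HPj. }
    apply holo_near_plus; apply holo_near_mult; auto. apply holo_near_sub_const. now apply CDeriv_holo_near.
  - apply (pnear_impl _ _ _ (pnear_and _ _ _ h2 W2)). intros u _ [-> EW]. unfold R, F.
    rewrite (sum1n_split n i (fun j => CDeriv (P j) u)), (sum1n_split n i (fun j => P j u)) by auto.
    rewrite (sum1n_ext n (fun j => if Nat.eqb j i then 0 else (u - t i) * CDeriv (P j) u + P j u * W u)
       (fun j => (u - t i) * (if Nat.eqb j i then 0 else CDeriv (P j) u) + W u * (if Nat.eqb j i then 0 else P j u))).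
    2: { intros j _. destruct (Nat.eqb j i); ring. }
    rewrite sum1n_plus, !sum1n_scal, EW. simpl. ring. }
set (h i := proj1_sig (constructive_indefinite_description _ (HR i))).
assert (Hhi : forall i, (1 <= i <= n)%nat -> holo_near (h i) (t i) /\ pnear (t i) (fun u => h i u = (u - t i) * R u)) by exact (fun i => proj2_sig (constructive_indefinite_description _ (HR i))).
exists (fun j => h j (t j)), F. split; auto.
assert (Z : forall u, ~ S_ u -> R u - sum1n n (fun j => h j (t j) * sfun tau (u - t j) mu) = 0).
{ apply (removable_multiplier_zero tau n t Htau (fun u => R u - sum1n n (fun j => h j (t j) * sfun tau (u - t j) mu)) mu); auto.
  - intros u Hu. apply holo_minus. unfold R. apply holo_minus; auto. apply holo_plus.
    + apply (holo_sum1n n (fun j => CDeriv (P j))). intros j Hj. apply holo_near_at, CDeriv_holo_near.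
      apply (near_impl _ _ _ (pole_set_near tau n t Htau u Hu)). intros w Hw. now apply HPd.
    + apply holo_mult. exact (is_derive_holo _ _ _ (DF u Hu)). now apply omega_holo.
    + apply (holo_sum1n n (fun j u => h j (t j) * sfun tau (u - t j) mu)). intros j Hj. apply holo_mult. apply holo_const.
      apply holo_near_at, sfun_holo_off; auto. now apply (not_pole_lattice tau n t).
  - intros u Hu. unfold R. destruct (Hp u Hu) as [-> _]. rewrite omega_add_1. destruct HFtw as [_ [_ HF]]. destruct (HF u Hu) as [-> _].
    rewrite (sum1n_ext n (fun j => CDeriv (P j) (u + 1)) (fun j => CDeriv (P j) u)).
    rewrite (sum1n_ext n (fun j => h j (t j) * sfun tau (u + 1 - t j) mu) (fun j => h j (t j) * sfun tau (u - t j) mu)). ring.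
    intros j _. replace (u + 1 - t j) with (u - t j + 1) by ring. now rewrite sfun_add_1.
    intros j Hj. rewrite (CDeriv_shift_rel (P j) 1 1 0). ring. now apply HPd.
    apply (near_impl _ _ _ (pole_set_near tau n t Htau u Hu)). intros w Hw. destruct (HPj j Hj) as [H' _].
    destruct (H' w (not_pole_lattice tau n t w j Hj Hw)) as [_ [-> _]]. ring.
  - intros u Hu. unfold R. destruct (Hp u Hu) as [_ ->]. rewrite omega_add_tau by auto. destruct HFtw as [_ [_ HF]]. destruct (HF u Hu) as [_ ->].
    rewrite (sum1n_ext n (fun j => CDeriv (P j) (u + tau)) (fun j => Cexp (twopii * mu) * CDeriv (P j) u)).
    rewrite (sum1n_ext n (fun j => h j (t j) * sfun tau (u + tau - t j) mu) (fun j => Cexp (twopii * mu) * (h j (t j) * sfun tau (u - t j) mu))). rewrite !sum1n_scal. ring.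
    intros j Hj. replace (u + tau - t j) with (u - t j + tau) by ring. rewrite sfun_add_tau; auto. ring. now apply (not_pole_lattice tau n t).
    intros j Hj. rewrite (CDeriv_shift_rel (P j) tau (Cexp (twopii * mu)) 0). ring. now apply HPd.
    apply (near_impl _ _ _ (pole_set_near tau n t Htau u Hu)). intros w Hw. destruct (HPj j Hj) as [H' _].
    destruct (H' w (not_pole_lattice tau n t w j Hj Hw)) as [_ [_ ->]]. ring.
  - intros i Hi. destruct (Hhi i Hi) as [h1 h2]. destruct (sfun_at_pole i mu Hmu) as [s0 [[s1 s2] [s3 _]]].
    apply removable_simple with (fun u => (h i u - h i (t i) * s0 u) - (u - t i) * sum1n n (fun j => if Nat.eqb j i then 0 else h j (t j) * sfun tau (u - t j) mu)).
    + apply holo_near_minus. apply holo_near_minus; auto. now apply holo_near_scal. apply holo_near_mult. apply holo_near_sub_const.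
      apply (holo_near_sum1n n (fun j u => if Nat.eqb j i then 0 else h j (t j) * sfun tau (u - t j) mu)). intros j Hj.
      destruct (Nat.eqb_spec j i) as [->|Hji]. apply holo_near_const. apply holo_near_scal, sfun_holo_off; auto.
    + apply (pnear_impl _ _ _ (pnear_and _ _ _ h2 s2)). intros u _ [-> ->].
      rewrite (sum1n_split n i (fun j => h j (t j) * sfun tau (u - t j) mu)) by auto. simpl. ring.
    + rewrite s3. ring. }
intros u Hu. change (F ~> (phi u - sum1n n (fun j => h j (t j) * sfun tau (u - t j) mu) - F u * om u) at u).
eapply is_derive_eq. exact (DF u Hu). specialize (Z u Hu). unfold R in Z.
transitivity (phi u - sum1n n (fun j => h j (t j) * sfun tau (u - t j) mu) - F u * om u - (phi u - (sum1n n (fun j => CDeriv (P j) u) + F u * om u) - sum1n n (fun j => h j (t j) * sfun tau (u - t j) mu))).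
ring. rewrite Z. ring.
Qed.

(** In these coordinates the pairing is diagonal. Since [eta] has only simple poles, the value at
    [t_j] of the regular part of a local solution is all that its residue detects. *)
Lemma int_form_simple_poles (phi eta : C -> C) (a e : nat -> C) :
  cohomologous tau n t c0 c mu phi (fun u => sum1n n (fun j => a j * sfun tau (u - t j) mu)) ->
  (forall u, ~ S_ u -> holo eta u) -> (forall u, ~ S_ u -> eta (u + 1) = eta u /\ eta (u + tau) = Cexp (twopii * - mu) * eta u) ->
  (forall j, (1 <= j <= n)%nat -> exists E, holo_near E (t j) /\ pnear (t j) (fun u => E u = (u - t j) * eta u) /\ E (t j) = e j) ->
  int_form tau n t c0 c phi eta = twopii * sum1n n (fun j => a j / c j * e j).
Proof.
intros [F [[F1 [F2 F3]] F4]] He1 He2 He3.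
assert (Hpt : forall j, (1 <= j <= n)%nat -> S_ (t j)).
{ intros j Hj. exists j. split; auto. replace (t j - t j) with (RtoC 0) by ring. apply in_lattice_0. }
assert (Hem : forall j, (1 <= j <= n)%nat -> merom_at eta (t j)).
{ intros j Hj. destruct (He3 j Hj) as [E [E1 [E2 _]]]. apply merom_at_iff. exists 1%nat, E. split; auto.
  apply (pnear_impl _ _ _ E2). intros u _ ->. simpl. ring. }
unfold int_form. f_equal.
transitivity (sum1n n (fun j => Res (fun u => F u * eta u) (t j) + a j / c j * e j)).
- apply sum1n_ext. intros j Hj.
  destruct (omega_lau j Hj) as [W [[W1 W2] [W3 _]]].
  assert (W2' : pnear (t j) (fun u => W u = (u - t j) * om u)) by (apply (pnear_impl _ _ _ W2); intros u _ ->; simpl; ring).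
  set (ch u := sum1n n (fun j => a j * sfun tau (u - t j) mu)).
  assert (HX : exists X, holo_near X (t j) /\ pnear (t j) (fun u => X u = (u - t j) * ch u) /\ X (t j) = a j).
  { destruct (sfun_at_pole j mu Hmu) as [s0 [[s1 s2] [s3 _]]].
    exists (fun u => a j * s0 u + (u - t j) * sum1n n (fun i => if Nat.eqb i j then 0 else a i * sfun tau (u - t i) mu)). split; [|split].
    - apply holo_near_plus. now apply holo_near_scal. apply holo_near_mult. apply holo_near_sub_const.
      apply (holo_near_sum1n n (fun i u => if Nat.eqb i j then 0 else a i * sfun tau (u - t i) mu)). intros i Hi.
      destruct (Nat.eqb_spec i j) as [->|Hij]. apply holo_near_const. apply holo_near_scal, sfun_holo_off; auto.
    - apply (pnear_impl _ _ _ s2). intros u _ ->. unfold ch. rewrite (sum1n_split n j (fun j => a j * sfun tau (u - t j) mu)) by auto. simpl. ring.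
    - rewrite s3. ring. }
  destruct HX as [X [X1 [X2 X3]]].
  assert (F4' : pnear (t j) (fun u => F ~> (phi u - ch u - F u * om u) at u)).
  { apply (pnear_impl _ _ _ (pole_set_pnear tau n t Htau (t j))). intros u _ Hu. exact (F4 u Hu). }
  (* Existence has to precede any use of the chosen [fj]; otherwise [epsilon] says nothing about
     it. *)
  assert (Hex : exists f, local_sol om phi (t j) f).
  { destruct (local_exist om ch W X (t j) W1 W2' X1 X2) as [h [L1 L2]]. intro k. rewrite W3. now apply nonint_plus_nat.
    exists (fun u => F u + h u). split. apply merom_at_plus. apply F2; auto. now apply merom_at_holo_near.
    destruct (pnear_and _ _ _ F4' L2) as [d [Hd K]]. exists d. split; auto. intros u Hu. destruct (K u Hu) as [K1 K2].
    change ((fun u => F u + h u) ~> (phi u - (F u + h u) * om u) at u). eapply is_derive_eq. apply is_derive_C_plus; eassumption. ring. }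
  set (fj := epsilon (inhabits (fun _ : C => RtoC 0)) (local_sol om phi (t j))).
  assert (Hfj : local_sol om phi (t j) fj) by (apply epsilon_spec; auto).
  destruct Hfj as [Hfm Hfd]. change (pnear (t j) (fun u => fj ~> (phi u - fj u * om u) at u)) in Hfd.
  (* [F] absorbs the higher poles of [phi]: the difference solves the equation with right-hand side
     [ch], which has only simple poles. *)
  destruct (local_leading om ch W X (t j) (fun u => fj u - F u) W1 W2' X1 X2) as [k [K1 [K2 K3]]].
  { intro m. rewrite W3. now apply nonint_neq_nat. }
  { apply merom_at_minus; auto. }
  { apply (pnear_impl _ _ _ (pnear_and _ _ _ F4' Hfd)). intros u _ [D1 D2]. eapply is_derive_eq. apply is_derive_C_minus; eassumption. ring. }
  destruct (He3 j Hj) as [E [E1 [E2 E3]]].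
  apply Res_eq. apply is_residue_ext with (fun u => F u * eta u + 1 * (k u * eta u)).
  { apply (pnear_impl _ _ _ K2). intros u _ H. rewrite <- H. ring. }
  replace (a j / c j * e j) with (1 * (k (t j) * E (t j))) by (rewrite K3, X3, W3, E3; ring).
  apply is_residue_lin.
  + destruct (merom_is_residue (fun u => F u * eta u) (t j)) as [r Hr]. apply merom_at_mult; auto. rewrite (Res_eq _ _ _ Hr). exact Hr.
  + apply (is_residue_simple _ (t j) (fun u => k u * E u)). now apply holo_near_mult.
    apply (pnear_impl _ _ _ E2). intros u _ ->. ring.
- rewrite sum1n_plus. rewrite (residue_theorem tau Htau n t (fun u => F u * eta u)); auto. ring.
  + intros u Hu. apply holo_mult; auto.
  + intros u Hu. destruct (F3 u Hu) as [-> ->]. destruct (He2 u Hu) as [-> ->]. split. reflexivity.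
    transitivity ((Cexp (twopii * mu) * Cexp (twopii * - mu)) * (F u * eta u)). ring. rewrite <- Cexp_plus.
    replace (twopii * mu + twopii * - mu) with (RtoC 0) by ring. rewrite Cexp_0. ring.
  + intros j Hj. apply merom_at_mult; auto.
Qed.
End Connection.
End Twisted.

(** * The contiguity relation *)
Lemma lau_sum1n N n (F : nat -> C -> C) a (r d : nat -> C) : (forall j, (1 <= j <= n)%nat -> lau N (F j) a (r j) (d j)) ->
  lau N (fun u => sum1n n (fun j => F j u)) a (sum1n n r) (sum1n n d).
Proof.
induction n; intro H.
- rewrite !sum1n_0. exists (fun _ => 0). split; [split|split]. apply holo_near_const.
  exists 1%R. split. lra. intros u _. rewrite sum1n_0. ring. reflexivity. apply CDeriv_unique, is_derive_C_const.
- rewrite !sum1n_S. apply lau_ext with (fun u => sum1n n (fun j => F j u) + 1 * F (S n) u).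
  exists 1%R. split. lra. intros u _. rewrite sum1n_S. ring.
  eapply lau_eq. apply lau_lin. apply IHn. intros; apply H; lia. apply H; lia. ring. ring.
Qed.

Lemma lau_mult_holo g f a r d : holo_near g a -> lau 1 f a r d -> lau 2 (fun u => g u * f u) a 0 (g a * r).
Proof.
intros H1 H2. eapply lau_eq. apply lau_mult. apply lau_regular. exact H1. exact H2. ring. ring.
Qed.

Lemma sum1n_delta n i x : (1 <= i <= n)%nat -> sum1n n (fun j => x j * (if Nat.eqb j i then 1 else 0)) = x i.
Proof.
intro Hi. rewrite (sum1n_split n i) by auto. rewrite Nat.eqb_refl. rewrite (sum1n_ext n _ (fun _ => 0)).
rewrite sum1n_zero. ring. intros j _. destruct (Nat.eqb j i); ring.
Qed.

Lemma sum1n_ne n p q a : (1 <= p <= n)%nat -> (1 <= q <= n)%nat -> p <> q -> sum1n n a = a p + a q + sum_ne n p q a.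
Proof.
intros Hp Hq Hpq. rewrite (sum1n_split n p a), (sum1n_split n q (fun j => if Nat.eqb j p then 0 else a j)) by auto.
destruct (Nat.eqb_spec q p). congruence. unfold sum_ne. rewrite Cplus_assoc. f_equal. apply sum1n_ext. intros j _.
destruct (Nat.eqb j p), (Nat.eqb j q); reflexivity.
Qed.

Lemma sum_ne_ext n p q a b : (forall j, (1 <= j <= n)%nat -> j <> p -> j <> q -> a j = b j) -> sum_ne n p q a = sum_ne n p q b.
Proof.
intro H. apply sum1n_ext. intros j Hj. destruct (Nat.eqb_spec j p); auto. destruct (Nat.eqb_spec j q); simpl; auto.
Qed.
Lemma sum_ne_plus n p q a b : sum_ne n p q (fun j => a j + b j) = sum_ne n p q a + sum_ne n p q b.
Proof. unfold sum_ne. rewrite <- sum1n_plus. apply sum1n_ext. intros j _. destruct (_ || _)%bool; ring. Qed.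
Lemma sum_ne_scal n p q k a : sum_ne n p q (fun j => k * a j) = k * sum_ne n p q a.
Proof. unfold sum_ne. rewrite <- sum1n_scal. apply sum1n_ext. intros j _. destruct (_ || _)%bool; ring. Qed.

Lemma reduced_not_in_lattice tau a b : (0 < Im tau)%R -> (0 <= a < 1)%R -> (0 <= b < 1)%R ->
  in_lattice tau (RtoC a + RtoC b * tau) -> RtoC a + RtoC b * tau = 0.
Proof.
intros Ht Ha Hb [m [k E]].
assert (EI := f_equal Im E). assert (ER := f_equal Re E). destruct tau as [s r]. simpl in *.
assert (Ek : b = IZR k). { apply Rmult_eq_reg_r with r; lra. }
assert (Em : a = IZR m). { rewrite Ek in ER. lra. }
assert (k = 0)%Z. { rewrite Ek in Hb. destruct Hb as [h1 h2]. apply le_IZR in h1. apply lt_IZR in h2. lia. }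
assert (m = 0)%Z. { rewrite Em in Ha. destruct Ha as [h1 h2]. apply le_IZR in h1. apply lt_IZR in h2. lia. }
rewrite Ek, Em, H, H0. simpl. ring.
Qed.

Section Main.
Variables (tau : C) (n : nat) (t : nat -> C) (c0 : C) (c : nat -> C) (lam : C) (p q : nat) (phi : C -> C).
Hypothesis Htau : (0 < Im tau)%R.
Hypothesis Hdist : forall i j, (1 <= i <= n)%nat -> (1 <= j <= n)%nat -> i <> j -> ~ in_lattice tau (t i - t j).
Hypothesis Hnonint : forall j, (1 <= j <= n)%nat -> ~ exists k : Z, c j = RtoC (IZR k).
Hypothesis Hsum : sum1n n c = 0.
Hypothesis Hlam : ~ in_lattice tau lam.
Hypothesis Hp : (1 <= p <= n)%nat.
Hypothesis Hq : (1 <= q <= n)%nat.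
Hypothesis Hpq : p <> q.
Hypothesis Hlp : ~ in_lattice tau (t p - t q - lam).
Hypothesis Hphi : twisted_sec tau n t (lamp t lam p q) phi.
Local Notation S_ := (pole_set tau n t).
Local Notation th := (theta1 tau).
Local Notation T0 := (theta1' tau 0).
Local Notation lp := (lamp t lam p q).
Local Notation c' := (cprime c p q).
Local Notation ratio u := (th (u - t p) / th (u - t q)).

Lemma lp_not_lattice : ~ in_lattice tau lp.
Proof. unfold lamp. intro H. apply Hlp. replace (t p - t q - lam) with (- (lam - t p + t q)) by ring. now apply in_lattice_opp. Qed.

Lemma cprime_p : c' p = c p + 1.
Proof. unfold cprime. now rewrite Nat.eqb_refl. Qed.
Lemma cprime_q : c' q = c q - 1.
Proof. unfold cprime. rewrite Nat.eqb_refl. destruct (Nat.eqb_spec q p). congruence. reflexivity. Qed.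
Lemma cprime_ne j : j <> p -> j <> q -> c' j = c j.
Proof. intros. unfold cprime. destruct (Nat.eqb_spec j p). congruence. destruct (Nat.eqb_spec j q). congruence. reflexivity. Qed.

Lemma cprime_sum : sum1n n c' = 0.
Proof.
rewrite <- Hsum, !(sum1n_ne n p q) by auto. rewrite cprime_p, cprime_q.
rewrite (sum_ne_ext n p q c' c). ring. intros; now apply cprime_ne.
Qed.

Lemma cprime_nonint j : (1 <= j <= n)%nat -> ~ exists k : Z, c' j = RtoC (IZR k).
Proof.
intros Hj [k E]. apply (Hnonint j Hj). unfold cprime in E. destruct (Nat.eqb j p); [|destruct (Nat.eqb j q)].
- exists (k - 1)%Z. rewrite minus_IZR, RtoC_minus, <- E. ring.
- exists (k + 1)%Z. rewrite plus_IZR, RtoC_plus, <- E. ring.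
- now exists k.
Qed.

Lemma omega_cprime u : omega tau n t c0 c' u = omega tau n t c0 c u + rho tau (u - t p) - rho tau (u - t q).
Proof.
unfold omega. rewrite !(sum1n_ne n p q) by auto. rewrite cprime_p, cprime_q.
rewrite (sum_ne_ext n p q (fun j => c' j * rho tau (u - t j)) (fun j => c j * rho tau (u - t j))). ring.
intros; now rewrite cprime_ne.
Qed.

Lemma lau_sfun_at mu i j : ~ in_lattice tau mu -> (1 <= i <= n)%nat -> (1 <= j <= n)%nat ->
  lau 1 (fun u => sfun tau (u - t j) mu) (t i) (if Nat.eqb j i then 1 else 0) (if Nat.eqb j i then - rho tau mu else sfun tau (t i - t j) mu).
Proof.
intros Hmu Hi Hj. destruct (Nat.eqb_spec j i) as [->|Hji].
- now apply sfun_at_pole.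
- apply (lau_regular (fun u => sfun tau (u - t j) mu)). apply sfun_holo_off; auto.
Qed.

Lemma sfun_simple_pole mu i j : ~ in_lattice tau mu -> (1 <= i <= n)%nat -> (1 <= j <= n)%nat ->
  exists E : C -> C, holo_near E (t i) /\ pnear (t i) (fun u => E u = (u - t i) * sfun tau (u - t j) mu) /\ E (t i) = (if Nat.eqb j i then 1 else 0).
Proof.
intros Hmu Hi Hj. destruct (lau_sfun_at mu i j Hmu Hi Hj) as [h [[H1 H2] [H3 _]]]. exists h. split; auto. split; auto.
apply (pnear_impl _ _ _ H2). intros u _ ->. simpl. ring.
Qed.

(** Every [etav] combines [psiv q] with at most one further [psiv k], so one computation serves all;
    [etav q] is obtained with coefficient 0 on [psiv p]. *)
Lemma int_form_pair a k z1 z2 :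
  cohomologous tau n t c0 c' lp phi (fun u => sum1n n (fun j => a j * sfun tau (u - t j) lp)) ->
  (1 <= k <= n)%nat -> k <> q ->
  int_form tau n t c0 c' phi (fun u => z1 * psiv tau t lam p q k u + z2 * psiv tau t lam p q q u) =
  twopii * (z1 * (a k / c' k) + z2 * (a q / c' q)).
Proof.
intros Hco Hk Hkq.
assert (Hlpn : ~ in_lattice tau (- lp)) by (rewrite in_lattice_opp_iff; apply lp_not_lattice).
rewrite (int_form_simple_poles tau n t Htau Hdist c0 c' cprime_nonint lp lp_not_lattice phi _ a (fun j => if Nat.eqb j k then z1 else if Nat.eqb j q then z2 else 0)); auto.
- f_equal. rewrite (sum1n_ne n k q) by auto. rewrite !Nat.eqb_refl. destruct (Nat.eqb_spec q k). congruence.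
  rewrite (sum_ne_ext n k q _ (fun _ => 0 * 0)). rewrite sum_ne_scal. ring.
  intros j _ h1 h2. destruct (Nat.eqb_spec j k). congruence. destruct (Nat.eqb_spec j q). congruence. ring.
- intros u Hu. assert (Huk := not_pole_lattice tau n t u k Hk Hu). assert (Huq := not_pole_lattice tau n t u q Hq Hu).
  assert (Sk := holo_near_at _ _ (sfun_holo_off tau Htau (t k) (- lp) u Hlpn Huk)).
  assert (Sq := holo_near_at _ _ (sfun_holo_off tau Htau (t q) (- lp) u Hlpn Huq)).
  exact (holo_plus _ _ u (holo_mult _ _ u (holo_const z1 u) Sk) (holo_mult _ _ u (holo_const z2 u) Sq)).
- intros u Hu. unfold psiv. split.
  + replace (u + 1 - t k) with (u - t k + 1) by ring. replace (u + 1 - t q) with (u - t q + 1) by ring. now rewrite !sfun_add_1.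
  + replace (u + tau - t k) with (u - t k + tau) by ring. replace (u + tau - t q) with (u - t q + tau) by ring.
    rewrite !sfun_add_tau by (auto; now apply (not_pole_lattice tau n t)). ring.
- intros j Hj. destruct (sfun_simple_pole (- lp) j k Hlpn Hj Hk) as [E1 [A1 [B1 C1]]]. destruct (sfun_simple_pole (- lp) j q Hlpn Hj Hq) as [E2 [A2 [B2 C2]]].
  exists (fun u => z1 * E1 u + z2 * E2 u). split; [|split].
  + apply holo_near_plus; now apply holo_near_scal.
  + apply (pnear_impl _ _ _ (pnear_and _ _ _ B1 B2)). intros u _ [-> ->]. unfold psiv. ring.
  + rewrite C1, C2. rewrite (Nat.eqb_sym k j), (Nat.eqb_sym q j). destruct (Nat.eqb_spec j k), (Nat.eqb_spec j q); try congruence; ring.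
Qed.

Lemma twopii_neq_0 : twopii <> 0.
Proof. rewrite twopii_eq. unfold RtoC. intro E. injection E as E. assert (h0 := PI_RGT_0). lra. Qed.

Lemma th_opp u : th (- u) = - th u.
Proof. now apply theta1_odd. Qed.
Lemma th_swap x y : th (x - y) = - th (y - x).
Proof. replace (x - y) with (- (y - x)) by ring. apply th_opp. Qed.

Lemma th_diff_neq i j : (1 <= i <= n)%nat -> (1 <= j <= n)%nat -> i <> j -> th (t i - t j) <> 0.
Proof. intros. apply theta1_neq_0; auto. Qed.

Lemma sfun_pq : sfun tau (t p - t q) (- lp) = th lam * T0 / (th (t p - t q) * th lp).
Proof. unfold sfun. replace (t p - t q - - lp) with lam by (unfold lamp; ring). now replace (- - lp) with lp by ring. Qed.

(** * Coefficients through intersection numbers, and the residues of the difference *)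

Section Coefficients.
Variable a : nat -> C.
Hypothesis Hco : cohomologous tau n t c0 c' lp phi (fun u => sum1n n (fun j => a j * sfun tau (u - t j) lp)).
Local Notation J := (Jk tau n t c0 c lam p q phi).

(** The constant Laurent term of [psiv p] at [t_p] is [rho lp]. Adding [Kp] times [psiv q] changes
    it to that of [omega'] divided by [c_p + 1], so [etav p] agrees at [t_p] with
    [omega' / (c_p + 1)] in its first two Laurent coefficients. *)
Definition Kp : C := / sfun tau (t p - t q) (- lp) * (/ (c p + 1) *
   (twopii * c0 + sum1n n (fun l => if Nat.eqb l p then RtoC 0 else c' l * rho tau (t p - t l))) - rho tau lp).

Lemma Jk_q : J q = a q / c' q.
Proof.
unfold Jk. replace (etav tau n t c0 c lam p q q) with (fun u => 0 * psiv tau t lam p q p u + 1 * psiv tau t lam p q q u).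
rewrite (int_form_pair a p 0 1 Hco Hp Hpq). assert (h := twopii_neq_0). unfold Cdiv.
transitivity (twopii * / twopii * (a q * / c' q)). ring. rewrite Cinv_r by auto. ring.
apply functional_extensionality. intro u. unfold etav. rewrite Nat.eqb_refl. ring.
Qed.

Lemma Jk_p : J p = a p / c' p + Kp * (a q / c' q).
Proof.
unfold Jk. replace (etav tau n t c0 c lam p q p) with (fun u => 1 * psiv tau t lam p q p u + Kp * psiv tau t lam p q q u).
rewrite (int_form_pair a p 1 Kp Hco Hp Hpq). assert (h := twopii_neq_0). unfold Cdiv.
transitivity (twopii * / twopii * (a p * / c' p + Kp * (a q * / c' q))). ring. rewrite Cinv_r by auto. ring.
apply functional_extensionality. intro u. unfold etav. rewrite Nat.eqb_refl. destruct (Nat.eqb_spec p q). congruence. unfold Kp. ring.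
Qed.

Lemma Jk_ne k : (1 <= k <= n)%nat -> k <> p -> k <> q ->
  J k = a k / c' k - sfun tau (t p - t k) (- lp) / sfun tau (t p - t q) (- lp) * (a q / c' q).
Proof.
intros Hk Hkp Hkq.
unfold Jk. replace (etav tau n t c0 c lam p q k) with (fun u => 1 * psiv tau t lam p q k u + (- (sfun tau (t p - t k) (- lp) / sfun tau (t p - t q) (- lp))) * psiv tau t lam p q q u).
rewrite (int_form_pair a k _ _ Hco Hk Hkq). assert (h := twopii_neq_0). set (X := sfun tau (t p - t k) (- lp) / sfun tau (t p - t q) (- lp)). unfold Cdiv.
transitivity (twopii * / twopii * (a k * / c' k - X * (a q * / c' q))). ring. rewrite Cinv_r by auto. ring.
apply functional_extensionality. intro u. unfold etav. destruct (Nat.eqb_spec k q). congruence. destruct (Nat.eqb_spec k p). congruence. ring.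
Qed.

(** At [t_q] the transformed section has double-pole coefficient
    [a_q theta_1(t_q - t_p) / theta_1'(0)], and [d psi_q + psi_q omega] has [c_q - 1]. As
    [a_q = (c_q - 1) J_q], the quotient needs no denominator [c_q - 1]. *)
Definition kap : C := J q * th (t q - t p) / T0.
Definition Rcoef (j : nat) : C :=
  if Nat.eqb j p then J q * c p * th (lam - t p + t q) / th lam
  else if Nat.eqb j q then Bcoef tau n t c0 c lam p q phi
  else J j * c j * th (t j - t p) / th (t j - t q).

Lemma rhs_sum u : rhs tau n t c0 c lam p q phi u = sum1n n (fun j => Rcoef j * psi tau t lam j u).
Proof.
unfold rhs. rewrite (sum1n_ne n p q) by auto.
rewrite (sum_ne_ext n p q (fun j => Rcoef j * psi tau t lam j u) (fun j => J j * c j * th (t j - t p) / th (t j - t q) * psi tau t lam j u)).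
unfold Rcoef. rewrite !Nat.eqb_refl. destruct (Nat.eqb_spec q p). congruence. ring.
intros j _ h1 h2. unfold Rcoef. destruct (Nat.eqb_spec j p). congruence. destruct (Nat.eqb_spec j q). congruence. reflexivity.
Qed.

Lemma cp1_neq : c p + 1 <> 0.
Proof. intro E. apply (cprime_nonint p Hp). exists 0%Z. now rewrite cprime_p. Qed.
Lemma cq1_neq : c q - 1 <> 0.
Proof. intro E. apply (cprime_nonint q Hq). exists 0%Z. now rewrite cprime_q. Qed.
Lemma cj_neq j : (1 <= j <= n)%nat -> c j <> 0.
Proof. intros Hj E. apply (Hnonint j Hj). exists 0%Z. auto. Qed.

Lemma a_q : a q = (c q - 1) * J q.
Proof. rewrite Jk_q, cprime_q. field. apply cq1_neq. Qed.
Lemma a_p : a p = (c p + 1) * (J p - Kp * J q).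
Proof. rewrite Jk_p, Jk_q, cprime_p. unfold Cdiv. transitivity ((c p + 1) * / (c p + 1) * a p). rewrite Cinv_r by apply cp1_neq. ring. ring. Qed.
Lemma a_ne k : (1 <= k <= n)%nat -> k <> p -> k <> q ->
  a k = c k * (J k + sfun tau (t p - t k) (- lp) / sfun tau (t p - t q) (- lp) * J q).
Proof.
intros Hk h1 h2. rewrite Jk_ne, Jk_q by auto. rewrite cprime_ne by auto. unfold Cdiv.
transitivity (c k * / c k * a k). rewrite Cinv_r by now apply cj_neq. ring. ring.
Qed.

(** The [J_q]-part of [a_i], due to the correction term in [etav i], cancels exactly against the
    residue of [kap psi_q omega]; the [J_i]-part is the coefficient in [rhs]. *)
Lemma residue_at_ne i : (1 <= i <= n)%nat -> i <> p -> i <> q ->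
  a i * (th (t i - t p) / th (t i - t q)) - Rcoef i - kap * (sfun tau (t i - t q) lam * c i) = 0.
Proof.
intros Hi h1 h2. rewrite (a_ne i) by auto. unfold Rcoef, kap. destruct (Nat.eqb_spec i p). congruence. destruct (Nat.eqb_spec i q). congruence.
rewrite sfun_pq. unfold sfun. replace (t p - t i - - lp) with (- (t i - t q - lam)) by (unfold lamp; ring).
replace (- - lp) with lp by ring. rewrite !th_opp. rewrite (th_swap (t q) (t p)), (th_swap (t p) (t i)).
assert (e1 := th_diff_neq i p Hi Hp h1). assert (e2 := th_diff_neq i q Hi Hq h2). assert (e3 := th_diff_neq p q Hp Hq Hpq).
assert (e4 := theta1_neq_0 tau Htau lam Hlam). assert (e5 := theta1_neq_0 tau Htau lp lp_not_lattice). assert (e6 := theta1'_0_neq_0 tau Htau).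
field. repeat split; auto.
Qed.

(** The factor [ratio] vanishes at [t_p], so [a_p] drops out and the coefficient of [psi_p] comes
    from [kap] alone. *)
Lemma residue_at_p : a p * (th (t p - t p) / th (t p - t q)) - Rcoef p - kap * (sfun tau (t p - t q) lam * c p) = 0.
Proof.
unfold Rcoef, kap. rewrite Nat.eqb_refl. replace (t p - t p) with (RtoC 0) by ring. rewrite theta1_0 by auto.
unfold sfun. replace (t p - t q - lam) with (- (lam - t p + t q)) by ring. rewrite !th_opp. rewrite (th_swap (t q) (t p)).
assert (e3 := th_diff_neq p q Hp Hq Hpq).
assert (e4 := theta1_neq_0 tau Htau lam Hlam). assert (e6 := theta1'_0_neq_0 tau Htau).
field. repeat split; auto.
Qed.

(** The share of [psi'_k] in the residue at [t_q]. Its [J_k]-part is the matching term of [Bcoef];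
    its [J_q]-part is a product of theta values which [rho_identity], at [t_p - t_k], [t_k - t_q]
    and [lp] with sum [lam], makes linear in [rho] and hence summable over [k]. *)
Lemma residue_term k : (1 <= k <= n)%nat -> k <> p -> k <> q ->
  th (t q - t p) / T0 * (a k * sfun tau (t q - t k) lp) =
  J k * c k * th (t p - t q) * th (lam - t p + t k) / (th (t k - t q) * th (lam - t p + t q))
  + J q * (th (t p - t q) / T0) * (c k * rho tau (t p - t k) + (- (1)) * (c k * rho tau (t q - t k)) + (rho tau lp - rho tau lam) * c k).
Proof.
intros Hk h1 h2. rewrite (a_ne k) by auto. rewrite sfun_pq.
assert (e1 := th_diff_neq p k Hp Hk (not_eq_sym h1)). assert (e2 := th_diff_neq k q Hk Hq h2). assert (e3 := th_diff_neq p q Hp Hq Hpq).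
assert (e4 := theta1_neq_0 tau Htau lam Hlam). assert (e5 := theta1_neq_0 tau Htau lp lp_not_lattice). assert (e6 := theta1'_0_neq_0 tau Htau).
assert (R := rho_identity tau Htau (t p - t k) (t k - t q) lp (Hdist p k Hp Hk (not_eq_sym h1)) (Hdist k q Hk Hq h2) lp_not_lattice).
replace (t p - t k + (t k - t q) + lp) with lam in R by (unfold lamp; ring). specialize (R Hlam).
replace (t p - t k + (t k - t q)) with (t p - t q) in R by ring.
replace (t k - t q + lp) with (lam - t p + t k) in R by (unfold lamp; ring).
replace (lp + (t p - t k)) with (lam + t q - t k) in R by (unfold lamp; ring).
replace (c k * rho tau (t p - t k) + (- (1)) * (c k * rho tau (t q - t k)) + (rho tau lp - rho tau lam) * c k) with
  (c k * (rho tau (t p - t k) + rho tau (t k - t q) + rho tau lp - rho tau lam)).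
2: { replace (t k - t q) with (- (t q - t k)) by ring. rewrite rho_odd by auto. ring. }
rewrite R. unfold sfun. replace (t q - t k - lp) with (- (lam - t p + t k)) by (unfold lamp; ring).
replace (t p - t k - - lp) with (lam + t q - t k) by (unfold lamp; ring). replace (- - lp) with lp by ring.
change (lam - t p + t q) with lp.
rewrite !th_opp. rewrite (th_swap (t q) (t p)), (th_swap (t q) (t k)).
field. repeat split; auto.
Qed.

(** After [residue_term] everything is linear in [rho]. The sums of [c_k rho(t_p - t_k)] and the
    constant [2 pi i c0] cancel against those in [Kp] and [omega_reg], the sums of
    [c_k rho(t_q - t_k)] against [omega_reg], and the sum of the remaining [c_k] is replaced by
    [-c_p - c_q]. *)
Lemma residue_at_q :
  sum1n n (fun j => a j * (theta1' tau (t q - t p) / T0 * (if Nat.eqb j q then 1 else 0)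
       + th (t q - t p) / T0 * (if Nat.eqb j q then - rho tau lp else sfun tau (t q - t j) lp)))
  - Rcoef q - kap * (- rho tau lam * c q + 1 * omega_reg tau n t c0 c q) = 0.
Proof.
rewrite (sum1n_ne n p q) by auto. rewrite Nat.eqb_refl. destruct (Nat.eqb_spec p q). congruence.
rewrite (sum_ne_ext n p q _ (fun k => J k * c k * th (t p - t q) * th (lam - t p + t k) / (th (t k - t q) * th (lam - t p + t q))
  + J q * (th (t p - t q) / T0) * (c k * rho tau (t p - t k) + (- (1)) * (c k * rho tau (t q - t k)) + (rho tau lp - rho tau lam) * c k))).
2: { intros k Hk h1 h2. rewrite <- residue_term by auto. destruct (Nat.eqb_spec k q). congruence. ring. }
rewrite sum_ne_plus, sum_ne_scal, !sum_ne_plus, !sum_ne_scal.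
unfold Rcoef. rewrite Nat.eqb_refl. destruct (Nat.eqb_spec q p). congruence. unfold Bcoef.
set (S1 := sum_ne n p q (fun j => J j * c j * th (t p - t q) * th (lam - t p + t j) / (th (t j - t q) * th (lam - t p + t q)))).
rewrite a_p, a_q. unfold Kp, omega_reg, kap. rewrite sfun_pq.
rewrite (sum1n_ne n p q (fun l => if Nat.eqb l p then RtoC 0 else c' l * rho tau (t p - t l))) by auto.
rewrite (sum1n_ne n p q (fun i => if Nat.eqb i q then 0 else c i * rho tau (t q - t i))) by auto.
rewrite !Nat.eqb_refl. destruct (Nat.eqb_spec q p). congruence. destruct (Nat.eqb_spec p q). congruence.
rewrite (sum_ne_ext n p q (fun l => if Nat.eqb l p then RtoC 0 else c' l * rho tau (t p - t l)) (fun k => c k * rho tau (t p - t k))).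
2: { intros j _ h1 h2. destruct (Nat.eqb_spec j p). congruence. now rewrite cprime_ne. }
rewrite (sum_ne_ext n p q (fun i => if Nat.eqb i q then 0 else c i * rho tau (t q - t i)) (fun k => c k * rho tau (t q - t k))).
2: { intros j _ h1 h2. destruct (Nat.eqb_spec j q). congruence. reflexivity. }
rewrite cprime_q.
assert (Es : sum_ne n p q c = - c p - c q).
{ assert (E := Hsum). rewrite (sum1n_ne n p q) in E by auto. transitivity (c p + c q + sum_ne n p q c - c p - c q). ring. rewrite E. ring. }
change (sum_ne n p q (fun j => c j)) with (sum_ne n p q c). rewrite Es.
set (U := sum_ne n p q (fun k => c k * rho tau (t p - t k))). set (V := sum_ne n p q (fun k => c k * rho tau (t q - t k))).
assert (e3 := th_diff_neq p q Hp Hq Hpq).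
assert (e4 := theta1_neq_0 tau Htau lam Hlam). assert (e5 := theta1_neq_0 tau Htau lp lp_not_lattice). assert (e6 := theta1'_0_neq_0 tau Htau).
assert (e7 := cp1_neq).
assert (Ed : theta1' tau (t q - t p) = rho tau (t p - t q) * th (t p - t q)).
{ unfold rho. replace (t q - t p) with (- (t p - t q)) by ring. rewrite theta1'_even by auto. field. auto. }
assert (Er : rho tau (t q - t p) = - rho tau (t p - t q)) by (replace (t q - t p) with (- (t p - t q)) by ring; now apply rho_odd).
rewrite Ed, Er. unfold sfun. replace (t q - t p - lp) with (- lam) by (unfold lamp; ring).
change (lam - t p + t q) with lp. rewrite !th_opp. rewrite (th_swap (t q) (t p)).
field. repeat split; auto.
Qed.

(** The section to be shown zero, written with explicit scalars, including a factor 1, so that its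
    parts have the shape [f + k * g] of [lau_lin]. *)
Definition Dsec (u : C) : C :=
  sum1n n (fun j => a j * (ratio u * sfun tau (u - t j) lp) + (- Rcoef j) * sfun tau (u - t j) lam)
  + (- kap) * (CDeriv (fun u => sfun tau (u - t q) lam) u + 1 * (sfun tau (u - t q) lam * omega tau n t c0 c u)).

Lemma psi_q_holo u : ~ S_ u -> holo_near (fun u => sfun tau (u - t q) lam) u.
Proof. intro Hu. apply sfun_holo_off; auto. now apply (not_pole_lattice tau n t). Qed.

Lemma ratio_holo_near u : ~ in_lattice tau (u - t q) -> holo_near (fun u => ratio u) u.
Proof.
intro Hu. apply holo_near_div. apply (holo_near_shift th). apply holo_near_all; intro; now apply holo_theta1.
apply (holo_near_shift th). apply holo_near_all; intro; now apply holo_theta1. now apply theta1_neq_0.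
Qed.

Lemma ratio_add_1 u : ratio (u + 1) = ratio u.
Proof.
replace (u + 1 - t p) with (u - t p + 1) by ring. replace (u + 1 - t q) with (u - t q + 1) by ring. rewrite !theta1_add_1 by auto.
unfold Cdiv. destruct (classic (th (u - t q) = 0)) as [->|h]. replace (- 0) with (RtoC 0) by ring. rewrite Cinv_0. ring. field. auto.
Qed.

Lemma ratio_add_tau u : ~ in_lattice tau (u - t q) -> ratio (u + tau) = Cexp (twopii * (t p - t q)) * ratio u.
Proof.
intro Hu. apply theta1_neq_0 in Hu; auto.
replace (u + tau - t p) with (u - t p + tau) by ring. replace (u + tau - t q) with (u - t q + tau) by ring. rewrite !theta1_tau by auto.
assert (E : theta_mult tau (u - t p) = Cexp (twopii * (t p - t q)) * theta_mult tau (u - t q)).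
{ unfold theta_mult. transitivity (- (Cexp (twopii * (t p - t q)) * Cexp (- (RtoC PI * Ci * tau) - twopii * (u - t q)))). 2: ring.
  rewrite <- Cexp_plus. do 2 f_equal. ring. }
rewrite E. field. split; auto. apply theta_mult_neq_0.
Qed.

Lemma lau_ratio_q : lau 1 (fun u => ratio u) (t q) (th (t q - t p) / T0) (theta1' tau (t q - t p) / T0).
Proof.
destruct (theta1_factor tau Htau) as [Th [T1 [T2 [T3 T4]]]]. assert (h0 := theta1'_0_neq_0 tau Htau).
assert (L : lau 1 (fun v => th (v + (t q - t p)) / th v) 0 (th (t q - t p) / T0) (theta1' tau (t q - t p) / T0)).
{ exists (fun v => th (v + (t q - t p)) / Th v). split; [split|split].
  - apply holo_near_div; auto. apply holo_near_all. intro v. eexists. apply (is_derive_shift_plus th). now apply theta1_derive. now rewrite T2.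
  - apply (pnear_impl _ _ _ (near_pnear _ _ T4)). intros v Hv [E1 E2]. rewrite E1. simpl. field. auto.
  - now rewrite T2, Cplus_0_l.
  - assert (DT := CDeriv_correct Th (RtoC 0) (holo_near_at _ _ T1)). rewrite T3 in DT.
    apply CDeriv_unique. eapply is_derive_eq. apply is_derive_C_div. apply (is_derive_shift_plus th). now apply theta1_derive. exact DT. now rewrite T2.
    cbv beta. rewrite T2, Cplus_0_l. field. auto. }
apply lau_ext with (fun u => th (u - t q + (t q - t p)) / th (u - t q)).
exists 1%R. split. lra. intros u _. f_equal. f_equal. ring.
apply (lau_shift 1 (fun v => th (v + (t q - t p)) / th v)). now replace (t q - t q) with (RtoC 0) by ring.
Qed.

Lemma Dsec_removable i : (1 <= i <= n)%nat -> removable Dsec (t i).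
Proof.
intro Hi. apply lau_removable. unfold Dsec.
assert (Hom := omega_lau tau n t Htau Hdist c0 c i Hi).
destruct (Nat.eq_dec i q) as [->|Hiq].
(* At [t_q] the products reach order two, so the constant Laurent terms of [ratio], [psi'_q],
   [psi_q] and [omega] all enter the residue. *)
- eapply lau_eq. eapply lau_lin.
  + apply (lau_sum1n 2 n (fun j u => a j * (ratio u * sfun tau (u - t j) lp) + (- Rcoef j) * sfun tau (u - t j) lam)). intros j Hj.
    eapply lau_lin. 2: eapply lau_raise, (lau_sfun_at lam q j Hlam Hq Hj).
    assert (L := lau_mult _ _ _ _ _ _ _ lau_ratio_q (lau_sfun_at lp q j lp_not_lattice Hq Hj)).
    (* A zero first summand turns [lau_lin] into multiplication by [a j]. *)
    assert (L' := lau_lin 2 _ _ _ _ _ _ _ (a j) (lau_raise _ _ _ _ (lau_regular (fun _ => 0) (t q) (holo_near_const 0 _))) L).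
    apply lau_ext with (2 := L'). exists 1%R. split. lra. intros u _. ring.
  + eapply lau_lin. apply (lau_derive _ _ _ _ _ (sfun_at_pole tau t Htau q lam Hlam)).
    apply (pnear_impl _ _ _ (lattice_discrete tau Htau (t q) (t q))). intros u _ Hu. apply CDeriv_correct, holo_near_at, sfun_holo_off; auto.
    eapply lau_mult. apply (sfun_at_pole tau t Htau q lam Hlam). exact Hom.
  + cbv beta. rewrite (sum1n_ext n _ (fun j => (a j * (th (t q - t p) / T0)) * (if Nat.eqb j q then 1 else 0))) by (intros; ring).
    rewrite sum1n_delta by auto. rewrite a_q. unfold kap. assert (h0 := theta1'_0_neq_0 tau Htau). field. auto.
  + cbv beta. etransitivity; [|exact residue_at_q].
    rewrite (sum1n_ext n _ (fun j => a j * (theta1' tau (t q - t p) / T0 * (if Nat.eqb j q then 1 else 0)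
       + th (t q - t p) / T0 * (if Nat.eqb j q then - rho tau lp else sfun tau (t q - t j) lp)) + (- Rcoef j) * (if Nat.eqb j q then 1 else 0))) by (intros; ring).
    rewrite sum1n_plus, (sum1n_delta n q (fun j => - Rcoef j)) by auto. ring.
(* Away from [t_q] the factor [ratio] is regular and all poles are simple: the order [-2]
   coefficient vanishes termwise and the residue decides. *)
- assert (Hn : ~ in_lattice tau (t i - t q)) by auto.
  eapply lau_eq. eapply lau_lin.
  + apply (lau_sum1n 2 n (fun j u => a j * (ratio u * sfun tau (u - t j) lp) + (- Rcoef j) * sfun tau (u - t j) lam)). intros j Hj.
    eapply lau_lin. 2: eapply lau_raise, (lau_sfun_at lam i j Hlam Hi Hj).
    assert (L := lau_mult_holo _ _ _ _ _ (ratio_holo_near (t i) Hn) (lau_sfun_at lp i j lp_not_lattice Hi Hj)).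
    assert (L' := lau_lin 2 _ _ _ _ _ _ _ (a j) (lau_raise _ _ _ _ (lau_regular (fun _ => 0) (t i) (holo_near_const 0 _))) L).
    apply lau_ext with (2 := L'). exists 1%R. split. lra. intros u _. ring.
  + eapply lau_lin. eapply lau_raise, lau_regular. apply CDeriv_holo_near, sfun_holo_off; auto.
    eapply lau_mult. apply (lau_regular (fun u => sfun tau (u - t q) lam)). apply sfun_holo_off; auto. exact Hom.
  + cbv beta. rewrite (sum1n_ext n _ (fun _ => 0)) by (intros; ring). rewrite sum1n_zero. ring.
  + cbv beta. rewrite (sum1n_ext n _ (fun j => (a j * (th (t i - t p) / th (t i - t q)) - Rcoef j) * (if Nat.eqb j i then 1 else 0))) by (intros; ring).
    rewrite sum1n_delta by auto. destruct (Nat.eq_dec i p) as [->|Hip].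
    etransitivity; [|exact residue_at_p]. ring. etransitivity; [|exact (residue_at_ne i Hi Hip Hiq)]. ring.
Qed.

Lemma Dsec_zero u : ~ S_ u -> Dsec u = 0.
Proof.
apply (removable_multiplier_zero tau n t Htau Dsec lam); auto.
- intros w Hw. unfold Dsec. apply holo_plus.
  + apply (holo_sum1n n (fun j u => a j * (ratio u * sfun tau (u - t j) lp) + (- Rcoef j) * sfun tau (u - t j) lam)). intros j Hj.
    assert (Hwj := not_pole_lattice tau n t w j Hj Hw). assert (Hwq := not_pole_lattice tau n t w q Hq Hw).
    assert (S1 := holo_near_at _ _ (sfun_holo_off tau Htau (t j) lp w lp_not_lattice Hwj)).
    assert (S2 := holo_near_at _ _ (sfun_holo_off tau Htau (t j) lam w Hlam Hwj)).
    assert (S3 := holo_near_at _ _ (ratio_holo_near w Hwq)).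
    exact (holo_plus _ _ w (holo_mult _ _ w (holo_const (a j) w) (holo_mult _ _ w S3 S1)) (holo_mult _ _ w (holo_const (- Rcoef j) w) S2)).
  + apply holo_mult. apply holo_const. apply holo_plus. apply holo_near_at, CDeriv_holo_near, psi_q_holo; auto.
    apply holo_mult. apply holo_const. apply holo_mult. apply holo_near_at, psi_q_holo; auto. now apply omega_holo.
- intros w Hw. unfold Dsec. rewrite omega_add_1 by auto.
  rewrite (CDeriv_shift_rel (fun u => sfun tau (u - t q) lam) 1 1 0).
  2: now apply holo_near_at, psi_q_holo.
  2: { apply near_true. intro v. replace (v + 1 - t q) with (v - t q + 1) by ring. rewrite sfun_add_1 by auto. ring. }
  replace (w + 1 - t q) with (w - t q + 1) by ring. rewrite sfun_add_1 by auto.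
  rewrite (sum1n_ext n _ (fun j => a j * (ratio w * sfun tau (w - t j) lp) + (- Rcoef j) * sfun tau (w - t j) lam)). ring.
  intros j Hj. rewrite <- (ratio_add_1 w). replace (w + 1 - t j) with (w - t j + 1) by ring. rewrite !(sfun_add_1 tau Htau (w - t j)).
  replace (w + 1 - t q) with (w - t q + 1) by ring. reflexivity.
- intros w Hw. assert (Hwq := not_pole_lattice tau n t w q Hq Hw). unfold Dsec. rewrite (omega_add_tau tau n t Htau c0 c Hsum) by auto.
  rewrite (CDeriv_shift_rel (fun u => sfun tau (u - t q) lam) tau (Cexp (twopii * lam)) 0).
  2: now apply holo_near_at, psi_q_holo.
  2: { apply (near_impl _ _ _ (lattice_near tau Htau (t q) w Hwq)). intros v Hv. replace (v + tau - t q) with (v - t q + tau) by ring. rewrite sfun_add_tau by auto. ring. }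
  rewrite (sum1n_ext n _ (fun j => Cexp (twopii * lam) * (a j * (ratio w * sfun tau (w - t j) lp) + (- Rcoef j) * sfun tau (w - t j) lam))).
  rewrite sum1n_scal. replace (w + tau - t q) with (w - t q + tau) by ring. rewrite sfun_add_tau by auto. ring.
  intros j Hj. assert (Hwj := not_pole_lattice tau n t w j Hj Hw). rewrite ratio_add_tau by auto.
  replace (w + tau - t j) with (w - t j + tau) by ring. rewrite !sfun_add_tau by auto.
  replace (twopii * lam) with (twopii * (t p - t q) + twopii * lp) by (unfold lamp; ring). rewrite Cexp_plus.
  ring.
- intros j Hj. now apply Dsec_removable.
Qed.

Lemma cohomologous_Spq : cohomologous tau n t c0 c lam (Spq tau t p q phi) (rhs tau n t c0 c lam p q phi).
Proof.
destruct Hco as [F [[F1 [F2 F3]] F4]].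
(* The logarithmic derivative of [ratio] is [rho(u - t_p) - rho(u - t_q)], which is
   [omega' - omega]; hence [ratio * F] carries the relation for [phi] over, and [kap psi_q] supplies
   the correction contained in [Dsec]. *)
set (G u := ratio u * F u + kap * sfun tau (u - t q) lam).
assert (HG : forall u, ~ S_ u -> G ~> (Spq tau t p q phi u - rhs tau n t c0 c lam p q phi u - G u * omega tau n t c0 c u) at u).
{ intros u Hu. assert (Hup := theta1_neq_0 tau Htau _ (not_pole_lattice tau n t u p Hp Hu)). assert (Huq := theta1_neq_0 tau Htau _ (not_pole_lattice tau n t u q Hq Hu)).
  assert (DF := F4 u Hu). change (F ~> (phi u - sum1n n (fun j => a j * sfun tau (u - t j) lp) - F u * omega tau n t c0 c' u) at u) in DF.
  unfold G. eapply is_derive_eq. apply is_derive_C_plus. apply is_derive_C_mult.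
  apply is_derive_C_div. apply is_derive_shift. now apply theta1_derive. apply is_derive_shift. now apply theta1_derive. exact Huq.
  exact DF. apply is_derive_C_scal. apply CDeriv_correct, holo_near_at, psi_q_holo; auto.
  assert (Z := Dsec_zero u Hu). unfold Dsec in Z.
  rewrite sum1n_plus in Z. rewrite (sum1n_ext n (fun j => a j * (ratio u * sfun tau (u - t j) lp)) (fun j => ratio u * (a j * sfun tau (u - t j) lp))) in Z by (intros; ring).
  rewrite sum1n_scal in Z.
  rewrite (sum1n_ext n (fun j => - Rcoef j * sfun tau (u - t j) lam) (fun j => (- (1)) * (Rcoef j * psi tau t lam j u))) in Z by (intros; unfold psi; ring).
  rewrite sum1n_scal, <- rhs_sum in Z. rewrite omega_cprime. unfold Spq, rho.
  set (A := sum1n n (fun j => a j * sfun tau (u - t j) lp)) in *. set (Rr := rhs tau n t c0 c lam p q phi u) in *.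
  set (om := omega tau n t c0 c u) in *. set (dps := CDeriv (fun u => sfun tau (u - t q) lam) u) in *. set (ps := sfun tau (u - t q) lam) in *.
  assert (Edps : kap * dps = ratio u * A - Rr - kap * (ps * om)).
  { transitivity (ratio u * A - Rr - kap * (ps * om) - (ratio u * A + - (1) * Rr + - kap * (dps + 1 * (ps * om)))). ring. rewrite Z. ring. }
  rewrite Edps. field. auto. }
exists G. split; [split; [|split]|].
- intros u Hu. exact (is_derive_holo _ _ _ (HG u Hu)).
- intros u Hu. unfold G. apply merom_at_plus. apply merom_at_mult; auto. apply merom_at_div; apply (merom_at_shift th); now apply merom_theta1.
  apply merom_at_scal. apply (merom_sfun_shift tau Htau).
- intros u Hu. assert (Huq := not_pole_lattice tau n t u q Hq Hu). destruct (F3 u Hu) as [E1 E2]. unfold G. split.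
  + rewrite ratio_add_1, E1. replace (u + 1 - t q) with (u - t q + 1) by ring. now rewrite sfun_add_1.
  + rewrite ratio_add_tau, E2 by auto. replace (u + tau - t q) with (u - t q + tau) by ring. rewrite sfun_add_tau by auto.
    replace (twopii * lam) with (twopii * (t p - t q) + twopii * lp) by (unfold lamp; ring). rewrite Cexp_plus. ring.
- intros u Hu. exact (HG u Hu).
Qed.
End Coefficients.
End Main.

Theorem mainTheorem9 (tau : C) (n : nat) (t : nat -> C) (c0 : C) (c : nat -> C)
  (lam : C) (p q : nat) (phi : C -> C) :
  (0 < Im tau)%R ->
  (2 <= n)%nat ->
  (forall i j, (1 <= i <= n)%nat -> (1 <= j <= n)%nat -> i <> j ->
     ~ in_lattice tau (t i - t j)) ->
  (forall j, (1 <= j <= n)%nat -> ~ exists k : Z, c j = RtoC (IZR k)) ->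
  sum1n n c = 0 ->
  (exists a b : R, (0 <= a < 1)%R /\ (0 <= b < 1)%R /\
     lam = RtoC a + RtoC b * tau) ->
  lam <> 0 ->
  (1 <= p <= n)%nat -> (1 <= q <= n)%nat -> p <> q ->
  ~ in_lattice tau (t p - t q + lam) ->
  ~ in_lattice tau (t p - t q - lam) ->
  twisted_sec tau n t (lamp t lam p q) phi ->
  cohomologous tau n t c0 c lam
    (Spq tau t p q phi)
    (rhs tau n t c0 c lam p q phi).
Proof.
intros Htau _ Hdist Hnonint Hsum [x [y [Hx [Hy Exy]]]] Hlam0 Hp Hq Hpq _ Hlp Hphi.
assert (Hlam : ~ in_lattice tau lam).
{ intro H. apply Hlam0. rewrite Exy in *. now apply reduced_not_in_lattice. }
destruct (cohomologous_simple_poles tau n t Htau Hdist c0 (cprime c p q) (cprime_sum n c p q Hsum Hp Hq Hpq)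
  (cprime_nonint n c p q Hnonint) (lamp t lam p q) (lp_not_lattice tau t lam p q Hlp) phi Hphi) as [a Ha].
now apply cohomologous_Spq with a.
Qed.
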